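(* Let $\omega\subset\mathbb{R}^2$ be a bounded and connected open set whose boundary is Lipschitz-continuous, and let $\boldsymbol{\theta}_0:\overline{\omega}\to\mathbb{R}^3$ be defined by $\boldsymbol{\theta}_0(y):=(y,0)$ for all $y\in\overline{\omega}$. Let real constants $\lambda\ge 0$, $\mu>0$, $\varepsilon>0$ be fixed, and let $\boldsymbol{p}=(p^1,p^2,p^3)\in (L^2(\omega))^3$ be arbitrary. Let $\boldsymbol{V}(\omega)=H^1_0(\omega)\times H^1_0(\omega)\times H^2_0(\omega)$, and let $J_{\boldsymbol{\theta}}$ (for an immersion $\boldsymbol{\theta}:\overline{\omega}\to\mathbb{R}^3$ of class $\mathcal{C}^2$) and $J$ be the shallow shell and plate energy functionals on $\boldsymbol{V}(\omega)$ defined in the context, with these data. Then the following hold. (i) There exists a number $\delta_0>0$ such that, for every immersion $\boldsymbol{\theta}$ of class $\mathcal{C}^2$ satisfying $\|\boldsymbol{\theta}-\boldsymbol{\theta}_0\|_{\mathcal{C}^2(\overline{\omega})}<\delta_0$, there exists a minimizer $\boldsymbol{u}_{\boldsymbol{\theta}}$ of $J_{\boldsymbol{\theta}}$ over $\boldsymbol{V}(\omega)$; and the family $(\boldsymbol{u}_{\boldsymbol{\theta}})_{\boldsymbol{\theta}}$, indexed by all such $\boldsymbol{\theta}$, where $\boldsymbol{u}_{\boldsymbol{\theta}}$ denotes any chosen minimizer of $J_{\boldsymbol{\theta}}$ over $\boldsymbol{V}(\omega)$, is bounded in $\boldsymbol{V}(\omega)$. (ii) Let $(\boldsymbol{\theta}_n)_n$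 be any sequence of immersions of class $\mathcal{C}^2$ converging to $\boldsymbol{\theta}_0$ in $\mathcal{C}^2(\overline{\omega})$, and consider the sequence $(\boldsymbol{u}_{\boldsymbol{\theta}_n})_n$ (defined for all $n$ large enough that $\|\boldsymbol{\theta}_n-\boldsymbol{\theta}_0\|_{\mathcal{C}^2(\overline{\omega})}<\delta_0$), where $\boldsymbol{u}_{\boldsymbol{\theta}_n}$ is a minimizer of $J_{\boldsymbol{\theta}_n}$ over $\boldsymbol{V}(\omega)$ as in (i). Then any subsequence of $(\boldsymbol{u}_{\boldsymbol{\theta}_n})_n$ that converges weakly in $\boldsymbol{V}(\omega)$ converges strongly in $\boldsymbol{V}(\omega)$ to a minimizer of $J$ over $\boldsymbol{V}(\omega)$. Consequently, if $J$ has a unique minimizer $\boldsymbol{u}_0$ over $\boldsymbol{V}(\omega)$, then the entire sequence $(\boldsymbol{u}_{\boldsymbol{\theta}_n})_n$ converges strongly to $\boldsymbol{u}_0$ in $\boldsymbol{V}(\omega)$.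
   Context: Conventions. Greek indices range in $\{1,2\}$, Latin indices in $\{1,2,3\}$ (except when indexing sequences), and repeated indices are summed. Points of $\mathbb{R}^2$ are written $y=(y_\alpha)$, with $\partial_\alpha=\partial/\partial y_\alpha$ and $\partial_{\alpha\beta}=\partial^2/\partial y_\alpha\partial y_\beta$. $\wedge$ is the vector product in $\mathbb{R}^3$. All functions are real-valued. $H^1_0(\omega)$ and $H^2_0(\omega)$ are the closures of $\mathcal{D}(\omega)$ (smooth compactly supported functions) in $H^1(\omega)=W^{1,2}(\omega)$ and $H^2(\omega)=W^{2,2}(\omega)$. The space $\boldsymbol{V}(\omega):=H^1_0(\omega)\times H^1_0(\omega)\times H^2_0(\omega)$ is normed by $\|\boldsymbol{u}\|_{\boldsymbol{V}(\omega)}=\|u_1\|_{H^1_0(\omega)}+\|u_2\|_{H^1_0(\omega)}+\|u_3\|_{H^2_0(\omega)}$ (with the norms induced from $H^1(\omega)$ and $H^2(\omega)$). $\mathcal{C}^2(\overline{\omega})$ is the space of (vector-valued) functions of class $\mathcal{C}^2$ in $\omega$ which, together with all partial derivatives of order $\le 2$, extend continuously to $\overline{\omega}$, with the usual sup-norm of the function and its derivatives of order $\le 2$. Geometry. An immersion of class $\mathcal{C}^2$ is a map $\boldsymbol{\theta}\in\mathcal{C}^2(\overline{\omega};\mathbb{R}^3)$ such that the vectors $\boldsymbol{a}_{\alpha,\boldsymbol{\theta}}:=\partial_\alpha\boldsymbol{\theta}$, $\alpha=1,2$, are linearly independent at every point of $\overline{\omega}$. For such $\boldsymbol{\theta}$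 set $$\boldsymbol{a}_{3,\boldsymbol{\theta}}:=\frac{\partial_1\boldsymbol{\theta}\wedge\partial_2\boldsymbol{\theta}}{|\partial_1\boldsymbol{\theta}\wedge\partial_2\boldsymbol{\theta}|},\qquad a_{\boldsymbol{\theta}}:=|\partial_1\boldsymbol{\theta}\wedge\partial_2\boldsymbol{\theta}|^2,$$ $$a_{\alpha\beta,\boldsymbol{\theta}}:=\boldsymbol{a}_{\alpha,\boldsymbol{\theta}}\cdot\boldsymbol{a}_{\beta,\boldsymbol{\theta}},\quad (a^{\alpha\beta}_{\boldsymbol{\theta}}):=(a_{\alpha\beta,\boldsymbol{\theta}})^{-1},\quad b_{\alpha\beta,\boldsymbol{\theta}}:=\boldsymbol{a}_{3,\boldsymbol{\theta}}\cdot\partial_{\alpha\beta}\boldsymbol{\theta},\quad \Gamma^\sigma_{\alpha\beta,\boldsymbol{\theta}}:=\boldsymbol{a}^\sigma_{\boldsymbol{\theta}}\cdot\partial_\beta\boldsymbol{a}_{\alpha,\boldsymbol{\theta}},$$ where the vectors $\boldsymbol{a}^i_{\boldsymbol{\theta}}$ are defined by $\boldsymbol{a}^i_{\boldsymbol{\theta}}\cdot\boldsymbol{a}_{j,\boldsymbol{\theta}}=\delta^i_j$ (Kronecker symbol). Standing assumption on the half-thickness $\varepsilon$: $\varepsilon>0$ is small enough that, for the immersions $\boldsymbol{\theta}$ under consideration, the map $(y,x_3)\mapsto\boldsymbol{\theta}(y)+x_3\boldsymbol{a}_{3,\boldsymbol{\theta}}(y)$ is an immersion of class $\mathcal{C}^1$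 on $\overline{\omega}\times[-\varepsilon,\varepsilon]$. Shallow shell energy. With $\lambda\ge0$, $\mu>0$, define $$a_{\boldsymbol{\theta}}^{\alpha\beta\sigma\tau}:=\frac{4\lambda\mu}{\lambda+2\mu}a_{\boldsymbol{\theta}}^{\alpha\beta}a_{\boldsymbol{\theta}}^{\sigma\tau}+2\mu\big(a_{\boldsymbol{\theta}}^{\alpha\sigma}a_{\boldsymbol{\theta}}^{\beta\tau}+a_{\boldsymbol{\theta}}^{\alpha\tau}a_{\boldsymbol{\theta}}^{\beta\sigma}\big),$$ and, for $\boldsymbol{\eta}=(\eta_i)\in\boldsymbol{V}(\omega)$, $$E^{\boldsymbol{\theta}}_{\alpha\beta}(\boldsymbol{\eta}):=\tfrac12(\partial_\beta\eta_\alpha+\partial_\alpha\eta_\beta)-\Gamma^\sigma_{\alpha\beta,\boldsymbol{\theta}}\eta_\sigma-b_{\alpha\beta,\boldsymbol{\theta}}\eta_3+\tfrac12\partial_\alpha\eta_3\,\partial_\beta\eta_3,\qquad F^{\boldsymbol{\theta}}_{\alpha\beta}(\boldsymbol{\eta}):=\partial_{\alpha\beta}\eta_3-\Gamma^\sigma_{\alpha\beta,\boldsymbol{\theta}}\partial_\sigma\eta_3,$$ $$J_{\boldsymbol{\theta}}(\boldsymbol{\eta}):=\frac12\int_\omega\Big\{\frac{\varepsilon^3}{3}a_{\boldsymbol{\theta}}^{\alpha\beta\sigma\tau}F^{\boldsymbol{\theta}}_{\sigma\tau}(\boldsymbol{\eta})F^{\boldsymbol{\theta}}_{\alpha\beta}(\boldsymbol{\eta})+\varepsilon\,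 a_{\boldsymbol{\theta}}^{\alpha\beta\sigma\tau}E^{\boldsymbol{\theta}}_{\sigma\tau}(\boldsymbol{\eta})E^{\boldsymbol{\theta}}_{\alpha\beta}(\boldsymbol{\eta})\Big\}\sqrt{a_{\boldsymbol{\theta}}}\,dy-\int_\omega p^i\eta_i\sqrt{a_{\boldsymbol{\theta}}}\,dy .$$ Plate energy. With $$a_0^{\alpha\beta\sigma\tau}:=\frac{4\lambda\mu}{\lambda+2\mu}\delta^{\alpha\beta}\delta^{\sigma\tau}+2\mu\big(\delta^{\alpha\sigma}\delta^{\beta\tau}+\delta^{\alpha\tau}\delta^{\beta\sigma}\big),\qquad E^0_{\alpha\beta}(\boldsymbol{\eta}):=\tfrac12(\partial_\alpha\eta_\beta+\partial_\beta\eta_\alpha)+\tfrac12\partial_\alpha\eta_3\,\partial_\beta\eta_3,$$ where $\delta^{\alpha\beta}$ is the Kronecker symbol, define for $\boldsymbol{\eta}\in\boldsymbol{V}(\omega)$ $$J(\boldsymbol{\eta}):=\frac12\int_\omega\Big\{\frac{\varepsilon^3}{3}a_0^{\alpha\beta\sigma\tau}\partial_{\sigma\tau}\eta_3\,\partial_{\alpha\beta}\eta_3+\varepsilon\, a_0^{\alpha\beta\sigma\tau}E^0_{\sigma\tau}(\boldsymbol{\eta})E^0_{\alpha\beta}(\boldsymbol{\eta})\Big\}\,dy-\int_\omega p^i\eta_i\,dy .$$ The functions $p^i$ and the constants $\lambda,\mu,\varepsilon$ are the same in $J$ and in all $J_{\boldsymbol{\theta}}$ (independent of $\boldsymbol{\theta}$).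 *)

(* Defs.v *)
From HB Require Import structures.
From mathcomp Require Import all_boot all_order all_algebra.
From mathcomp Require Import all_classical all_reals all_analysis.
Import Order.TTheory GRing.Theory Num.Theory.
Import numFieldNormedType.Exports.

Set Implicit Arguments.
Unset Strict Implicit.
Unset Printing Implicit Defensive.

Local Open Scope classical_set_scope.
Local Open Scope ring_scope.

(* Greek indices range in ['I_2], Latin indices in ['I_3].  A function on a
   domain [w] is represented by a total function of which only the values on
   [w] (or on [closure w]) matter. *)

Section plane.
Context {R : realType}.
Local Notation plane := (R * R)%type.
Implicit Types (w : set plane) (a b s t : 'I_2).

Definition leb2 :
    {measure set (measurableTypeR R * measurableTypeR R) -> \bar R} :=
  (@lebesgue_measure R \x @lebesgue_measure R)%E.

Definition e_ a : plane := ((a == 0)%:R, (a == 1)%:R).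

(* Around each boundary point, in orthonormal coordinates [(t, z)] obtained by
   a rotation [(c, s)], [w] is the strict epigraph and the complement of
   [closure w] the strict hypograph of a Lipschitz function. *)
Definition lipschitz_boundary w : Prop :=
  forall x, (closure w `\` interior w) x ->
  exists c s r h k : R, exists g : R -> R,
    [/\ c ^+ 2 + s ^+ 2 = 1, 0 < r, 0 < h, k.-lipschitz g &
      forall y : plane,
        let t := c * (y.1 - x.1) + s * (y.2 - x.2) in
        let z := c * (y.2 - x.2) - s * (y.1 - x.1) in
        `|t| < r -> `|z| < h ->
        (w y <-> g t < z) /\ (~ closure w y <-> z < g t)].

Definition iter_partial (l : seq 'I_2) (f : plane -> R) : plane -> R :=
  foldr (fun a g => 'D_(e_ a) g) f l.

Definition smooth (f : plane -> R) : Prop :=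
  forall l, continuous (iter_partial l f) /\
    forall a y, derivable (iter_partial l f) y (e_ a).

(* The space D(w), its elements being extended by zero outside [w]. *)
Definition test_function w (phi : plane -> R) : Prop :=
  [/\ smooth phi, compact (closure [set y | phi y != 0]) &
      closure [set y | phi y != 0] `<=` w].

Definition L2 w (f : plane -> R) : Prop := f \_ w \in Lfun leb2 2%:E.

Definition L2norm w (f : plane -> R) : R :=
  fine ('N[leb2]_2%:E [EFin \o f \_ w])%E.

Definition is_weak_partial w a (f g : plane -> R) : Prop :=
  L2 w g /\ forall phi, test_function w phi ->
    \int[leb2]_(y in w) (f y * 'D_(e_ a) phi y) =
    - \int[leb2]_(y in w) (g y * phi y).

(* A representative of the weak partial derivative, when there is one in
   L^2; it is unique up to equality almost everywhere in [w]. *)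
Definition wpartial w a (f : plane -> R) : plane -> R :=
  xget (cst 0) [set g | is_weak_partial w a f g].

Definition H1 w (f : plane -> R) : Prop :=
  L2 w f /\ forall a, exists g, is_weak_partial w a f g.

Definition H2 w (f : plane -> R) : Prop :=
  H1 w f /\ forall a, H1 w (wpartial w a f).

Definition H1norm w (f : plane -> R) : R :=
  Num.sqrt (L2norm w f ^+ 2 + \sum_a L2norm w (wpartial w a f) ^+ 2).

Definition H2norm w (f : plane -> R) : R :=
  Num.sqrt (L2norm w f ^+ 2 + \sum_a L2norm w (wpartial w a f) ^+ 2 +
            \sum_a \sum_b L2norm w (wpartial w b (wpartial w a f)) ^+ 2).

Definition H10 w (f : plane -> R) : Prop :=
  H1 w f /\ forall e, 0 < e ->
    exists2 phi, test_function w phi & H1norm w (f - phi) < e.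

Definition H20 w (f : plane -> R) : Prop :=
  H2 w f /\ forall e, 0 < e ->
    exists2 phi, test_function w phi & H2norm w (f - phi) < e.

Definition lat a : 'I_3 := widen_ord (isT : (2 <= 3)%N) a.
Definition i3 : 'I_3 := ord_max.

Definition field3 := 'I_3 -> plane -> R.
Implicit Types (u v : field3).

Definition V w u : Prop := (forall a, H10 w (u (lat a))) /\ H20 w (u i3).

Definition Vnorm w u : R := \sum_a H1norm w (u (lat a)) + H2norm w (u i3).

(* Equality in V(w), whose elements are classes modulo equality a.e. *)
Definition Veq w u v : Prop :=
  forall i, {ae leb2, forall y, w y -> u i y = v i y}.

Definition Vcvg w (u_ : nat -> field3) u : Prop :=
  V w u /\ Vnorm w (u_ n - u) @[n --> \oo] --> (0 : R).

(* Continuous linear forms on V(w); the bound makes them compatible with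
   [Veq]. *)
Definition Vdual w (L : field3 -> R) : Prop :=
  (forall (k : R) u v, V w u -> V w v ->
     L (fun i y => k * u i y + v i y) = k * L u + L v) /\
  exists C : R, forall u, V w u -> `|L u| <= C * Vnorm w u.

Definition Vweak_cvg w (u_ : nat -> field3) u : Prop :=
  V w u /\ forall L, Vdual w L -> L (u_ n) @[n --> \oo] --> L u.

Definition is_minimizer w (J : field3 -> R) u : Prop :=
  V w u /\ forall v, V w v -> J u <= J v.

Definition is_unique_minimizer w (J : field3 -> R) u : Prop :=
  is_minimizer w J u /\ forall v, is_minimizer w J v -> Veq w v u.

Implicit Types (x z : 'rV[R]_3) (th : plane -> 'rV[R]_3).

Definition dotv x z : R := \sum_i x 0 i * z 0 i.

Definition enorm x : R := Num.sqrt (dotv x x).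

(* Index arithmetic in ['I_3] is modulo 3. *)
Definition cross x z : 'rV[R]_3 :=
  \row_i (x 0 (i + 1) * z 0 (i + 2%:R) - x 0 (i + 2%:R) * z 0 (i + 1)).

Definition extends_to_closure w (g G : plane -> 'rV[R]_3) : Prop :=
  {within closure w, continuous G} /\ {in w, G =1 g}.

Definition cext w (g : plane -> 'rV[R]_3) : plane -> 'rV[R]_3 :=
  xget (cst 0) [set G | extends_to_closure w g G].

(* Partial derivatives on [w], continuously extended to [closure w]. *)
Definition partial1 w a th := cext w ('D_(e_ a) th).
Definition partial2 w a b th := cext w ('D_(e_ a) ('D_(e_ b) th)).

(* The existence of the extensions entails the continuity in [w] of the
   derivatives. *)
Definition C2bar w th : Prop :=
  [/\ {within closure w, continuous th},
      forall a y, w y -> derivable th y (e_ a),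
      forall a b y, w y -> derivable ('D_(e_ b) th) y (e_ a),
      forall a, exists G, extends_to_closure w ('D_(e_ a) th) G &
      forall a b, exists G, extends_to_closure w ('D_(e_ a) ('D_(e_ b) th)) G].

Definition C2norm w th : R :=
  sup ([set enorm (th y) | y in closure w] `|`
       \bigcup_a [set enorm (partial1 w a th y) | y in closure w] `|`
       \bigcup_a \bigcup_b
         [set enorm (partial2 w a b th y) | y in closure w]).

Definition C2cvg w (th_ : nat -> plane -> 'rV[R]_3) th : Prop :=
  C2norm w (th_ n - th) @[n --> \oo] --> (0 : R).

Definition immersion w th : Prop :=
  C2bar w th /\
  forall y, closure w y -> free [:: partial1 w 0 th y; partial1 w 1 th y].

Definition theta0 : plane -> 'rV[R]_3 :=
  fun y => \row_i [:: y.1; y.2; 0]`_i.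

Definition normal_dir w th y := cross (partial1 w 0 th y) (partial1 w 1 th y).

Definition a3 w th y : 'rV[R]_3 :=
  (enorm (normal_dir w th y))^-1 *: normal_dir w th y.

Definition area w th y : R := enorm (normal_dir w th y) ^+ 2.

Definition acov w th (i : 'I_3) y : 'rV[R]_3 :=
  [:: partial1 w 0 th y; partial1 w 1 th y; a3 w th y]`_i.

(* The dual basis: [dotv (acontra w th i y) (acov w th j y)] is the [(j, i)]
   entry of [M *m invmx M], where [M] is the matrix of rows [acov]. *)
Definition acontra w th (i : 'I_3) y : 'rV[R]_3 :=
  (col i (invmx (\matrix_j acov w th j y)))^T.

Definition metric w th y : 'M[R]_2 :=
  \matrix_(a, b) dotv (acov w th (lat a) y) (acov w th (lat b) y).

Definition metric_inv w th y : 'M[R]_2 := invmx (metric w th y).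

Definition bcov w th a b y : R := dotv (a3 w th y) (partial2 w a b th y).

Definition Gamma w th s a b y : R :=
  dotv (acontra w th (lat s) y) (partial2 w b a th y).

(* The elasticity tensor associated with contravariant metric components
   [g]; the plate corresponds to [g = 1%:M]. *)
Definition elast (lam mu : R) (g : 'M[R]_2) a b s t : R :=
  4%:R * lam * mu / (lam + 2%:R * mu) * (g a b * g s t) +
  2%:R * mu * (g a s * g b t + g a t * g b s).

Definition Eshell w th (u : field3) a b y : R :=
  2^-1 * (wpartial w b (u (lat a)) y + wpartial w a (u (lat b)) y)
  - \sum_s Gamma w th s a b y * u (lat s) y
  - bcov w th a b y * u i3 y
  + 2^-1 * (wpartial w a (u i3) y * wpartial w b (u i3) y).

Definition Fshell w th (u : field3) a b y : R :=
  wpartial w a (wpartial w b (u i3)) y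
  - \sum_s Gamma w th s a b y * wpartial w s (u i3) y.

Definition Jshell w (lam mu eps : R) (p : field3) th (u : field3) : R :=
  2^-1 * \int[leb2]_(y in w)
    ((\sum_a \sum_b \sum_s \sum_t
       (eps ^+ 3 / 3%:R * elast lam mu (metric_inv w th y) a b s t *
          Fshell w th u s t y * Fshell w th u a b y +
        eps * elast lam mu (metric_inv w th y) a b s t *
          Eshell w th u s t y * Eshell w th u a b y)) *
     Num.sqrt (area w th y))
  - \int[leb2]_(y in w)
      ((\sum_i p i y * u i y) * Num.sqrt (area w th y)).

Definition Eplate w (u : field3) a b y : R :=
  2^-1 * (wpartial w a (u (lat b)) y + wpartial w b (u (lat a)) y)
  + 2^-1 * (wpartial w a (u i3) y * wpartial w b (u i3) y).

Definition Jplate w (lam mu eps : R) (p : field3) (u : field3) : R :=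
  2^-1 * \int[leb2]_(y in w)
    (\sum_a \sum_b \sum_s \sum_t
       (eps ^+ 3 / 3%:R * elast lam mu 1%:M a b s t *
          wpartial w s (wpartial w t (u i3)) y *
          wpartial w a (wpartial w b (u i3)) y +
        eps * elast lam mu 1%:M a b s t *
          Eplate w u s t y * Eplate w u a b y))
  - \int[leb2]_(y in w) (\sum_i p i y * u i y).

End plane.

(* Main.v *)
Require Import Defs.
From HB Require Import structures.
From mathcomp Require Import all_boot all_order all_algebra.
From mathcomp Require Import all_classical all_reals all_analysis.
From mathcomp Require Import measurable_realfun ring lra.
Import Order.TTheory GRing.Theory Num.Theory.
Import numFieldNormedType.Exports.
Local Open Scope classical_set_scope.
Local Open Scope ring_scope.

Set Implicit Arguments.
Unset Strict Implicit.
Unset Printing Implicit Defensive.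

(** The energies are coercive without any smallness of the load, thanks to the
    trace of the strain: if [u_1, u_2] vanish on the boundary, the integral of
    [div (u_1, u_2)] is zero, so that the squared L^2 norm of [grad u_3] is
    twice the integral of the trace of [E^0(u)], hence at most
    [C * |E^0(u)|].  Ladyzhenskaya's inequality then bounds the products
    [d_a u_3 d_b u_3] by [|grad u_3| |hess u_3|], and the inequalities of Korn
    and Poincare bound [u_1, u_2].  All these estimates survive a small
    perturbation of the coefficients, and the coefficients of [J_theta] are
    uniformly close to those of the plate when [theta] is C^2-close to
    [theta_0]; hence uniform bounds on the minimizers.

    Bounded families converge weakly in [V] along every ultrafilter, and the
    products [d_a u_3 d_b u_3] then converge strongly in L^2 by Ladyzhenskaya's
    inequality and the compactness of H^1_0 in L^2.  So [E] and [F] converge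
    weakly, and [J(u_i) - Q(u_i - u) / 2] tends to [J(u)] where [Q >= 0] is
    the quadratic form of the energy evaluated on the differences of the
    strains.  This gives the lower semicontinuity of the energy, hence
    existence; and as [J_theta -> J] uniformly on bounded sets, a weak limit
    [u] of minimizers minimizes [J] and [Q(u_i - u)] tends to 0, which is the
    strong convergence. *)

(** * Square integrable functions *)

(** Weak derivatives are chosen representatives, so identities between them hold only almost
    everywhere: they are recorded as [nr (f - g) = 0], and differences of derivatives are preferred
    to derivatives of differences. The analytic inequalities are proved for test functions, with the
    one-dimensional fundamental theorem of calculus and Tonelli, and pass to the closures. The load
    is absorbed as follows. The squared gradient of [u_3] being at most linear in the membrane
    strain, Young's inequality bounds [|grad u_3| |hess u_3|] by [k |hess u_3|^2 + C |E| / k] for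
    every [k > 0]. The displacement is then at most linear in the strains, up to a multiple of
    [k |F|^2]; with [k] small in terms of the load, half of the bending energy absorbs that term.
    Geometry enters only through [near_flat eta], a condition on coefficients, so that the existence
    and convergence arguments never mention an immersion. The elasticity tensor sees only symmetric
    parts, whence the estimates on [X + tr2 X]. *)

HB.lock Definition ip {d} {T : measurableType d} {R : realType}
  (mu : {measure set T -> \bar R}) (D : set T) (f g : T -> R) : R :=
  \int[mu]_(x in D) (f x * g x).

HB.lock Definition nr {d} {T : measurableType d} {R : realType}
  (mu : {measure set T -> \bar R}) (D : set T) (f : T -> R) : R :=
  Num.sqrt (ip mu D f f).

Lemma ipE {d} {T : measurableType d} {R : realType}
  (mu : {measure set T -> \bar R}) (D : set T) (f g : T -> R) :
  ip mu D f g = \int[mu]_(x in D) (f x * g x).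
Proof. by rewrite ip.unlock. Qed.

Lemma nrE {d} {T : measurableType d} {R : realType}
  (mu : {measure set T -> \bar R}) (D : set T) (f : T -> R) :
  nr mu D f = Num.sqrt (ip mu D f f).
Proof. by rewrite nr.unlock. Qed.

Section square_integrable.
Context d (T : measurableType d) (R : realType) (mu : {measure set T -> \bar R}).
Context (D : set T) (mD : measurable D).
Implicit Types f g h : T -> R.

Definition sqi f :=
  measurable_fun D f /\ mu.-integrable D (EFin \o (fun x => f x ^+ 2)).

Local Notation ip := (ip mu D).
Local Notation nr := (nr mu D).

Lemma sqi_int f g : sqi f -> sqi g ->
  mu.-integrable D (EFin \o (fun x => f x * g x)).
Proof.
move=> [mf If] [mg Ig].
apply: (@le_integrable _ _ _ mu D mD _
  ((EFin \o (fun x => (f x ^+ 2)%R)) \+ (EFin \o (fun x => (g x ^+ 2)%R)))%E).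
- by apply/measurable_EFinP; exact: measurable_funM.
- move=> x Dx /=; rewrite lee_fin.
  rewrite (@ger0_norm _ (_ + _)) ?addr_ge0 ?sqr_ge0// normrM.
  rewrite -(real_normK (num_real (f x))) -(real_normK (num_real (g x))).
  by nra.
- exact: integrableD.
Qed.

Lemma sqi_dom f g : measurable_fun D f -> sqi g ->
  (forall x, D x -> `|f x| <= `|g x|) -> sqi f.
Proof.
move=> mf [mg Ig] fg; split => //.
apply: le_integrable Ig => //; first exact/measurable_EFinP/measurable_funX.
move=> x Dx /=; rewrite lee_fin !normrX.
by rewrite lerXn2r ?nnegrE ?normr_ge0 ?fg.
Qed.

Lemma sqi0 : sqi 0.
Proof.
split; first exact: measurable_cst.
rewrite (_ : _ \o _ = cst 0%E); first exact: integrable0.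
by apply/funext => x /=; rewrite expr0n.
Qed.

Lemma sqiZ (k : R) f : sqi f -> sqi (k *: f).
Proof.
move=> [mf If]; split.
  by apply: measurable_funM => //; exact: measurable_cst.
rewrite (_ : _ \o _ = (fun x => (k ^+ 2)%:E * (EFin \o (fun x => (f x ^+ 2)%R)) x)%E).
  exact: integrableZl.
by apply/funext => x /=; rewrite -EFinM -exprMn.
Qed.

Lemma sqiN f : sqi f -> sqi (- f).
Proof. by rewrite -scaleN1r; exact: sqiZ. Qed.

Lemma sqiD f g : sqi f -> sqi g -> sqi (f + g).
Proof.
move=> sf sg; have [mf If] := sf; have [mg Ig] := sg; split.
  exact: measurable_funD.
rewrite (_ : _ \o _ = ((EFin \o (fun x => (f x ^+ 2)%R)) \+
  ((fun x => 2%:E * (EFin \o (fun x => (f x * g x)%R)) x) \+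
   (EFin \o (fun x => (g x ^+ 2)%R))))%E).
  apply: integrableD => //; apply: integrableD => //.
  exact/integrableZl/sqi_int.
apply/funext => x /=; rewrite -EFinM -!EFinD.
by congr EFin; rewrite fctE; ring.
Qed.

Lemma sqiB f g : sqi f -> sqi g -> sqi (f - g).
Proof. by move=> sf sg; apply: sqiD => //; exact: sqiN. Qed.

Lemma sqi_sum (I : Type) (r : seq I) (P : pred I) (F : I -> T -> R) :
  (forall i, P i -> sqi (F i)) -> sqi (\sum_(i <- r | P i) F i).
Proof. by move=> H; apply: big_ind => //; [exact: sqi0|exact: sqiD]. Qed.

Lemma sqiM (c : T -> R) K f : measurable_fun D c ->
  (forall x, D x -> `|c x| <= K) -> sqi f -> sqi (c * f).
Proof.
move=> mc cK sf; apply: (@sqi_dom _ (K *: f)).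
- by apply: measurable_funM => //; exact: sf.1.
- exact: sqiZ.
- move=> x Dx; rewrite !fctE normrM [leRHS]normrM ler_wpM2r//.
  by rewrite (le_trans (cK _ Dx))// ler_norm.
Qed.

Lemma sqi_cst (k : R) : (mu D < +oo)%E -> sqi (cst k).
Proof.
move=> fD; split; first exact: measurable_cst.
apply: measurable_bounded_integrable => //; first exact: (measurable_cst (k ^+ 2)).
exists `|k ^+ 2|; split; first exact: normr_real.
by move=> M kM x _ /=; exact: ltW.
Qed.

Lemma eq_ip f f' g g' : {in D, f =1 f'} -> {in D, g =1 g'} ->
  ip f g = ip f' g'.
Proof. by move=> ff gg; rewrite !ipE; apply: eq_Rintegral => x xD; rewrite ff// gg. Qed.

Lemma ipC f g : ip f g = ip g f.
Proof. by rewrite !ipE; apply: eq_Rintegral => x _; rewrite mulrC. Qed.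

Lemma ipDl f g h : sqi f -> sqi g -> sqi h -> ip (f + g) h = ip f h + ip g h.
Proof.
move=> sf sg sh; rewrite !ipE -RintegralD//; try exact: sqi_int.
by apply: eq_Rintegral => x _; rewrite -mulrDl.
Qed.

Lemma ipZl k f h : sqi f -> sqi h -> ip (k *: f) h = k * ip f h.
Proof.
move=> sf sh; rewrite !ipE -RintegralZl//; try exact: sqi_int.
by apply: eq_Rintegral => x _; rewrite mulrA.
Qed.

Lemma ipNl f h : sqi f -> sqi h -> ip (- f) h = - ip f h.
Proof. by move=> sf sh; rewrite -scaleN1r ipZl// mulN1r. Qed.

Lemma ipBl f g h : sqi f -> sqi g -> sqi h -> ip (f - g) h = ip f h - ip g h.
Proof. by move=> sf sg sh; rewrite ipDl ?ipNl//; exact: sqiN. Qed.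

Lemma ipDr f g h : sqi f -> sqi g -> sqi h -> ip h (f + g) = ip h f + ip h g.
Proof. by move=> *; rewrite ipC ipDl// !(ipC h). Qed.

Lemma ipZr k f h : sqi f -> sqi h -> ip h (k *: f) = k * ip h f.
Proof. by move=> *; rewrite ipC ipZl// !(ipC h). Qed.

Lemma ipNr f h : sqi f -> sqi h -> ip h (- f) = - ip h f.
Proof. by move=> *; rewrite ipC ipNl// !(ipC h). Qed.

Lemma ipBr f g h : sqi f -> sqi g -> sqi h -> ip h (f - g) = ip h f - ip h g.
Proof. by move=> *; rewrite ipC ipBl// !(ipC h). Qed.

Lemma ip0l h : ip 0 h = 0.
Proof.
rewrite ipE /Rintegral (eq_integral (cst 0%E)) ?integral0//.
by move=> x _; rewrite mul0r.
Qed.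

Lemma ip_mulA c f g : ip (c * f) g = ip f (c * g).
Proof. by rewrite !ipE; apply: eq_Rintegral => x _; rewrite !fctE; ring. Qed.

Lemma ipff_ge0 f : 0 <= ip f f.
Proof. by rewrite ipE; apply: Rintegral_ge0 => x _; rewrite -expr2 sqr_ge0. Qed.

Lemma nr_ge0 f : 0 <= nr f. Proof. by rewrite nrE; exact: sqrtr_ge0. Qed.
Hint Resolve nr_ge0 : core.

Lemma sqr_nr f : nr f ^+ 2 = ip f f.
Proof. by rewrite nrE sqr_sqrtr// ipff_ge0. Qed.

Lemma nr0 : nr 0 = 0.
Proof. by rewrite nrE ip0l sqrtr0. Qed.

Lemma nrZ k f : sqi f -> nr (k *: f) = `|k| * nr f.
Proof.
move=> sf; rewrite !nrE ipZl ?ipZr//; try exact: sqiZ.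
by rewrite mulrA -expr2 sqrtrM ?sqr_ge0// sqrtr_sqr.
Qed.

Lemma nrN f : nr (- f) = nr f.
Proof.
by rewrite !nrE !ipE; congr Num.sqrt; apply: eq_Rintegral => x _; rewrite !fctE mulrNN.
Qed.

Lemma nrBC f g : nr (f - g) = nr (g - f).
Proof. by rewrite -nrN opprB. Qed.

Lemma sqr_nrD f g : sqi f -> sqi g ->
  nr (f + g) ^+ 2 = nr f ^+ 2 + 2 * ip f g + nr g ^+ 2.
Proof.
move=> sf sg; rewrite !sqr_nr ipDl ?ipDr//; try exact: sqiD.
by rewrite (ipC g f); ring.
Qed.

Lemma sqr_nrB f g : sqi f -> sqi g ->
  nr (f - g) ^+ 2 = nr f ^+ 2 - 2 * ip f g + nr g ^+ 2.
Proof.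
move=> sf sg; rewrite sqr_nrD//; last exact: sqiN.
by rewrite ipNr// nrN; ring.
Qed.

Lemma ip_le f g : sqi f -> sqi g -> `|ip f g| <= nr f * nr g.
Proof.
move=> sf sg.
have Hs k : 0 <= nr f ^+ 2 + 2 * (k * ip f g) + k ^+ 2 * nr g ^+ 2.
  have := sqr_ge0 (nr (f + k *: g)); rewrite sqr_nrD ?ipZr ?nrZ//; last exact: sqiZ.
  by rewrite exprMn real_normK ?num_real.
have [f0 g0] := (nr_ge0 f, nr_ge0 g).
have [g1|g1] := eqVneq (nr g) 0.
  rewrite g1 mulr0 normr_le0; apply/eqP; apply: contrapT => /eqP p0.
  (* When [nr g] is 0 the quadratic is affine in its parameter; this value makes it equal to -1. *)
  have := Hs (- ((nr f ^+ 2 + 1) / (2 * ip f g))).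
  have -> : - ((nr f ^+ 2 + 1) / (2 * ip f g)) * ip f g = - (nr f ^+ 2 + 1) / 2.
    by field.
  by rewrite g1; lra.
have gp : 0 < nr g by rewrite lt_neqAle eq_sym g1.
rewrite -ler_sqr ?nnegrE ?mulr_ge0// real_normK ?num_real//.
have := Hs (- ip f g / nr g ^+ 2).
have -> : nr f ^+ 2 + 2 * (- ip f g / nr g ^+ 2 * ip f g) +
  (- ip f g / nr g ^+ 2) ^+ 2 * nr g ^+ 2 =
  (nr f ^+ 2 * nr g ^+ 2 - ip f g ^+ 2) / nr g ^+ 2 by field.
by rewrite pmulr_lge0 ?invr_gt0 ?exprn_gt0// subr_ge0 exprMn.
Qed.

Lemma nrD f g : sqi f -> sqi g -> nr (f + g) <= nr f + nr g.
Proof.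
move=> sf sg; rewrite -ler_sqr ?nnegrE ?addr_ge0// sqr_nrD//.
have := le_trans (ler_norm _) (ip_le sf sg); lra.
Qed.

Lemma nrB f g : sqi f -> sqi g -> nr (f - g) <= nr f + nr g.
Proof. by move=> sf sg; rewrite -(nrN g) nrD//; exact: sqiN. Qed.

Lemma nr_tri f g h : sqi f -> sqi g -> sqi h -> nr (f - h) <= nr (f - g) + nr (g - h).
Proof.
move=> sf sg sh; rewrite (_ : f - h = (f - g) + (g - h)); last by rewrite addrA subrK.
by apply: nrD; exact: sqiB.
Qed.

Lemma nr_dist f g : sqi f -> sqi g -> `|nr f - nr g| <= nr (f - g).
Proof.
move=> sf sg; have sfg := sqiB sf sg.
have := nrD sfg sg; rewrite subrK => H1.
have := nrB sf sfg; rewrite opprB addrC subrK => H2.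
rewrite ler_norml; lra.
Qed.

Lemma nr_sum (I : Type) (r : seq I) (P : pred I) (F : I -> T -> R) :
  (forall i, P i -> sqi (F i)) ->
  nr (\sum_(i <- r | P i) F i) <= \sum_(i <- r | P i) nr (F i).
Proof.
move=> sF; elim: r => [|i r IH]; first by rewrite !big_nil nr0.
rewrite !big_cons; case: ifPn => // Pi.
apply: (le_trans (nrD _ _)); [exact: sF|exact: sqi_sum|].
by rewrite lerD2l.
Qed.

Lemma nr_le f g : measurable_fun D f -> sqi g ->
  (forall x, D x -> `|f x| <= `|g x|) -> nr f <= nr g.
Proof.
move=> mf sg fg; have sf := sqi_dom mf sg fg.
rewrite !nrE ler_sqrt ?ipff_ge0// !ipE; apply: le_Rintegral => //; try exact: sqi_int.
move=> x Dx; rewrite -!expr2 -[X in X <= _](real_normK (num_real _)).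
by rewrite -[X in _ <= X](real_normK (num_real _)) lerXn2r ?nnegrE// fg.
Qed.

Lemma nrM (c : T -> R) K f : measurable_fun D c ->
  (forall x, D x -> `|c x| <= K) -> 0 <= K -> sqi f -> nr (c * f) <= K * nr f.
Proof.
move=> mc cK K0 sf; rewrite -[K in leRHS](ger0_norm K0) -nrZ//; apply: nr_le.
- by apply: measurable_funM => //; exact: sf.1.
- exact: sqiZ.
- by move=> x Dx; rewrite !fctE !normrM ler_wpM2r// (ger0_norm K0) cK.
Qed.

Lemma nr_eq0 f : sqi f -> nr f = 0 -> {ae mu, forall x, D x -> f x = 0}.
Proof.
move=> sf f0; have := sqr_nr f; rewrite ipE f0 expr0n /= => /esym fz.
have If := sqi_int sf sf.
have H : (\int[mu]_(x in D) `|((fun x => (f x * f x)%:E) x)| = 0)%E.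
  rewrite -[LHS]fineK.
    congr EFin; rewrite -[RHS]fz; congr fine; apply: eq_integral => x _.
    by rewrite abse_EFin -expr2 ger0_norm ?sqr_ge0.
  by apply: integrable_fin_num => //; exact: (integrable_abse If).
have := (ae_eq_integral_abs mu mD (measurable_int _ If)).1 H.
apply: filterS => x H1 Dx; have [] := H1 Dx.
by move/eqP; rewrite mulf_eq0 orbb => /eqP.
Qed.

Lemma nr_ae f : measurable_fun D f -> {ae mu, forall x, D x -> f x = 0} -> nr f = 0.
Proof.
move=> mf H; rewrite nrE ipE /Rintegral.
rewrite (_ : (\int[mu]_(x in D) (f x * f x)%:E)%E = 0%E) ?sqrtr0//.
rewrite (ae_eq_integral (cst 0%E)) ?integral0//.
- by apply/measurable_EFinP; exact: measurable_funM.
- by apply: filterS H => x H Dx; rewrite H// mulr0.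
Qed.

Lemma sqi_ae f g : measurable_fun D g -> {ae mu, forall x, D x -> f x = g x} ->
  sqi f -> sqi g.
Proof.
move=> mg H [mf If]; split => //.
apply/integrableP; split; first exact/measurable_EFinP/measurable_funX.
have /integrableP[_] := If; rewrite (ae_eq_integral (abse \o (EFin \o (fun x => g x ^+ 2))))//.
- by apply: measurableT_comp => //; exact/measurable_EFinP/measurable_funX.
- by apply: measurableT_comp => //; exact/measurable_EFinP/measurable_funX.
- by apply: filterS H => x H Dx /=; rewrite H.
Qed.

Lemma ip_nr0l f g : sqi f -> sqi g -> nr f = 0 -> ip f g = 0.
Proof.
move=> sf sg f0; apply/eqP; rewrite -normr_le0.
by rewrite (le_trans (ip_le sf sg))// f0 mul0r.
Qed.

Lemma nr_eq f g : sqi f -> sqi g -> nr (f - g) = 0 -> nr f = nr g.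
Proof.
move=> sf sg fg; apply/eqP; rewrite -subr_eq0 -normr_le0.
by rewrite -fg nr_dist.
Qed.

End square_integrable.
#[global] Hint Resolve nr_ge0 : core.

(** * Completeness of L^2 *)

Section completeness.
Context d (T : measurableType d) (R : realType) (mu : {measure set T -> \bar R}).
Context (D : set T) (mD : measurable D) (fD : (mu D < +oo)%E).
Local Notation sqi := (sqi mu D).
Local Notation nr := (nr mu D).
Local Notation ip := (ip mu D).

(** The measure being finite, L^2 norms dominate L^1 norms: the sum of the increments is integrable,
    hence finite almost everywhere, and the telescoping series converges absolutely there. *)
Lemma ae_cvg_rapid (u : nat -> T -> R) : (forall k, sqi (u k)) ->
  (forall k, nr (u k.+1 - u k) <= (2 ^+ k.+1)^-1) ->
  {ae mu, forall x, D x -> cvgn (u ^~ x)}.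
Proof.
move=> su hu.
pose a (k : nat) (x : T) : R := `|u k.+1 x - u k x|.
have ma k : measurable_fun D (a k).
  apply: measurableT_comp => //; apply: measurable_funB; exact: (su _).1.
have sa k : sqi (a k).
  by apply: (sqi_dom mD (ma k) (sqiB mD (su k.+1) (su k))) => x Dx; rewrite normr_id.
have s1 : sqi (cst 1) := sqi_cst mD 1 fD.
have na k : nr (a k) <= (2 ^+ k.+1)^-1.
  apply: le_trans (hu k); apply: nr_le => //; first exact: sqiB.
  by move=> x Dx; rewrite normr_id.
have Ia k : (\int[mu]_(x in D) (a k x)%:E <= (nr (cst 1) / (2 ^ (k + 1)%N)%:R)%:E)%E.
  have := sqi_int mD (sa k) s1.
  rewrite (_ : (fun x => _) = a k); last by apply/funext => x; rewrite mulr1.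
  move=> /(integrable_fin_num mD)/fineK <-; rewrite lee_fin.
  rewrite -[X in X <= _]/(\int[mu]_(x in D) a k x).
  rewrite (_ : \int[mu]_(x in D) a k x = ip (a k) (cst 1)); last first.
    by rewrite ipE; apply: eq_Rintegral => x _; rewrite mulr1.
  apply: (le_trans (ler_norm _)); apply: (le_trans (ip_le mD (sa k) s1)).
  rewrite addn1 natrX (mulrC (nr (a k))); by rewrite ler_wpM2l ?nr_ge0.
pose G x := (\sum_(0 <= k <oo) (a k x)%:E)%E.
have a0 k x : D x -> (0 <= (a k x)%:E)%E by move=> _; rewrite lee_fin /a normr_ge0.
have mG : measurable_fun D G.
  apply: ge0_emeasurable_sum => [k x Dx _|k _]; first exact: a0.
  exact/measurable_EFinP.
have GI : mu.-integrable D G.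
  apply/integrableP; split => //.
  under eq_integral => x xD.
    rewrite gee0_abs; last by apply: nneseries_ge0 => k _ _; rewrite lee_fin /a normr_ge0.
    over.
  rewrite integral_nneseries//; last by move=> k; exact/measurable_EFinP.
  apply: (@le_lt_trans _ _ (\sum_(0 <= k <oo) (nr (cst 1) / (2 ^ (k + 1)%N)%:R)%:E)%E).
    apply: lee_nneseries => [k _ _|k _]; last exact: Ia.
    by apply: integral_ge0 => x _; rewrite lee_fin /a normr_ge0.
  by rewrite (cvg_lim _ (@cvg_geometric_eseries_half R (nr (cst 1)) 0))// ltry.
have := integrable_ae mD GI; apply: filterS => x H Dx.
have {}H := H Dx.
have C : cvgn (series (telescope (u ^~ x))).
  apply: normed_cvg.
  apply: nondecreasing_is_cvgn.
    by apply/nondecreasing_seqP => n; rewrite /= seriesS lerDr/=.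
  exists (fine (G x)) => _ [n _ <-].
  rewrite -lee_fin fineK//.
  apply: le_trans (nneseries_lim_ge n _); last by move=> k _ _; rewrite lee_fin /a normr_ge0.
  by rewrite sumEFin lee_fin /series/=.
rewrite (_ : u^~ x = (fun n => u 0%N x + series (telescope (u ^~ x)) n)).
  by apply: is_cvgD => //; exact: is_cvg_cst.
by apply/funext => n; rewrite -(eq_sum_telescope (u ^~ x)).
Qed.

Lemma limn_einf_le (v : nat -> \bar R) B (N : nat) :
  (forall n, (N <= n)%N -> (v n <= B)%E) -> (limn_einf v <= B)%E.
Proof.
move=> H; rewrite limn_einf_lim; apply: lime_le; first exact: is_cvg_einfs.
exists N => // n /= Nn; apply: le_trans (H n Nn).
by apply: ereal_inf_lbound; exists n => //=.
Qed.

(** Riesz-Fischer for rapidly Cauchy sequences. The telescoped increments bound [nr (u m - u k)] for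
    [m >= k], and Fatou's lemma as [m] grows transfers the bound to the almost everywhere limit. *)
Lemma rapid_cvg (u : nat -> T -> R) : (forall k, sqi (u k)) ->
  (forall k, nr (u k.+1 - u k) <= (2 ^+ k.+1)^-1) ->
  exists2 f, sqi f & forall k, nr (u k - f) <= (2 ^+ k)^-1.
Proof.
move=> su hu.
have tail k m : nr (u (k + m)%N - u k) <= (2 ^+ k)^-1 - (2 ^+ (k + m)%N)^-1.
  elim: m => [|m IH]; first by rewrite addn0 !subrr nr0.
  rewrite addnS; apply: (le_trans (nr_tri mD (su _) (su (k + m)%N) (su _))).
  have := hu (k + m)%N; set x := nr _; set y := nr _ in IH * => h.
  have e : (2 ^+ (k + m).+1)^-1 = 2^-1 * (2 ^+ (k + m))^-1 :> R.
    by rewrite exprS invfM.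
  by move: h IH; rewrite e; lra.
(* The upper limit is measurable on all of [D], whereas the limit exists only almost everywhere. *)
pose f x := fine (limn_esup (fun k => (u k x)%:E)).
have mu_ k : measurable_fun D (u k) by exact: (su k).1.
have mf : measurable_fun D f.
  apply: (measurableT_comp (fine_measurable measurableT)).
  by apply: measurable_fun_limn_esup => k; exact/measurable_EFinP.
have Hf : {ae mu, forall x, D x -> u k x @[k --> \oo] --> f x}.
  apply: filterS (ae_cvg_rapid su hu) => x H Dx; have {}H := H Dx.
  have E : (u k x)%:E @[k --> \oo] --> (limn (u^~ x))%:E by apply: cvg_EFin => //; exact/nearW.
  by rewrite /f (cvg_limn_einf_sup E).2.
have key k : mu.-integrable D (EFin \o (fun x => (u k x - f x) ^+ 2)) /\
   (\int[mu]_(x in D) ((u k x - f x) ^+ 2)%:E <= (((2 ^+ k)^-1) ^+ 2)%:E)%E.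
  have B : (\int[mu]_(x in D) ((u k x - f x) ^+ 2)%:E <= (((2 ^+ k)^-1) ^+ 2)%:E)%E.
    pose g m x := ((u k x - u m x) ^+ 2)%:E.
    have mg m : measurable_fun D (g m).
      by apply/measurable_EFinP/measurable_funX; exact: measurable_funB.
    have g0 m x : D x -> (0 <= g m x)%E by move=> _; rewrite lee_fin sqr_ge0.
    have := fatou mu mD mg g0.
    rewrite (_ : (\int[mu]_(x in D) limn_einf (g^~ x))%E =
                 (\int[mu]_(x in D) ((u k x - f x) ^+ 2)%:E)%E); last first.
      apply: ae_eq_integral => //.
      - rewrite (_ : (fun x => limn_einf (g^~ x)) =
          (fun x => - limn_esup (fun m => - g m x))%E).
          apply: measurableT_comp => //; apply: measurable_fun_limn_esup => m.
          exact: measurableT_comp.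
        by apply/funext => x; rewrite limn_esupN oppeK.
      - by apply/measurable_EFinP/measurable_funX; exact: measurable_funB.
      - apply: filterS Hf => x H Dx; have {}H := H Dx.
        suff E : g m x @[m --> \oo] --> ((u k x - f x) ^+ 2)%:E.
          by rewrite (cvg_limn_einf_sup E).1.
        apply: cvg_EFin; first exact/nearW.
        by apply: (@cvg_comp _ _ _ _ (fun y : R => y ^+ 2) _ (nbhs (u k x - f x)));
          [apply: cvgB => //; exact: cvg_cst|exact: exprn_continuous].
    move/le_trans; apply; apply: (@limn_einf_le _ _ k) => m km.
    have sk := sqiB mD (su k) (su m).
    have := sqi_int mD sk sk => /(integrable_fin_num mD) Hfin.
    have -> : (\int[mu]_(x in D) g m x)%E = (nr (u k - u m) ^+ 2)%:E.
      rewrite sqr_nr ipE -[LHS]fineK; first by congr EFin; apply: congr1; apply: eq_integral.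
      by move: Hfin; congr (_ \is a fin_num); apply: eq_integral.
    rewrite lee_fin lerXn2r ?nnegrE ?nr_ge0 ?invr_ge0 ?exprn_ge0//.
    rewrite nrBC -(subnKC km) (le_trans (tail _ _))// gerBl invr_ge0 exprn_ge0//.
  split=> //; apply/integrableP; split.
    by apply/measurable_EFinP/measurable_funX; exact: measurable_funB.
  under eq_integral => x xD do rewrite gee0_abs ?lee_fin ?sqr_ge0//.
  by apply: le_lt_trans B _; rewrite ltry.
have sd k : sqi (u k - f).
  by split; [exact: measurable_funB|exact: (key k).1].
exists f.
  by rewrite (_ : f = u 0%N - (u 0%N - f)); [exact: sqiB|rewrite opprB addrCA subrr addr0].
move=> k; rewrite -ler_sqr ?nnegrE ?nr_ge0 ?invr_ge0 ?exprn_ge0// sqr_nr -lee_fin.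
apply: le_trans (key k).2; rewrite ipE /Rintegral fineK//.
by apply: integrable_fin_num => //; exact: sqi_int.
Qed.

(** Stated along an arbitrary proper filter because compactness is expressed with ultrafilters. A
    rapidly Cauchy sequence is drawn from nested members of the filter, and its limit is the limit
    of the whole family. *)
Lemma sqi_complete (I : Type) (F : set_system I) (FF : ProperFilter F)
    (u : I -> T -> R) :
  (\forall i \near F, sqi (u i)) ->
  (forall e, 0 < e -> exists2 A, F A &
     forall i j, A i -> A j -> nr (u i - u j) <= e) ->
  exists2 f, sqi f & nr (u i - f) @[i --> F] --> (0 : R).
Proof.
move=> su Cu.
have e0 k : 0 < (2 ^+ k.+1)^-1 :> R by rewrite invr_gt0 exprn_gt0.
have /choice[A HA] k : exists A, [/\ F A, forall i, A i -> sqi (u i) &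
    forall i j, A i -> A j -> nr (u i - u j) <= (2 ^+ k.+1)^-1].
  have [A FA HA] := Cu _ (e0 k).
  exists (A `&` [set i | sqi (u i)]); split => [|i []//|i j [Ai _] [Aj _]].
    exact: filterI.
  exact: HA.
(* Nesting puts both [s k] and [s k.+1] in [A k], whatever the choices made. *)
pose B := fix B k := if k is k'.+1 then B k' `&` A k else A 0%N.
have FB k : F (B k).
  by elim: k => [|k IH] /=; [have [] := HA 0%N|apply: filterI => //; have [] := HA k.+1].
have BA k i : B k i -> A k i by case: k => [|k] //= [].
have /choice[s Hs] : forall k, exists i, B k i.
  by move=> k; have [i Bi] := filter_ex (FB k); exists i.
have ss k : sqi (u (s k)) by have [_ + _] := HA k; apply; exact/BA/Hs.
have hs k : nr (u (s k.+1) - u (s k)) <= (2 ^+ k.+1)^-1.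
  have [_ _] := HA k; apply; last exact/BA/Hs.
  by apply: BA; have [] := Hs k.+1.
have [f sf Hf] := rapid_cvg ss hs.
exists f => //; apply/cvgrPdist_le => e ep.
have [k Hk] : exists k, 2 * (2 ^+ k)^-1 <= e :> R.
  have := @cvg_geometric _ (2 : R) (2^-1) _.
  rewrite ger0_norm// => /(_ _)/cvgrPdist_le H.
  have [N _ HN] := H (ltac:(lra)) e ep.
  exists N; have := HN N (leqnn N).
  by rewrite sub0r normrN /geometric/= exprVn => /(le_trans (ler_norm _)).
have [FA sA dA] := HA k.
near=> i.
have Ai : A k i by near: i.
rewrite sub0r normrN ger0_norm ?nr_ge0//.
apply: (le_trans (nr_tri mD (sA _ Ai) (ss k) sf)); apply: le_trans Hk.
have H1 := dA _ _ Ai (BA _ _ (Hs k)).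
have H2 := Hf k.
rewrite (le_trans (lerD H1 H2))// exprS invfM.
have : 0 <= (2 ^+ k)^-1 :> R by rewrite invr_ge0 exprn_ge0.
lra.
Unshelve. all: by end_near.
Qed.

End completeness.

(** * Lebesgue measure of the plane and test functions *)

Section dynkin.
Context d (T : measurableType d) (R : realType) (mu : {measure set T -> \bar R}).

(** The sets on which the integral vanishes form a Dynkin class. The map [pr] allows the argument to
    be run on one coordinate at a time, and on the plane with [pr] the identity. *)
Lemma Rintegral_pi_system d' (X : measurableType d') (G : set (set X))
    (D : set T) (h : T -> R) (pr : T -> X) :
  @measurable d' X = <<s G >> -> setI_closed G -> measurable D ->
  measurable_fun setT pr -> mu.-integrable D (EFin \o h) ->
  \int[mu]_(x in D) h x = 0 ->
  (forall A, G A -> \int[mu]_(x in D `&` pr @^-1` A) h x = 0) ->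
  forall A, measurable A -> \int[mu]_(x in D `&` pr @^-1` A) h x = 0.
Proof.
move=> GE GI mD mpr ih h0 hG A mA.
have mpre B : measurable B -> measurable (D `&` pr @^-1` B).
  by move=> mB; apply: measurableI => //; rewrite -[X in measurable X]setTI; exact: mpr.
have iD B : measurable B -> mu.-integrable (D `&` pr @^-1` B) (EFin \o h).
  by move=> mB; apply: (integrableS mD (mpre _ mB) _ ih) => x [].
have mA' := mA; rewrite GE in mA'.
apply: (dynkin_induction (P := [set B | \int[mu]_(x in D `&` pr @^-1` B) h x = 0]) GE GI _ _ _ _ mA').
- by rewrite /= preimage_setT setIT.
- exact: hG.
- move=> S mS /= HS.
  have := h0; rewrite -{1}[D](setIT) -(preimage_setT pr) -(setUv S) preimage_setU setIUr.
  rewrite Rintegral_setU ?HS ?add0r//; first exact: mpre.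
  + exact/mpre/measurableC.
  + rewrite -setIUr -preimage_setU setUv preimage_setT setIT//.
  + apply/disj_setPS => x [[_ /= Sx] [_ /=]]; exact.
- move=> F mF tF HF /=.
  rewrite /Rintegral preimage_bigcup setI_bigcupr integral_bigcup//.
  + rewrite (eq_eseriesr (g := fun=> 0%E)) ?eseries0//.
    move=> n _; have := HF n; rewrite /= /Rintegral => H0.
    by rewrite -[LHS]fineK ?H0//; apply: integrable_fin_num; [exact: mpre|exact: iD].
  + apply/trivIsetP => i j _ _ ij; apply/seteqP; split => // x [[_ Fi] [_ Fj]].
    have /trivIsetP/(_ i j Logic.I Logic.I ij)/seteqP[/(_ (pr x))] := tF.
    by move=> H _; apply: H.
  + by move=> n; exact: mpre.
  + rewrite -setI_bigcupr -preimage_bigcup; apply: iD; exact: bigcupT_measurable.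
Qed.

End dynkin.

Section plane.
Context {R : realType}.
Local Notation plane := (R * R)%type.
Local Notation mplane := (measurableTypeR R * measurableTypeR R)%type.
Implicit Types (w : set plane).

Definition box (a b c d : R) : set plane := `]a, b[ `*` `]c, d[.
Definition cbox (a b c d : R) : set plane := `[a, b] `*` `[c, d].

Lemma measurable_box a b c d : measurable (box a b c d : set mplane).
Proof. by apply: measurableX; exact: measurable_itv. Qed.

Lemma measurable_cbox a b c d : measurable (cbox a b c d : set mplane).
Proof. by apply: measurableX; exact: measurable_itv. Qed.

Lemma compact_cbox a b c d : compact (cbox a b c d).
Proof. by apply: compact_setX; exact: segment_compact. Qed.

Lemma sub_box_cbox a b c d : box a b c d `<=` cbox a b c d.
Proof. by move=> x [/=]; rewrite !in_itv/= => /andP[? ?] /andP[? ?]; split=> /=; rewrite in_itv/= !ltW. Qed.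

Lemma open_rat_box w (y : plane) : open w -> w y ->
  exists q : (rat * rat) * (rat * rat),
    box (ratr q.1.1) (ratr q.1.2) (ratr q.2.1) (ratr q.2.2) y /\
    cbox (ratr q.1.1) (ratr q.1.2) (ratr q.2.1) (ratr q.2.2) `<=` w.
Proof.
move=> ow wy; have : nbhs y w by exact: open_nbhs_nbhs.
case => -[A B] /= [/nbhs_ballP[r1 /= r1p H1] /nbhs_ballP[r2 /= r2p H2]] AB.
have h1 r : 0 < r -> exists p : rat * rat, forall z : R,
    (y.1 \in `]ratr p.1, ratr p.2[ ) = true /\ (z \in `[ratr p.1, ratr p.2] -> ball y.1 r z).
  move=> rp.
  have [|p1 hp1] := @rat_in_itvoo R (y.1 - r) y.1; first lra.
  have [|p2 hp2] := @rat_in_itvoo R y.1 (y.1 + r); first lra.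
  exists (p1, p2) => z; move: hp1 hp2; rewrite !in_itv/= => /andP[a1 a2] /andP[a3 a4].
  rewrite a2 a3; split=> // /andP[a5 a6]; rewrite /ball/= ltr_norml; lra.
have h2 r : 0 < r -> exists p : rat * rat, forall z : R,
    (y.2 \in `]ratr p.1, ratr p.2[ ) = true /\ (z \in `[ratr p.1, ratr p.2] -> ball y.2 r z).
  move=> rp.
  have [|p1 hp1] := @rat_in_itvoo R (y.2 - r) y.2; first lra.
  have [|p2 hp2] := @rat_in_itvoo R y.2 (y.2 + r); first lra.
  exists (p1, p2) => z; move: hp1 hp2; rewrite !in_itv/= => /andP[a1 a2] /andP[a3 a4].
  rewrite a2 a3; split=> // /andP[a5 a6]; rewrite /ball/= ltr_norml; lra.
have [p hp] := h1 _ r1p; have [q hq] := h2 _ r2p.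
exists (p, q); split.
  by split=> /=; [exact: (hp 0).1|exact: (hq 0).1].
move=> z [/= z1 z2]; apply: AB; split; [apply: H1|apply: H2].
  exact: (hp _).2.
exact: (hq _).2.
Qed.

Definition rbox (q : (rat * rat) * (rat * rat)) : set plane :=
  box (ratr q.1.1) (ratr q.1.2) (ratr q.2.1) (ratr q.2.2).
Definition rcbox (q : (rat * rat) * (rat * rat)) : set plane :=
  cbox (ratr q.1.1) (ratr q.1.2) (ratr q.2.1) (ratr q.2.2).

(** Countably many boxes with rational corners suffice, so open sets belong to the product
    sigma-algebra. Only boxes whose closed version lies in [w] are kept. *)
Lemma open_bigcup_rbox w : open w ->
  w = \bigcup_q (if `[< rcbox q `<=` w >] then rbox q else set0).
Proof.
move=> ow; apply/seteqP; split.
  move=> y wy; have [q [Hq1 Hq2]] := open_rat_box ow wy.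
  by exists q => //; case: asboolP.
by move=> y [q _]; case: asboolP => // H /sub_box_cbox; exact: H.
Qed.

Lemma open_measurable2 w : open w -> measurable (w : set mplane).
Proof.
move=> /open_bigcup_rbox ->; apply: countable_bigcupT_measurable => [|q].
  exact: countableP.
by case: ifP => // _; exact: measurable_box.
Qed.

Lemma continuous_measurable2 w (f : plane -> R) : open w ->
  (forall y, w y -> {for y, continuous f}) -> measurable_fun (w : set mplane) f.
Proof.
move=> ow cf mw; apply: (measurability _ (RGenOInfty.measurableE R)) => //.
move=> /= _ [_ [a ->] <-]; apply: open_measurable2.
rewrite openE => y [wy /= fy].
apply: filterI; first by have := ow; rewrite openE; exact.
have := cf _ wy; apply.
have : open (`]a, +oo[%classic : set R) by exact: interval_open.
by rewrite openE; exact.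
Qed.

Lemma L2normE w (f : plane -> R) : L2norm w f = nr leb2 w f.
Proof.
rewrite /L2norm unlock nrE ipE /Rintegral.
have -> : (\int[leb2]_x (`|(EFin \o f \_ w) x| `^ 2))%E =
          (\int[leb2]_(x in w) (f x * f x)%:E)%E.
  rewrite [RHS]integral_mkcond; apply: eq_integral => x _ /=.
  rewrite /patch; case: ifP => _; last by rewrite normr0 powR0.
  by rewrite powR_mulrn// -expr2 real_normK ?num_real.
rewrite poweR12_sqrt; last by apply: integral_ge0 => x _; rewrite lee_fin -expr2 sqr_ge0.
case: (\int[leb2]_(x in w) _)%E => [r||] //=; by rewrite sqrtr0.
Qed.

Lemma L2E w (f : plane -> R) : measurable (w : set mplane) ->
  L2 w f <-> sqi leb2 w f.
Proof.
move=> mw; have fE : EFin \o (fun x => (f \_ w) x ^+ 2) = (EFin \o (fun x => f x ^+ 2)) \_ w.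
  by apply/funext => x /=; rewrite /patch; case: ifP => //= _; rewrite expr0n.
split=> [Lf|[mf If]].
  split.
    have : measurable_fun setT (f \_ w : mplane -> R) by case/andP: (Lf) => + _; rewrite inE.
    by move/(measurable_restrictT _ mw).
  have := Lfun2_integrable_sqr Lf.
  by rewrite fE => /(integrable_mkcond _ mw).
rewrite /L2 inE; apply/andP; split.
  by rewrite inE; apply/(measurable_restrictT _ mw).
rewrite inE /= /finite_norm unlock.
have := If => /(integrable_mkcond _ mw); rewrite -fE => /integrableP[_].
move=> H; apply: poweR_lty; apply: le_lt_trans H.
rewrite le_eqVlt; apply/orP; left; apply/eqP; apply: eq_integral => x _ /=.
by rewrite powR_mulrn// normrX.
Qed.

Lemma leb2_cbox a b c d : (leb2 (cbox a b c d : set mplane) < +oo)%E.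
Proof.
have -> : leb2 (cbox a b c d : set mplane) =
    (lebesgue_measure (`[a, b]%classic : set R) * lebesgue_measure (`[c, d]%classic : set R))%E.
  by apply: product_measure1E; exact: measurable_itv.
rewrite !lebesgue_measure_itv; case: ifP => _; case: ifP => _; rewrite ?mule0 ?mul0e//.
by rewrite -!EFinD -EFinM ltry.
Qed.

Lemma bounded_cbox w : bounded_set w -> exists2 r, 0 < r & w `<=` cbox (- r) r (- r) r.
Proof.
move=> [M [Mr HM]]; exists (`|M| + 1).
  by rewrite ltr_wpDl.
move=> y wy; have : `|y| <= `|M| + 1 by apply: HM => //; rewrite ltr_pwDr// ler_norm.
rewrite prod_normE ge_max => /andP[]; rewrite !ler_norml => h1 h2.
by split; rewrite /= in_itv.
Qed.

Lemma leb2_bounded w : measurable (w : set mplane) -> bounded_set w -> (leb2 (w : set mplane) < +oo)%E.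
Proof.
move=> mw /bounded_cbox[r _ wr]; apply: le_lt_trans (leb2_cbox (-r) r (-r) r).
by apply: le_measure => //; rewrite inE//; exact: measurable_cbox.
Qed.

(* Vanishing of the integrals over all open subboxes is tested first on
   products of measurable sets, one factor at a time. *)
Lemma box_integral0 a b c d (g : plane -> R) :
  leb2.-integrable (box a b c d : set mplane) (EFin \o g) ->
  (forall a' b' c' d', box a' b' c' d' `<=` box a b c d ->
     \int[leb2]_(y in box a' b' c' d') g y = 0) ->
  {ae leb2, forall y, box a b c d y -> g y = 0}.
Proof.
move=> ig Hg; set Q := box a b c d in ig Hg *.
have mQ : measurable (Q : set mplane) by exact: measurable_box.
have GI : setI_closed (@RGenOInfty.G R).
  move=> _ _ [x ->] [y ->]; exists (Num.max x y); apply/seteqP; split => z /=;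
    by rewrite !in_itv/= !andbT gt_max => /andP.
have box_max x y : Q `&` fst @^-1` `]x, +oo[ `&` snd @^-1` `]y, +oo[ =
   box (Num.max a x) b (Num.max c y) d.
  apply/seteqP; split => z /=; rewrite /Q /box /= !in_itv/= !andbT !gt_max.
    by move=> [[[/andP[-> ->] /andP[-> ->]] ->] ->].
  by move=> [/andP[/andP[-> ->] ->] /andP[/andP[-> ->] ->]].
have Q0 : \int[leb2]_(y in Q) g y = 0 by exact: Hg.
have mf : measurable_fun setT (fst : mplane -> measurableTypeR R) by exact: measurable_fst.
have ms : measurable_fun setT (snd : mplane -> measurableTypeR R) by exact: measurable_snd.
have mE : @measurable _ (measurableTypeR R) = <<s @RGenOInfty.G R >> by exact: RGenOInfty.measurableE.
have H1 x (A : set R) : measurable (A : set (measurableTypeR R)) ->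
    \int[leb2]_(y in Q `&` fst @^-1` `]x, +oo[ `&` snd @^-1` A) g y = 0.
  have mQx : measurable (Q `&` fst @^-1` `]x, +oo[ : set mplane).
    apply: measurableI => //; rewrite -[X in measurable X]setTI; exact: mf.
  have Qxsub : Q `&` fst @^-1` `]x, +oo[ = box (Num.max a x) b c d.
    apply/seteqP; split => z /=; rewrite /Q /box /= !in_itv/= !andbT !gt_max.
      by move=> [[/andP[-> ->] ->] ->].
    by move=> [/andP[/andP[-> ->] ->] ->].
  apply: (Rintegral_pi_system mE GI) => //.
  - by apply: integrableS ig => // z [].
  - by rewrite Qxsub; apply: Hg; rewrite -Qxsub => z [].
  - move=> _ [y ->]; rewrite box_max; apply: Hg.
    by rewrite -box_max => z [[]].
have H2 (A B : set R) : measurable (A : set (measurableTypeR R)) ->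
    measurable (B : set (measurableTypeR R)) -> \int[leb2]_(y in Q `&` (A `*` B)) g y = 0.
  move=> mA mB; rewrite (_ : Q `&` (A `*` B) = Q `&` snd @^-1` B `&` fst @^-1` A); last first.
    by apply/seteqP; split => z; [move=> [? []]|move=> [[]]].
  have mQB : measurable (Q `&` snd @^-1` B : set mplane).
    by apply: measurableI => //; rewrite -[X in measurable X]setTI; apply: ms.
  apply: (Rintegral_pi_system mE GI) => //.
  - by apply: integrableS ig => // z [].
  - have := H1 a _ mB; congr (_ = _); congr (Rintegral _ _ _).
    apply/seteqP; split => z.
      by move=> [[]].
    by move=> [Qz Bz]; split=> //; split => //=; have [/=] := Qz; rewrite !in_itv/= => /andP[->].
  - by move=> _ [x ->]; rewrite setIAC; exact: H1.
have H3 (S : set mplane) : measurable S -> \int[leb2]_(y in Q `&` S) g y = 0.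
  move=> mS.
  apply: (@Rintegral_pi_system _ _ _ leb2 _ mplane
     [set A `*` B | A in measurable & B in measurable] Q g id) => //.
  - exact: measurable_prod_measurableType.
  - move=> _ _ [A mA [B mB <-]] [A' mA' [B' mB' <-]]; rewrite -setXI.
    exists (A `&` A'); first exact: measurableI.
    by exists (B `&` B') => //; exact: measurableI.
  - by move=> _ [A mA [B mB <-]]; exact: H2.
have : ae_eq leb2 (Q : set mplane) (EFin \o g) (cst 0%E).
  apply: integral_ae_eq => //.
  move=> E EQ mS; rewrite integral0.
  have := H3 E mS; rewrite (setIidr EQ) /Rintegral => H.
  rewrite -[LHS]fineK ?H//; apply: integrable_fin_num => //.
  exact: integrableS ig.
by apply: filterS => y H Qy; have [] := H Qy.
Qed.

Lemma ae2S (P Q : plane -> Prop) : (forall y, P y -> Q y) ->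
  {ae leb2, forall y, P y} -> {ae leb2, forall y, Q y}.
Proof. by move=> PQ; apply: (@filterS _ _ (ae_filter_ringOfSetsType leb2)). Qed.

(** The rational boxes are countably many, so their exceptional null sets can be united; [F]
    transports the enumeration to the natural numbers. *)
Lemma ae_open w (P : plane -> Prop) : open w ->
  (forall q, rcbox q `<=` w -> {ae leb2, forall y, rbox q y -> P y}) ->
  {ae leb2, forall y, w y -> P y}.
Proof.
move=> ow H.
have : {ae leb2, forall y, forall q, rcbox q `<=` w -> rbox q y -> P y}.
  have : countable [set: (rat * rat) * (rat * rat)] by exact: countableP.
  move=> /countable_bijP[B] /ppcard_eqP[f].
  pose F (n : nat) : set mplane := if n \in B then [set y : mplane | rcbox (f^-1%FUN n) `<=` w -> rbox (f^-1%FUN n) y -> P y] else setT.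
  have : {ae leb2, forall y : mplane, forall n, F n y}.
    apply/ae_foralln => n; rewrite /F; case: ifPn => _.
      have [Hn|Hn] := pselect (rcbox (f^-1%FUN n) `<=` w).
        by apply: ae2S (H _ Hn) => y Hy _.
      by apply: aeW => y /Hn.
    exact: aeW.
  apply: ae2S => y Hy q; have := Hy (f q); rewrite /F ifT /=.
    by rewrite funK// inE.
  by rewrite inE; apply: funS.
apply: ae2S => y Hy wy; have [q [q1 q2]] := open_rat_box ow wy.
exact: Hy q1.
Qed.

End plane.

Section line.
Context {R : realType} {V : normedModType R} {W : normedModType R}.

Lemma is_derive_line (f : V -> W) (y v : V) (l : W) :
  is_derive (0 : R) 1 (fun t : R => f (t *: v + y)) l <-> is_derive y v f l.
Proof.
have E : (fun h : R => h^-1 *: (((fun t : R => f (t *: v + y)) \o shift 0) (h *: 1) -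
      (fun t : R => f (t *: v + y)) 0)) =
   (fun h : R => h^-1 *: ((f \o shift y) (h *: v) - f y)).
  apply/funext => h /=; rewrite addr0 scale0r add0r.
  by rewrite -[X in X *: v]/(h * 1) mulr1.
split=> -[d1 d2]; split.
- by move: d1; rewrite /derivable E.
- by move: d2; rewrite /derive E.
- by rewrite /derivable E.
- by rewrite /derive E.
Qed.

End line.

Lemma is_derive_shift {R : realType} {V W : normedModType R} (f : V -> W) (y v : V) (t : R) (l : W) :
  is_derive (t *: v + y) v f l -> is_derive t 1 (fun t : R => f (t *: v + y)) l.
Proof.
move=> H; apply/(@is_derive_line R R W _ t 1 l).
move: H => /(@is_derive_line R V W); congr (is_derive _ _ _ _).
apply/funext => s; rewrite -[s *: 1]/(s * 1) mulr1.
by rewrite scalerDl addrA.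
Qed.


(** * Smooth functions supported in a box *)

Section bump.
Context {R : realType}.
Local Notation plane := (R * R)%type.

(** The function [t^-k exp (- 1 / t)] extended by zero. The exponent is a parameter because
    differentiation maps the span of this family to itself. *)
Definition bump (k : nat) (t : R) : R := if 0 < t then t^-1 ^+ k * expR (- t^-1) else 0.

Lemma bump_ge0 k t : 0 <= bump k t.
Proof.
by rewrite /bump; case: ifPn => // t0; rewrite mulr_ge0 ?expR_ge0// exprn_ge0// invr_ge0 ltW.
Qed.

Lemma bump0_le1 t : bump 0 t <= 1.
Proof.
rewrite /bump; case: ifPn => // t0; rewrite expr0 mul1r -expR0 ler_expR.
by rewrite oppr_le0 invr_ge0 ltW.
Qed.

(** With [s = 1 / t] and [m = k + 2], [exp s >= (s / m) ^ m] gives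
    [s ^ k exp (- s) <= m ^ m / s ^ 2]. Quadratic decay at 0 is what makes the derivative there
    exist and vanish. *)
Lemma bump_le k : exists2 C, 0 < C & forall t, bump k t <= C * t ^+ 2.
Proof.
pose m := k.+2; exists (m%:R ^+ m) => [|t]; first by rewrite exprn_gt0 ?ltr0n.
have C0 : 0 < m%:R :> R by rewrite ltr0n.
rewrite /bump; case: ifPn => t0; last by rewrite mulr_ge0 ?sqr_ge0 ?exprn_ge0 ?ltW.
have s0 : 0 < t^-1 by rewrite invr_gt0.
have : (t^-1 / m%:R) ^+ m <= expR (t^-1).
  have -> : expR t^-1 = expR (t^-1 / m%:R) ^+ m by rewrite -expRM_natl mulrC divfK// gt_eqF.
  rewrite lerXn2r ?nnegrE ?expR_ge0 ?divr_ge0 ?ltW//.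
  by apply: lt_le_trans (expR_ge1Dx _); rewrite ltrDr.
rewrite expr_div_n ler_pdivrMr ?exprn_gt0// => H.
rewrite expRN -[leLHS](@mulfK _ (t^-1 ^+ 2)) ?expf_neq0 ?gt_eqF//.
rewrite (_ : (t^-1 ^+ 2)^-1 = t ^+ 2); last by rewrite exprVn invrK.
rewrite ler_wpM2r ?sqr_ge0// -mulrA (mulrC (expR _)^-1) mulrA -exprD addn2.
by rewrite ler_pdivrMr ?expR_gt0// (le_trans H)// mulrC.
Qed.

Lemma is_derive_bump k (t : R) :
  is_derive t 1 (bump k) (bump k.+2 t - k%:R * bump k.+1 t).
Proof.
have [t0|t0|<-] := ltgtP 0 t.
- have Hn : \forall s \near t, s^-1 ^+ k * expR (- s^-1) = bump k s.
    near=> s; rewrite /bump ifT//; near: s; exact: lt_nbhsr.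
  apply: (near_eq_is_derive Hn).
  have tn0 : t != 0 by rewrite gt_eqF.
  have dV : is_derive t 1 (fun s : R => s^-1) (- t ^- 2).
    have := @is_deriveV R id t 1 1 tn0 (is_derive_id _ _).
    by rewrite -[X in is_derive _ _ _ X -> _]/(- t ^- 2 * 1) mulr1.
  have dE : is_derive t 1 (expR \o (- (fun s : R => s^-1))) (expR (- t^-1) * t ^- 2).
    apply: (@is_derive1_comp _ expR (- (fun s : R => s^-1)) t (expR (- t^-1)) (t ^- 2)).
    by rewrite -[t ^- 2]opprK; exact: is_deriveN.
  have := is_deriveM (is_deriveX k dV) dE.
  rewrite (_ : (fun s : R => s^-1) ^+ k * (expR \o (- (fun s : R => s^-1))) =
     (fun s => s^-1 ^+ k * expR (- s^-1))); last first.
    by apply/funext => s /=; rewrite !fctE; congr (_ * _); rewrite exprfctE.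
  move/is_derive_eq; apply; rewrite /bump t0 exprfctE /=.
  rewrite -![_ *: _]/(_ * _) (_ : (- _) t = - t^-1)//.
  rewrite -exprVn; move: (t^-1) (expR _) => x E.
  case: k {Hn} => [|k]; rewrite /= ?exprS; ring.
- have Hn : \forall s \near t, cst 0 s = bump k s.
    near=> s; rewrite /bump ifF//; apply/negbTE; rewrite -leNgt ltW//; near: s.
    exact: lt_nbhsl.
  apply: (near_eq_is_derive Hn); rewrite /bump ltNge (ltW t0)/= mulr0 subr0.
  exact: is_derive_cst.
- have [C C0 HC] := bump_le k.
  rewrite /bump ltxx mulr0 subr0.
  have H : (h^-1 *: ((bump k \o shift 0) (h *: 1) - bump k 0)) @[h --> (0:R)^'] --> (0 : R).
    apply/cvgrPdist_le => e e0; near=> h.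
    have hn0 : h != 0 by near: h; exact: nbhs_dnbhs_neq.
    rewrite sub0r normrN -![_ *: _]/(_ * _) mulr1 /= addr0 /bump ltxx subr0 -/(bump k h).
    rewrite normrM (ger0_norm (bump_ge0 _ _)) (le_trans (ler_wpM2l _ (HC h)))//.
    have -> : `|h^-1| * (C * h ^+ 2) = C * `|h|.
      rewrite -(real_normK (num_real h)) normfV; field.
      by rewrite normr_eq0.
    rewrite mulrC -ler_pdivlMr// mulrC; near: h.
    by apply: dnbhs0_le; rewrite mulr_gt0 ?invr_gt0.
  split; first by apply/cvg_ex; exists 0.
  exact: (cvg_lim _ H).
Unshelve. all: by end_near.
Qed.

Lemma continuous_bump k : continuous (bump k).
Proof.
move=> t; apply: differentiable_continuous; apply/derivable1_diffP.
by have [] := is_derive_bump k t.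
Qed.

(* A class of smooth functions that is visibly stable under partial
   derivatives and whose partial derivatives visibly commute. *)
Inductive Smf : (plane -> R) -> Prop :=
| Smf_cst c : Smf (cst c)
| Smf_fst k (al be : R) : Smf (fun y => bump k (al * y.1 + be))
| Smf_snd k (al be : R) : Smf (fun y => bump k (al * y.2 + be))
| Smf_add f g : Smf f -> Smf g -> Smf (f + g)
| Smf_mul f g : Smf f -> Smf g -> Smf (f * g).

Lemma ord2P (P : 'I_2 -> Prop) : P 0 -> P 1 -> forall a, P a.
Proof.
move=> P0 P1 a; have [->|->] : a = 0 \/ a = 1; last by [].
  by case: a => -[|[|//]] i; [left|right]; apply: val_inj.
by [].
Qed.

Lemma is_derive_affine (al be s t : R) : is_derive t 1 (fun x => al * (x * s + be)) (al * s).
Proof.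
have := @is_deriveZ R R R _ (al * s) t 1 1 (is_derive_id t 1).
rewrite -[_ *: 1]/(_ * 1) mulr1 => H.
have := is_deriveD H (is_derive_cst (al * be) t 1).
by rewrite addr0; congr (is_derive _ _ _ _); apply/funext => x; rewrite !fctE /= -[_ *: x]/((al * s) * x); ring.
Qed.

Lemma is_derive_bump_fst k al be (y : plane) a :
  is_derive y (e_ a) (fun y => bump k (al * y.1 + be))
    ((bump k.+2 (al * y.1 + be) - k%:R * bump k.+1 (al * y.1 + be)) * (al * (a == 0)%:R)).
Proof.
apply/is_derive_line.
rewrite (_ : (fun t => _) = bump k \o (fun t : R => al * (t * (a == 0)%:R + (y.1)) + be)); last first.
  by apply/funext => t /=.
apply: is_derive1_comp.
  by rewrite mul0r add0r; exact: is_derive_bump.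
have := is_deriveD (is_derive_affine al y.1 (a == 0)%:R 0) (is_derive_cst be (0:R) 1).
by rewrite addr0.
Qed.

Lemma is_derive_bump_snd k al be (y : plane) a :
  is_derive y (e_ a) (fun y => bump k (al * y.2 + be))
    ((bump k.+2 (al * y.2 + be) - k%:R * bump k.+1 (al * y.2 + be)) * (al * (a == 1)%:R)).
Proof.
apply/is_derive_line.
rewrite (_ : (fun t => _) = bump k \o (fun t : R => al * (t * (a == 1)%:R + (y.2)) + be)); last first.
  by apply/funext => t /=.
apply: is_derive1_comp.
  by rewrite mul0r add0r; exact: is_derive_bump.
have := is_deriveD (is_derive_affine al y.2 (a == 1)%:R 0) (is_derive_cst be (0:R) 1).
by rewrite addr0.
Qed.

Lemma Smf_scale c f : Smf f -> Smf (c *: f).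
Proof.
move=> sf; rewrite (_ : c *: f = cst c * f); first by apply: Smf_mul => //; exact: Smf_cst.
by apply/funext.
Qed.

Lemma Smf_derive f : Smf f -> forall a, Smf ('D_(e_ a) f) /\ forall y, derivable f y (e_ a).
Proof.
elim=> {f} [c|k al be|k al be|f g sf IHf sg IHg|f g sf IHf sg IHg] a.
- split=> [|y]; last exact: derivable_cst.
  by rewrite (_ : 'D_(e_ a) _ = cst 0); [exact: Smf_cst|apply/funext => y; rewrite derive_cst].
- split=> [|y]; last by have [] := is_derive_bump_fst k al be y a.
  rewrite (_ : 'D_(e_ a) _ = (al * (a == 0)%:R) *: ((fun y => bump k.+2 (al * y.1 + be)) +
    (- k%:R) *: (fun y => bump k.+1 (al * y.1 + be)))).
    by apply: Smf_scale; apply: Smf_add; [|apply: Smf_scale]; exact: Smf_fst.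
  apply/funext => y; have [_ ->] := is_derive_bump_fst k al be y a.
  by rewrite !fctE -![_ *: _]/(_ * _); ring.
- split=> [|y]; last by have [] := is_derive_bump_snd k al be y a.
  rewrite (_ : 'D_(e_ a) _ = (al * (a == 1)%:R) *: ((fun y => bump k.+2 (al * y.2 + be)) +
    (- k%:R) *: (fun y => bump k.+1 (al * y.2 + be)))).
    by apply: Smf_scale; apply: Smf_add; [|apply: Smf_scale]; exact: Smf_snd.
  apply/funext => y; have [_ ->] := is_derive_bump_snd k al be y a.
  by rewrite !fctE -![_ *: _]/(_ * _); ring.
- have [sDf Df] := IHf a; have [sDg Dg] := IHg a.
  split=> [|y]; last exact: derivableD.
  rewrite (_ : 'D_(e_ a) _ = 'D_(e_ a) f + 'D_(e_ a) g); first exact: Smf_add.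
  by apply/funext => y; rewrite deriveD.
- have [sDf Df] := IHf a; have [sDg Dg] := IHg a.
  split=> [|y]; last exact: derivableM.
  rewrite (_ : 'D_(e_ a) _ = f * 'D_(e_ a) g + g * 'D_(e_ a) f).
    by apply: Smf_add; exact: Smf_mul.
  by apply/funext => y; rewrite deriveM.
Qed.

Lemma Smf_continuous f : Smf f -> continuous f.
Proof.
have aff (al be : R) : continuous (fun x : R => al * x + be).
  move=> x; apply: cvgD; last exact: cvg_cst.
  by apply: cvgM; [exact: cvg_cst|exact: cvg_id].
elim=> {f} [c|k al be|k al be|f g sf IHf sg IHg|f g sf IHf sg IHg] y.
- exact: cvg_cst.
- apply: (@continuous_comp _ _ _ fst (fun x => bump k (al * x + be))); first exact: cvg_fst.
  apply: (@continuous_comp _ _ _ (fun x => al * x + be) (bump k)); first exact: aff.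
  exact: continuous_bump.
- apply: (@continuous_comp _ _ _ snd (fun x => bump k (al * x + be))); first exact: cvg_snd.
  apply: (@continuous_comp _ _ _ (fun x => al * x + be) (bump k)); first exact: aff.
  exact: continuous_bump.
- by apply: cvgD; [exact: IHf|exact: IHg].
- by apply: cvgM; [exact: IHf|exact: IHg].
Qed.

Lemma Smf_iter f l : Smf f -> Smf (iter_partial l f).
Proof. by move=> sf; elim: l => [//|a l IH] /=; have [] := Smf_derive IH a. Qed.

Lemma Smf_smooth f : Smf f -> smooth f.
Proof.
move=> sf l; split; first exact/Smf_continuous/Smf_iter.
by move=> a y; have [_] := Smf_derive (Smf_iter l sf) a; exact.
Qed.

Definition Dr a (f g : plane -> R) := forall y, is_derive y (e_ a) f (g y).

Lemma DrE a f g : Dr a f g -> 'D_(e_ a) f = g.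
Proof. by move=> H; apply/funext => y; have [_] := H y. Qed.

(** The derivatives are carried along the induction as explicit formulas, so that the symmetry of
    the second ones is a matter of algebra. *)
Lemma Smf_D2 f : Smf f -> exists F G, [/\ forall a, Dr a f (F a),
  forall a b, Dr a (F b) (G a b) & forall a b, G a b = G b a].
Proof.
elim=> {f} [c|k al be|k al be|f g sf IHf sg IHg|f g sf IHf sg IHg].
- exists (fun=> cst 0), (fun _ _ => cst 0).
  by split => // [a y|a b y]; exact: is_derive_cst.
- pose B j (y : plane) := bump j (al * y.1 + be).
  pose B' j (y : plane) := B j.+2 y - j%:R * B j.+1 y.
  have dB j a y : is_derive y (e_ a) (B j) (B' j y * (al * (a == 0)%:R)) by exact: is_derive_bump_fst.
  exists (fun a y => B' k y * (al * (a == 0)%:R)),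
    (fun a b y => (B' k.+2 y - k%:R * B' k.+1 y) * ((al * (a == 0)%:R) * (al * (b == 0)%:R))).
  split=> [a y|a b y|a b]; first exact: dB; last by apply/funext => y; congr (_ * _); rewrite mulrC.
  have := is_deriveZ (al * (b == 0)%:R) (is_deriveD (dB k.+2 a y) (is_deriveZ (- k%:R) (dB k.+1 a y))).
  rewrite (_ : _ \*: _ = (fun y => B' k y * (al * (b == 0)%:R))); last first.
    by apply/funext => x; rewrite /B' -[LHS]/((al * (b == 0)%:R) * (B k.+2 x + (- k%:R) * B k.+1 x)); ring.
  by move/is_derive_eq; apply; rewrite -![_ *: _]/(_ * _); ring.
- pose B j (y : plane) := bump j (al * y.2 + be).
  pose B' j (y : plane) := B j.+2 y - j%:R * B j.+1 y.
  have dB j a y : is_derive y (e_ a) (B j) (B' j y * (al * (a == 1)%:R)) by exact: is_derive_bump_snd.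
  exists (fun a y => B' k y * (al * (a == 1)%:R)),
    (fun a b y => (B' k.+2 y - k%:R * B' k.+1 y) * ((al * (a == 1)%:R) * (al * (b == 1)%:R))).
  split=> [a y|a b y|a b]; first exact: dB; last by apply/funext => y; congr (_ * _); rewrite mulrC.
  have := is_deriveZ (al * (b == 1)%:R) (is_deriveD (dB k.+2 a y) (is_deriveZ (- k%:R) (dB k.+1 a y))).
  rewrite (_ : _ \*: _ = (fun y => B' k y * (al * (b == 1)%:R))); last first.
    by apply/funext => x; rewrite /B' -[LHS]/((al * (b == 1)%:R) * (B k.+2 x + (- k%:R) * B k.+1 x)); ring.
  by move/is_derive_eq; apply; rewrite -![_ *: _]/(_ * _); ring.
- have [F [G [D1 D2 D3]]] := IHf; have [F' [G' [D1' D2' D3']]] := IHg.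
  exists (fun a => F a + F' a), (fun a b => G a b + G' a b); split=> [a y|a b y|a b].
  + exact: is_deriveD (D1 a y) (D1' a y).
  + exact: is_deriveD (D2 a b y) (D2' a b y).
  + by rewrite D3 D3'.
- have [F [G [D1 D2 D3]]] := IHf; have [F' [G' [D1' D2' D3']]] := IHg.
  exists (fun a => f * F' a + g * F a),
    (fun a b => (f * G' a b + F' b * F a) + (g * G a b + F b * F' a)); split=> [a y|a b y|a b].
  + exact: is_deriveM (D1 a y) (D1' a y).
  + exact: is_deriveD (is_deriveM (D1 a y) (D2' a b y)) (is_deriveM (D1' a y) (D2 a b y)).
  + by rewrite D3 D3'; ring.
Qed.

Lemma Smf_comm f a b : Smf f -> 'D_(e_ a) ('D_(e_ b) f) = 'D_(e_ b) ('D_(e_ a) f).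
Proof.
move=> /Smf_D2[F [G [D1 D2 D3]]].
by rewrite (DrE (D1 b)) (DrE (D1 a)) (DrE (D2 a b)) (DrE (D2 b a)) D3.
Qed.

(* Inside the box the four arguments tend to +oo with [n], so that [box_bump]
   tends to its indicator function. *)
Definition box_bump (a b c d : R) (n : nat) (y : plane) : R :=
  bump 0 (n%:R * y.1 + - (n%:R * a)) * bump 0 (- n%:R * y.1 + n%:R * b) *
  (bump 0 (n%:R * y.2 + - (n%:R * c)) * bump 0 (- n%:R * y.2 + n%:R * d)).

Lemma Smf_box_bump a b c d n : Smf (box_bump a b c d n).
Proof.
have E : box_bump a b c d n =
  ((fun y => bump 0 (n%:R * y.1 + - (n%:R * a))) * (fun y => bump 0 (- n%:R * y.1 + n%:R * b)))
  * ((fun y => bump 0 (n%:R * y.2 + - (n%:R * c))) * (fun y => bump 0 (- n%:R * y.2 + n%:R * d))).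
  by [].
by rewrite E; apply: Smf_mul; apply: Smf_mul;
  first [exact: Smf_fst|exact: Smf_snd].
Qed.

Lemma box_bump_bound a b c d n y : 0 <= box_bump a b c d n y <= 1.
Proof.
have H s t : 0 <= bump 0 s * bump 0 t <= 1.
  by rewrite mulr_ge0 ?bump_ge0//= mulr_ile1 ?bump_ge0 ?bump0_le1.
have /andP[p0 p1] := H (n%:R * y.1 + - (n%:R * a)) (- n%:R * y.1 + n%:R * b).
have /andP[q0 q1] := H (n%:R * y.2 + - (n%:R * c)) (- n%:R * y.2 + n%:R * d).
by rewrite /box_bump mulr_ge0//= mulr_ile1.
Qed.

Lemma bump0_out k t : t <= 0 -> bump k t = 0.
Proof. by rewrite /bump ltNge => ->. Qed.

Lemma box_bump_out a b c d n y : ~ box a b c d y -> box_bump a b c d n y = 0.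
Proof.
move=> yb; apply/eqP/negPn/negP => H; apply: yb; move: H; rewrite /box_bump !mulf_eq0 !negb_or.
have P x z : bump 0 (n%:R * x + - (n%:R * z)) != 0 -> z < x.
  apply: contraNT; rewrite -leNgt => xz; apply/eqP/bump0_out.
  by rewrite subr_le0 ler_wpM2l.
have Q x z : bump 0 (- n%:R * x + n%:R * z) != 0 -> x < z.
  apply: contraNT; rewrite -leNgt => xz; apply/eqP/bump0_out.
  by rewrite addrC mulNr subr_le0 ler_wpM2l.
move=> /andP[/andP[/P h1 /Q h2] /andP[/P h3 /Q h4]].
by split; rewrite /= in_itv/= ?h1 ?h2 ?h3 ?h4.
Qed.

Lemma bump0_cvg1 (t : R) : 0 < t -> bump 0 (n%:R * t) @[n --> \oo] --> (1 : R).
Proof.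
move=> t0; have /cvgrPdist_le H : expR s @[s --> (0 : R)] --> (1 : R).
  by rewrite -(@expR0 R); exact: continuous_expR.
apply/cvgrPdist_le => e e0; near=> n.
have n0 : (0 < n)%N by near: n; exact: nbhs_infty_gt.
rewrite /bump mulr_gt0 ?ltr0n// expr0 mul1r.
near: n.
have : (- (n%:R * t)^-1) @[n --> \oo] --> (0 : R).
  rewrite -[X in _ --> X]oppr0; apply: cvgN.
  under eq_fun do rewrite invfM mulrC.
  have {1}-> : (0 : R) = t^-1 * 0 by rewrite mulr0.
  apply: cvgM; first exact: cvg_cst.
  rewrite -(cvg_shiftS (fun n : nat => (n%:R : R)^-1)); exact: cvg_harmonic.
by move=> /(_ _ (H _ e0)).
Unshelve. all: by end_near.
Qed.

Lemma box_bump_cvg a b c d y : box a b c d y -> box_bump a b c d n y @[n --> \oo] --> (1 : R).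
Proof.
move=> [/=]; rewrite !in_itv/= => /andP[h1 h2] /andP[h3 h4].
have -> : (1 : R) = (1 * 1) * (1 * 1) by rewrite !mulr1.
have E (x z : R) (n : nat) : n%:R * x + - (n%:R * z) = n%:R * (x - z) by ring.
have E' (x z : R) (n : nat) : - n%:R * x + n%:R * z = n%:R * (z - x) by ring.
by apply: cvgM; apply: cvgM; under eq_fun do rewrite ?E ?E'; apply: bump0_cvg1; rewrite subr_gt0.
Qed.

Lemma test_box_bump w a b c d n : cbox a b c d `<=` w -> test_function w (box_bump a b c d n).
Proof.
move=> bw.
have cc : closed (cbox a b c d).
  apply: compact_closed; last exact: compact_cbox.
  exact: norm_hausdorff.
have sub : closure [set y | box_bump a b c d n y != 0] `<=` cbox a b c d.
  move/closure_id : cc => ->; apply: closure_subset => y /= /eqP H; apply: sub_box_cbox.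
  by apply: contrapT => Hb; apply: H; exact: box_bump_out.
split; first exact/Smf_smooth/Smf_box_bump.
  by apply: subclosed_compact sub; [exact: closed_closure|exact: compact_cbox].
exact: subset_trans bw.
Qed.

End bump.

(** * The fundamental lemma of the calculus of variations *)

Section fundamental.
Context {R : realType} (w : set (R * R)) (ow : open w)
  (fw : (leb2 (w : set (measurableTypeR R * measurableTypeR R)) < +oo)%E).
Local Notation plane := (R * R)%type.
Local Notation mplane := (measurableTypeR R * measurableTypeR R)%type.
Local Notation sqi := (sqi (@leb2 R) w).
Local Notation ip := (ip (@leb2 R) w).
Local Notation nr := (nr (@leb2 R) w).

Let mw : measurable (w : set mplane) := open_measurable2 ow.

(** By dominated convergence, the test against [box_bump] tends to the integral over the open box as
    [n] grows, and [box_integral0] concludes on each rational box. Testing against these functions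
    alone is what [weak_comm] exploits, since their partial derivatives commute. *)
Lemma fundamental (g : plane -> R) : sqi g ->
  (forall a b c d n, cbox a b c d `<=` w -> ip g (box_bump a b c d n) = 0) -> nr g = 0.
Proof.
move=> sg H; apply: nr_ae => //; first exact: sg.1.
have ig : leb2.-integrable (w : set mplane) (EFin \o g).
  have := sqi_int mw sg (sqi_cst mw 1 fw); rewrite (_ : (fun x => _) = g)//.
  by apply/funext => y; rewrite mulr1.
apply: ae_open => // q qw; apply: box_integral0.
  apply: integrableS ig => //; first exact: measurable_box.
  by apply: subset_trans qw; exact: sub_box_cbox.
move=> a b c d sub.
have [Hne|He] := pselect (exists y, box a b c d y); last first.
  rewrite (_ : box a b c d = set0) ?Rintegral_set0//.
  by apply/seteqP; split => // y yb; apply: He; exists y.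
(* A nonempty open box inside an open rational box has its closure inside the closed rational box,
   hence in [w], as the support condition on [box_bump] demands. *)
have cw : cbox a b c d `<=` w.
  apply: subset_trans qw => y [/= y1 y2].
  move: Hne => [[z1 z2] [/= Hz1 Hz2]].
  have S1 t : t \in `]a, b[ -> t \in `](ratr q.1.1 : R), ratr q.1.2[.
    by move=> tab; have [/=] := sub (t, z2) (conj tab Hz2).
  have S2 t : t \in `]c, d[ -> t \in `](ratr q.2.1 : R), ratr q.2.2[.
    by move=> tab; have [/=] := sub (z1, t) (conj Hz1 tab).
  clear - S1 S2 Hz1 Hz2 y1 y2.
  suff K : forall (a b p r z t : R), z \in `]a, b[ -> (forall t, t \in `]a, b[ -> t \in `]p, r[) ->
      t \in `[a, b] -> t \in `[p, r].
    split; [exact: (K _ _ _ _ z1 _ Hz1 S1 y1)|exact: (K _ _ _ _ z2 _ Hz2 S2 y2)].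
  clear; move=> a b p r z t.
  rewrite !in_itv/= => /andP[az zb] S /andP[at_ tb]; apply/andP; split.
      rewrite leNgt; apply/negP => tp; have := S ((a + Num.min p b) / 2).
      have : Num.min p b <= b by rewrite ge_min lexx orbT.
      have : Num.min p b <= p by rewrite ge_min lexx.
      have : a < Num.min p b by rewrite lt_min (le_lt_trans at_ tp) (lt_trans az zb).
      by rewrite !in_itv/= => h1 h2 h3 /(_ _)/andP[|h4 h5]; lra.
    rewrite leNgt; apply/negP => tp; have := S ((b + Num.max r a) / 2).
    have : a <= Num.max r a by rewrite le_max lexx orbT.
    have : r <= Num.max r a by rewrite le_max lexx.
    have : Num.max r a < b by rewrite gt_max (lt_le_trans tp tb) (lt_trans az zb).
    by rewrite !in_itv/= => h1 h2 h3 /(_ _)/andP[|h4 h5]; lra.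
have mB : measurable (box a b c d : set mplane) by exact: measurable_box.
have mbump n : measurable_fun (w : set mplane) (box_bump a b c d n).
  by apply: continuous_measurable2 => // y _; apply/Smf_continuous/Smf_box_bump.
have bw : box a b c d `<=` w by apply: subset_trans cw; exact: sub_box_cbox.
have mgw : measurable_fun (w : set mplane) g by exact: sg.1.
have mn n : measurable_fun (w : set mplane) (fun y => g y * box_bump a b c d n y).
  exact: measurable_funM.
pose F n (y : mplane) := (g y * box_bump a b c d n y)%:E.
pose G : mplane -> \bar R := (EFin \o g) \_ (box a b c d).
have mF n : measurable_fun (w : set mplane) (F n) by exact: (measurable_EFinP _ _).2 (mn n).
have mG : measurable_fun (w : set mplane) G.
  apply/(measurable_restrict _ mB mw).
  by apply/measurable_EFinP; apply: measurable_funS mgw => //; exact: subIsetl.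
have FG : {ae leb2, forall y : mplane, (w : set mplane) y -> F n y @[n --> \oo] --> G y}.
  apply: aeW => y wy; rewrite /F /G /patch; case: ifPn => yb.
    apply: cvg_EFin; first exact/nearW.
    rewrite -[X in _ --> X]mulr1; apply: cvgM; first exact: cvg_cst.
    by apply: box_bump_cvg; rewrite inE in yb.
  apply: cvg_near_cst; apply: nearW => n.
  by rewrite box_bump_out ?mulr0// => yb'; move/negP: yb; apply; rewrite inE.
have FB : {ae leb2, forall y : mplane, forall n, (w : set mplane) y ->
     (`|F n y| <= (EFin \o (fun y => `|g y|)%R) y)%E}.
  apply: aeW => y n wy /=; rewrite lee_fin normrM ler_piMr//.
  have /andP[h0 h1] := box_bump_bound a b c d n y.
  by rewrite ger0_norm.
have [_ _ L] := dominated_convergence mw mF mG FG (integrable_norm ig) FB.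
have F0 n : (\int[leb2]_(y in w) F n y = 0)%E.
  have := H a b c d n cw; rewrite ipE /Rintegral => H0.
  rewrite -[LHS]fineK; first by rewrite H0.
  apply: integrable_fin_num => //; apply: sqi_int => //; split => //.
  apply: measurable_bounded_integrable => //; first exact: measurable_funX.
  exists 1; split; first exact: num_real.
  move=> M M1 y _ /=; rewrite (le_trans _ (ltW M1))//.
  have /andP[h0 h1] := box_bump_bound a b c d n y.
  by rewrite ger0_norm ?sqr_ge0// exprn_ile1.
have {}L : (fun=> 0%E) @ \oo --> (\int[leb2]_(y in w) G y)%E.
  by apply: cvg_trans L; rewrite (_ : [sequence _]_n = fun=> 0%E)//; apply/funext.
have E0 : (\int[leb2]_(y in w) G y)%E = 0%E.
  by apply/esym; apply: (cvg_unique _ _ L) => //; exact: cvg_cst.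
rewrite -(setIidr bw) /Rintegral integral_mkcondr.
by rewrite -[RHS]/(fine 0%E); congr fine.
Qed.

End fundamental.

(** * Integrals of derivatives of compactly supported functions *)

Section ftc.
Context {R : realType}.
Local Notation mu := (@lebesgue_measure R).

Lemma FTC_Rintegral (f f' : R -> R) (a b : R) : a <= b ->
  (forall t : R, is_derive t 1 f (f' t)) -> continuous f' ->
  (\int[mu]_(t in `[a, b]) (f' t)%:E = (f b - f a)%:E)%E.
Proof.
move=> ab df cf'; have := ab; rewrite le_eqVlt => /orP[/eqP<-|ltab].
  by rewrite subrr set_itv1 integral_set1.
have cf : continuous f.
  move=> t; apply: differentiable_continuous; apply/derivable1_diffP.
  by have [] := df t.
rewrite (@continuous_FTC2 _ f' f) ?EFinB//.
- exact: continuous_subspaceT.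
- split.
  + by move=> t _; have [] := df t.
  + exact/cvg_at_right_filter/cf.
  + exact/cvg_at_left_filter/cf.
- by move=> t _; rewrite derive1E; have [_] := df t.
Qed.

End ftc.

Section C0.
Context {R : realType}.
Local Notation plane := (R * R)%type.
Local Notation mplane := (measurableTypeR R * measurableTypeR R)%type.

Definition C0 (r : R) (f : plane -> R) :=
  continuous f /\ forall y, ~ cbox (- r) r (- r) r y -> f y = 0.

Lemma C0_bounded r f : C0 r f -> exists2 M, 0 < M & forall y, `|f y| <= M.
Proof.
move=> [cf f0].
have : compact (f @` cbox (- r) r (- r) r).
  by apply: continuous_compact; [exact: continuous_subspaceT|exact: compact_cbox].
move=> /compact_bounded[M [Mr HM]]; exists (`|M| + 1); first by rewrite ltr_wpDl.
move=> y; have [yb|yb] := pselect (cbox (- r) r (- r) r y); last by rewrite f0// normr0 addr_ge0.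
by apply: HM; [rewrite ltr_pwDr// ler_norm|exists y].
Qed.

Lemma C0_measurable r f D : C0 r f -> measurable (D : set mplane) -> measurable_fun D f.
Proof.
move=> [cf _] mD; apply: (@measurable_funS _ _ _ _ setT) => //.
by apply: continuous_measurable2; [exact: openT|move=> y _; exact: cf].
Qed.

Lemma C0M r f g : C0 r f -> continuous g -> C0 r (f * g).
Proof.
move=> [cf f0] cg; split; last by move=> y yb; rewrite fctE f0// mul0r.
by move=> y; apply: cvgM; [exact: cf|exact: cg].
Qed.

Lemma C0_integrable r f : C0 r f -> leb2.-integrable (setT : set mplane) (EFin \o f).
Proof.
move=> Cf; have [cf f0] := Cf; have mb := measurable_cbox (- r) r (- r) r.
have -> : EFin \o f = (EFin \o f) \_ (cbox (- r) r (- r) r).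
  apply/funext => y /=; rewrite /patch; case: ifPn => // /negP yb.
  by rewrite /= f0// => yb'; apply: yb; rewrite inE.
apply/(integrable_mkcond _ mb); apply: measurable_bounded_integrable => //.
- exact: leb2_cbox.
- exact: C0_measurable Cf mb.
- have [M _ HM] := C0_bounded Cf.
  by exists M; split; [exact: num_real|move=> x Mx y _ /=; rewrite (le_trans (HM y))// ltW].
Qed.

Lemma is_derive_fst (f g : plane -> R) (y : R) : Dr 0 f g ->
  forall t : R, is_derive t 1 (fun t => f (t, y)) (g (t, y)).
Proof.
move=> H t; have E s : s *: e_ 0 + (0, y) = (s, y) :> plane.
  by apply/pair_equal_spec; split; rewrite /= -[_ *: _]/(_ * _) ?mulr1 ?mulr0 ?addr0 ?add0r.
have := @is_derive_shift _ _ _ f (0, y) (e_ 0) t _ (H _).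
rewrite E; congr (is_derive _ _ _ _); apply/funext => s; congr f; exact: E.
Qed.

Lemma is_derive_snd (f g : plane -> R) (x : R) : Dr 1 f g ->
  forall t : R, is_derive t 1 (fun t => f (x, t)) (g (x, t)).
Proof.
move=> H t; have E s : s *: e_ 1 + (x, 0) = (x, s) :> plane.
  by apply/pair_equal_spec; split; rewrite /= -[_ *: _]/(_ * _) ?mulr1 ?mulr0 ?addr0 ?add0r.
have := @is_derive_shift _ _ _ f (x, 0) (e_ 1) t _ (H _).
rewrite E; congr (is_derive _ _ _ _); apply/funext => s; congr f; exact: E.
Qed.

Lemma continuous_fst_section (g : plane -> R) (y : R) : continuous g -> continuous (fun t => g (t, y)).
Proof.
move=> cg t; apply: (@continuous_comp _ _ _ (fun t => (t, y)) g); last exact: cg.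
move=> A [[B C] /= [HB HC] BC]; apply: filterS HB => s Bs; apply: BC.
by split => //=; exact: nbhs_singleton HC.
Qed.

Lemma continuous_snd_section (g : plane -> R) (x : R) : continuous g -> continuous (fun t => g (x, t)).
Proof.
move=> cg t; apply: (@continuous_comp _ _ _ (fun t => (x, t)) g); last exact: cg.
move=> A [[B C] /= [HB HC] BC]; apply: filterS HC => s Cs; apply: BC.
by split => //=; exact: nbhs_singleton HB.
Qed.

Lemma C0_out_fst r f t y : C0 r f -> ~ (t \in `[- r, r]) -> f (t, y) = 0.
Proof. by move=> [_ f0] H; apply: f0 => -[/=]. Qed.

Lemma C0_out_snd r f t y : C0 r f -> ~ (y \in `[- r, r]) -> f (t, y) = 0.
Proof. by move=> [_ f0] H; apply: f0 => -[/=]. Qed.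

Lemma integral_out (D : set R) (f : R -> \bar R) : (forall t, ~ D t -> f t = 0%E) ->
  (\int[lebesgue_measure]_t f t = \int[lebesgue_measure]_(t in D) f t)%E.
Proof.
move=> H; rewrite [RHS]integral_mkcond; congr integral; apply/funext => t.
rewrite /patch; case: ifPn => // /negP tD; apply: H => Dt; apply: tD; by rewrite inE.
Qed.

Lemma integral_Dr0 r a f g : 0 < r -> C0 r f -> C0 r g -> Dr a f g ->
  (\int[leb2]_y (g y)%:E = 0)%E.
Proof.
move=> r0 Cf Cg; have ig := C0_integrable Cg; have [cg _] := Cg.
(* The interval is enlarged by 1 because [C0 r] makes a function vanish only outside the closed
   square, and the endpoints must be zeros. *)
have rr : - (r + 1) <= r + 1 by lra.
have o1 : ~ (r + 1 \in `[- r, r]) by rewrite in_itv/= => /andP[]; lra.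
have o2 : ~ (- (r + 1) \in `[- r, r]) by rewrite in_itv/= => /andP[]; lra.
have sub t : ~ [set` `[- (r + 1), r + 1]] t -> ~ (t \in `[- r, r]).
  by move=> H; rewrite in_itv/= => /andP[h1 h2]; apply: H; rewrite /= in_itv/=; lra.
move: a; apply: ord2P => D.
- rewrite /leb2 -(@integral21_prod_meas1 _ _ _ _ _ lebesgue_measure lebesgue_measure (EFin \o g))//.
  rewrite /fubini_G; rewrite integral0_eq// => y _ /=.
  rewrite (@integral_out `[- (r + 1), r + 1]); last first.
    by move=> t /sub H; rewrite (C0_out_fst _ Cg H).
  rewrite (FTC_Rintegral rr (is_derive_fst y D) (continuous_fst_section cg)).
  by rewrite !(C0_out_fst _ Cf) ?subrr.
- rewrite /leb2 -(@integral12_prod_meas1 _ _ _ _ _ lebesgue_measure lebesgue_measure (EFin \o g))//.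
  rewrite /fubini_F; rewrite integral0_eq// => x _ /=.
  rewrite (@integral_out `[- (r + 1), r + 1]); last first.
    by move=> t /sub H; rewrite (C0_out_snd _ Cg H).
  rewrite (FTC_Rintegral rr (is_derive_snd x D) (continuous_snd_section cg)).
  by rewrite !(C0_out_snd _ Cf) ?subrr.
Qed.

End C0.

(** * Stability properties of test functions *)

Section test.
Context {R : realType}.
Local Notation plane := (R * R)%type.
Local Notation mplane := (measurableTypeR R * measurableTypeR R)%type.
Context (w : set plane).
Notation supp f := (closure [set y | f y != 0]).

Lemma supp_out (f : plane -> R) y : ~ supp f y -> f y = 0.
Proof.
by move=> H; apply/eqP/negPn/negP => fy; apply: H; apply: subset_closure.
Qed.

Lemma test_sub (f g : plane -> R) : smooth g -> supp g `<=` supp f ->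
  test_function w f -> test_function w g.
Proof.
move=> sg sub [_ cf fw]; split => //; last exact: subset_trans fw.
by apply: subclosed_compact sub => //; exact: closed_closure.
Qed.

Lemma smooth_derive (f : plane -> R) a : smooth f -> smooth ('D_(e_ a) f).
Proof.
move=> sf l; have := sf (rcons l a); rewrite /iter_partial foldr_rcons; exact.
Qed.

Lemma iterD (f g : plane -> R) l : smooth f -> smooth g ->
  iter_partial l (f + g) = iter_partial l f + iter_partial l g.
Proof.
move=> sf sg; elim: l => [//|a l IH] /=; rewrite IH; apply/funext => y.
by rewrite deriveD//; [have [_] := sf l|have [_] := sg l]; exact.
Qed.

Lemma iterZ (f : plane -> R) k l : smooth f ->
  iter_partial l (k *: f) = k *: iter_partial l f.
Proof.
move=> sf; elim: l => [//|a l IH] /=; rewrite IH; apply/funext => y.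
by rewrite deriveZ//; have [_] := sf l; exact.
Qed.

Lemma smoothD (f g : plane -> R) : smooth f -> smooth g -> smooth (f + g).
Proof.
move=> sf sg l; rewrite iterD//; have [cf df] := sf l; have [cg dg] := sg l; split.
  by move=> y; apply: cvgD; [exact: cf|exact: cg].
by move=> a y; apply: derivableD; [exact: df|exact: dg].
Qed.

Lemma smoothZ k (f : plane -> R) : smooth f -> smooth (k *: f).
Proof.
move=> sf l; rewrite iterZ//; have [cf df] := sf l; split.
  by move=> y; apply: cvgZr; exact: cf.
by move=> a y; apply: derivableZ; exact: df.
Qed.

Lemma smooth0 : smooth (0 : plane -> R).
Proof. exact: (Smf_smooth (Smf_cst 0)). Qed.

Lemma test0 : test_function w 0.
Proof.
have E : [set y : plane | (0 : plane -> R) y != 0] = set0.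
  by apply/seteqP; split => y //=; rewrite eqxx.
by split; rewrite ?E ?closure0//; [exact: smooth0|exact: compact0].
Qed.

Lemma test_der f a : test_function w f -> test_function w ('D_(e_ a) f).
Proof.
move=> tf; have [sf cf fw] := tf; apply: test_sub tf; first exact: smooth_derive.
have : closed (supp f) by exact: closed_closure.
move=> /closure_id ->; apply: closure_subset => y /= /eqP H.
apply: contrapT => yf; apply: H.
have : \forall z \near y, ~ supp f z.
  have /closed_openC : closed (supp f) by exact: closed_closure.
  by rewrite openE => /(_ _ yf).
move=> H; rewrite (near_eq_derive (g := cst 0)) ?derive_cst//.
by apply: filterS H => z; exact: supp_out.
Qed.

Lemma testD f g : test_function w f -> test_function w g -> test_function w (f + g).
Proof.
move=> [sf cf fw] [sg cg gw].
have sub : supp (f + g) `<=` supp f `|` supp g.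
  rewrite -closureU; apply: closure_subset => y /=; rewrite fctE => H.
  have [f0|] := eqVneq (f y) 0; last by left.
  by right; move: H; rewrite f0 add0r.
split; first exact: smoothD.
  by apply: subclosed_compact sub; [exact: closed_closure|exact: compactU].
by apply: subset_trans sub _ => y [/fw|/gw].
Qed.

Lemma testZ k f : test_function w f -> test_function w (k *: f).
Proof.
move=> tf; have [sf cf fw] := tf; apply: test_sub tf; first exact: smoothZ.
by apply: closure_subset => y /=; rewrite mulf_eq0 negb_or => /andP[].
Qed.

Lemma testB f g : test_function w f -> test_function w g -> test_function w (f - g).
Proof. by move=> tf tg; apply: testD => //; rewrite -scaleN1r; exact: testZ. Qed.

Lemma test_continuous f : test_function w f -> continuous f.
Proof. by move=> [sf _ _]; have [] := sf [::]. Qed.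

Lemma test_Dr f a : test_function w f -> Dr a f ('D_(e_ a) f).
Proof. by move=> [sf _ _] y; have [_ df] := sf [::]; split => //; exact: df. Qed.

Lemma test_out f y : test_function w f -> ~ w y -> f y = 0.
Proof. by move=> [_ _ fw] H; apply: supp_out => /fw. Qed.

Lemma test_C0 r f : w `<=` cbox (- r) r (- r) r -> test_function w f -> C0 r f.
Proof.
move=> wr tf; split; first exact: test_continuous.
by move=> y yb; apply: (test_out tf) => /wr.
Qed.

End test.

(** * Weak partial derivatives *)

Section weak.
Context {R : realType}.
Local Notation plane := (R * R)%type.
Local Notation mplane := (measurableTypeR R * measurableTypeR R)%type.
Context (w : set plane) (ow : open w) (bw : bounded_set w).
Local Notation sqi := (sqi (@leb2 R) w).
Local Notation ip := (ip (@leb2 R) w).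
Local Notation nr := (nr (@leb2 R) w).

Lemma mw : measurable (w : set mplane). Proof. exact: open_measurable2. Qed.
Lemma fw : (leb2 (w : set mplane) < +oo)%E.
Proof. by apply: leb2_bounded => //; exact: mw. Qed.
Hint Resolve mw fw : core.

Lemma test_sqi f : test_function w f -> sqi f.
Proof.
move=> tf; have [r r0 wr] := bounded_cbox bw; have Cf := test_C0 wr tf.
have mf := C0_measurable Cf mw; split => //.
apply: measurable_bounded_integrable => //; first exact: measurable_funX.
have [M M0 HM] := C0_bounded Cf.
exists (M ^+ 2); split; first exact: num_real.
move=> x Mx y _ /=; rewrite normrX (le_trans _ (ltW Mx))// lerXn2r ?nnegrE//.
exact: ltW.
Qed.

Lemma test_ip0 a (f : plane -> R) : test_function w f -> ip ('D_(e_ a) f) (cst 1) = 0.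
Proof.
move=> tf; have [r r0 wr] := bounded_cbox bw; have Cf := test_C0 wr tf.
have Cg := test_C0 wr (test_der a tf).
have := integral_Dr0 r0 Cf Cg (test_Dr a tf) => H.
rewrite ipE /Rintegral integral_mkcond.
rewrite (_ : (fun x => _) \_ w = (fun x => ('D_(e_ a) f x)%:E)) ?H//.
apply/funext => y; rewrite /patch mulr1; case: ifPn => // /negP yw.
by rewrite (test_out (test_der a tf))// => wy; apply: yw; rewrite inE.
Qed.

Lemma test_parts a f g : test_function w f -> test_function w g ->
  ip f ('D_(e_ a) g) = - ip ('D_(e_ a) f) g.
Proof.
move=> tf tg; have [r r0 wr] := bounded_cbox bw.
have Cf := test_C0 wr tf; have Cg := test_C0 wr tg.
have Cf' := test_C0 wr (test_der a tf); have Cg' := test_C0 wr (test_der a tg).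
have D : Dr a (f * g) (f * 'D_(e_ a) g + g * 'D_(e_ a) f).
  by move=> y; exact: is_deriveM (test_Dr a tf y) (test_Dr a tg y).
have C : C0 r (f * 'D_(e_ a) g + g * 'D_(e_ a) f).
  have [c1 z1] := C0M Cf Cg'.1; have [c2 z2] := C0M Cg Cf'.1.
  split; first by move=> y; apply: cvgD; [exact: c1|exact: c2].
  by move=> y yb; have := z1 y yb; have := z2 y yb; rewrite !fctE => -> ->; rewrite addr0.
have := integral_Dr0 r0 (C0M Cf Cg.1) C D => H.
apply/eqP; rewrite -addr_eq0; apply/eqP.
have sf := test_sqi tf; have sg := test_sqi tg.
have sf' := test_sqi (test_der a tf); have sg' := test_sqi (test_der a tg).
rewrite (_ : ip ('D_(e_ a) f) g = ip g ('D_(e_ a) f)); last exact: ipC.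
rewrite !ipE -RintegralD//; try exact: sqi_int.
rewrite /Rintegral integral_mkcond.
rewrite (_ : (fun x => _) \_ w = (fun x => ((f * 'D_(e_ a) g + g * 'D_(e_ a) f) x)%:E)) ?H//.
apply/funext => y; rewrite /patch; case: ifPn => // /negP yw.
have wy : ~ w y by move=> wy; apply: yw; rewrite inE.
by rewrite !fctE (test_out tf wy) (test_out tg wy) !mul0r addr0.
Qed.

Lemma is_weakP a f g : is_weak_partial w a f g <->
  sqi g /\ forall phi, test_function w phi -> ip f ('D_(e_ a) phi) = - ip g phi.
Proof.
rewrite /is_weak_partial L2E; last exact: mw.
by split=> -[sg H]; split=> // phi tphi; have := H _ tphi; rewrite !ipE.
Qed.

Lemma weak_test a f : test_function w f -> is_weak_partial w a f ('D_(e_ a) f).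
Proof.
move=> tf; apply/is_weakP; split; first exact/test_sqi/test_der.
by move=> phi tphi; exact: test_parts.
Qed.

Lemma weak_lin a k f g f' g' : sqi f -> sqi f' ->
  is_weak_partial w a f g -> is_weak_partial w a f' g' ->
  is_weak_partial w a (k *: f + f') (k *: g + g').
Proof.
move=> sf sf' /is_weakP[sg H] /is_weakP[sg' H']; apply/is_weakP; split.
  by apply: sqiD => //; exact: sqiZ.
move=> phi tphi; have sp := test_sqi tphi; have sp' := test_sqi (test_der a tphi).
by rewrite !ipDl ?ipZl ?H ?H'//; do ?exact: sqiZ; ring.
Qed.

Lemma weak_unique a f g g' : is_weak_partial w a f g -> is_weak_partial w a f g' ->
  nr (g - g') = 0.
Proof.
move=> /is_weakP[sg H] /is_weakP[sg' H']; apply: (fundamental ow fw); first exact: sqiB.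
move=> b c d e n sub; have tb := test_box_bump n sub.
rewrite ipBl//; last exact: test_sqi.
have := H _ tb; rewrite H'// => /oppr_inj ->; exact: subrr.
Qed.

Lemma weak_eq a f f' g : sqi f -> sqi f' -> nr (f - f') = 0 ->
  is_weak_partial w a f g -> is_weak_partial w a f' g.
Proof.
move=> sf sf' ff /is_weakP[sg H]; apply/is_weakP; split => // phi tphi.
rewrite -H//; apply/eqP; rewrite -subr_eq0 -ipBl//; last exact/test_sqi/test_der.
apply/eqP; apply: ip_nr0l => //; [exact: sqiB|exact/test_sqi/test_der|by rewrite nrBC].
Qed.

Lemma weak_cvg (I : Type) (F : set_system I) (FF : ProperFilter F) a
    (f_ g_ : I -> plane -> R) f g : sqi f -> sqi g ->
  (\forall i \near F, sqi (f_ i)) -> (\forall i \near F, is_weak_partial w a (f_ i) (g_ i)) ->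
  nr (f_ i - f) @[i --> F] --> (0 : R) -> nr (g_ i - g) @[i --> F] --> (0 : R) ->
  is_weak_partial w a f g.
Proof.
move=> sf sg Hs Hw Cf Cg; apply/is_weakP; split => // phi tphi.
have sp := test_sqi tphi; have sp' := test_sqi (test_der a tphi).
apply/eqP; rewrite -addr_eq0 -normr_le0; apply/ler_addgt0Pr => e e0; rewrite add0r.
pose C := nr ('D_(e_ a) phi) + nr phi + 1.
have C0 : 0 < C by rewrite ltr_wpDl ?addr_ge0 ?nr_ge0.
have e1 : 0 < e / C by rewrite divr_gt0.
near F => i.
have s1 : sqi (f_ i) by near: i.
have w1 : is_weak_partial w a (f_ i) (g_ i) by near: i.
have /is_weakP[s2 H] := w1.
have n1 : nr (f_ i - f) <= e / C.
  near: i; have /cvgrPdist_le := Cf => /(_ _ e1); apply: filterS => i.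
  by rewrite sub0r normrN ger0_norm ?nr_ge0.
have n2 : nr (g_ i - g) <= e / C.
  near: i; have /cvgrPdist_le := Cg => /(_ _ e1); apply: filterS => i.
  by rewrite sub0r normrN ger0_norm ?nr_ge0.
have -> : ip f ('D_(e_ a) phi) + ip g phi =
    - (ip (f_ i - f) ('D_(e_ a) phi) + ip (g_ i - g) phi).
  by rewrite !ipBl// H//; ring.
rewrite normrN (le_trans (ler_normD _ _))//.
have h1 := ip_le mw (sqiB mw s1 sf) sp'; have h2 := ip_le mw (sqiB mw s2 sg) sp.
have h3 := ler_wpM2r (nr_ge0 leb2 w ('D_(e_ a) phi)) n1.
have h4 := ler_wpM2r (nr_ge0 leb2 w phi) n2.
rewrite (le_trans (lerD (le_trans h1 h3) (le_trans h2 h4)))// -mulrDr.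
rewrite mulrAC ler_pdivrMr// ler_wpM2l ?(ltW e0)// /C.
by rewrite lerDl.
Unshelve. all: by end_near.
Qed.

Lemma wpartialP a f g : is_weak_partial w a f g -> is_weak_partial w a f (wpartial w a f).
Proof. by move=> H; apply: (@xgetPex _ _ [set g | is_weak_partial w a f g]); exists g. Qed.

Lemma wpartial_nr a f g : is_weak_partial w a f g -> nr (wpartial w a f - g) = 0.
Proof. by move=> H; apply: (weak_unique (wpartialP H) H). Qed.

(** Two integrations by parts turn both sides into the pairing of [f] with a second derivative of
    [box_bump], where the order of derivation is immaterial. *)
Lemma weak_comm a b f g h g' h' :
  is_weak_partial w b f g -> is_weak_partial w a g h ->
  is_weak_partial w a f g' -> is_weak_partial w b g' h' -> nr (h - h') = 0.
Proof.
move=> /is_weakP[sg Hg] /is_weakP[sh Hh] /is_weakP[sg' Hg'] /is_weakP[sh' Hh'].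
apply: (fundamental ow fw); first exact: sqiB.
move=> c d c' d' n sub.
have := Smf_comm b a (Smf_box_bump c d c' d' n) => /(congr1 (ip f)).
have := test_box_bump n sub.
move: (box_bump c d c' d' n) => phi tb.
rewrite (ipBl mw sh sh' (test_sqi tb)).
move=> E.
have E3 := etrans (esym (Hg _ (test_der a tb))) (etrans E (Hg' _ (test_der b tb))).
have E4 := etrans (esym (Hh _ tb)) (etrans (oppr_inj E3) (Hh' _ tb)).
by rewrite (oppr_inj E4) subrr.
Qed.

End weak.

(** * Inequalities for test functions *)

Section onedim.
Context {R : realType}.
Local Notation mu := (@lebesgue_measure R).

Lemma mu_cc (a b : R) : a <= b -> mu `[a, b]%classic = (b - a)%:E.
Proof.
move=> ab; rewrite lebesgue_measure_itv/= lte_fin.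
by case: ltP => [//|h1]; congr EFin; lra.
Qed.

(** Integrate [2 * f * f'], the derivative of the square, from a point where [f] vanishes. This is
    the one-dimensional half of the inequalities of Ladyzhenskaya and Poincare. *)
Lemma FTC_sqr_le (f f' : R -> R) r x : 0 < r ->
  (forall t : R, is_derive t 1 f (f' t)) -> continuous f' ->
  (forall t, ~ (t \in `[- r, r]) -> f t = 0) ->
  ((f x ^+ 2)%:E <= 2%:E * \int[mu]_t (`|f t * f' t|)%:E)%E.
Proof.
move=> r0 df cf' f0; set I := (\int[mu]_t _)%E.
have I0 : (0 <= I)%E by apply: integral_ge0 => t _; rewrite lee_fin.
have [xr|xr] := boolP (x \in `[- r, r]); last first.
  by rewrite f0 ?expr0n ?mule_ge0//; exact/negP.
have cf : continuous f.
  move=> t; apply: differentiable_continuous; apply/derivable1_diffP.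
  by have [] := df t.
have d2 (t : R) : is_derive t 1 (f * f) (2 * (f t * f' t)).
  by apply: is_derive_eq (is_deriveM (df t) (df t)) _; rewrite -[_ *: _]/(_ * _); ring.
have c2 : continuous (fun t => 2 * (f t * f' t)).
  move=> t; apply: cvgM; first exact: cvg_cst.
  by apply: cvgM; [exact: cf|exact: cf'].
have ax : - (r + 1) <= x by move: xr; rewrite in_itv/= => /andP[]; lra.
have := FTC_Rintegral ax d2 c2.
rewrite [in X in _ = X](fctE) (f0 (- (r + 1))); last by rewrite in_itv/= => /andP[]; lra.
rewrite mulr0 subr0 -expr2 => <-.
have mf (D : set R) (g : R -> R) : continuous g -> measurable_fun D g.
  by move=> cg; apply: (@measurable_funS _ _ _ _ setT) => //; exact: continuous_measurable_fun.
have cff : continuous (fun t => f t * f' t) by move=> t; apply: cvgM; [exact: cf|exact: cf'].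
have cab : continuous (fun t => `|f t * f' t|) by move=> t; apply: cvg_norm; exact: cff.
apply: (@le_trans _ _ (\int[mu]_(t in `[(- (r + 1))%R, x]) (2%:E * (`|f t * f' t|)%:E))%E).
  apply: le_trans (lee_abs _) _; apply: le_trans (le_abse_integral _ _ _) _ => //.
    by apply/measurable_EFinP; exact: mf.
  apply: ge0_le_integral => //.
  - by apply/measurable_EFinP; apply: mf => t; apply: cvg_norm; exact: c2.
  - apply/measurable_EFinP; apply: mf => t; apply: cvgM; [exact: cvg_cst|exact: cab].
  - by move=> t _; rewrite -EFinM lee_fin normrM ger0_norm.
rewrite ge0_integralZl//; last by apply/measurable_EFinP; exact: mf.
apply: lee_wpmul2l => //; apply: ge0_subset_integral => //.
by apply/measurable_EFinP; exact: mf.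
Qed.

(** Cauchy-Schwarz for the integral of [f'] between the two points, at distance at most [h].
    Integrating over the whole interval makes the bound independent of these points. *)
Lemma FTC_osc_le (f f' : R -> R) a h x x' : 0 < h ->
  (forall t : R, is_derive t 1 f (f' t)) -> continuous f' ->
  x \in `]a, a + h] -> x' \in `]a, a + h] ->
  (((f x - f x') ^+ 2)%:E <= h%:E * \int[mu]_(t in `]a, (a + h)%R]) (f' t ^+ 2)%:E)%E.
Proof.
move=> h0 df cf'; wlog xx : x x' / x' <= x.
  move=> H xi xi'; have [le|lt] := leP x' x; first exact: H.
  by rewrite -opprB sqrrN; apply: H => //; exact: ltW.
rewrite !in_itv/= => /andP[ax xh] /andP[ax' xh'].
have mf (D : set R) (g : R -> R) : continuous g -> measurable_fun D g.
  by move=> cg; apply: (@measurable_funS _ _ _ _ setT) => //; exact: continuous_measurable_fun.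
pose D : set (measurableTypeR R) := `[x', x]%classic; have mD : measurable D by exact: measurable_itv.
have fD : (mu D < +oo)%E.
  by rewrite lebesgue_measure_itv/=; case: ifP => // _; rewrite -EFinD ltry.
have s1 : sqi mu D (cst 1) := sqi_cst mD 1 fD.
have sf : sqi mu D f'.
  split; first exact: mf.
  apply: continuous_compact_integrable; first exact: segment_compact.
  by apply: continuous_subspaceT => t; apply: (@continuous_comp _ _ _ f' (fun y => y ^+ 2)); [exact: cf'|exact: exprn_continuous].
have E : f x - f x' = ip mu D f' (cst 1).
  have := FTC_Rintegral xx df cf' => H.
  have -> : ip mu D f' (cst 1) = \int[mu]_(t in D) f' t.
    by rewrite ipE; apply: eq_Rintegral => t _; rewrite mulr1.
  by rewrite /Rintegral H.
have n1 : nr mu D (cst 1) ^+ 2 = x - x'.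
  have -> : nr mu D (cst 1) ^+ 2 = \int[mu]_(t in D) (cst 1) t.
    by rewrite sqr_nr ipE; apply: eq_Rintegral => t _; rewrite mulr1.
  rewrite (Rintegral_cst _ mD) mul1r.
  by apply: (@eq_trans _ _ (fine (x - x')%:E)) => //; congr fine; exact: mu_cc.
have H : (f x - f x') ^+ 2 <= h * nr mu D f' ^+ 2.
  rewrite E -real_normK ?num_real//.
  have := ip_le mD sf s1; rewrite -ler_sqr ?nnegrE ?mulr_ge0 ?nr_ge0// exprMn n1 => /le_trans; apply.
  by rewrite mulrC ler_wpM2r ?sqr_ge0//; lra.
apply: (@le_trans _ _ (h * nr mu D f' ^+ 2)%:E); first by rewrite lee_fin.
rewrite EFinM; apply: lee_wpmul2l; first by rewrite lee_fin ltW.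
rewrite sqr_nr ipE /Rintegral fineK; last first.
  by apply: integrable_fin_num => //; exact: sqi_int.
apply: (@ge0_subset_integral _ _ _ mu D _ mD _ (fun t => (f' t * f' t)%:E)) => //.
- apply/measurable_EFinP; apply: mf => t; apply: cvgM; exact: cf'.
- by move=> t _; rewrite lee_fin -expr2 sqr_ge0.
- by move=> t; rewrite /D /= !in_itv/= => /andP[h1 h2]; apply/andP; split; lra.
Qed.

End onedim.

Section planar.
Context {R : realType}.
Local Notation plane := (R * R)%type.
Local Notation mplane := (measurableTypeR R * measurableTypeR R)%type.
Local Notation mu := (@lebesgue_measure R).
Local Open Scope ereal_scope.

Lemma tensor_measurable (B A : R -> \bar R) :
  measurable_fun (setT : set (measurableTypeR R)) B -> measurable_fun (setT : set (measurableTypeR R)) A ->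
  measurable_fun (setT : set mplane) (fun p => B p.1 * A p.2).
Proof.
move=> mB mA; apply: emeasurable_funM.
  exact: (measurableT_comp mB (@measurable_fst _ _ (measurableTypeR R) (measurableTypeR R))).
exact: (measurableT_comp mA (@measurable_snd _ _ (measurableTypeR R) (measurableTypeR R))).
Qed.

Lemma tensor (B A : R -> \bar R) :
  measurable_fun (setT : set (measurableTypeR R)) B -> measurable_fun (setT : set (measurableTypeR R)) A ->
  (forall t, 0 <= B t) -> (forall t, 0 <= A t) ->
  \int[leb2]_p (B p.1 * A p.2) = \int[mu]_x B x * \int[mu]_y A y.
Proof.
move=> mB mA B0 A0.
rewrite /leb2 (fubini_tonelli1 (m1 := mu) (m2 := mu)); first last.
- by move=> p; rewrite mule_ge0.
- exact: tensor_measurable.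
rewrite /fubini_F -ge0_integralZr//; last exact: integral_ge0.
by apply: eq_integral => x _; rewrite /= ge0_integralZl.
Qed.

Lemma tonelli1 (F : plane -> R) : measurable_fun (setT : set mplane) F -> (forall p, (0 <= F p)%R) ->
  \int[leb2]_p (F p)%:E = \int[mu]_x \int[mu]_y (F (x, y))%:E /\
  measurable_fun (setT : set (measurableTypeR R)) (fun x => \int[mu]_y (F (x, y))%:E).
Proof.
move=> mF F0; have mE : measurable_fun (setT : set mplane) (EFin \o F) by exact/measurable_EFinP.
have E0 (x : mplane) : 0 <= (EFin \o F) x by rewrite lee_fin.
split; first exact: (fubini_tonelli1 (m1 := mu) (m2 := mu) (EFin \o F)).
exact: (@measurable_fun_fubini_tonelli_F _ _ (measurableTypeR R) (measurableTypeR R) R mu (EFin \o F)).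
Qed.

Lemma tonelli2 (F : plane -> R) : measurable_fun (setT : set mplane) F -> (forall p, (0 <= F p)%R) ->
  \int[leb2]_p (F p)%:E = \int[mu]_y \int[mu]_x (F (x, y))%:E /\
  measurable_fun (setT : set (measurableTypeR R)) (fun y => \int[mu]_x (F (x, y))%:E).
Proof.
move=> mF F0; have mE : measurable_fun (setT : set mplane) (EFin \o F) by exact/measurable_EFinP.
have E0 (x : mplane) : 0 <= (EFin \o F) x by rewrite lee_fin.
split; first exact: (fubini_tonelli2 (m1 := mu) (m2 := mu) (EFin \o F)).
exact: (@measurable_fun_fubini_tonelli_G _ _ (measurableTypeR R) (measurableTypeR R) R mu (EFin \o F)).
Qed.

End planar.

Section test_inequalities.
Context {R : realType}.
Local Notation plane := (R * R)%type.
Local Notation mplane := (measurableTypeR R * measurableTypeR R)%type.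
Local Notation mu := (@lebesgue_measure R).
Context (w : set plane) (ow : open w) (bw : bounded_set w).
Local Notation sqi := (sqi (@leb2 R) w).
Local Notation ip := (ip (@leb2 R) w).
Local Notation nr := (nr (@leb2 R) w).

Let mw := mw ow.
Let fw := fw ow bw.

Lemma integral_out2 (D : set plane) (F : plane -> \bar R) : (forall y, ~ D y -> F y = 0%E) ->
  (\int[leb2]_y F y = \int[leb2]_(y in D) F y)%E.
Proof.
move=> H; rewrite [RHS]integral_mkcond; congr integral; apply/funext => t.
rewrite /patch; case: ifPn => // /negP tD; apply: H => Dt; apply: tD; by rewrite inE.
Qed.

Lemma ip_integral (f g : plane -> R) : sqi f -> sqi g ->
  (\int[leb2]_(y in w) (f y * g y)%:E = (ip f g)%:E)%E.
Proof.
by move=> sf sg; rewrite ipE /Rintegral fineK//; apply: integrable_fin_num => //; exact: sqi_int.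
Qed.

Lemma integral_abs_le (f g : plane -> R) : test_function w f -> sqi g ->
  (\int[leb2]_y (`|f y * g y|)%:E <= (nr f * nr g)%:E)%E.
Proof.
move=> tf sg; have sf := test_sqi ow bw tf.
rewrite (@integral_out2 w); last by move=> y wy; rewrite (test_out tf wy) mul0r normr0.
have sa h : sqi h -> sqi (fun y => `|h y|) /\ (nr (fun y => `|h y|) <= nr h)%R.
  move=> sh; have mh : measurable_fun w (fun y : mplane => `|h y|).
    by apply: measurableT_comp => //; exact: sh.1.
  split; first by apply: (sqi_dom mw mh sh) => y _; rewrite normr_id.
  by apply: (nr_le mw mh sh) => y _; rewrite normr_id.
have [sf' nf] := sa _ sf; have [sg' ng] := sa _ sg.
under eq_integral do rewrite normrM.
rewrite ip_integral// lee_fin (le_trans (ler_norm _))//.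
by rewrite (le_trans (ip_le mw sf' sg'))// ler_pM// nr_ge0.
Qed.

(** By [FTC_sqr_le], a majorant of [f (x, y) ^+ 2] that depends on [y] alone, while [S2] provides
    one that depends on [x] alone. *)
Definition S1 (f : plane -> R) (y : R) : \bar R :=
  (2%:E * \int[mu]_t (`|f (t, y) * ('D_(e_ 0) f) (t, y)|)%:E)%E.
Definition S2 (f : plane -> R) (x : R) : \bar R :=
  (2%:E * \int[mu]_t (`|f (x, t) * ('D_(e_ 1) f) (x, t)|)%:E)%E.

Lemma S1_le f x y : test_function w f -> ((f (x, y) ^+ 2)%:E <= S1 f y)%E.
Proof.
move=> tf; have [r r0 wr] := bounded_cbox bw.
apply: (FTC_sqr_le x r0 (is_derive_fst y (test_Dr 0 tf))).
  exact: (continuous_fst_section (y := y) (test_continuous (test_der 0 tf))).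
by move=> t; exact: (C0_out_fst _ (test_C0 wr tf)).
Qed.

Lemma S2_le f x y : test_function w f -> ((f (x, y) ^+ 2)%:E <= S2 f x)%E.
Proof.
move=> tf; have [r r0 wr] := bounded_cbox bw.
apply: (FTC_sqr_le y r0 (is_derive_snd x (test_Dr 1 tf))).
  exact: (continuous_snd_section (x := x) (test_continuous (test_der 1 tf))).
by move=> t; exact: (C0_out_snd _ (test_C0 wr tf)).
Qed.

Lemma test_meas f (D : set plane) : test_function w f -> measurable (D : set mplane) ->
  measurable_fun (D : set mplane) f.
Proof. by have [r r0 wr] := bounded_cbox bw; move=> tf; exact: C0_measurable (test_C0 wr tf). Qed.

Lemma S1P f : test_function w f ->
  measurable_fun (setT : set (measurableTypeR R)) (S1 f) /\
  (\int[mu]_y S1 f y <= (2 * (nr f * nr ('D_(e_ 0) f)))%:E)%E.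
Proof.
move=> tf; have td := test_der 0 tf.
have [||E M] := @tonelli2 R (fun p => `|f p * 'D_(e_ 0) f p|).
- by apply: measurableT_comp => //; apply: measurable_funM; exact: test_meas.
- by move=> p.
split; first exact: (measurable_funeM 2%:E M).
rewrite ge0_integralZl//; last by move=> t _; apply: integral_ge0 => s _; rewrite lee_fin.
rewrite EFinM; apply: lee_wpmul2l => //; rewrite -[X in (X <= _)%E]E.
by apply: integral_abs_le => //; exact: test_sqi.
Qed.

Lemma S2P f : test_function w f ->
  measurable_fun (setT : set (measurableTypeR R)) (S2 f) /\
  (\int[mu]_y S2 f y <= (2 * (nr f * nr ('D_(e_ 1) f)))%:E)%E.
Proof.
move=> tf; have td := test_der 1 tf.
have [||E M] := @tonelli1 R (fun p => `|f p * 'D_(e_ 1) f p|).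
- by apply: measurableT_comp => //; apply: measurable_funM; exact: test_meas.
- by move=> p.
split; first exact: (measurable_funeM 2%:E M).
rewrite ge0_integralZl//; last by move=> t _; apply: integral_ge0 => s _; rewrite lee_fin.
rewrite EFinM; apply: lee_wpmul2l => //; rewrite -[X in (X <= _)%E]E.
by apply: integral_abs_le => //; exact: test_sqi.
Qed.

Lemma S1_ge0 f y : (0 <= S1 f y)%E.
Proof. by apply: mule_ge0 => //; apply: integral_ge0 => t _; rewrite lee_fin. Qed.
Lemma S2_ge0 f y : (0 <= S2 f y)%E.
Proof. by apply: mule_ge0 => //; apply: integral_ge0 => t _; rewrite lee_fin. Qed.

Opaque S1 S2.

Lemma sqi_testM f g : test_function w f -> sqi g -> sqi (f * g).
Proof.
move=> tf sg; have [r r0 wr] := bounded_cbox bw.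
have [M _ HM] := C0_bounded (test_C0 wr tf).
exact: (sqiM mw (test_meas tf mw) (fun y _ => HM y) sg).
Qed.

(** Bound [f ^+ 2] by a function of [y] and [g ^+ 2] by a function of [x]: the integral of the
    product then factors. Each factor contributes a 2, and each function is differentiated in its
    own direction. *)
Lemma test_ladyzhenskaya f g : test_function w f -> test_function w g ->
  nr (f * g) ^+ 2 <= 4 * ((nr f * nr ('D_(e_ 0) f)) * (nr g * nr ('D_(e_ 1) g))).
Proof.
move=> tf tg; have [mf If] := S1P tf; have [mg Ig] := S2P tg.
have sfg : sqi (f * g) by apply: sqi_testM => //; exact: test_sqi.
rewrite -lee_fin sqr_nr -ip_integral// -integral_out2; last first.
  by move=> y wy; rewrite fctE (test_out tf wy) !mul0r.
apply: (@le_trans _ _ (\int[leb2]_p ((S2 g p.1) * (S1 f p.2)))%E).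
  apply: ge0_le_integral => //.
  - by move=> p _; rewrite lee_fin -expr2 sqr_ge0.
  - by apply/measurable_EFinP; apply: measurable_funM; apply: measurable_funM; exact: test_meas.
  - apply: (tensor_measurable (B := S2 g) (A := S1 f)).
      exact: mg.
    exact: mf.
  - move=> [x y] _; rewrite !fctE.
    rewrite (_ : f (x, y) * g (x, y) * (f (x, y) * g (x, y)) = g (x, y) ^+ 2 * f (x, y) ^+ 2); last by ring.
    rewrite EFinM; by apply: lee_pmul; rewrite ?lee_fin ?sqr_ge0//; [exact: S2_le|exact: S1_le].
rewrite (tensor (B := S2 g) (A := S1 f)); first last.
- by move=> t; exact: S1_ge0.
- by move=> t; exact: S2_ge0.
- exact: mf.
- exact: mg.
have E4 (a b c d : R) : 4 * (a * b * (c * d)) = 2 * (c * d) * (2 * (a * b)) by ring.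
rewrite E4.
rewrite EFinM; refine (lee_pmul _ _ Ig If).
  by apply: integral_ge0 => t _; exact: S2_ge0.
by apply: integral_ge0 => t _; exact: S1_ge0.
Qed.

Lemma test_poincare : exists2 C, 0 < C & forall f, test_function w f ->
  nr f <= C * nr ('D_(e_ 0) f).
Proof.
have [r r0 wr] := bounded_cbox bw.
(* The width [2 * r] of a square containing [w], times the factor 2 of [S1]; a power of [nr f]
   cancels on both sides. *)
exists (4 * r); first lra.
move=> f tf; have [mf If] := S1P tf; have sf := test_sqi ow bw tf.
have [n0|n0] := eqVneq (nr f) 0; first by rewrite n0 mulr_ge0 ?nr_ge0//; lra.
have np : 0 < nr f by rewrite lt_neqAle eq_sym n0 nr_ge0.
rewrite -(ler_pM2l np) -expr2 -lee_fin sqr_nr -ip_integral// -integral_out2; last first.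
  by move=> y wy; rewrite (test_out tf wy) !mul0r.
pose J : R -> \bar R := EFin \o (\1_(`[- r, r]%classic : set R) : R -> R).
have m1 : measurable_fun (setT : set (measurableTypeR R)) J.
  by apply/measurable_EFinP; apply: measurable_indic; exact: measurable_itv.
apply: (@le_trans _ _ (\int[leb2]_p (J p.1 * (S1 f p.2)))%E).
  apply: ge0_le_integral => //.
  - by move=> p _; rewrite lee_fin -expr2 sqr_ge0.
  - by apply/measurable_EFinP; apply: measurable_funM; exact: test_meas.
  - apply: (tensor_measurable (A := S1 f)) => //.
  - move=> [x y] _; rewrite /J /= indicE; have [xr|xr] := boolP (x \in _).
      by rewrite mul1e -expr2; exact: S1_le.
    rewrite (C0_out_fst _ (test_C0 wr tf)) ?mul0r ?mul0e//.
    by move=> H; move/negP: xr; apply; rewrite inE.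
rewrite (tensor (A := S1 f)) => //; first last.
- by move=> t; exact: S1_ge0.
- by move=> t; rewrite lee_fin.
have -> : (\int[mu]_x J x = (r - - r)%:E)%E.
  by rewrite /J integral_indic// setIT; apply: mu_cc; lra.
have E4 (a b c : R) : a * (4 * b * c) = (b - - b) * (2 * (a * c)) by ring.
rewrite E4.
rewrite EFinM; apply: lee_wpmul2l If; rewrite lee_fin; lra.
Qed.

End test_inequalities.

Lemma cell_arith {R : realType} (x s k y : R) :
  2 * x * s - 2 * k <= 2 * y -> x * s <= k + y.
Proof. lra. Qed.

(** * The Poincare-Wirtinger inequality on a square, and grids *)

Section cell.
Context {R : realType}.
Local Notation plane := (R * R)%type.
Local Notation mplane := (measurableTypeR R * measurableTypeR R)%type.
Local Notation mu := (@lebesgue_measure R).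
Context (w : set plane) (ow : open w) (bw : bounded_set w).

Definition cell (a c h : R) : set plane := `]a, a + h] `*` `]c, c + h].

Lemma measurable_cell a c h : measurable (cell a c h : set mplane).
Proof. by apply: measurableX; exact: measurable_itv. Qed.

Lemma mu_oc (a h : R) : 0 < h -> mu `]a, a + h]%classic = h%:E.
Proof.
move=> h0; rewrite lebesgue_measure_itv/= lte_fin ifT; last lra.
by rewrite -EFinD; congr EFin; lra.
Qed.

Context (a c h : R) (h0 : 0 < h).
Let Q := cell a c h.
Let mQ : measurable (Q : set mplane) := measurable_cell a c h.

Lemma leb2_cell : leb2 (Q : set mplane) = (h ^+ 2)%:E.
Proof.
have -> : leb2 (Q : set mplane) = (mu `]a, (a + h)%R]%classic * mu `]c, (c + h)%R]%classic)%E.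
  by apply: product_measure1E; exact: measurable_itv.
by rewrite !mu_oc// -EFinM expr2.
Qed.

Let fQ : (leb2 (Q : set mplane) < +oo)%E. Proof. by rewrite leb2_cell ltry. Qed.

Let oneI (t : R) : \bar R := (\1_(`]a, (a + h)%R]%classic : set R) t : R)%:E.
Let oneK (t : R) : \bar R := (\1_(`]c, (c + h)%R]%classic : set R) t : R)%:E.

Let m1I : measurable_fun (setT : set (measurableTypeR R)) oneI.
Proof. by apply/measurable_EFinP; apply: measurable_indic. Qed.
Let m1K : measurable_fun (setT : set (measurableTypeR R)) oneK.
Proof. by apply/measurable_EFinP; apply: measurable_indic. Qed.
Let int1I : (\int[mu]_t oneI t = h%:E)%E.
Proof. by rewrite /oneI integral_indic// setIT; exact: mu_oc. Qed.
Let int1K : (\int[mu]_t oneK t = h%:E)%E.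
Proof. by rewrite /oneK integral_indic// setIT; exact: mu_oc. Qed.
Let ge1I t : (0 <= oneI t)%E. Proof. by rewrite lee_fin. Qed.
Let ge1K t : (0 <= oneK t)%E. Proof. by rewrite lee_fin. Qed.

Lemma sqi_Q f : test_function w f -> sqi leb2 (Q : set mplane) f.
Proof.
move=> tf; have [r r0 wr] := bounded_cbox bw.
split; first exact: test_meas tf mQ.
apply: measurable_bounded_integrable => //.
  by apply: measurable_funX; exact: test_meas tf mQ.
have [M M0 HM] := C0_bounded (test_C0 wr tf).
exists (M ^+ 2); split; first exact: num_real.
move=> x Mx y _ /=; rewrite normrX (le_trans _ (ltW Mx))// lerXn2r ?nnegrE//.
exact: ltW.
Qed.

Lemma integral_QE (f g : plane -> R) : sqi leb2 (Q : set mplane) f -> sqi leb2 (Q : set mplane) g ->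
  (\int[leb2]_(y in Q) (f y * g y)%:E = (ip leb2 (Q : set mplane) f g)%:E)%E.
Proof.
move=> sf sg; rewrite ipE /Rintegral fineK//.
by apply: integrable_fin_num => //; exact: sqi_int.
Qed.

Section onecell.
Context (u : plane -> R) (tu : test_function w u).
Let F1 (p : plane) : R := ('D_(e_ 0) u p) ^+ 2 * \1_Q p.
Let F2 (p : plane) : R := ('D_(e_ 1) u p) ^+ 2 * \1_Q p.
Let D1 (y : R) : \bar R := (\int[mu]_t (F1 (t, y))%:E)%E.
Let D2 (x : R) : \bar R := (\int[mu]_t (F2 (x, t))%:E)%E.
Let T1 := ip leb2 (Q : set mplane) ('D_(e_ 0) u) ('D_(e_ 0) u).
Let T2 := ip leb2 (Q : set mplane) ('D_(e_ 1) u) ('D_(e_ 1) u).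

Let mF1 : measurable_fun (setT : set mplane) F1.
Proof.
apply: measurable_funM; last exact: measurable_indic.
by apply: measurable_funX; exact: test_meas (test_der 0 tu) measurableT.
Qed.
Let mF2 : measurable_fun (setT : set mplane) F2.
Proof.
apply: measurable_funM; last exact: measurable_indic.
by apply: measurable_funX; exact: test_meas (test_der 1 tu) measurableT.
Qed.
Let F1_ge0 p : 0 <= F1 p. Proof. by rewrite mulr_ge0// sqr_ge0. Qed.
Let F2_ge0 p : 0 <= F2 p. Proof. by rewrite mulr_ge0// sqr_ge0. Qed.
Let D1_ge0 y : (0 <= D1 y)%E. Proof. by apply: integral_ge0 => t _; rewrite lee_fin. Qed.
Let D2_ge0 y : (0 <= D2 y)%E. Proof. by apply: integral_ge0 => t _; rewrite lee_fin. Qed.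

Let intF (g : plane -> R) : test_function w g ->
  (\int[leb2]_p (g p ^+ 2 * \1_Q p)%:E = (ip leb2 (Q : set mplane) g g)%:E)%E.
Proof.
move=> tg; rewrite -integral_QE; [|exact: sqi_Q|exact: sqi_Q].
rewrite [RHS]integral_mkcond; apply: eq_integral => p _.
by rewrite /patch indicE; case: ifPn => _; rewrite ?mulr1 ?mulr0 -?expr2.
Qed.

Let mD1 : measurable_fun (setT : set (measurableTypeR R)) D1.
Proof. by have [] := tonelli2 mF1 F1_ge0. Qed.
Let mD2 : measurable_fun (setT : set (measurableTypeR R)) D2.
Proof. by have [] := tonelli1 mF2 F2_ge0. Qed.
Let intD1 : (\int[mu]_y D1 y = T1%:E)%E.
Proof. by have [<- _] := tonelli2 mF1 F1_ge0; exact: intF (test_der 0 tu). Qed.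
Let intD2 : (\int[mu]_y D2 y = T2%:E)%E.
Proof. by have [<- _] := tonelli1 mF2 F2_ge0; exact: intF (test_der 1 tu). Qed.

Let osc1 x x' y : x \in `]a, a + h] -> x' \in `]a, a + h] -> y \in `]c, c + h] ->
  (((u (x, y) - u (x', y)) ^+ 2)%:E <= h%:E * D1 y)%E.
Proof.
move=> xI xI' yK.
have := FTC_osc_le h0 (is_derive_fst y (test_Dr 0 tu))
  (continuous_fst_section (y := y) (test_continuous (test_der 0 tu))) xI xI'.
move=> /le_trans; apply; apply: lee_wpmul2l; first by rewrite lee_fin ltW.
rewrite integral_mkcond; apply: ge0_le_integral => //.
- by move=> t _; rewrite /patch; case: ifPn => // _; rewrite lee_fin sqr_ge0.
- apply/(measurable_restrictT _ (measurable_itv _)).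
  apply/measurable_EFinP; apply: measurable_funX.
  apply: (@measurable_funS _ _ _ _ setT) => //; apply: continuous_measurable_fun.
  exact: (continuous_fst_section (y := y) (test_continuous (test_der 0 tu))).
- apply/measurable_EFinP; apply: (measurableT_comp mF1).
  exact: (@measurable_pair2 _ _ (measurableTypeR R) (measurableTypeR R) y).
- move=> t _; rewrite /patch; case: ifPn => tI; last by rewrite lee_fin.
  by rewrite lee_fin /F1 indicE mem_set ?mulr1//; split => //=; rewrite inE in tI.
Qed.

Let osc2 x y y' : x \in `]a, a + h] -> y \in `]c, c + h] -> y' \in `]c, c + h] ->
  (((u (x, y) - u (x, y')) ^+ 2)%:E <= h%:E * D2 x)%E.
Proof.
move=> xI yK yK'.
have := FTC_osc_le h0 (is_derive_snd x (test_Dr 1 tu))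
  (continuous_snd_section (x := x) (test_continuous (test_der 1 tu))) yK yK'.
move=> /le_trans; apply; apply: lee_wpmul2l; first by rewrite lee_fin ltW.
rewrite integral_mkcond; apply: ge0_le_integral => //.
- by move=> t _; rewrite /patch; case: ifPn => // _; rewrite lee_fin sqr_ge0.
- apply/(measurable_restrictT _ (measurable_itv _)).
  apply/measurable_EFinP; apply: measurable_funX.
  apply: (@measurable_funS _ _ _ _ setT) => //; apply: continuous_measurable_fun.
  exact: (continuous_snd_section (x := x) (test_continuous (test_der 1 tu))).
- apply/measurable_EFinP; apply: (measurableT_comp mF2).
  exact: (@measurable_pair1 _ _ (measurableTypeR R) (measurableTypeR R) x).
- move=> t _; rewrite /patch; case: ifPn => tI; last by rewrite lee_fin.
  by rewrite lee_fin /F2 indicE mem_set ?mulr1//; split => //=; rewrite inE in tI.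
Qed.

(** Go from [p] to [q] through the corner [(q.1, p.2)]: the bound is the sum of a function of [p.2]
    and a function of [q.1], ready for Tonelli. *)
Let osc p q : Q p -> Q q ->
  (((u p - u q) ^+ 2)%:E <= (2 * h)%:E * D1 p.2 + (2 * h)%:E * D2 q.1)%E.
Proof.
case: p q => [x y] [x' y'] [/= xI yK] [/= xI' yK'].
apply: (@le_trans _ _ (2%:E * ((u (x, y) - u (x', y)) ^+ 2)%:E + 2%:E * ((u (x', y) - u (x', y')) ^+ 2)%:E)%E).
  rewrite -!EFinM -EFinD lee_fin.
  have := sqr_ge0 (u (x, y) - u (x', y) - (u (x', y) - u (x', y'))).
  by nra.
by rewrite !EFinM -!muleA; apply: leeD; apply: lee_wpmul2l => //; [exact: osc1|exact: osc2].
Qed.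

Let m := ip leb2 (Q : set mplane) u (cst 1).
Let S := ip leb2 (Q : set mplane) u u.

Let su : sqi leb2 (Q : set mplane) u := sqi_Q tu.
Let s1 k : sqi leb2 (Q : set mplane) (cst k) := sqi_cst mQ k fQ.

Let ip_cst k l : ip leb2 (Q : set mplane) (cst k) (cst l) = k * l * h ^+ 2.
Proof.
rewrite ipE /Rintegral (eq_integral (fun=> (k * l)%:E))//.
by rewrite integral_cst// leb2_cell -EFinM.
Qed.

Let scale_cst (k : R) : cst k = k *: (cst 1) :> (plane -> R).
Proof. by apply/funext => y; rewrite /= -[RHS]/(k * 1) mulr1. Qed.

(** The expression is the expanded integral over [q] of [(u p - u q) ^+ 2]; its bound is the
    integral of [osc] in [q], with [p] fixed. *)
Let step1 p : Q p -> 0 <= u p ^+ 2 * h ^+ 2 - 2 * (u p * m) + S /\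
  ((u p ^+ 2 * h ^+ 2 - 2 * (u p * m) + S)%:E <=
     ((2 * h)%:E * D1 p.2 * (h ^+ 2)%:E + (2 * h * h * T2)%:E)%E)%E.
Proof.
move=> Qp.
have E : (\int[leb2]_(q in Q) ((u p - u q) ^+ 2)%:E =
    (u p ^+ 2 * h ^+ 2 - 2 * (u p * m) + S)%:E)%E.
  have sB : sqi leb2 (Q : set mplane) (cst (u p) - u) by exact: sqiB.
  rewrite (eq_integral (fun q : mplane => ((cst (u p) - u) q * (cst (u p) - u) q)%:E)); last first.
    by move=> q _; rewrite -expr2.
  rewrite integral_QE//; congr EFin; rewrite -sqr_nr sqr_nrB// !sqr_nr ip_cst.
  have -> : ip leb2 (Q : set mplane) (cst (u p)) u = u p * m.
    by rewrite (scale_cst (u p)) ipZl// ipC.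
  by rewrite -/S; ring.
split.
  by rewrite -lee_fin -E; apply: integral_ge0 => q _; rewrite lee_fin sqr_ge0.
rewrite -E.
apply: (@le_trans _ _ (\int[leb2]_q (((2 * h)%:E * D1 p.2 * oneI q.1 * oneK q.2) + ((2 * h)%:E * D2 q.1 * oneK q.2)))%E).
  rewrite integral_mkcond; apply: ge0_le_integral => //.
  - by move=> q _; rewrite /patch; case: ifPn => // _; rewrite lee_fin sqr_ge0.
  - apply/(measurable_restrictT _ mQ); apply/measurable_EFinP/measurable_funX.
    by apply: measurable_funB; [exact: measurable_cst|exact: su.1].
  - apply: emeasurable_funD.
      apply: (tensor_measurable (B := (fun t => (2 * h)%:E * D1 p.2 * oneI t)%E) (A := oneK)) => //.
      exact: measurable_funeM.
    apply: (tensor_measurable (B := (fun t => (2 * h)%:E * D2 t)%E) (A := oneK)) => //.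
    exact: measurable_funeM.
  - move=> [x' y'] _; rewrite /patch; case: ifPn => [|_]; last first.
      by rewrite adde_ge0// !mule_ge0//= lee_fin mulr_ge0// ltW.
    rewrite inE => Qq; have := osc Qp Qq; have [/= xI yK] := Qq.
    by rewrite /oneI /oneK !indicE !mem_set// !mule1.
have h2 : (0 <= (2 * h)%:E :> \bar R)%E by rewrite lee_fin mulr_ge0// ltW.
rewrite ge0_integralD//; first last.
- apply: (tensor_measurable (B := (fun t => (2 * h)%:E * D2 t)%E) (A := oneK)) => //.
  exact: measurable_funeM.
- by move=> q _; rewrite !mule_ge0.
- apply: (tensor_measurable (B := (fun t => (2 * h)%:E * D1 p.2 * oneI t)%E) (A := oneK)) => //.
  exact: measurable_funeM.
- by move=> q _; rewrite !mule_ge0.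
rewrite (tensor (B := (fun t => (2 * h)%:E * D1 p.2 * oneI t)%E) (A := oneK))//; first last.
- by move=> t; rewrite !mule_ge0.
- exact: measurable_funeM.
rewrite (tensor (B := (fun t => (2 * h)%:E * D2 t)%E) (A := oneK))//; first last.
- by move=> t; rewrite !mule_ge0.
- exact: measurable_funeM.
rewrite ge0_integralZl//; last by rewrite mule_ge0.
rewrite ge0_integralZl// int1I int1K intD2 -muleA -EFinM -expr2 -!EFinM.
by rewrite (_ : (2 * h * T2 * h)%R = 2 * h * h * T2)//; ring.
Qed.

(** Integrating [step1] over [p] as well, the double integral of [(u p - u q) ^+ 2] is
    [2 * h ^+ 2 * S - 2 * m ^+ 2]. Divided by [h ^+ 2], the result bounds the squared distance of
    [u] to its mean by [h ^+ 2] times the squared gradient. *)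
Lemma cell_poincare : h ^+ 2 * S <= m ^+ 2 + h ^+ 4 * (T1 + T2).
Proof.
have h2 : (0 <= (2 * h)%:E :> \bar R)%E by rewrite lee_fin mulr_ge0// ltW.
have T20 : 0 <= T2 by exact: ipff_ge0.
pose P p := u p ^+ 2 * h ^+ 2 - 2 * (u p * m) + S.
have E : (\int[leb2]_(p in Q) (P p)%:E = (2 * h ^+ 2 * S - 2 * m ^+ 2)%:E)%E.
  rewrite (eq_integral (fun p : mplane => ((h ^+ 2 *: u - (2 * m) *: cst 1) p * u p)%:E + (cst S p * cst 1 p)%:E)%E); last first.
    move=> p _; rewrite -EFinD; congr EFin.
    by rewrite /P !fctE /= -![_ *: _]/(_ * _); ring.
  have sA : sqi leb2 (Q : set mplane) (h ^+ 2 *: u - (2 * m) *: cst 1).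
    by apply: sqiB => //; apply: sqiZ => //; exact: s1.
  rewrite integralD//; [|exact: sqi_int|exact: sqi_int].
  rewrite !integral_QE// ip_cst.
  have -> : ip leb2 (Q : set mplane) (h ^+ 2 *: u - (2 * m) *: cst 1) u = h ^+ 2 * S - 2 * m * m.
    have := ipBl mQ (sqiZ mQ (h ^+ 2) su) (sqiZ mQ (2 * m) (s1 1)) su.
    rewrite (ipZl mQ _ su su) (ipZl mQ _ (s1 1) su) => ->.
    by congr (_ - _ * _); exact: ipC.
  by rewrite -EFinD; congr EFin; ring.
have H : (\int[leb2]_(p in Q) (P p)%:E <= (2 * h ^+ 4 * (T1 + T2))%:E)%E.
  have mA1 : measurable_fun (setT : set (measurableTypeR R)) (fun t => (2 * h)%:E * D1 t * (h ^+ 2)%:E)%E.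
    by apply: emeasurable_funM => //; exact: measurable_funeM.
  have mA2 : measurable_fun (setT : set (measurableTypeR R)) (fun t => (2 * h * h * T2)%:E * oneK t)%E.
    exact: measurable_funeM.
  have A1_ge0 t : (0 <= (2 * h)%:E * D1 t * (h ^+ 2)%:E)%E.
    by rewrite !mule_ge0// lee_fin sqr_ge0.
  have A2_ge0 t : (0 <= (2 * h * h * T2)%:E * oneK t)%E.
    by rewrite mule_ge0// lee_fin !mulr_ge0// ltW.
  have t1 := tensor_measurable m1I mA1; have t2 := tensor_measurable m1I mA2.
  apply: (@le_trans _ _ (\int[leb2]_p (oneI p.1 * ((2 * h)%:E * D1 p.2 * (h ^+ 2)%:E) + oneI p.1 * ((2 * h * h * T2)%:E * oneK p.2)))%E).
    rewrite integral_mkcond; apply: ge0_le_integral => //.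
    - move=> p _; rewrite /patch; case: ifPn => //; rewrite inE => Qp.
      by rewrite lee_fin; exact: (step1 Qp).1.
    - apply/(measurable_restrictT _ mQ); apply/measurable_EFinP.
      apply: measurable_funD => //; apply: measurable_funB.
        by apply: measurable_funM => //; apply: measurable_funX; exact: su.1.
      by apply: measurable_funM => //; apply: measurable_funM => //; exact: su.1.
    - exact: emeasurable_funD.
    - move=> [x y] _; rewrite /patch; case: ifPn => [|_]; last by rewrite adde_ge0// mule_ge0.
      rewrite inE => Qp; have [_ /le_trans] := step1 Qp; apply; have [/= xI yK] := Qp.
      by rewrite /oneI /oneK !indicE !mem_set// !mul1e mule1.
  rewrite ge0_integralD//; do ?by [move=> p _; rewrite mule_ge0].
  rewrite (tensor m1I mA1)// (tensor m1I mA2)// int1I.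
  rewrite ge0_integralZl// ?int1K; last by rewrite lee_fin !mulr_ge0// ltW.
  have -> : (\int[mu]_y ((2 * h)%:E * D1 y * (h ^+ 2)%:E) = (2 * h * h ^+ 2 * T1)%:E)%E.
    rewrite [RHS]EFinM -intD1 -ge0_integralZl//; last by rewrite lee_fin !mulr_ge0// ?sqr_ge0// ltW.
    by apply: eq_integral => y _; rewrite muleAC -EFinM.
  rewrite -!EFinM -EFinD lee_fin.
  by rewrite le_eqVlt; apply/orP; left; apply/eqP; ring.
move: H; rewrite E lee_fin => H.
by apply: cell_arith; rewrite mulrA; exact: H.
Qed.

End onecell.
End cell.

Section grid.
Context {R : realType}.
Local Notation plane := (R * R)%type.
Local Notation mplane := (measurableTypeR R * measurableTypeR R)%type.
Context (w : set plane) (ow : open w) (bw : bounded_set w).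

Definition gcell (r : R) (n : nat) (ij : 'I_n * 'I_n) : set plane :=
  let h := 2 * r / n%:R in cell (- r + ij.1%:R * h) (- r + ij.2%:R * h) h.

Lemma subdivide (a h t : R) n : 0 < h -> a < t -> t <= a + n%:R * h ->
  exists i : 'I_n, t \in `]a + i%:R * h, a + i%:R * h + h].
Proof.
move=> h0 at_; elim: n => [|n IH].
  by rewrite mul0r addr0 leNgt at_.
have [tn _|tn tn1] := leP t (a + n%:R * h).
  have [i Hi] := IH tn; exists (widen_ord (leqnSn n) i).
  by move: Hi; rewrite !in_itv.
exists ord_max; rewrite in_itv/= tn/=; move: tn1; rewrite -natr1; lra.
Qed.

(** Half-open cells tile without overlap but miss the left and lower edges of the square of
    half-side [r]. The square of half-side [r / 2] avoids these edges, whence the doubled radius in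
    [test_grid]. *)
Lemma gcell_cover r n y : 0 < r -> (0 < n)%N -> cbox (- r / 2) (r / 2) (- r / 2) (r / 2) y ->
  exists ij : 'I_n * 'I_n, gcell r ij y.
Proof.
move=> r0 n0 [/=]; rewrite !in_itv/= => /andP[a1 a2] /andP[a3 a4].
have nr0 : 0 < n%:R :> R by rewrite ltr0n.
have h0 : 0 < 2 * r / n%:R by rewrite divr_gt0// mulr_gt0.
have e : n%:R * (2 * r / n%:R) = 2 * r by field; exact: lt0r_neq0.
have [||i Hi] := @subdivide (- r) (2 * r / n%:R) y.1 n h0; rewrite ?e; try lra.
have [||j Hj] := @subdivide (- r) (2 * r / n%:R) y.2 n h0; rewrite ?e; try lra.
by exists (i, j); split.
Qed.

Lemma gcell_disjoint r n : 0 < r -> (0 < n)%N -> trivIset setT (@gcell r n).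
Proof.
move=> r0 n0.
have nr0 : 0 < n%:R :> R by rewrite ltr0n.
have h0 : 0 < 2 * r / n%:R by rewrite divr_gt0// mulr_gt0.
have K (i j : 'I_n) t : t \in `](- r + i%:R * (2 * r / n%:R)), (- r + i%:R * (2 * r / n%:R) + 2 * r / n%:R)] ->
    t \in `](- r + j%:R * (2 * r / n%:R)), (- r + j%:R * (2 * r / n%:R) + 2 * r / n%:R)] -> (i <= j)%N.
  rewrite !in_itv/= => /andP[h1 h2] /andP[h3 h4]; rewrite leqNgt; apply/negP => ji.
  have : (j%:R + 1) * (2 * r / n%:R) <= i%:R * (2 * r / n%:R).
    by rewrite ler_wpM2r ?(ltW h0)// natr1 ler_nat.
  by rewrite mulrDl mul1r; lra.
move=> [i j] [i' j'] _ _ [y [[/= a1 a2] [/= b1 b2]]].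
congr pair; apply/val_inj/eqP; rewrite /= eqn_leq; apply/andP; split.
- exact: K a1 b1.
- exact: K b1 a1.
- exact: K a2 b2.
- exact: K b2 a2.
Qed.

Lemma grid_sum r n (f : plane -> R) : 0 < r -> (0 < n)%N ->
  w `<=` cbox (- r / 2) (r / 2) (- r / 2) (r / 2) -> test_function w f ->
  nr leb2 w f ^+ 2 = \sum_ij ip leb2 (@gcell r n ij : set mplane) f f.
Proof.
move=> r0 n0 wr tf.
have nr0 : 0 < n%:R :> R by rewrite ltr0n.
have h0 : 0 < 2 * r / n%:R by rewrite divr_gt0// mulr_gt0.
have mC ij : measurable (@gcell r n ij : set mplane) by exact: measurable_cell.
have sf := test_sqi ow bw tf.
apply: EFin_inj; rewrite sqr_nr -(ip_integral ow sf sf) -sumEFin -integral_out2; last first.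
  by move=> y wy; rewrite (test_out tf wy) mul0r.
pose D := \big[setU/set0]_(ij <- index_enum ('I_n * 'I_n)%type) gcell r ij.
rewrite (@integral_out2 _ D); last first.
  move=> y Dy; rewrite (test_out tf) ?mul0r// => /wr/(gcell_cover r0 n0)[ij Hij].
  by apply: Dy; rewrite /D -bigcup_seq; exists ij => //=; rewrite mem_index_enum.
rewrite /D (@ge0_integral_bigsetU _ mplane R leb2 _ _ (fun y => (f y * f y)%:E))//.
- apply: eq_bigr => ij _.
  have sQ := sqi_Q bw (- r + ij.1%:R * (2 * r / n%:R)) (- r + ij.2%:R * (2 * r / n%:R)) h0 tf.
  exact: (integral_QE sQ sQ).
- exact: index_enum_uniq.
- by apply: sub_trivIset (gcell_disjoint r0 n0).
- apply/measurable_EFinP; apply: measurable_funM.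
    by apply: (test_meas bw tf); apply: bigsetU_measurable.
  by apply: (test_meas bw tf); apply: bigsetU_measurable.
- by move=> y _; rewrite lee_fin -expr2 sqr_ge0.
Qed.

Lemma indic_sqi (Q : set mplane) : measurable Q -> sqi leb2 (w : set mplane) (\1_Q : plane -> R).
Proof.
move=> mQ; have mw := mw ow; have fw := fw ow bw.
apply: (sqi_dom mw _ (sqi_cst mw 1 fw)); first exact: measurable_indic.
by move=> y _; rewrite indicE normr1; case: (_ \in _); rewrite ?normr1 ?normr0.
Qed.

Lemma ip_indic (Q : set mplane) (f : plane -> R) : measurable Q -> test_function w f ->
  ip leb2 Q f (cst 1) = ip leb2 (w : set mplane) f (\1_Q).
Proof.
move=> mQ tf; rewrite !ipE; transitivity (\int[leb2]_y (f y * \1_Q y)).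
  rewrite [LHS]Rintegral_mkcond; apply: eq_Rintegral => y _.
  by rewrite /patch indicE; case: ifPn => _; rewrite ?mulr1 ?mulr0.
rewrite [RHS]Rintegral_mkcond; apply: eq_Rintegral => y _.
rewrite /patch; case: ifPn => // /negP yw; rewrite (test_out tf) ?mul0r// => wy.
by apply: yw; rewrite inE.
Qed.

(* The Rellich-type estimate: up to an error controlled by the gradient, the
   L^2 norm is controlled by finitely many bounded linear forms. *)
Lemma test_grid : exists2 r : R, 0 < r & forall n f, (0 < n)%N -> test_function w f ->
  nr leb2 w f ^+ 2 <=
    (2 * r / n%:R) ^+ 2 * (nr leb2 w ('D_(e_ 0) f) ^+ 2 + nr leb2 w ('D_(e_ 1) f) ^+ 2) +
    (2 * r / n%:R) ^- 2 * \sum_(ij : 'I_n * 'I_n) ip leb2 w f (\1_(gcell r ij)) ^+ 2.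
Proof.
have [r r0 wr] := bounded_cbox bw; exists (2 * r); first by rewrite mulr_gt0.
move=> n f n0 tf.
have wr2 : w `<=` cbox (- (2 * r) / 2) (2 * r / 2) (- (2 * r) / 2) (2 * r / 2).
  have -> : 2 * r / 2 = r by field.
  by have -> : - (2 * r) / 2 = - r by field.
have r20 : 0 < 2 * r by rewrite mulr_gt0.
have nr0 : 0 < n%:R :> R by rewrite ltr0n.
set h := 2 * (2 * r) / n%:R; have h0 : 0 < h by rewrite divr_gt0// mulr_gt0.
have abs (a b c a' b' c' k l : R) : a = a' -> b = b' -> c = c' ->
  a' <= k * (b' + c') + l -> a <= k * (b + c) + l by move=> -> -> ->.
apply: (abs _ _ _ _ _ _ _ _ (grid_sum r20 n0 wr2 tf) (grid_sum r20 n0 wr2 (test_der 0 tf))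
  (grid_sum r20 n0 wr2 (test_der 1 tf))).
rewrite -big_split/= !big_distrr/= -big_split/=; apply: ler_sum => ij _.
have mC : measurable (gcell (2 * r) ij : set mplane) by exact: measurable_cell.
rewrite -(ip_indic mC tf).
have fin (x S m T1 T2 : R) : 0 < x -> x ^+ 2 * S <= m ^+ 2 + x ^+ 4 * (T1 + T2) ->
    S <= x ^+ 2 * (T1 + T2) + x ^- 2 * m ^+ 2.
  move=> x0 H; rewrite -(ler_pM2l (exprn_gt0 2 x0)) (le_trans H)//.
  by rewrite le_eqVlt; apply/orP; left; apply/eqP; field; exact: lt0r_neq0.
exact: (fin _ _ _ _ _ h0 (cell_poincare bw (- (2 * r) + ij.1%:R * h) (- (2 * r) + ij.2%:R * h) h0 tf)).
Qed.

End grid.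

(** * The spaces H^1_0 and H^2_0 *)

Section norms.
Context {R : realType}.
Implicit Types x y s t : R.

Lemma sqrt_ge x s : 0 <= x -> x ^+ 2 <= s -> x <= Num.sqrt s.
Proof.
move=> x0 xs; rewrite -[x]ger0_norm// -sqrtr_sqr ler_sqrt//.
exact: le_trans (sqr_ge0 x) xs.
Qed.

Lemma sqrt_le y s : 0 <= y -> s <= y ^+ 2 -> Num.sqrt s <= y.
Proof. by move=> y0 sy; rewrite -[y]ger0_norm// -sqrtr_sqr ler_sqrt ?sqr_ge0. Qed.

Lemma sqrD_le x y s t : 0 <= x -> 0 <= y -> s <= x ^+ 2 -> t <= y ^+ 2 -> s + t <= (x + y) ^+ 2.
Proof. by move=> x0 y0 sx ty; rewrite sqrrD; have := mulr_ge0 x0 y0; lra. Qed.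

Lemma sum_le n (x y : 'I_n -> R) : (forall a, 0 <= x a) -> (forall a, y a <= x a ^+ 2) ->
  0 <= \sum_a x a /\ \sum_a y a <= (\sum_a x a) ^+ 2.
Proof.
move=> x0 yx; apply: (big_ind2 (fun s t => 0 <= s /\ t <= s ^+ 2)).
- by rewrite expr0n.
- by move=> s t s' t' [s0 ts] [s0' ts']; split; [exact: addr_ge0|exact: sqrD_le].
- by [].
Qed.

Lemma sum2_ge (x : 'I_2 -> R) a : (forall b, 0 <= x b) -> x a <= \sum_b x b.
Proof. by move=> x0; rewrite (bigD1 a)//= lerDl; apply: sumr_ge0. Qed.

End norms.

Section limits.
Context {R : realType} (I : Type) (F : set_system I) {FF : ProperFilter F}.

Lemma cvg0_squeeze (a b : I -> R) : (\forall i \near F, 0 <= a i <= b i) ->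
  b i @[i --> F] --> (0 : R) -> a i @[i --> F] --> (0 : R).
Proof.
move=> ab b0; apply: (@squeeze_cvgr _ _ _ _ (cst 0) b) => //; exact: cvg_cst.
Qed.

Lemma cvg_le_lim (a b : I -> R) (l m : R) : a i @[i --> F] --> l -> b i @[i --> F] --> m ->
  (\forall i \near F, a i <= b i) -> l <= m.
Proof.
move=> al bm ab.
apply/ler_addgt0Pr => e e0; have e20 : 0 < e / 2 by rewrite divr_gt0.
near F => i.
have H1 : `|l - a i| <= e / 2 by near: i; move/cvgrPdist_le: al; exact.
have H2 : `|m - b i| <= e / 2 by near: i; move/cvgrPdist_le: bm; exact.
have H3 : a i <= b i by near: i.
move: H1 H2; rewrite !ler_norml; lra.
Unshelve. all: by end_near.
Qed.

Context d (T : measurableType d) (mu : {measure set T -> \bar R})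
  (D : set T) (mD : measurable D).

Lemma nr_cvg (u : I -> T -> R) f : sqi mu D f -> (\forall i \near F, sqi mu D (u i)) ->
  nr mu D (u i - f) @[i --> F] --> (0 : R) -> nr mu D (u i) @[i --> F] --> nr mu D f.
Proof.
move=> sf su H; apply/cvgrPdist_le => e e0; move/cvgrPdist_le : H => /(_ _ e0).
apply: filterS2 su => i si; rewrite sub0r normrN ger0_norm ?nr_ge0// => H.
by rewrite distrC (le_trans (nr_dist mD si sf)).
Qed.

Lemma ip_cvg (u v : I -> T -> R) f g : sqi mu D f -> sqi mu D g ->
  (\forall i \near F, sqi mu D (u i)) -> (\forall i \near F, sqi mu D (v i)) ->
  nr mu D (u i - f) @[i --> F] --> (0 : R) -> nr mu D (v i - g) @[i --> F] --> (0 : R) ->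
  ip mu D (u i) (v i) @[i --> F] --> ip mu D f g.
Proof.
move=> sf sg su sv Hu Hv.
suff : ip mu D (u i) (v i) - ip mu D f g @[i --> F] --> (0 : R).
  move=> /cvgrPdist_le H; apply/cvgrPdist_le => e e0.
  by apply: filterS (H e e0) => i; rewrite sub0r normrN distrC.
have nv := nr_cvg sg sv Hv.
apply: norm_cvg0; apply: (cvg0_squeeze (b := fun i => nr mu D (u i - f) * nr mu D (v i) + nr mu D f * nr mu D (v i - g))).
  apply: filterS2 su sv => i si sj; rewrite normr_ge0/=.
  have -> : ip mu D (u i) (v i) - ip mu D f g = ip mu D (u i - f) (v i) + ip mu D f (v i - g).
    by rewrite ipBl// ipBr//; ring.
  apply: (le_trans (ler_normD _ _)); apply: lerD; apply: ip_le => //; exact: sqiB.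
rewrite (_ : (0 : R) = 0 * nr mu D g + nr mu D f * 0); last by rewrite mul0r mulr0 addr0.
by apply: cvgD; apply: cvgM => //; exact: cvg_cst.
Qed.

Lemma nr_cvg_eq (u : I -> T -> R) f g : sqi mu D f -> sqi mu D g ->
  (\forall i \near F, sqi mu D (u i)) -> nr mu D (f - g) = 0 ->
  nr mu D (u i - f) @[i --> F] --> (0 : R) -> nr mu D (u i - g) @[i --> F] --> (0 : R).
Proof.
move=> sf sg su fg; apply: cvg0_squeeze.
apply: filterS su => i si; rewrite nr_ge0/=.
by rewrite (le_trans (nr_tri mD si sf sg))// fg addr0.
Qed.

End limits.

(* Locked, because unfolding these constants makes unification diverge. *)
HB.lock Definition wd {R : realType} (w : set (R * R)) (a : 'I_2) (f : R * R -> R) : R * R -> R :=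
  wpartial w a f.
HB.lock Definition cd {R : realType} (a : 'I_2) (f : R * R -> R) : R * R -> R := 'D_(e_ a) f.

Lemma wdE {R : realType} (w : set (R * R)) a f : wd w a f = wpartial w a f.
Proof. by rewrite wd.unlock. Qed.

Lemma cdE {R : realType} a (f : R * R -> R) : cd a f = 'D_(e_ a) f.
Proof. by rewrite cd.unlock. Qed.

Section H1.
Context {R : realType}.
Local Notation plane := (R * R)%type.
Local Notation mplane := (measurableTypeR R * measurableTypeR R)%type.
Context (w : set plane) (ow : open w) (bw : bounded_set w).
Local Notation sqi := (sqi (@leb2 R) w).
Local Notation ip := (ip (@leb2 R) w).
Local Notation nr := (nr (@leb2 R) w).
Local Notation D := (wd w).
Implicit Types (f g : plane -> R) (a b : 'I_2).
Let mw : measurable (w : set mplane) := mw ow.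

Lemma H1_sqi f : H1 w f -> sqi f.
Proof. by move=> [/(L2E _ mw)]. Qed.

Lemma H1_weak f a : H1 w f -> is_weak_partial w a f (D a f).
Proof. by move=> [_ /(_ a)[g]]; rewrite wdE; exact: wpartialP. Qed.

Lemma wd_nr a f g : is_weak_partial w a f g -> nr (D a f - g) = 0.
Proof. by rewrite wdE; exact: wpartial_nr. Qed.

Lemma H1_sqiD f a : H1 w f -> sqi (D a f).
Proof. by move=> /(H1_weak a)/(is_weakP ow)[]. Qed.

Lemma weak_H1 f (G : 'I_2 -> plane -> R) : sqi f ->
  (forall a, is_weak_partial w a f (G a)) -> H1 w f.
Proof. by move=> sf H; split; [exact/(L2E _ mw)|move=> a; exists (G a)]. Qed.

Lemma H1_lin k f g : H1 w f -> H1 w g -> H1 w (k *: f + g).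
Proof.
move=> Hf Hg; apply: (weak_H1 (G := fun a => k *: D a f + D a g)).
  by apply: sqiD => //; [apply: sqiZ => //|]; exact: H1_sqi.
by move=> a; apply: weak_lin => //; do ?exact: H1_sqi; exact: H1_weak.
Qed.

Lemma H1_sub f g : H1 w f -> H1 w g -> H1 w (f - g).
Proof. by move=> Hf Hg; rewrite addrC -scaleN1r; exact: H1_lin. Qed.

Lemma D_lin k f g a : H1 w f -> H1 w g -> nr (D a (k *: f + g) - (k *: D a f + D a g)) = 0.
Proof.
move=> Hf Hg; apply: wd_nr; apply: weak_lin => //; do ?exact: H1_sqi; exact: H1_weak.
Qed.

Lemma D_sub f g a : H1 w f -> H1 w g -> nr (D a (f - g) - (D a f - D a g)) = 0.
Proof.
move=> Hf Hg; have := D_lin (-1) a Hg Hf.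
by rewrite !scaleN1r (addrC (- g)) (addrC (- D a g)).
Qed.

Lemma nrD_sub f g a : H1 w f -> H1 w g -> nr (D a (f - g)) = nr (D a f - D a g).
Proof.
move=> Hf Hg; apply: (nr_eq mw) (D_sub a Hf Hg); first exact/H1_sqiD/H1_sub.
by apply: sqiB => //; exact: H1_sqiD.
Qed.

Lemma H1_eq f g : H1 w f -> sqi g -> nr (f - g) = 0 -> H1 w g.
Proof.
move=> Hf sg fg; apply: (weak_H1 (G := fun a => D a f)) => // a.
by apply: (weak_eq ow bw (f := f)) => //; [exact: H1_sqi|exact: H1_weak].
Qed.

Lemma D_eq f g a : H1 w f -> sqi g -> nr (f - g) = 0 -> nr (D a f - D a g) = 0.
Proof.
move=> Hf sg fg; rewrite nrBC; apply: wd_nr.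
by apply: (weak_eq ow bw (f := f)) => //; [exact: H1_sqi|exact: H1_weak].
Qed.

Lemma test_H1 f : test_function w f -> H1 w f.
Proof.
move=> tf; apply: (weak_H1 (G := fun a => cd a f)); first exact: test_sqi.
by move=> a; rewrite cdE; exact: weak_test.
Qed.

Lemma test_D f a : test_function w f -> nr (D a f - cd a f) = 0.
Proof. by move=> tf; apply: wd_nr; rewrite cdE; exact: weak_test. Qed.

Lemma test_cd f a : test_function w f -> test_function w (cd a f).
Proof. by rewrite cdE; exact: test_der. Qed.

Lemma nr_congr f f' g : sqi f -> sqi f' -> sqi g -> nr (f - f') = 0 -> nr (f - g) = nr (f' - g).
Proof.
move=> sf sf' sg ff; apply: (nr_eq mw); [exact: sqiB|exact: sqiB|].
by rewrite opprB addrA subrK.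
Qed.

Lemma nr_congr2 f f' g g' : sqi f -> sqi f' -> sqi g -> sqi g' ->
  nr (f - f') = 0 -> nr (g - g') = 0 -> nr (f - g) = nr (f' - g').
Proof.
move=> sf sf' sg sg' ff gg; rewrite (nr_congr sf sf' sg ff) nrBC.
by rewrite (nr_congr sg sg' sf' gg) nrBC.
Qed.

Lemma H1normE f : H1norm w f = Num.sqrt (nr f ^+ 2 + \sum_a nr (D a f) ^+ 2).
Proof. by rewrite /H1norm L2normE; congr Num.sqrt; congr (_ + _); apply: eq_bigr => a _; rewrite L2normE wdE. Qed.

Lemma H2normE f : H2norm w f = Num.sqrt (nr f ^+ 2 + \sum_a nr (D a f) ^+ 2 +
   \sum_a \sum_b nr (D b (D a f)) ^+ 2).
Proof.
rewrite /H2norm L2normE; congr Num.sqrt; congr (_ + _ + _); apply: eq_bigr => a _.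
  by rewrite L2normE wdE.
by apply: eq_bigr => b _; rewrite L2normE !wdE.
Qed.

Lemma H1norm_ge0 f : 0 <= H1norm w f. Proof. exact: sqrtr_ge0. Qed.
Lemma H2norm_ge0 f : 0 <= H2norm w f. Proof. exact: sqrtr_ge0. Qed.

Let sqr2 (x : 'I_2 -> R) : 0 <= \sum_a x a ^+ 2.
Proof. by apply: sumr_ge0 => a _; exact: sqr_ge0. Qed.
Let sqr22 (x : 'I_2 -> 'I_2 -> R) : 0 <= \sum_a \sum_b x a b ^+ 2.
Proof. by apply: sumr_ge0 => a _; exact: sqr2. Qed.
Let ge2 (x : 'I_2 -> R) a : x a ^+ 2 <= \sum_a x a ^+ 2.
Proof. by apply: (sum2_ge (x := fun a => x a ^+ 2)) => b; exact: sqr_ge0. Qed.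
Let ge22 (x : 'I_2 -> 'I_2 -> R) a b : x a b ^+ 2 <= \sum_a \sum_b x a b ^+ 2.
Proof.
apply: (le_trans (ge2 (x a) b)).
by apply: (sum2_ge (x := fun a => \sum_b x a b ^+ 2)) => c; exact: sqr2.
Qed.

Lemma nr_le_H1norm f : nr f <= H1norm w f.
Proof. by rewrite H1normE; apply: sqrt_ge; [exact: nr_ge0|rewrite lerDl; exact: sqr2]. Qed.

Lemma nrD_le_H1norm f a : nr (D a f) <= H1norm w f.
Proof.
rewrite H1normE; apply: sqrt_ge; first exact: nr_ge0.
by apply: (le_trans (ge2 (fun a => nr (D a f)) a)); rewrite lerDr sqr_ge0.
Qed.

Lemma H1norm_le f : H1norm w f <= nr f + \sum_a nr (D a f).
Proof.
have [S0 S1] := sum_le (x := fun a => nr (D a f)) (fun a => nr_ge0 _ _ _) (fun a => lexx _).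
by rewrite H1normE; apply: sqrt_le; [apply: addr_ge0 => //; exact: nr_ge0|apply: sqrD_le => //; exact: nr_ge0].
Qed.

Lemma nr_le_H2norm f : nr f <= H2norm w f.
Proof.
rewrite H2normE; apply: sqrt_ge; first exact: nr_ge0.
by rewrite -addrA lerDl; apply: addr_ge0; [exact: sqr2|exact: sqr22].
Qed.

Lemma nrD_le_H2norm f a : nr (D a f) <= H2norm w f.
Proof.
rewrite H2normE; apply: sqrt_ge; first exact: nr_ge0.
apply: (le_trans (ge2 (fun a => nr (D a f)) a)).
by rewrite addrAC lerDr; apply: addr_ge0; [exact: sqr_ge0|exact: sqr22].
Qed.

Lemma nrDD_le_H2norm f a b : nr (D b (D a f)) <= H2norm w f.
Proof.
rewrite H2normE; apply: sqrt_ge; first exact: nr_ge0.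
apply: (le_trans (ge22 (fun a b => nr (D b (D a f))) a b)).
by rewrite lerDr; apply: addr_ge0; [exact: sqr_ge0|exact: sqr2].
Qed.

Lemma H2norm_le f : H2norm w f <= nr f + \sum_a nr (D a f) + \sum_a \sum_b nr (D b (D a f)).
Proof.
have [S0 S1] := sum_le (x := fun a => nr (D a f)) (fun a => nr_ge0 _ _ _) (fun a => lexx _).
have T a := sum_le (x := fun b => nr (D b (D a f))) (fun a => nr_ge0 _ _ _) (fun a => lexx _).
have [U0 U1] := sum_le (x := fun a => \sum_b nr (D b (D a f))) (fun a => (T a).1) (fun a => (T a).2).
have V0 : 0 <= nr f + \sum_a nr (D a f) by apply: addr_ge0 => //; exact: nr_ge0.
rewrite H2normE; apply: sqrt_le; first exact: addr_ge0.
by apply: sqrD_le => //; apply: sqrD_le => //; exact: nr_ge0.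
Qed.

End H1.

Section H10.
Context {R : realType}.
Local Notation plane := (R * R)%type.
Local Notation mplane := (measurableTypeR R * measurableTypeR R)%type.
Context (w : set plane) (ow : open w) (bw : bounded_set w).
Local Notation sqi := (sqi (@leb2 R) w).
Local Notation ip := (ip (@leb2 R) w).
Local Notation nr := (nr (@leb2 R) w).
Local Notation D := (wd w).
Implicit Types (f g : plane -> R) (a b : 'I_2).
Let mw : measurable (w : set mplane) := mw ow.

(** Equivalent on H^1 to [H1norm w (f - g)], but with differences of derivatives: [D a (f - g)] is a
    chosen representative, equal to [D a f - D a g] only almost everywhere. It makes the triangle
    inequality componentwise. *)
Definition d1 f g : R := nr (f - g) + \sum_a nr (D a f - D a g).
Definition d2 f g : R := d1 f g + \sum_a \sum_b nr (D b (D a f) - D b (D a g)).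

Lemma d1_ge0 f g : 0 <= d1 f g.
Proof. by apply: addr_ge0; [exact: nr_ge0|apply: sumr_ge0 => a _; exact: nr_ge0]. Qed.

Lemma d1_tri f g h : H1 w f -> H1 w g -> H1 w h -> d1 f h <= d1 f g + d1 g h.
Proof.
move=> Hf Hg Hh; rewrite /d1 addrACA -big_split/=; apply: lerD.
  by apply: nr_tri => //; exact: H1_sqi.
by apply: ler_sum => a _; apply: nr_tri => //; exact: H1_sqiD.
Qed.

Lemma H1norm_d1 f g : H1 w f -> H1 w g -> H1norm w (f - g) <= d1 f g.
Proof.
move=> Hf Hg; apply: le_trans (H1norm_le _ _) _.
by rewrite /d1 lerD2l; apply: ler_sum => a _; rewrite nrD_sub.
Qed.

Lemma d1_H1norm f g : H1 w f -> H1 w g -> d1 f g <= 3 * H1norm w (f - g).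
Proof.
move=> Hf Hg; rewrite /d1 big_ord_recl big_ord_recl big_ord0.
have := nr_le_H1norm w (f - g).
have := nrD_le_H1norm w (f - g) ord0; rewrite nrD_sub//.
have := nrD_le_H1norm w (f - g) (lift ord0 ord0); rewrite nrD_sub//.
move: (nr _) (nr _) (nr _) (H1norm _ _) => x y z t; lra.
Qed.

Lemma H2_H1 f : H2 w f -> H1 w f. Proof. by case. Qed.
Lemma H2_D f a : H2 w f -> H1 w (D a f). Proof. by rewrite wdE => -[_]. Qed.

Lemma DD_eq f g a b : H2 w f -> sqi g -> nr (f - g) = 0 -> nr (D b (D a f) - D b (D a g)) = 0.
Proof.
move=> Hf sg fg; have Hg := H1_eq ow bw (H2_H1 Hf) sg fg.
by apply: (D_eq ow bw _ (H2_D a Hf)); [exact: H1_sqiD|exact: (D_eq ow bw a (H2_H1 Hf))].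
Qed.

Lemma H2_lin k f g : H2 w f -> H2 w g -> H2 w (k *: f + g).
Proof.
move=> Hf Hg; split; first by apply: (H1_lin ow bw); exact: H2_H1.
move=> a; rewrite -wdE; have H : H1 w (k *: D a f + D a g) by apply: (H1_lin ow bw); exact: H2_D.
have Hl : H1 w (k *: f + g) by apply: (H1_lin ow bw); exact: H2_H1.
by apply: (H1_eq ow bw H); [exact: H1_sqiD|rewrite nrBC; apply: (D_lin ow bw); exact: H2_H1].
Qed.

Lemma DD_lin k f g a b : H2 w f -> H2 w g ->
  nr (D b (D a (k *: f + g)) - (k *: D b (D a f) + D b (D a g))) = 0.
Proof.
move=> Hf Hg; have Hl := H2_lin k Hf Hg.
have H : H1 w (k *: D a f + D a g) by apply: (H1_lin ow bw); exact: H2_D.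
have E1 : nr (D b (D a (k *: f + g)) - D b (k *: D a f + D a g)) = 0.
  apply: (D_eq ow bw b (H2_D a Hl)); first exact: H1_sqi.
  by apply: (D_lin ow bw); exact: H2_H1.
rewrite -(D_lin ow bw k b (H2_D a Hf) (H2_D a Hg)).
apply: (nr_congr ow) => //; do ?exact: H1_sqiD (H2_D a Hl).
- exact: H1_sqiD.
- by apply: sqiD => //; [apply: sqiZ => //|]; apply: H1_sqiD => //; exact: H2_D.
Qed.

Lemma H2_sub f g : H2 w f -> H2 w g -> H2 w (f - g).
Proof. by move=> Hf Hg; rewrite addrC -scaleN1r; exact: H2_lin. Qed.

Lemma nrDD_sub f g a b : H2 w f -> H2 w g ->
  nr (D b (D a (f - g))) = nr (D b (D a f) - D b (D a g)).
Proof.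
move=> Hf Hg; apply: (nr_eq mw).
- by apply: H1_sqiD => //; apply: H2_D; exact: H2_sub.
- by apply: sqiB => //; apply: H1_sqiD => //; exact: H2_D.
have := DD_lin (-1) a b Hg Hf.
by rewrite !scaleN1r (addrC (- g)) (addrC (- D b (D a g))).
Qed.

Lemma d2_ge0 f g : 0 <= d2 f g.
Proof.
apply: addr_ge0; first exact: d1_ge0.
by apply: sumr_ge0 => a _; apply: sumr_ge0 => b _; exact: nr_ge0.
Qed.

Lemma d2_tri f g h : H2 w f -> H2 w g -> H2 w h -> d2 f h <= d2 f g + d2 g h.
Proof.
move=> Hf Hg Hh; rewrite /d2 addrACA -big_split/=; apply: lerD.
  by apply: d1_tri; exact: H2_H1.
apply: ler_sum => a _; rewrite -big_split/=; apply: ler_sum => b _.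
by apply: nr_tri => //; apply: H1_sqiD => //; exact: H2_D.
Qed.

Lemma H2norm_d2 f g : H2 w f -> H2 w g -> H2norm w (f - g) <= d2 f g.
Proof.
move=> Hf Hg; apply: le_trans (H2norm_le _ _) _.
rewrite /d2 /d1; apply: lerD.
  by rewrite lerD2l; apply: ler_sum => a _; rewrite nrD_sub//; exact: H2_H1.
by apply: ler_sum => a _; apply: ler_sum => b _; rewrite nrDD_sub.
Qed.

Lemma d2_H2norm f g : H2 w f -> H2 w g -> d2 f g <= 7 * H2norm w (f - g).
Proof.
move=> Hf Hg; have h0 := nr_le_H2norm w (f - g).
have h1 a : nr (D a f - D a g) <= H2norm w (f - g).
  by rewrite -nrD_sub ?nrD_le_H2norm//; exact: H2_H1.
have h2 a b : nr (D b (D a f) - D b (D a g)) <= H2norm w (f - g).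
  by rewrite -nrDD_sub ?nrDD_le_H2norm.
have s1 : \sum_a nr (D a f - D a g) <= \sum_(a < 2) H2norm w (f - g) by apply: ler_sum.
have s2 : \sum_a \sum_b nr (D b (D a f) - D b (D a g)) <= \sum_(a < 2) \sum_(b < 2) H2norm w (f - g).
  by apply: ler_sum => a _; apply: ler_sum.
rewrite /d2 /d1; apply: (le_trans (lerD (lerD h0 s1) s2)).
rewrite !sumr_const !card_ord; lra.
Qed.

Lemma test_H2 f : test_function w f -> H2 w f.
Proof.
move=> tf; split; first exact: test_H1.
move=> a; rewrite -wdE; apply: (H1_eq ow bw (test_H1 ow bw (test_cd a tf))).
  by apply: H1_sqiD => //; exact: test_H1.
by rewrite nrBC; exact: test_D.
Qed.

Lemma H10P f : H10 w f <-> H1 w f /\ forall e, 0 < e -> exists2 phi, test_function w phi & d1 f phi < e.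
Proof.
split=> -[Hf H]; split => // e e0.
  have [|phi tphi lt] := H (e / 3); first by rewrite divr_gt0.
  exists phi => //; apply: (le_lt_trans (d1_H1norm Hf (test_H1 ow bw tphi))).
  by move: lt; move: (H1norm _ _) => x; lra.
have [phi tphi lt] := H _ e0; exists phi => //.
exact: le_lt_trans (H1norm_d1 Hf (test_H1 ow bw tphi)) lt.
Qed.

Lemma H20P f : H20 w f <-> H2 w f /\ forall e, 0 < e -> exists2 phi, test_function w phi & d2 f phi < e.
Proof.
split=> -[Hf H]; split => // e e0.
  have [|phi tphi lt] := H (e / 7); first by rewrite divr_gt0.
  exists phi => //; apply: (le_lt_trans (d2_H2norm Hf (test_H2 tphi))).
  by move: lt; move: (H2norm _ _) => x; lra.
have [phi tphi lt] := H _ e0; exists phi => //.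
exact: le_lt_trans (H2norm_d2 Hf (test_H2 tphi)) lt.
Qed.

Lemma H10_H1 f : H10 w f -> H1 w f. Proof. by case. Qed.
Lemma H20_H2 f : H20 w f -> H2 w f. Proof. by case. Qed.

Lemma test_H10 f : test_function w f -> H10 w f.
Proof.
move=> tf; apply/H10P; split; first exact: test_H1.
move=> e e0; exists f => //; rewrite /d1 subrr nr0 add0r big1// => a _.
by rewrite subrr nr0.
Qed.

Lemma test_H20 f : test_function w f -> H20 w f.
Proof.
move=> tf; apply/H20P; split; first exact: test_H2.
move=> e e0; exists f => //; rewrite /d2 /d1 subrr nr0 add0r !big1 ?addr0// => a _.
  by rewrite big1// => b _; rewrite subrr nr0.
by rewrite subrr nr0.
Qed.

(** The approximants come with their classical derivatives [cd], for which the inequalities on test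
    functions are stated. *)
Lemma H10_approx f : H10 w f -> exists phi : nat -> plane -> R,
  [/\ forall k, test_function w (phi k), nr (phi k - f) @[k --> \oo] --> (0 : R) &
      forall a, nr (cd a (phi k) - D a f) @[k --> \oo] --> (0 : R)].
Proof.
move=> /H10P[Hf H].
have /choice[phi Hphi] : forall k : nat, exists phi, test_function w phi /\ d1 f phi < harmonic k.
  by move=> k; have [|phi tphi lt] := H (harmonic k); [exact: harmonic_gt0|exists phi].
exists phi; split=> [k|| a]; first by have [] := Hphi k.
  apply: (cvg0_squeeze (b := harmonic)); last exact: cvg_harmonic.
  apply: nearW => k; rewrite nr_ge0/= nrBC (le_trans _ (ltW (Hphi k).2))//.
  by rewrite /d1 lerDl; apply: sumr_ge0 => a _; exact: nr_ge0.
apply: (cvg0_squeeze (b := harmonic)); last exact: cvg_harmonic.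
apply: nearW => k; rewrite nr_ge0/= nrBC (le_trans _ (ltW (Hphi k).2))//.
have tp := (Hphi k).1.
have -> : nr (D a f - cd a (phi k)) = nr (D a f - D a (phi k)).
  rewrite nrBC [RHS]nrBC; apply: (nr_congr ow).
  - exact/test_sqi/test_cd.
  - exact/H1_sqiD/test_H1.
  - exact: H1_sqiD.
  - by rewrite nrBC; exact: test_D.
rewrite /d1 (le_trans (sum2_ge (x := fun a => nr (D a f - D a (phi k))) a (fun _ => nr_ge0 _ _ _)))//.
by rewrite lerDr nr_ge0.
Qed.

Lemma cvgD0 (I : Type) (F : set_system I) (FF : ProperFilter F) (x y : I -> R) :
  x i @[i --> F] --> (0 : R) -> y i @[i --> F] --> (0 : R) -> x i + y i @[i --> F] --> (0 : R).
Proof.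
move=> Hx Hy; have K : x i + y i @[i --> F] --> (0 + 0 : R) by exact: cvgD Hx Hy.
by rewrite addr0 in K.
Qed.

Lemma sum2_cvg0 (I : Type) (F : set_system I) (FF : ProperFilter F) (x : 'I_2 -> I -> R) :
  (forall a, x a i @[i --> F] --> (0 : R)) -> \sum_a x a i @[i --> F] --> (0 : R).
Proof.
move=> H; under eq_fun do rewrite big_ord_recl big_ord_recl big_ord0 addr0.
have K : x ord0 i + x (lift ord0 ord0) i @[i --> F] --> (0 + 0 : R).
  exact: cvgD (H ord0) (H (lift ord0 ord0)).
by rewrite addr0 in K.
Qed.

(** Weak derivatives pass to L^2 limits, so [G a] is a derivative of [f]; a test function close to
    [u i], for [i] far enough, is then close to [f]. *)
Lemma H10_closed (I : Type) (F : set_system I) (FF : ProperFilter F) (u : I -> plane -> R)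
    f (G : 'I_2 -> plane -> R) :
  sqi f -> (forall a, sqi (G a)) -> (\forall i \near F, H10 w (u i)) ->
  nr (u i - f) @[i --> F] --> (0 : R) ->
  (forall a, nr (D a (u i) - G a) @[i --> F] --> (0 : R)) ->
  H10 w f /\ forall a, nr (D a f - G a) = 0.
Proof.
move=> sf sG Hu uf uG.
have su : \forall i \near F, sqi (u i).
  by apply: filterS Hu => i /H10_H1; exact: H1_sqi.
have sD a : \forall i \near F, sqi (D a (u i)).
  by apply: filterS Hu => i /H10_H1; exact: H1_sqiD.
have W a : is_weak_partial w a f (G a).
  apply: (weak_cvg ow bw FF sf (sG a) su _ uf (uG a)).
  by apply: filterS Hu => i /H10_H1; exact: H1_weak.
have Hf : H1 w f by exact: (weak_H1 ow sf W).
have E a : nr (D a f - G a) = 0 by exact: wd_nr.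
split => //; apply/H10P; split => // e e0.
have C : d1 (u i) f @[i --> F] --> (0 : R).
  apply: cvgD0 => //.
  apply: sum2_cvg0 => a.
  apply: (nr_cvg_eq mw (sG a) (H1_sqiD ow a Hf) (sD a) _ (uG a)).
  by rewrite nrBC.
have e20 : 0 < e / 2 by rewrite divr_gt0.
near F => i.
have Hi : H10 w (u i) by near: i.
have lt : d1 (u i) f < e / 2.
  near: i; move/cvgrPdist_lt : C => /(_ _ e20); apply: filterS => i.
  by rewrite sub0r normrN ger0_norm ?d1_ge0.
have [_ /(_ _ e20)[phi tphi lt2]] := (H10P (u i)).1 Hi; exists phi => //.
have d1C : d1 f (u i) = d1 (u i) f.
  by rewrite /d1 nrBC; congr (_ + _); apply: eq_bigr => a _; rewrite nrBC.
apply: (le_lt_trans (d1_tri Hf (H10_H1 Hi) (test_H1 ow bw tphi))).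
rewrite d1C; move: lt lt2; move: (d1 _ _) (d1 _ _) => x y; lra.
Unshelve. all: by end_near.
Qed.

Lemma H20_closed (I : Type) (F : set_system I) (FF : ProperFilter F) (u : I -> plane -> R)
    f (G : 'I_2 -> plane -> R) (K : 'I_2 -> 'I_2 -> plane -> R) :
  sqi f -> (forall a, sqi (G a)) -> (forall a b, sqi (K a b)) -> (\forall i \near F, H20 w (u i)) ->
  nr (u i - f) @[i --> F] --> (0 : R) ->
  (forall a, nr (D a (u i) - G a) @[i --> F] --> (0 : R)) ->
  (forall a b, nr (D b (D a (u i)) - K a b) @[i --> F] --> (0 : R)) ->
  [/\ H20 w f, forall a, nr (D a f - G a) = 0 & forall a b, nr (D b (D a f) - K a b) = 0].
Proof.
move=> sf sG sK Hu uf uG uK.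
have su : \forall i \near F, sqi (u i).
  by apply: filterS Hu => i /H20_H2/H2_H1; exact: H1_sqi.
have sD a : \forall i \near F, sqi (D a (u i)).
  by apply: filterS Hu => i /H20_H2/H2_H1; exact: H1_sqiD.
have sDD a b : \forall i \near F, sqi (D b (D a (u i))).
  by apply: filterS Hu => i /H20_H2 H; apply: H1_sqiD => //; exact: H2_D.
have W a : is_weak_partial w a f (G a).
  apply: (weak_cvg ow bw FF sf (sG a) su _ uf (uG a)).
  by apply: filterS Hu => i /H20_H2/H2_H1; exact: H1_weak.
have Hf : H1 w f by exact: (weak_H1 ow sf W).
have E a : nr (D a f - G a) = 0 by exact: wd_nr.
have sDf a := H1_sqiD ow a Hf.
have uD a : nr (D a (u i) - D a f) @[i --> F] --> (0 : R).
  by apply: (nr_cvg_eq mw (sG a) (sDf a) (sD a) _ (uG a)); rewrite nrBC.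
have WW a b : is_weak_partial w b (D a f) (K a b).
  apply: (weak_cvg ow bw FF (sDf a) (sK a b) (sD a) _ (uD a) (uK a b)).
  by apply: filterS Hu => i /H20_H2 H; apply: H1_weak; exact: H2_D.
have Hf2 : H2 w f by split => // a; rewrite -wdE; exact: (weak_H1 ow (sDf a) (WW a)).
have E2 a b : nr (D b (D a f) - K a b) = 0 by exact: wd_nr.
split => //; apply/H20P; split => // e e0.
have C : d2 (u i) f @[i --> F] --> (0 : R).
  apply: cvgD0.
    apply: cvgD0 => //; apply: sum2_cvg0 => a; exact: uD.
  apply: sum2_cvg0 => a; apply: sum2_cvg0 => b.
  apply: (nr_cvg_eq mw (sK a b) _ (sDD a b) _ (uK a b)); first exact/H1_sqiD/H2_D.
  by rewrite nrBC.
have e20 : 0 < e / 2 by rewrite divr_gt0.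
near F => i.
have Hi : H20 w (u i) by near: i.
have lt : d2 (u i) f < e / 2.
  near: i; move/cvgrPdist_lt : C => /(_ _ e20); apply: filterS => i.
  by rewrite sub0r normrN ger0_norm ?d2_ge0.
have [_ /(_ _ e20)[phi tphi lt2]] := (H20P (u i)).1 Hi; exists phi => //.
have d2C : d2 f (u i) = d2 (u i) f.
  rewrite /d2 /d1 nrBC; congr (_ + _ + _); apply: eq_bigr => a _; first by rewrite nrBC.
  by apply: eq_bigr => b _; rewrite nrBC.
apply: (le_lt_trans (d2_tri Hf2 (H20_H2 Hi) (test_H2 tphi))).
rewrite d2C; move: lt lt2; move: (d2 _ _) (d2 _ _) => x y; lra.
Unshelve. all: by end_near.
Qed.

Lemma H20_approx f : H20 w f -> exists phi : nat -> plane -> R,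
  [/\ forall k, test_function w (phi k), nr (phi k - f) @[k --> \oo] --> (0 : R),
      forall a, nr (D a (phi k) - D a f) @[k --> \oo] --> (0 : R) &
      forall a b, nr (D b (D a (phi k)) - D b (D a f)) @[k --> \oo] --> (0 : R)].
Proof.
move=> /H20P[Hf H].
have /choice[phi Hphi] : forall k : nat, exists phi, test_function w phi /\ d2 f phi < harmonic k.
  by move=> k; have [|phi tphi lt] := H (harmonic k); [exact: harmonic_gt0|exists phi].
have d10 k : 0 <= \sum_a nr (D a f - D a (phi k)) by apply: sumr_ge0 => a _; exact: nr_ge0.
have d20 k : 0 <= \sum_a \sum_b nr (D b (D a f) - D b (D a (phi k))).
  by apply: sumr_ge0 => a _; apply: sumr_ge0 => b _; exact: nr_ge0.
exists phi; split=> [k|| a|a b]; first by have [] := Hphi k.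
- apply: (cvg0_squeeze (b := harmonic)); last exact: cvg_harmonic.
  apply: nearW => k; rewrite nr_ge0/= nrBC (le_trans _ (ltW (Hphi k).2))//.
  by rewrite /d2 /d1 -addrA lerDl addr_ge0.
- apply: (cvg0_squeeze (b := harmonic)); last exact: cvg_harmonic.
  apply: nearW => k; rewrite nr_ge0/= nrBC (le_trans _ (ltW (Hphi k).2))//.
  rewrite /d2 /d1 (le_trans (sum2_ge (x := fun a => nr (D a f - D a (phi k))) a (fun _ => nr_ge0 _ _ _)))//.
  by rewrite addrAC lerDr addr_ge0// nr_ge0.
- apply: (cvg0_squeeze (b := harmonic)); last exact: cvg_harmonic.
  apply: nearW => k; rewrite nr_ge0/= nrBC (le_trans _ (ltW (Hphi k).2))//.
  rewrite /d2 (le_trans (sum2_ge (x := fun b => nr (D b (D a f) - D b (D a (phi k)))) b (fun _ => nr_ge0 _ _ _)))//.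
  rewrite (le_trans (sum2_ge (x := fun a => \sum_b nr (D b (D a f) - D b (D a (phi k)))) a _))//.
    by move=> c; apply: sumr_ge0 => e _; exact: nr_ge0.
  by rewrite lerDr d1_ge0.
Qed.

Lemma H20_H10 f : H20 w f -> H10 w f.
Proof.
move=> /H20P[Hf H]; apply/H10P; split; first exact: H2_H1.
move=> e e0; have [phi tphi lt] := H _ e0; exists phi => //; apply: le_lt_trans lt.
by rewrite /d2 lerDl; apply: sumr_ge0 => a _; apply: sumr_ge0 => b _; exact: nr_ge0.
Qed.

(** Derivatives of approximating test functions are test functions. This makes the inequalities of
    Poincare and Ladyzhenskaya available for the gradient of [u_3]. *)
Lemma H20_D f a : H20 w f -> H10 w (D a f).
Proof.
move=> Hf; have [phi [tphi c0 c1 c2]] := H20_approx Hf; have H2f := H20_H2 Hf.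
have HD := H2_D a H2f.
have [|||||//] := @H10_closed nat \oo _ (fun k => cd a (phi k)) (D a f) (fun b => D b (D a f)).
- exact: H1_sqi HD.
- by move=> b; exact: H1_sqiD.
- by apply: nearW => k; apply: test_H10; exact: test_cd.
- apply: (cvg0_squeeze _ (c1 a)); apply: nearW => k; rewrite nr_ge0/=.
  rewrite (nr_congr ow (f' := D a (phi k)))//.
  + exact/test_sqi/test_cd.
  + exact/H1_sqiD/test_H1.
  + exact: H1_sqi HD.
  + by rewrite nrBC; exact: test_D.
- move=> b; apply: (cvg0_squeeze _ (c2 a b)); apply: nearW => k; rewrite nr_ge0/=.
  have td := test_cd a (tphi k).
  rewrite (nr_congr ow (f' := D b (D a (phi k))))//.
  + exact/H1_sqiD/test_H1.
  + by apply: H1_sqiD => //; apply: H2_D; exact: test_H2.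
  + exact: H1_sqiD.
  + apply: (D_eq ow bw b (test_H1 ow bw td)); first exact/H1_sqiD/test_H1.
    by rewrite nrBC; exact: test_D.
Qed.

Lemma H10_lin k f g : H10 w f -> H10 w g -> H10 w (k *: f + g).
Proof.
move=> /H10P[Hf H] /H10P[Hg H']; apply/H10P; split; first exact: H1_lin.
move=> e e0; have C0 : 0 < `|k| + 1 by rewrite ltr_wpDl.
have [|phi tphi lt] := H (e / 2 / (`|k| + 1)); first by rewrite !divr_gt0.
have [|psi tpsi lt'] := H' (e / 2); first by rewrite !divr_gt0.
exists (k *: phi + psi); first by apply: testD => //; exact: testZ.
have Hp := test_H1 ow bw tphi; have Hq := test_H1 ow bw tpsi.
have K (F G P Q : plane -> R) : sqi F -> sqi G -> sqi P -> sqi Q ->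
    nr (k *: F + G - (k *: P + Q)) <= `|k| * nr (F - P) + nr (G - Q).
  move=> sF sG sP sQ; rewrite (_ : _ - _ = k *: (F - P) + (G - Q)); last first.
    by rewrite scalerBr opprD addrACA.
  rewrite -nrZ//; last exact: sqiB.
  by apply: nrD => //; [apply: sqiZ => //|]; exact: sqiB.
apply: (@le_lt_trans _ _ (`|k| * d1 f phi + d1 g psi)).
  rewrite /d1 mulrDr addrACA big_distrr/= -big_split/=; apply: lerD.
    by apply: K; exact: H1_sqi.
  apply: ler_sum => a _.
  rewrite (nr_congr2 ow (f' := k *: D a f + D a g) (g' := k *: D a phi + D a psi)).
  - by apply: K; exact: H1_sqiD.
  - by apply: H1_sqiD => //; exact: H1_lin.
  - by apply: sqiD => //; [apply: sqiZ => //|]; exact: H1_sqiD.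
  - by apply: H1_sqiD => //; exact: H1_lin.
  - by apply: sqiD => //; [apply: sqiZ => //|]; exact: H1_sqiD.
  - exact: D_lin.
  - exact: D_lin.
have := ler_wpM2l (normr_ge0 k) (ltW lt).
have : `|k| * (e / 2 / (`|k| + 1)) <= e / 2.
  by rewrite mulrCA -[leRHS]mulr1 ler_wpM2l ?divr_ge0 ?(ltW e0)// ler_pdivrMr// mul1r lerDl.
move: lt'; move: (`|k| * d1 _ _) (d1 _ _) (`|k| * _) => x y z; lra.
Qed.

Lemma H20_lin k f g : H20 w f -> H20 w g -> H20 w (k *: f + g).
Proof.
move=> /H20P[Hf H] /H20P[Hg H']; apply/H20P; split; first exact: H2_lin.
move=> e e0; have C0 : 0 < `|k| + 1 by rewrite ltr_wpDl.
have [|phi tphi lt] := H (e / 2 / (`|k| + 1)); first by rewrite !divr_gt0.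
have [|psi tpsi lt'] := H' (e / 2); first by rewrite !divr_gt0.
exists (k *: phi + psi); first by apply: testD => //; exact: testZ.
have Hp := test_H2 tphi; have Hq := test_H2 tpsi.
have K (F G P Q : plane -> R) : sqi F -> sqi G -> sqi P -> sqi Q ->
    nr (k *: F + G - (k *: P + Q)) <= `|k| * nr (F - P) + nr (G - Q).
  move=> sF sG sP sQ; rewrite (_ : _ - _ = k *: (F - P) + (G - Q)); last first.
    by rewrite scalerBr opprD addrACA.
  rewrite -nrZ//; last exact: sqiB.
  by apply: nrD => //; [apply: sqiZ => //|]; exact: sqiB.
apply: (@le_lt_trans _ _ (`|k| * d2 f phi + d2 g psi)).
  rewrite /d2 mulrDr addrACA big_distrr/= -big_split/=; apply: lerD.
    rewrite /d1 mulrDr addrACA big_distrr/= -big_split/=; apply: lerD.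
      by apply: K; apply: H1_sqi => //; exact: H2_H1.
    apply: ler_sum => a _.
    have [H1f H1g] := (H2_H1 Hf, H2_H1 Hg); have [H1p H1q] := (H2_H1 Hp, H2_H1 Hq).
    rewrite (nr_congr2 ow (f' := k *: D a f + D a g) (g' := k *: D a phi + D a psi)).
    - by apply: K; exact: H1_sqiD.
    - by apply: H1_sqiD => //; exact: H1_lin.
    - by apply: sqiD => //; [apply: sqiZ => //|]; exact: H1_sqiD.
    - by apply: H1_sqiD => //; exact: H1_lin.
    - by apply: sqiD => //; [apply: sqiZ => //|]; exact: H1_sqiD.
    - exact: D_lin.
    - exact: D_lin.
  apply: ler_sum => a _; rewrite big_distrr/= -big_split/=; apply: ler_sum => b _.
  have [H1f H1g] := (H2_D a Hf, H2_D a Hg); have [H1p H1q] := (H2_D a Hp, H2_D a Hq).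
  rewrite (nr_congr2 ow (f' := k *: D b (D a f) + D b (D a g)) (g' := k *: D b (D a phi) + D b (D a psi))).
  - by apply: K; exact: H1_sqiD.
  - by apply: H1_sqiD => //; apply: H2_D; exact: H2_lin.
  - by apply: sqiD => //; [apply: sqiZ => //|]; exact: H1_sqiD.
  - by apply: H1_sqiD => //; apply: H2_D; exact: H2_lin.
  - by apply: sqiD => //; [apply: sqiZ => //|]; exact: H1_sqiD.
  - exact: DD_lin.
  - exact: DD_lin.
have := ler_wpM2l (normr_ge0 k) (ltW lt).
have : `|k| * (e / 2 / (`|k| + 1)) <= e / 2.
  by rewrite mulrCA -[leRHS]mulr1 ler_wpM2l ?divr_ge0 ?(ltW e0)// ler_pdivrMr// mul1r lerDl.
move: lt'; move: (`|k| * d2 _ _) (d2 _ _) (`|k| * _) => x y z; lra.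
Qed.

End H10.

(** * Products of functions of H^1_0 *)

Section damp.
Context {R : realType}.
Implicit Types t : R.

(** Both functions are bounded, [damp] vanishes only at 0, and [damp t ^+ 2 = damp2 t * t]: testing
    a function [dl] against the bounded [damp2 \o dl] produces the squared norm of [damp \o dl]. *)
Definition damp t := t / (1 + t ^+ 2).
Definition damp2 t := t / (1 + t ^+ 2) ^+ 2.

Lemma damp_pos t : 0 < 1 + t ^+ 2. Proof. by rewrite ltr_pwDl ?sqr_ge0. Qed.

Lemma damp_le1 t : `|damp t| <= 1.
Proof.
have p := damp_pos t; rewrite normrM normfV (gtr0_norm p) ler_pdivrMr// mul1r.
have := sqr_ge0 (`|t| - 1); have := real_normK (num_real t); have := normr_ge0 t.
move: `|t| => x x0 <-; nra.
Qed.

Lemma damp2E t : damp2 t = damp t * (1 + t ^+ 2)^-1.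
Proof. by rewrite /damp2 /damp expr2 invfM mulrA. Qed.

Lemma damp2_le1 t : `|damp2 t| <= 1.
Proof.
have p := damp_pos t; rewrite damp2E normrM -[leRHS]mulr1 ler_pM ?damp_le1//.
by rewrite normfV (gtr0_norm p) invf_le1// lerDl sqr_ge0.
Qed.

Lemma damp_sqr t : damp t * damp t = damp2 t * t.
Proof. rewrite damp2E /damp; move: (_^-1) => x; ring. Qed.

Lemma damp_eq0 t : damp t = 0 -> t = 0.
Proof.
move/eqP; rewrite /damp mulf_eq0 invr_eq0 => /orP[/eqP//|/eqP h].
by have := damp_pos t; rewrite h ltxx.
Qed.

Lemma cont_pos1 : continuous (fun t => 1 + t ^+ 2).
Proof. by move=> t; apply: cvgD; [exact: cvg_cst|exact: exprn_continuous]. Qed.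

Lemma continuous_damp : continuous damp.
Proof.
move=> t; apply: cvgM; first exact: cvg_id.
by apply: cvgV; [rewrite gt_eqF// damp_pos|exact: cont_pos1].
Qed.

Lemma continuous_damp2 : continuous damp2.
Proof.
rewrite (_ : damp2 = (fun t => damp t * (1 + t ^+ 2)^-1)); last exact/funext/damp2E.
move=> t; apply: cvgM; first exact: continuous_damp.
by apply: cvgV; [rewrite gt_eqF// damp_pos|exact: cont_pos1].
Qed.

End damp.

Section mul_limit.
Context d (T : measurableType d) (R : realType) (mu : {measure set T -> \bar R}).
Context (D : set T) (mD : measurable D) (fD : (mu D < +oo)%E).
Local Notation sqi := (sqi mu D).
Local Notation ip := (ip mu D).
Local Notation nr := (nr mu D).
Context (I : Type) (F : set_system I) {FF : ProperFilter F}.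

(** The product [f * g] is only known to be integrable, so [f * g - G] cannot be tested against
    itself; it is tested against its image by [damp2], which may be moved onto the factor [u i]
    before taking limits. *)
Lemma mul_lim (u v : I -> T -> R) (f g G : T -> R) : sqi f -> sqi g -> sqi G ->
  (\forall i \near F, sqi (u i)) -> (\forall i \near F, sqi (v i)) ->
  (\forall i \near F, sqi (u i * v i)) ->
  nr (u i - f) @[i --> F] --> (0 : R) -> nr (v i - g) @[i --> F] --> (0 : R) ->
  nr (u i * v i - G) @[i --> F] --> (0 : R) ->
  sqi (f * g) /\ nr (f * g - G) = 0.
Proof.
move=> sf sg sG su sv suv cu cv cuv.
pose dl : T -> R := f * g - G.
have mfg : measurable_fun D (f * g) by apply: measurable_funM; [exact: sf.1|exact: sg.1].
have mdl : measurable_fun D dl by apply: measurable_funB => //; exact: sG.1.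
pose m := damp2 \o dl; pose h := damp \o dl.
have mm : measurable_fun D m.
  apply: measurableT_comp => //; apply: continuous_measurable_fun; exact: continuous_damp2.
have mh : measurable_fun D h.
  apply: measurableT_comp => //; apply: continuous_measurable_fun; exact: continuous_damp.
have m1 x : D x -> `|m x| <= 1 by move=> _; exact: damp2_le1.
have bs (k : T -> R) : measurable_fun D k -> (forall x, D x -> `|k x| <= 1) -> sqi k.
  move=> mk k1; apply: (sqi_dom mD mk (sqi_cst mD 1 fD)) => x Dx.
  by rewrite normr1; exact: k1.
have sm : sqi m by exact: bs.
have sh : sqi h by apply: bs => // x _; exact: damp_le1.
have C1 : ip (u i * v i) m @[i --> F] --> ip G m.
  apply: (ip_cvg mD (v := fun=> m)) => //; first exact: nearW.
  by under eq_fun do rewrite subrr nr0; exact: cvg_cst.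
have C2 : ip (m * u i) (v i) @[i --> F] --> ip (m * f) g.
  apply: (ip_cvg mD) => //; first exact: (sqiM mD mm m1).
    by apply: filterS su => i; exact: (sqiM mD mm m1).
  apply: cvg0_squeeze cu; apply: filterS su => i si; rewrite nr_ge0/=.
  rewrite (_ : m * u i - m * f = m * (u i - f)); last by rewrite mulrBr.
  by rewrite -[leRHS]mul1r; apply: (nrM mD mm) => //; exact: sqiB.
have E i : ip (u i * v i) m = ip (m * u i) (v i).
  by rewrite !ipE; apply: eq_Rintegral => x _; rewrite !fctE; ring.
have eq0 : ip (m * f) g = ip G m.
  have C3 : ip (u i * v i) m @[i --> F] --> ip (m * f) g by under eq_fun do rewrite E.
  apply/eqP; rewrite eq_le.
  rewrite (cvg_le_lim C3 C1)/= ?(cvg_le_lim C1 C3)//; exact: nearW.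
have h0 : nr h = 0.
  apply/eqP; rewrite -sqrf_eq0 sqr_nr; apply/eqP.
  rewrite -[RHS](subrr (ip G m)) -{1}eq0 !ipE -RintegralB//.
  - apply: eq_Rintegral => x _; transitivity (m x * dl x); first exact: damp_sqr.
    rewrite -[dl x]/(f x * g x - G x) -[(m * f) x]/(m x * f x).
    by move: (m x) (f x) (g x) (G x) => *; ring.
  - apply: sqi_int => //; exact: (sqiM mD mm m1).
  - exact: sqi_int.
have ae : {ae mu, forall x, D x -> (f * g) x = G x}.
  have := nr_eq0 mD sh h0; apply: filterS => x hx Dx.
  by apply/eqP; rewrite -subr_eq0; apply/eqP; exact: (damp_eq0 (hx Dx)).
split.
  apply: (sqi_ae mD mfg _ sG); apply: filterS ae => x hx Dx.
  by rewrite hx.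
apply: nr_ae => //; apply: filterS ae => x hx Dx.
by rewrite !fctE -[f x * g x]/((f * g) x) hx// subrr.
Qed.

End mul_limit.

Lemma allN (P : nat -> Prop) : (forall k, P k) -> \forall k \near \oo, P k.
Proof. exact: nearW. Qed.

Lemma nr_cvgn d (T : measurableType d) (R : realType) (mu : {measure set T -> \bar R})
    (D : set T) (mD : measurable D) (u : nat -> T -> R) f :
  sqi mu D f -> (forall k, sqi mu D (u k)) ->
  nr mu D (u k - f) @[k --> \oo] --> (0 : R) -> nr mu D (u k) @[k --> \oo] --> nr mu D f.
Proof. by move=> sf su; apply: nr_cvg => //; exact: allN. Qed.

Section arith.
Context {R : realType}.
Implicit Types x p q r s t f g M e : R.

Lemma small_product x p q r s M e : 0 <= x -> 0 < e -> 1 <= M ->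
  x ^+ 2 <= 4 * ((p * q) * (r * s)) -> 0 <= p <= M -> 0 <= q <= M ->
  0 <= r <= e ^+ 2 / (16 * M ^+ 3) -> 0 <= s <= 2 * M -> x <= e.
Proof.
move=> x0 e0 M1 xle /andP[p0 pM] /andP[q0 qM] /andP[r0 rM] /andP[s0 sM].
rewrite -ler_sqr ?nnegrE ?(ltW e0)//; apply: (le_trans xle).
have M0 : 0 < M by lra.
have H : (p * q) * (r * s) <= (M * M) * (e ^+ 2 / (16 * M ^+ 3) * (2 * M)).
  by rewrite !ler_pM// ?mulr_ge0.
have E : (M * M) * (e ^+ 2 / (16 * M ^+ 3) * (2 * M)) = e ^+ 2 / 8 by field; rewrite gt_eqF.
by move: H; rewrite E; move: (p * q * (r * s)) => z H; have := sqr_ge0 e; lra.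
Qed.

Lemma bound_sum1 x f g s t : 0 <= f -> 0 <= g -> 0 <= t -> x <= s -> x + 1 <= 1 + f + g + s + t.
Proof. by move=> *; lra. Qed.

Lemma bound_sum2 x f g s t : 0 <= f -> 0 <= g -> 0 <= s -> x <= t -> x + 1 <= 1 + f + g + s + t.
Proof. by move=> *; lra. Qed.

End arith.

Section H10.
Context {R : realType}.
Local Notation plane := (R * R)%type.
Local Notation mplane := (measurableTypeR R * measurableTypeR R)%type.
Context (w : set plane) (ow : open w) (bw : bounded_set w).
Local Notation sqi := (sqi (@leb2 R) w).
Local Notation ip := (ip (@leb2 R) w).
Local Notation nr := (nr (@leb2 R) w).
Local Notation D := (wd w).
Implicit Types (f g : plane -> R) (a b : 'I_2).
Let mw : measurable (w : set mplane) := mw ow.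
Let fw := fw ow bw.

Lemma test_lady_cd f g : test_function w f -> test_function w g ->
  nr (f * g) ^+ 2 <= 4 * ((nr f * nr (cd 0 f)) * (nr g * nr (cd 1 g))).
Proof. by move=> tf tg; rewrite !cdE; exact: test_ladyzhenskaya. Qed.

Lemma test_cd_sqi f a : test_function w f -> sqi (cd a f).
Proof. by move=> tf; apply: test_sqi => //; exact: test_cd. Qed.

Lemma cd_sub f g a : test_function w f -> test_function w g ->
  nr (cd a (f - g)) = nr (cd a f - cd a g).
Proof.
move=> tf tg; have tfg := testB tf tg.
have Hf := test_H1 ow bw tf; have Hg := test_H1 ow bw tg.
rewrite -(nr_eq mw (H1_sqiD ow a (test_H1 ow bw tfg)) (test_cd_sqi a tfg) (test_D ow bw a tfg)).
rewrite nrD_sub//; apply: nr_congr2 => //; do ?exact: H1_sqiD; do ?exact: test_cd_sqi; exact: test_D.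
Qed.

Lemma cvg_bounded (I : Type) (F : set_system I) (FF : ProperFilter F) (x : I -> R) l :
  x i @[i --> F] --> l -> \forall i \near F, x i <= l + 1.
Proof.
move=> /cvgrPdist_le /(_ 1 ltr01); apply: filterS => i; rewrite ler_norml => /andP[+ _]; lra.
Qed.

(** Products of approximating test functions form a Cauchy sequence by Ladyzhenskaya's inequality,
    and [mul_lim] identifies their limit with [f * g]. The inequality then passes to the limit. *)
Lemma H10_mul f g : H10 w f -> H10 w g -> sqi (f * g) /\
  nr (f * g) ^+ 2 <= 4 * ((nr f * nr (D 0 f)) * (nr g * nr (D 1 g))).
Proof.
move=> Hf Hg.
have [phi [tp cp dp]] := H10_approx ow bw Hf; have [psi [tq cq dq]] := H10_approx ow bw Hg.
have sf := H1_sqi ow (H10_H1 Hf); have sg := H1_sqi ow (H10_H1 Hg).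
have sDf a := H1_sqiD ow a (H10_H1 Hf); have sDg a := H1_sqiD ow a (H10_H1 Hg).
have sp k := test_sqi ow bw (tp k); have sq k := test_sqi ow bw (tq k).
have sdp a k := test_cd_sqi a (tp k); have sdq a k := test_cd_sqi a (tq k).
have N1 := nr_cvgn mw sf sp cp; have N2 := nr_cvgn mw sg sq cq.
have N3 a := nr_cvgn mw (sDf a) (sdp a) (dp a).
have N4 a := nr_cvgn mw (sDg a) (sdq a) (dq a).
have spq k l : sqi (phi k * psi l) by apply: sqi_testM.
pose M := 1 + nr f + nr g + \sum_a nr (D a f) + \sum_a nr (D a g).
have [S1 S2] : 0 <= \sum_a nr (D a f) /\ 0 <= \sum_a nr (D a g).
  by split; apply: sumr_ge0 => a _; exact: nr_ge0.
have le1 a := sum2_ge (x := fun a => nr (D a f)) a (fun _ => nr_ge0 _ _ _).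
have le2 a := sum2_ge (x := fun a => nr (D a g)) a (fun _ => nr_ge0 _ _ _).
have [Mf Mg] : nr f + 1 <= M /\ nr g + 1 <= M.
  rewrite /M; have := nr_ge0 leb2 w f; have := nr_ge0 leb2 w g.
  by move: S1 S2; move: (nr f) (nr g) (\sum_a _) (\sum_a _) => *; split; lra.
have [Mf' Mg'] : (forall a, nr (D a f) + 1 <= M) /\ (forall a, nr (D a g) + 1 <= M).
  by split=> a; [exact: (bound_sum1 (nr_ge0 _ _ _) (nr_ge0 _ _ _))|
    exact: (bound_sum2 (nr_ge0 _ _ _) (nr_ge0 _ _ _))].
have M1 : 1 <= M by move: Mf; have := nr_ge0 leb2 w f; move: (nr f) => *; lra.
have M0 : 0 < M by lra.
have B1 : \forall k \near \oo, nr (phi k) <= M by apply: filterS (cvg_bounded _ N1) => k /le_trans; exact.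
have B2 : \forall k \near \oo, nr (psi k) <= M by apply: filterS (cvg_bounded _ N2) => k /le_trans; exact.
have B3 a : \forall k \near \oo, nr (cd a (phi k)) <= M.
  by apply: filterS (cvg_bounded _ (N3 a)) => k /le_trans; exact.
have B4 a : \forall k \near \oo, nr (cd a (psi k)) <= M.
  by apply: filterS (cvg_bounded _ (N4 a)) => k /le_trans; exact.
have sub2 k l a : nr (cd a (phi k) - cd a (phi l)) <= nr (cd a (phi k)) + nr (cd a (phi l)) by exact: nrB.
have sub3 k l a : nr (cd a (psi k) - cd a (psi l)) <= nr (cd a (psi k)) + nr (cd a (psi l)) by exact: nrB.
have [G sG cG] : exists2 G, sqi G & nr (phi k * psi k - G) @[k --> \oo] --> (0 : R).
  apply: (sqi_complete mw fw); first by apply: nearW => k; exact: spq.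
  (* The threshold of [small_product] for an error [e / 2], each of the two terms of the difference
     of products receiving half of [e]. *)
  move=> e e0; pose dl := (e / 2) ^+ 2 / (16 * M ^+ 3).
  have d0 : 0 < dl by rewrite !(divr_gt0, exprn_gt0, mulr_gt0).
  have d20 : 0 < dl / 2 by rewrite divr_gt0.
  move/cvgrPdist_le : cp => /(_ _ d20) cp; move/cvgrPdist_le : cq => /(_ _ d20) cq.
  exists [set k | [/\ nr (phi k - f) <= dl / 2, nr (psi k - g) <= dl / 2,
     nr (phi k) <= M /\ nr (psi k) <= M, forall a, nr (cd a (phi k)) <= M & forall a, nr (cd a (psi k)) <= M]].
    near=> k; split.
    - by near: k; apply: filterS cp => k; rewrite sub0r normrN ger0_norm ?nr_ge0.
    - by near: k; apply: filterS cq => k; rewrite sub0r normrN ger0_norm ?nr_ge0.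
    - by split; near: k.
    - by apply: ord2P; near: k; exact: B3.
    - by apply: ord2P; near: k; exact: B4.
  move=> k l [k1 k2 [k3 k4] k5 k6] [l1 l2 [l3 l4] l5 l6].
  have -> : phi k * psi k - phi l * psi l = phi k * (psi k - psi l) + (phi k - phi l) * psi l by ring.
  have skl : sqi (phi k * (psi k - psi l)) by apply: sqi_testM => //; exact: sqiB.
  have slk : sqi ((phi k - phi l) * psi l) by apply: sqi_testM => //; exact: testB.
  apply: (le_trans (nrD mw skl slk)); rewrite [leRHS]splitr; apply: lerD.
    have dd : nr (psi k - psi l) <= dl.
      apply: (le_trans (nr_tri mw (sq k) sg (sq l))); rewrite [leRHS]splitr; apply: lerD; [exact: k2|rewrite nrBC; exact: l2].
    apply: (small_product (nr_ge0 _ _ _) _ M1 (test_lady_cd (tp k) (testB (tq k) (tq l)))).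
    - by rewrite divr_gt0.
    - by rewrite nr_ge0.
    - by rewrite nr_ge0/=; exact: k5.
    - by rewrite nr_ge0.
    - rewrite nr_ge0/= cd_sub//; apply: (le_trans (sub3 _ _ _)).
      by move: (k6 1) (l6 1); move: (nr _) (nr _) => *; lra.
  have dd : nr (phi k - phi l) <= dl.
    apply: (le_trans (nr_tri mw (sp k) sf (sp l))); rewrite [leRHS]splitr; apply: lerD; [exact: k1|rewrite nrBC; exact: l1].
  have := test_lady_cd (testB (tp k) (tp l)) (tq l).
  (* The small difference is now the first factor, while [small_product] expects it in the third
     place; exchanging the two functions would change the directions of derivation. *)
  rewrite (_ : forall p q r s, (p * q) * (r * s) = (r * s) * (p * q) :> R); last by move=> *; ring.
  move=> H; apply: (small_product (nr_ge0 _ _ _) _ M1 H).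
  - by rewrite divr_gt0.
  - by rewrite nr_ge0.
  - by rewrite nr_ge0/=; exact: l6.
  - by rewrite nr_ge0.
  - rewrite nr_ge0/= cd_sub//; apply: (le_trans (sub2 _ _ _)).
    by move: (k5 0) (l5 0); move: (nr _) (nr _) => *; lra.
have [sfg eG] := mul_lim mw fw sf sg sG (allN sp) (allN sq) (allN (fun k => spq k k)) cp cq cG.
split => //.
rewrite (nr_eq mw sfg sG eG).
have L1 : nr (phi k * psi k) ^+ 2 @[k --> \oo] --> nr G ^+ 2.
  have := nr_cvgn mw sG (fun k => spq k k) cG => C.
  by rewrite !expr2; apply: cvgM.
have L2 : 4 * ((nr (phi k) * nr (cd 0 (phi k))) * (nr (psi k) * nr (cd 1 (psi k)))) @[k --> \oo] -->
   4 * ((nr f * nr (D 0 f)) * (nr g * nr (D 1 g))).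
  apply: cvgM; first exact: cvg_cst.
  by apply: cvgM; apply: cvgM; [exact: N1|exact: N3|exact: N2|exact: N4].
apply: (cvg_le_lim L1 L2); apply: nearW => k; exact: test_lady_cd.
Unshelve. all: by end_near.
Qed.

Lemma H10_sub f g : H10 w f -> H10 w g -> H10 w (f - g).
Proof. by move=> Hf Hg; rewrite addrC -scaleN1r; exact: H10_lin. Qed.

Lemma H10_poincare : exists2 C, 0 < C & forall f, H10 w f -> nr f <= C * nr (D 0 f).
Proof.
have [C C0 HC] := test_poincare ow bw; exists C => // f Hf.
have [phi [tp cp dp]] := H10_approx ow bw Hf.
have sf := H1_sqi ow (H10_H1 Hf); have sDf a := H1_sqiD ow a (H10_H1 Hf).
have sp k := test_sqi ow bw (tp k); have sdp a k := test_cd_sqi a (tp k).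
have C2 : C * nr (cd 0 (phi k)) @[k --> \oo] --> C * nr (D 0 f).
  by apply: cvgM; [exact: cvg_cst|exact: (nr_cvgn mw (sDf 0) (sdp 0) (dp 0))].
apply: (cvg_le_lim (nr_cvgn mw sf sp cp) C2).
by apply: nearW => k; rewrite cdE; exact: HC.
Qed.

Lemma H10_ip0 f a : H10 w f -> ip (D a f) (cst 1) = 0.
Proof.
move=> Hf; have [phi [tp cp dp]] := H10_approx ow bw Hf.
have sDf a := H1_sqiD ow a (H10_H1 Hf).
have sp k := test_sqi ow bw (tp k); have sdp a k := test_cd_sqi a (tp k).
have s1 := sqi_cst mw 1 fw.
have C1 : ip (cd a (phi k)) (cst 1) @[k --> \oo] --> ip (D a f) (cst 1).
  apply: (ip_cvg mw (v := fun=> cst 1)) => //; [exact: nearW|exact: nearW|].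
  by under eq_fun do rewrite subrr nr0; exact: cvg_cst.
have E k : ip (cd a (phi k)) (cst 1) = 0 by rewrite cdE; exact: test_ip0.
have C2 : ip (cd a (phi k)) (cst 1) @[k --> \oo] --> (0 : R).
  by under eq_fun do rewrite E; exact: cvg_cst.
by apply/eqP; rewrite eq_le; rewrite (cvg_le_lim C1 C2)/= ?(cvg_le_lim C2 C1)//; exact: nearW.
Qed.

(** Both sides are minus the pairing of [f] with a mixed second derivative of [g]. Classical
    derivatives of test functions are weak ones, so these agree in L^2 by [weak_comm]. *)
Lemma test_swap f g : test_function w f -> test_function w g ->
  ip (cd 0 f) (cd 1 g) = ip (cd 1 f) (cd 0 g).
Proof.
move=> tf tg; have t0 := test_cd 0 tg; have t1 := test_cd 1 tg.
have H1 : ip (cd 0 f) (cd 1 g) = - ip f (cd 0 (cd 1 g)).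
  by rewrite !(cdE 0) test_parts ?opprK.
have H2 : ip (cd 1 f) (cd 0 g) = - ip f (cd 1 (cd 0 g)).
  by rewrite !(cdE 1) test_parts ?opprK.
rewrite H1 H2; congr (- _); apply/eqP; rewrite -subr_eq0 -ipBr//; try exact: test_sqi.
- have W a h : test_function w h -> is_weak_partial w a h (cd a h) by move=> th; rewrite cdE; exact: weak_test.
  rewrite ipC ip_nr0l//.
  - by apply: sqiB => //; exact: test_cd_sqi.
  - exact: test_sqi.
  - exact: (weak_comm ow bw (W _ _ tg) (W _ _ t1) (W _ _ tg) (W _ _ t0)).
- exact: test_cd_sqi.
- exact: test_cd_sqi.
Qed.

Lemma H10_swap f g : H10 w f -> H10 w g -> ip (D 0 f) (D 1 g) = ip (D 1 f) (D 0 g).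
Proof.
move=> Hf Hg.
have [phi [tp cp dp]] := H10_approx ow bw Hf; have [psi [tq cq dq]] := H10_approx ow bw Hg.
have sDf a := H1_sqiD ow a (H10_H1 Hf); have sDg a := H1_sqiD ow a (H10_H1 Hg).
have sdp a k := test_cd_sqi a (tp k); have sdq a k := test_cd_sqi a (tq k).
have C a b : ip (cd a (phi k)) (cd b (psi k)) @[k --> \oo] --> ip (D a f) (D b g).
  by apply: (ip_cvg mw); do ?[exact: nearW]; [exact: sDf|exact: sDg|exact: dp|exact: dq].
have C1 : ip (cd 0 (phi k)) (cd 1 (psi k)) @[k --> \oo] --> ip (D 1 f) (D 0 g).
  by under eq_fun do rewrite test_swap//; exact: C.
apply/eqP; rewrite eq_le.
by rewrite (cvg_le_lim (C 0 1) C1)/= ?(cvg_le_lim C1 (C 0 1))//; exact: nearW.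
Qed.

(** Expand the square of [D 0 g + D 1 f]: by [H10_swap] the cross term is the pairing of [D 1 g] and
    [D 0 f], bounded below by minus half the sum of their squared norms. *)
Lemma H10_korn f g : H10 w f -> H10 w g ->
  nr (D 0 g) ^+ 2 + nr (D 1 f) ^+ 2 <=
  nr (D 0 g + D 1 f) ^+ 2 + nr (D 0 f) ^+ 2 + nr (D 1 g) ^+ 2.
Proof.
move=> Hf Hg; have sDf a := H1_sqiD ow a (H10_H1 Hf); have sDg a := H1_sqiD ow a (H10_H1 Hg).
rewrite sqr_nrD// (H10_swap Hg Hf).
have := sqr_ge0 (nr (D 1 g + D 0 f)); rewrite sqr_nrD//.
by move: (nr _) (nr _) (nr _) (nr _) (ip _ _) => *; lra.
Qed.

Lemma gcell_sqi r n (ij : 'I_n * 'I_n) : sqi (\1_(gcell r ij) : plane -> R).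
Proof. by apply: indic_sqi => //; exact: measurable_cell. Qed.

Lemma H10_grid : exists2 r : R, 0 < r & forall n f, (0 < n)%N -> H10 w f ->
  nr f ^+ 2 <= (2 * r / n%:R) ^+ 2 * (nr (D 0 f) ^+ 2 + nr (D 1 f) ^+ 2) +
    (2 * r / n%:R) ^- 2 * \sum_(ij : 'I_n * 'I_n) ip f (\1_(gcell r ij)) ^+ 2.
Proof.
have [r r0 H] := test_grid ow bw; exists r => // n f n0 Hf.
have [phi [tp cp dp]] := H10_approx ow bw Hf.
have sf := H1_sqi ow (H10_H1 Hf); have sDf a := H1_sqiD ow a (H10_H1 Hf).
have sp k := test_sqi ow bw (tp k); have sdp a k := test_cd_sqi a (tp k).
have sqc (x : nat -> R) (l : R) : x k @[k --> \oo] --> l -> x k ^+ 2 @[k --> \oo] --> l ^+ 2.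
  by move=> c; rewrite expr2; exact: cvgM.
have C0 := sqc _ _ (nr_cvgn mw sf sp cp).
have C1 a := sqc _ _ (nr_cvgn mw (sDf a) (sdp a) (dp a)).
have C2 (ij : 'I_n * 'I_n) : ip (phi k) (\1_(gcell r ij) : plane -> R) ^+ 2 @[k --> \oo] --> ip f (\1_(gcell r ij)) ^+ 2.
  apply: sqc; apply: (ip_cvg mw (v := fun=> (\1_(gcell r ij) : plane -> R))) => //; do ?[exact: nearW].
  - exact: gcell_sqi.
  - by apply: nearW => k; exact: gcell_sqi.
  - by under eq_fun do rewrite subrr nr0; exact: cvg_cst.
have C3 : \sum_(ij : 'I_n * 'I_n) ip (phi k) (\1_(gcell r ij) : plane -> R) ^+ 2 @[k --> \oo] -->
    \sum_(ij : 'I_n * 'I_n) ip f (\1_(gcell r ij) : plane -> R) ^+ 2.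
  by apply: cvg_big => [|ij _]; [exact: add_continuous|exact: C2].
have C4 : (2 * r / n%:R) ^+ 2 * (nr (cd 0 (phi k)) ^+ 2 + nr (cd 1 (phi k)) ^+ 2) +
    (2 * r / n%:R) ^- 2 * \sum_(ij : 'I_n * 'I_n) ip (phi k) (\1_(gcell r ij) : plane -> R) ^+ 2 @[k --> \oo] -->
    (2 * r / n%:R) ^+ 2 * (nr (D 0 f) ^+ 2 + nr (D 1 f) ^+ 2) +
    (2 * r / n%:R) ^- 2 * \sum_(ij : 'I_n * 'I_n) ip f (\1_(gcell r ij)) ^+ 2.
  apply: cvgD; apply: cvgM => //; try exact: cvg_cst.
  by apply: cvgD; exact: C1.
refine (cvg_le_lim C0 C4 _).
by apply: nearW => k; rewrite !cdE; exact: H.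
Qed.

End H10.

(** * Compactness in V *)

(** Segments are compact, and a cluster point of an ultrafilter is a limit. This takes the place of
    the extraction of subsequences. *)
Lemma ultra_bounded {R : realType} (I : Type) (U : set_system I) (UU : UltraFilter U)
    (x : I -> R) M : (\forall i \near U, `|x i| <= M) ->
  exists2 l, `|l| <= M & x i @[i --> U] --> l.
Proof.
move=> xM; have PU : ProperFilter (x @ U) by exact: fmap_proper_filter.
have SU : (x @ U) `[- M, M]%classic.
  by apply: filterS xM => i; rewrite ler_norml => H /=; rewrite in_itv.
have [l [lM cl]] := @segment_compact R (- M) M (x @ U) PU SU.
exists l; first by move: lM => /=; rewrite in_itv/= -ler_norml.
move=> B Bl; have [//|nB] := @in_ultra_setVsetC _ U (x @^-1` B) _.
have [y [nBy By]] := cl (~` B) B nB Bl.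
by [].
Qed.

(** * Nested convex sets in a Hilbert space *)

Section hilbert.
Context d (T : measurableType d) (R : realType) (mu : {measure set T -> \bar R}).
Context (D : set T) (mD : measurable D).
Local Notation sqi := (sqi mu D).
Local Notation ip := (ip mu D).
Local Notation nr := (nr mu D).
Context (E : lmodType R) (J : finType) (c : J -> E -> T -> R) (W : E -> Prop).
Context (Wlin : forall k u v, W u -> W v -> W (k *: u + v)).
Context (csqi : forall j u, W u -> sqi (c j u)).
Context (clin : forall j k u v, W u -> W v -> nr (c j (k *: u + v) - (k *: c j u + c j v)) = 0).

(** A squared Hilbert norm made of finitely many L^2 components, linear only up to null functions.
    Unlike a sum of norms such as [Vnorm], it obeys the parallelogram identity. *)
Definition hn (u : E) : R := \sum_j nr (c j u) ^+ 2.

Lemma hn_ge0 u : 0 <= hn u. Proof. by apply: sumr_ge0 => j _; exact: sqr_ge0. Qed.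

Lemma nr_parallelogram p q : sqi p -> sqi q ->
  nr (2^-1 *: (p - q) + q) ^+ 2 = (nr p ^+ 2 + nr q ^+ 2) / 2 - nr (p - q) ^+ 2 / 4.
Proof.
move=> sp sq; have spq := sqiB mD sp sq.
rewrite (sqr_nrD mD (sqiZ mD 2^-1 spq) sq) (nrZ mD 2^-1 spq) (ipZl mD 2^-1 spq sq).
rewrite (ipBl mD sp sq sq) exprMn normfV ger0_norm// (sqr_nrB mD sp sq) (sqr_nr _ _ q).
by move: (nr p) (ip q q) (ip p q) => x y z; field.
Qed.

Lemma hn_parallelogram u v : W u -> W v ->
  hn (2^-1 *: (u - v) + v) = (hn u + hn v) / 2 - hn (u - v) / 4.
Proof.
move=> Wu Wv; have Wuv : W (u - v) by rewrite addrC -scaleN1r; exact: Wlin.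
rewrite /hn -big_split/= mulr_suml mulr_suml -sumrB; apply: eq_bigr => j _.
have su := csqi j Wu; have sv := csqi j Wv; have suv := csqi j Wuv.
have E1 : nr (c j (u - v) - (c j u - c j v)) = 0.
  by have := clin j (-1) Wv Wu; rewrite !scaleN1r (addrC (- v)) (addrC (- c j v)).
have s1 := sqiB mD su sv.
rewrite (nr_eq mD suv s1 E1) -nr_parallelogram//; congr (_ ^+ 2).
have sh (h : T -> R) : sqi h -> sqi (2^-1 *: h + c j v) by move=> ?; apply: sqiD => //; exact: (sqiZ mD).
have Wm : W (2^-1 *: (u - v) + v) by exact: Wlin.
have smm := csqi j Wm.
rewrite (nr_eq mD smm (sh _ suv) (clin j _ Wuv Wv)); apply: (nr_eq mD) => //; do ?exact: sh.
rewrite (_ : _ - _ = 2^-1 *: (c j (u - v) - (c j u - c j v))).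
  by rewrite nrZ// ?E1 ?mulr0//; exact: sqiB.
by rewrite opprD addrACA subrr addr0 -scalerBr.
Qed.

(* The argument for the uniform convexity of Hilbert spaces: take [v k] almost
   minimizing [hn] in [K k]. *)
Lemma nested_convex (K : nat -> E -> Prop) B :
  (forall k u, K k u -> W u) -> (forall k l u, (k <= l)%N -> K l u -> K k u) ->
  (forall k u v, K k u -> K k v -> K k (2^-1 *: (u - v) + v)) ->
  (forall k, exists2 u, K k u & hn u <= B) ->
  exists2 v : nat -> E, forall k, K k (v k) &
    forall e, 0 < e -> exists N, forall k l, (N <= k)%N -> (N <= l)%N -> hn (v k - v l) <= e.
Proof.
move=> KW Knest Kconv Kne.
pose S k := [set hn u | u in K k]; pose m k := inf (S k).
have lbS k : has_lbound (S k) by exists 0 => _ [u _ <-]; exact: hn_ge0.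
have infS k : has_inf (S k) by split=> //; have [u Ku _] := Kne k; exists (hn u), u.
have mle k u : K k u -> m k <= hn u by move=> Ku; apply: ge_inf => //; exists u.
have mhomo : {homo m : k l / (k <= l)%N >-> k <= l}.
  move=> k l kl; apply: lb_le_inf; first by have [u Ku _] := Kne l; exists (hn u), u.
  by move=> _ [u Ku <-]; apply: mle; exact: Knest Ku.
have mB : has_ubound (range m).
  by exists B => _ [k _ <-]; have [u Ku uB] := Kne k; exact: le_trans (mle _ _ Ku) uB.
have /choice[v Hv] : forall k : nat, exists u, K k u /\ hn u < m k + harmonic k.
  move=> k; have [_ [u Ku <-] lt] := inf_adherent (harmonic_gt0 (R := R) k) (infS k).
  by exists u.
exists v => [k|e e0]; first by have [] := Hv k.
have [N _ HN] : \forall k \near \oo, m k - limn m <= e / 4 /\ `|m k - limn m| <= e / 16 /\ harmonic k <= e / 16.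
  have e16 : 0 < e / 16 by rewrite divr_gt0.
  have /cvgrPdist_le/(_ _ e16) H1 := nondecreasing_is_cvgn mhomo mB.
  have /cvgrPdist_le/(_ _ e16) H2 := cvg_harmonic (R := R).
  near=> k; have h1 : `|limn m - m k| <= e / 16 by near: k.
  have h2 : `|0 - harmonic k| <= e / 16 by near: k.
  rewrite sub0r normrN ger0_norm ?harmonic_ge0// in h2; rewrite distrC in h1.
  split; last by split.
  by move: h1; rewrite ler_norml => /andP[_]; lra.
exists N.
have key k l : (N <= k)%N -> (k <= l)%N -> hn (v k - v l) <= e.
  move=> Nk kl; have [Kk hk] := Hv k; have [Kl hl] := Hv l.
  have Kl' := Knest _ _ _ kl Kl.
  (* The midpoint of [v k] and [v l] lies in [K k], so its [hn] is at least [m k]; the parallelogram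
     identity then leaves [hn (v k - v l)] at most [2 * (m l - m k)] plus twice the two excesses. *)
  have := mle _ _ (Kconv _ _ _ Kk Kl'); rewrite hn_parallelogram; [|exact: KW Kk|exact: KW Kl].
  have [_ [h1 h2]] := HN k Nk; have [_ [h3 h4]] := HN l (leq_trans Nk kl).
  move: h1 h3; rewrite !ler_norml => /andP[a1 a2] /andP[b1 b2].
  by move: hk hl h2 h4 a1 a2 b1 b2; move: (hn _) (hn _) (hn _) (m k) (m l) (limn m) (harmonic k) (harmonic l) => *; lra.
move=> k l Nk Nl; have [kl|lk] := leqP k l; first exact: key.
have -> : hn (v k - v l) = hn (v l - v k).
  rewrite -(opprB (v l)) /hn; apply: eq_bigr => j _; congr (_ ^+ 2).
  have Wl := KW _ _ (Hv l).1; have Wk := KW _ _ (Hv k).1.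
  have sub x y : W x -> W y -> W (x - y) by move=> Wx Wy; rewrite addrC -scaleN1r; exact: Wlin.
  have Elk := clin j (-1) Wk Wl; have Ekl := clin j (-1) Wl Wk.
  rewrite !scaleN1r !(addrC (- v _)) !(addrC (- c j _)) in Elk, Ekl.
  rewrite opprB; have sk := csqi j Wk; have sl := csqi j Wl.
  rewrite (nr_eq mD _ _ Elk) ?(nr_eq mD _ _ Ekl) 1?nrBC//; do ?exact: sqiB; apply: csqi; exact: sub.
by apply: key => //; exact: ltnW.
Unshelve. all: by end_near.
Qed.

End hilbert.

Lemma ord3P (P : 'I_3 -> Prop) : (forall a, P (lat a)) -> P i3 -> forall i, P i.
Proof.
move=> Pl P3 [[|[|[|//]]] ilt].
- by rewrite (_ : Ordinal ilt = lat 0); [exact: Pl|exact: val_inj].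
- by rewrite (_ : Ordinal ilt = lat 1); [exact: Pl|exact: val_inj].
- by rewrite (_ : Ordinal ilt = i3); [exact: P3|exact: val_inj].
Qed.

Lemma sum_cvg0 {R : realType} (J : finType) (I : Type) (F : set_system I) (FF : ProperFilter F)
    (x : J -> I -> R) : (forall j, x j i @[i --> F] --> (0 : R)) ->
  \sum_j x j i @[i --> F] --> (0 : R).
Proof.
move=> H; have K : \sum_j x j i @[i --> F] --> \sum_(j : J) (0 : R).
  by apply: cvg_big => [|j _]; [exact: add_continuous|exact: H].
by rewrite big1 in K.
Qed.

Section Vspace.
Context {R : realType}.
Local Notation plane := (R * R)%type.
Local Notation mplane := (measurableTypeR R * measurableTypeR R)%type.
Local Notation field := ('I_3 -> plane -> R).
Context (w : set plane) (ow : open w) (bw : bounded_set w).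
Local Notation sqi := (sqi (@leb2 R) w).
Local Notation ip := (ip (@leb2 R) w).
Local Notation nr := (nr (@leb2 R) w).
Local Notation D := (wd w).
Implicit Types (f g : plane -> R) (a b : 'I_2) (u v : field).
Let mw : measurable (w : set mplane) := mw ow.
Let fw := fw ow bw.

(* The indices of [u_i], [D_a u_i] and [D_b D_a u_3]. *)
Definition cindex := ('I_3 + 'I_3 * 'I_2 + 'I_2 * 'I_2)%type.

Definition comp (j : cindex) u : plane -> R :=
  match j with
  | inl (inl i) => u i
  | inl (inr (i, a)) => D a (u i)
  | inr (a, b) => D b (D a (u i3))
  end.

Lemma V_H10 u i : V w u -> H10 w (u i).
Proof. by move=> [H1 H2]; move: i; apply: ord3P => //; exact: H20_H10. Qed.
Lemma V_H20 u : V w u -> H20 w (u i3). Proof. by case. Qed.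
Lemma V_H1 u i : V w u -> H1 w (u i). Proof. by move=> Vu; apply: H10_H1; exact: V_H10. Qed.
Lemma V_H2 u : V w u -> H2 w (u i3). Proof. by move=> Vu; apply: H20_H2; exact: V_H20. Qed.

Lemma comp_sqi j u : V w u -> sqi (comp j u).
Proof.
move=> Vu; case: j => [[i|[i a]]|[a b]] /=.
- by apply: H1_sqi => //; exact: V_H1.
- by apply: H1_sqiD => //; exact: V_H1.
- by apply: H1_sqiD => //; apply: H2_D; exact: V_H2.
Qed.

Lemma V_lin k u v : V w u -> V w v -> V w (k *: u + v).
Proof.
move=> [u1 u2] [v1 v2]; split=> [a|]; last exact: (H20_lin ow bw k u2 v2).
exact: (H10_lin ow bw k (u1 a) (v1 a)).
Qed.

Lemma V_sub u v : V w u -> V w v -> V w (u - v).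
Proof. by move=> Vu Vv; rewrite addrC -scaleN1r; exact: V_lin. Qed.

Lemma comp_lin j k u v : V w u -> V w v ->
  nr (comp j (k *: u + v) - (k *: comp j u + comp j v)) = 0.
Proof.
move=> Vu Vv; case: j => [[i|[i a]]|[a b]] /=.
- by rewrite -[(k *: u + v) i]/(k *: u i + v i) subrr nr0.
- by apply: (D_lin ow bw k a (f := u i) (g := v i)); exact: V_H1.
- by apply: (DD_lin ow bw k a b (f := u i3) (g := v i3)); exact: V_H2.
Qed.

Lemma comp_sub j u v : V w u -> V w v -> nr (comp j (u - v)) = nr (comp j u - comp j v).
Proof.
move=> Vu Vv; have := comp_lin j (-1) Vv Vu; rewrite !scaleN1r (addrC (- v)) (addrC (- comp j v)).
by apply: (nr_eq mw); [exact/comp_sqi/V_sub|apply: sqiB => //; exact: comp_sqi].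
Qed.

Lemma comp_le_Vnorm j u : nr (comp j u) <= Vnorm w u.
Proof.
have p1 b : 0 <= H1norm w (u (lat b)) by exact: H1norm_ge0.
have p2 : 0 <= H2norm w (u i3) by exact: H2norm_ge0.
have l1 a x : x <= H1norm w (u (lat a)) -> x <= Vnorm w u.
  move=> h; apply: (le_trans h); rewrite /Vnorm.
  apply: (le_trans (sum2_ge (x := fun a => H1norm w (u (lat a))) a p1)).
  by rewrite lerDl.
have l2 x : x <= H2norm w (u i3) -> x <= Vnorm w u.
  by move=> h; apply: (le_trans h); rewrite lerDr sumr_ge0.
case: j => [[i|[i a]]|[a b]] /=.
- move: i; apply: ord3P => [a|]; first by apply: (l1 a); exact: nr_le_H1norm.
  by apply: l2; exact: nr_le_H2norm.
- move: i; apply: ord3P => [b|]; first by apply: (l1 b); exact: nrD_le_H1norm.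
  by apply: l2; exact: nrD_le_H2norm.
- by apply: l2; exact: nrDD_le_H2norm.
Qed.

Lemma Vnorm_le_comp u : Vnorm w u <= \sum_j nr (comp j u).
Proof.
rewrite /Vnorm big_sumType big_sumType.
have E3 (x : 'I_3 -> R) : \sum_i x i = \sum_a x (lat a) + x i3.
  rewrite big_ord_recr/=; congr (_ + _).
  by apply: eq_bigr => i _; congr (x _); exact: val_inj.
have P1 : \sum_(p : 'I_3 * 'I_2) nr (comp (inl (inr p)) u) = \sum_i \sum_a nr (D a (u i)).
  by rewrite pair_big; apply: eq_bigr => -[i a] _.
have P2 : \sum_(p : 'I_2 * 'I_2) nr (comp (inr p) u) = \sum_a \sum_b nr (D b (D a (u i3))).
  by rewrite pair_big; apply: eq_bigr => -[i a] _.
rewrite P1 P2 !E3.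
apply: (@le_trans _ _ (\sum_a (nr (u (lat a)) + \sum_b nr (D b (u (lat a)))) +
  (nr (u i3) + \sum_a nr (D a (u i3)) + \sum_a \sum_b nr (D b (D a (u i3)))))).
  apply: lerD; last exact: H2norm_le.
  by apply: ler_sum => a _; exact: H1norm_le.
rewrite big_split/=; move: (\sum_a _) (\sum_a _) (\sum_a _) (\sum_a _) (nr _) => *; lra.
Qed.

Lemma Vnorm_ge0 u : 0 <= Vnorm w u.
Proof. by apply: addr_ge0; [apply: sumr_ge0 => a _; exact: H1norm_ge0|exact: H2norm_ge0]. Qed.

Lemma comp_eq j u v : V w u -> V w v -> (forall i, nr (u i - v i) = 0) ->
  nr (comp j u - comp j v) = 0.
Proof.
move=> Vu Vv uv; have sv i : sqi (v i) by apply: H1_sqi => //; exact: V_H1.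
case: j => [[i|[i a]]|[a b]] //=.
- by apply: D_eq => //; exact: V_H1.
- by apply: DD_eq => //; exact: V_H2.
Qed.

Lemma Vnorm_eq0 u v : V w u -> V w v -> (forall i, nr (u i - v i) = 0) -> Vnorm w (u - v) = 0.
Proof.
move=> Vu Vv uv; apply/eqP; rewrite eq_le Vnorm_ge0 andbT.
apply: (le_trans (Vnorm_le_comp _)); rewrite big1// => j _.
by rewrite comp_sub//; exact: comp_eq.
Qed.

Lemma Vdual_dist L : Vdual w L -> exists2 C, 0 <= C & forall u v, V w u -> V w v ->
  `|L u - L v| <= C * Vnorm w (u - v).
Proof.
move=> [Llin [C HC]]; exists `|C|; first exact: normr_ge0.
move=> u v Vu Vv.
have -> : L u - L v = L (u - v).
  have := Llin (-1) v u Vv Vu; rewrite mulN1r addrC => <-; congr L.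
  by apply/funext => i; apply/funext => y; rewrite !fctE; ring.
apply: (le_trans (HC _ (V_sub Vu Vv))).
by rewrite ler_wpM2r ?Vnorm_ge0// ler_norm.
Qed.

Lemma V_closed (I : Type) (F : set_system I) (FF : ProperFilter F) (v : I -> field)
    (g : cindex -> plane -> R) : (\forall i \near F, V w (v i)) -> (forall j, sqi (g j)) ->
  (forall j, nr (comp j (v i) - g j) @[i --> F] --> (0 : R)) ->
  exists2 u, V w u & forall j, nr (comp j u - g j) = 0.
Proof.
move=> Vv sg Hg; pose u : field := fun i => g (inl (inl i)).
have H i : H10 w (u i) /\ forall a, nr (D a (u i) - g (inl (inr (i, a)))) = 0.
  apply: (H10_closed ow bw FF (u := fun k => v k i)) => //.
  - exact: sg.
  - by apply: filterS Vv => k; exact: V_H10.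
  - exact: (Hg (inl (inl i))).
  - by move=> a; exact: (Hg (inl (inr (i, a)))).
have [K1 K2 K3] : [/\ H20 w (u i3), forall a, nr (D a (u i3) - g (inl (inr (i3, a)))) = 0 &
    forall a b, nr (D b (D a (u i3)) - g (inr (a, b))) = 0].
  apply: (H20_closed ow bw FF (u := fun k => v k i3)) => //.
  - exact: sg.
  - by apply: filterS Vv => k; exact: V_H20.
  - exact: (Hg (inl (inl i3))).
  - by move=> a; exact: (Hg (inl (inr (i3, a)))).
  - by move=> a b; exact: (Hg (inr (a, b))).
exists u; first by split=> // a; have [] := H (lat a).
move=> [[i|[i a]]|[a b]] /=; first by rewrite subrr nr0.
- by have [_] := H i.
- exact: K3.
Qed.

Lemma Vnorm_cvg (I : Type) (F : set_system I) (FF : ProperFilter F) (v : I -> field) u :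
  (\forall i \near F, V w (v i)) -> V w u ->
  (forall j, nr (comp j (v i) - comp j u) @[i --> F] --> (0 : R)) ->
  Vnorm w (v i - u) @[i --> F] --> (0 : R).
Proof.
move=> Vv Vu H; apply: (cvg0_squeeze (b := fun i => \sum_j nr (comp j (v i) - comp j u))).
  apply: filterS Vv => i Vi; rewrite Vnorm_ge0/=.
  by apply: (le_trans (Vnorm_le_comp _)); apply: ler_sum => j _; rewrite comp_sub.
exact: sum_cvg0.
Qed.

(** Rellich's theorem. On a fine enough grid the gradient term of [H10_grid] is at most
    [e ^+ 2 / 2]; the other term involves finitely many bounded cell integrals, which converge along
    the ultrafilter. The family is therefore Cauchy. *)
Lemma H10_compact (I : Type) (U : set_system I) (UU : UltraFilter U) (g : I -> plane -> R) M :
  (\forall i \near U, H10 w (g i) /\ forall a, nr (D a (g i)) <= M) ->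
  exists2 f, sqi f & nr (g i - f) @[i --> U] --> (0 : R).
Proof.
move=> H; have [r r0 G] := H10_grid ow bw; have [C C0 P] := H10_poincare ow bw.
have PU : ProperFilter U by exact: ultra_proper.
have sg : \forall i \near U, sqi (g i).
  by apply: filterS H => i [/H10_H1 h _]; exact: H1_sqi.
apply: (sqi_complete mw fw PU sg) => e e0.
have M0 : 0 <= M by have [i [_ /(_ 0)]] := filter_ex H; apply: le_trans; exact: nr_ge0.
pose h n := 2 * r / n%:R.
have [n n0 hn] : exists2 n, (0 < n)%N & h n ^+ 2 * (8 * M ^+ 2) <= e ^+ 2 / 2.
  (* [8 * M ^+ 2] bounds the squared gradient of [g i - g j]: two directions, [(2 * M) ^+ 2] for
     each. The next integer [n] above [X] is enough, since [n ^+ 2 >= n]. *)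
  pose X := 8 * M ^+ 2 * (2 * r) ^+ 2 / (e ^+ 2 / 2).
  exists (Num.trunc X).+1 => //; rewrite /h exprMn exprVn.
  have e20 : 0 < e ^+ 2 / 2 by rewrite divr_gt0// exprn_gt0.
  set m := (Num.trunc X).+1%:R; have X0 : 0 <= X by rewrite !(divr_ge0, mulr_ge0)// ?sqr_ge0// ltW.
  have Xm : X <= m by have /andP[_ /ltW] := truncn_itv X0.
  have m1 : 1 <= m by rewrite ler1n.
  have mp : 0 < m ^+ 2 by rewrite exprn_gt0// (lt_le_trans ltr01).
  rewrite mulrAC ler_pdivrMr//.
  have Xm2 : X <= m ^+ 2 by apply: (le_trans Xm); rewrite expr2 ler_peMl// (le_trans ler01).
  by move: Xm2; rewrite /X ler_pdivrMr// [m ^+ 2 * _]mulrC [(2 * r) ^+ 2 * _]mulrC.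
have /choice[l Hl] : forall ij : 'I_n * 'I_n, exists l : R,
    ip (g i) (\1_(gcell r ij) : plane -> R) @[i --> U] --> l.
  move=> ij; have sI := gcell_sqi ow bw r ij.
  have [|l _ Hl] := @ultra_bounded R _ U _ (fun i => ip (g i) (\1_(gcell r ij) : plane -> R))
     (C * M * nr (\1_(gcell r ij) : plane -> R)); last by exists l.
  apply: filterS H => i [Hi Di]; have si : sqi (g i) by apply: H1_sqi => //; exact: H10_H1.
  apply: (le_trans (ip_le mw si sI)); apply: ler_wpM2r; first exact: nr_ge0.
  by apply: (le_trans (P _ Hi)); rewrite ler_wpM2l// ltW.
pose S i := \sum_(ij : 'I_n * 'I_n) (ip (g i) (\1_(gcell r ij) : plane -> R) - l ij) ^+ 2.
have S0 : S i @[i --> U] --> (0 : R).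
  apply: sum_cvg0 => ij.
  have K : ip (g i) (\1_(gcell r ij) : plane -> R) - l ij @[i --> U] --> (0 : R).
    by rewrite -(subrr (l ij)); apply: cvgB; [exact: Hl|exact: cvg_cst].
  by rewrite -(mulr0 (0 : R)); exact: (cvgM K K).
have hp : 0 < h n by rewrite divr_gt0 ?mulr_gt0// ltr0n.
have dl0 : 0 < h n ^+ 2 * (e ^+ 2 / 8) by rewrite mulr_gt0 ?exprn_gt0// divr_gt0// exprn_gt0.
move/cvgrPdist_le : S0 => /(_ _ dl0) S0.
exists [set i | [/\ H10 w (g i), forall a, nr (D a (g i)) <= M & S i <= h n ^+ 2 * (e ^+ 2 / 8)]].
  apply: filterS2 H S0 => i [h1 h2]; rewrite sub0r normrN ger0_norm; first by [].
  by apply: sumr_ge0 => ij _; exact: sqr_ge0.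
move=> i j [Hi Mi Si] [Hj Mj Sj].
have si : sqi (g i) by apply: H1_sqi => //; exact: H10_H1.
have sj : sqi (g j) by apply: H1_sqi => //; exact: H10_H1.
rewrite -ler_sqr ?nnegrE ?nr_ge0 ?(ltW e0)//.
apply: (le_trans (G n _ n0 (H10_sub ow bw Hi Hj))).
have Dle a : nr (D a (g i - g j)) ^+ 2 <= 4 * M ^+ 2.
  rewrite nrD_sub//; try exact: H10_H1.
  have H4 : nr (D a (g i) - D a (g j)) <= 2 * M.
    have sDi := H1_sqiD ow a (H10_H1 Hi); have sDj := H1_sqiD ow a (H10_H1 Hj).
    apply: (le_trans (nrB mw sDi sDj)); move: (Mi a) (Mj a); move: (nr _) (nr _) => *; lra.
  rewrite -[4 * _](_ : (2 * M) ^+ 2 = _); last by ring.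
  by rewrite ler_sqr ?nnegrE ?nr_ge0// mulr_ge0.
have Sle : \sum_(ij : 'I_n * 'I_n) ip (g i - g j) (\1_(gcell r ij) : plane -> R) ^+ 2 <= 2 * S i + 2 * S j.
  rewrite /S !big_distrr/= -big_split/=; apply: ler_sum => ij _.
  rewrite (ipBl mw si sj (gcell_sqi ow bw r ij)).
  move: (ip (g i) _) (ip (g j) _) (l ij) => x y z; have := sqr_ge0 (x - z + (y - z)); nra.
have E1 : (2 * r / n%:R) ^+ 2 * (nr (D 0 (g i - g j)) ^+ 2 + nr (D 1 (g i - g j)) ^+ 2) <= e ^+ 2 / 2.
  apply: (le_trans _ hn); apply: ler_wpM2l; first exact: sqr_ge0.
  by move: (Dle 0) (Dle 1); move: (nr _) (nr _) => *; lra.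
have E2 : (2 * r / n%:R) ^- 2 * \sum_(ij : 'I_n * 'I_n) ip (g i - g j) (\1_(gcell r ij)) ^+ 2 <= e ^+ 2 / 2.
  rewrite mulrC ler_pdivrMr ?exprn_gt0//; apply: (le_trans Sle).
  move: Si Sj; rewrite -/(h n); move: (S i) (S j) (h n ^+ 2) (e ^+ 2) => *; nra.
by rewrite [leRHS]splitr; exact: lerD.
Qed.

End Vspace.

Lemma half_sum_le {R : realType} (x y z e : R) : x <= e -> y <= e -> z <= 2^-1 * x + 2^-1 * y -> z <= e.
Proof. by move=> *; lra. Qed.

Lemma half_dist_le {R : realType} (x y c e : R) : `|x - c| <= e -> `|y - c| <= e ->
  `|2^-1 * (x - y) + y - c| <= e.
Proof. by rewrite !ler_norml => /andP[? ?] /andP[? ?]; lra. Qed.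

Lemma sqr_le_mono {R : realType} (x e : R) : 0 <= e -> x ^+ 2 <= e ^+ 2 -> x <= e.
Proof. by move=> e0 xe; have [x0|x0] := ltP x 0; [lra|rewrite -ler_sqr ?nnegrE]. Qed.

Section Vcompact.
Context {R : realType}.
Local Notation plane := (R * R)%type.
Local Notation mplane := (measurableTypeR R * measurableTypeR R)%type.
Local Notation field := ('I_3 -> plane -> R).
Context (w : set plane) (ow : open w) (bw : bounded_set w).
Local Notation sqi := (sqi (@leb2 R) w).
Local Notation ip := (ip (@leb2 R) w).
Local Notation nr := (nr (@leb2 R) w).
Local Notation D := (wd w).
Implicit Types (f g : plane -> R) (a b : 'I_2) (u v : field).
Let mw : measurable (w : set mplane) := mw ow.
Let fw := fw ow bw.

Lemma V_sqi i u : V w u -> sqi (u i).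
Proof. by move=> Vu; apply: H1_sqi => //; exact: V_H1. Qed.

Lemma V_sqiD a i u : V w u -> sqi (D a (u i)).
Proof. by move=> Vu; apply: H1_sqiD => //; exact: V_H1. Qed.

Lemma Vdual_lin (L : field -> R) k u v : Vdual w L -> V w u -> V w v ->
  L (k *: u + v) = k * L u + L v.
Proof. by move=> [H _]; exact: H. Qed.

Lemma Vdual_sub (L : field -> R) u v : Vdual w L -> V w u -> V w v -> L (u - v) = L u - L v.
Proof.
move=> HL Vu Vv; have := Vdual_lin (-1) HL Vv Vu.
by rewrite scaleN1r (addrC (- v)) mulN1r (addrC (- L v)).
Qed.

(* Banach-Alaoglu is avoided: the convex sets of the [v] that are 1/k-close to
   [s] in L^2 and whose image by [L] is 1/k-close to [lim L (u_ i)] are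
   nested, and contain bounded elements, namely some [u_ i]. *)
Lemma weak_limit (I : Type) (U : set_system I) (UU : UltraFilter U) (u_ : I -> field) M
    (s : 'I_3 -> plane -> R) (L : field -> R) :
  (\forall i \near U, V w (u_ i) /\ Vnorm w (u_ i) <= M) ->
  (forall i, sqi (s i)) -> (forall i, nr (u_ k i - s i) @[k --> U] --> (0 : R)) ->
  Vdual w L ->
  exists v, [/\ V w v, forall i, nr (v i - s i) = 0 & L (u_ k) @[k --> U] --> L v].
Proof.
move=> Hu ss us HL; have PU : ProperFilter U by exact: ultra_proper.
have [C C0 LC] := Vdual_dist ow bw HL.
have V0 : V w (0 : field).
  have [i [Vi _]] := filter_ex Hu; rewrite -(subrr (u_ i)); exact: V_sub.
have L0 : L 0 = 0 by have := Vdual_sub HL V0 V0; rewrite !subrr.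
have [c _ Lc] : exists2 c, `|c| <= C * M & L (u_ k) @[k --> U] --> c.
  apply: ultra_bounded; apply: filterS Hu => i [Vi Mi].
  rewrite -[L _]subr0 -L0; apply: (le_trans (LC _ _ Vi V0)).
  by rewrite subr0 ler_wpM2l.
pose K (k : nat) (v : field) := [/\ V w v, forall i, nr (v i - s i) <= harmonic k & `|L v - c| <= harmonic k].
pose B : R := \sum_(j : cindex) M ^+ 2.
have KV k v : K k v -> V w v by case.
have Knest k l v : (k <= l)%N -> K l v -> K k v.
  move=> kl [Vv h1 h2]; have hh : harmonic l <= harmonic k :> R.
    by rewrite /harmonic /= lef_pV2 ?posrE ?ltr0n// ler_nat.
  by split=> // [i|]; apply: le_trans hh => //; exact: h1.
have Kconv k u v : K k u -> K k v -> K k (2^-1 *: (u - v) + v).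
  move=> [Vu u1 u2] [Vv v1 v2]; have Vuv := V_sub ow bw Vu Vv.
  split; [exact: V_lin| |].
    move=> i; apply: (half_sum_le (u1 i) (v1 i)).
    have su : sqi (u i - s i) by apply: sqiB => //; exact: (V_sqi i Vu).
    have sv : sqi (v i - s i) by apply: sqiB => //; exact: (V_sqi i Vv).
    rewrite (_ : _ - s i = 2^-1 *: (u i - s i) + 2^-1 *: (v i - s i)); last first.
      apply/funext => y.
      rewrite -[LHS]/(2^-1 * (u i y - v i y) + v i y - s i y).
      rewrite -[RHS]/(2^-1 * (u i y - s i y) + 2^-1 * (v i y - s i y)).
      by move: (u i y) (v i y) (s i y) => *; field.
    apply: (le_trans (nrD mw (sqiZ mw 2^-1 su) (sqiZ mw 2^-1 sv))).
    by rewrite (nrZ mw 2^-1 su) (nrZ mw 2^-1 sv) ger0_norm.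
  by rewrite Vdual_lin// Vdual_sub//; exact: half_dist_le.
have Kne k : exists2 v, K k v & hn (@leb2 R) w (fun j : cindex => comp w j) v <= B.
  have hk : 0 < harmonic k :> R by exact: harmonic_gt0.
  have H1 : \forall i \near U, forall j, nr (u_ i j - s j) <= harmonic k.
    have F j : \forall i \near U, nr (u_ i j - s j) <= harmonic k.
      move/cvgrPdist_le : (us j) => /(_ _ hk); apply: filterS => i.
      by rewrite sub0r normrN ger0_norm ?nr_ge0.
    apply: filterS3 (F (lat 0)) (F (lat 1)) (F i3) => i f1 f2 f3.
    by apply: ord3P => //; exact: ord2P.
  move/cvgrPdist_le : Lc => /(_ _ hk) H2.
  have [i [[Vi Mi] [h1 h2]]] := filter_ex (filterI Hu (filterI H1 H2)).
  exists (u_ i); first by split=> //; rewrite distrC.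
  apply: ler_sum => j _; rewrite ler_sqr ?nnegrE ?nr_ge0 ?(le_trans (Vnorm_ge0 w (u_ i)) Mi)//.
  exact: le_trans (comp_le_Vnorm _ _ _) Mi.
have [v Kv Cv] := nested_convex mw (c := fun j : cindex => comp w j) (fun k u v => @V_lin R w ow bw k u v)
  (fun j u => @comp_sqi R w ow bw j u) (fun j k u v => @comp_lin R w ow bw j k u v) KV Knest Kconv Kne.
have Vv k := KV _ _ (Kv k).
have /choice[g Hg] : forall j : cindex, exists g, sqi g /\ nr (comp w j (v k) - g) @[k --> \oo] --> (0 : R).
  move=> j; have [||g sg cg] := @sqi_complete _ _ _ _ _ mw fw nat \oo _ (fun k => comp w j (v k)).
  - apply: nearW => k; exact: (comp_sqi ow bw j (Vv k)).
  - move=> e e0; have e20 : 0 < e ^+ 2 by rewrite exprn_gt0.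
    have [N HN] := Cv _ e20; exists [set k | (N <= k)%N]; first by exists N.
    move=> k l Nk Nl; rewrite -(comp_sub ow bw j (Vv k) (Vv l)).
    apply: (sqr_le_mono (ltW e0)); apply: le_trans (HN _ _ Nk Nl).
    rewrite /hn (bigD1 j) // lerDl.
    by apply: sumr_ge0 => i _; exact: sqr_ge0.
  - by exists g.
have [v0 V0' gv] := V_closed ow bw eventually_filter (allN Vv) (fun j => (Hg j).1) (fun j => (Hg j).2).
have cv j : nr (comp w j (v k) - comp w j v0) @[k --> \oo] --> (0 : R).
  have [sg cg] := Hg j.
  apply: (nr_cvg_eq mw sg (comp_sqi ow bw j V0') _ _ cg); last by rewrite nrBC.
  apply: nearW => k; exact: (comp_sqi ow bw j (Vv k)).
have Nv := Vnorm_cvg ow bw eventually_filter (allN Vv) V0' cv.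
exists v0; split=> //.
  move=> i; apply/eqP; rewrite eq_le nr_ge0 andbT.
  have c1 : nr (v k i - v0 i) + harmonic k @[k --> \oo] --> (0 : R).
    by apply: cvgD0; [exact: (cv (inl (inl i)))|exact: cvg_harmonic].
  apply: (cvg_le_lim (cvg_cst (nr (v0 i - s i))) c1); apply: nearW => k.
  have [_ /(_ i) h _] := Kv k.
  have sv0 : sqi (v0 i) := V_sqi i V0'.
  have svk : sqi (v k i) := V_sqi i (Vv k).
  apply: (le_trans (nr_tri mw sv0 svk (ss i))).
  by rewrite nrBC lerD2l.
rewrite (_ : L v0 = c)//.
apply/eqP; rewrite -subr_eq0 -normr_le0.
have c1 : C * Vnorm w (v k - v0) + harmonic k @[k --> \oo] --> (0 : R).
  apply: cvgD0; last exact: cvg_harmonic.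
  by rewrite -(mulr0 C); apply: cvgM => //; exact: cvg_cst.
apply: (cvg_le_lim (cvg_cst `|L v0 - c|) c1); apply: nearW => k.
have [_ _ h] := Kv k.
rewrite (_ : L v0 - c = (L v0 - L (v k)) + (L (v k) - c)); last by rewrite addrA subrK.
apply: (le_trans (ler_normD _ _)); apply: lerD => //.
rewrite (distrC (L v0)); exact (LC _ _ (Vv k) V0').
Qed.

(** The limit given by [weak_limit] may depend on the form [L], but all these limits agree in L^2
    with [s]; the one obtained for the zero form therefore serves for every [L]. Rellich's theorem
    applied to [D a u_3], in H^1_0 as well, gives the strong convergence of the gradients. *)
Lemma V_compact (I : Type) (U : set_system I) (UU : UltraFilter U) (u_ : I -> field) M :
  (\forall i \near U, V w (u_ i) /\ Vnorm w (u_ i) <= M) ->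
  exists u, [/\ V w u, forall i, nr (u_ k i - u i) @[k --> U] --> (0 : R),
    forall a, nr (D a (u_ k i3) - D a (u i3)) @[k --> U] --> (0 : R) &
    forall L, Vdual w L -> L (u_ k) @[k --> U] --> L u].
Proof.
move=> Hu; have PU : ProperFilter U by exact: ultra_proper.
have Vu : \forall i \near U, V w (u_ i) by apply: filterS Hu => i [].
have su i : \forall k \near U, sqi (u_ k i).
  by apply: filterS Vu => k Vk; exact: (V_sqi i Vk).
have sDu a : \forall k \near U, sqi (D a (u_ k i3)).
  by apply: filterS Vu => k Vk; exact: (V_sqiD a i3 Vk).
have /choice[s Hs] : forall i, exists s, sqi s /\ nr (u_ k i - s) @[k --> U] --> (0 : R).
  move=> i; have [|s ss cs] := @H10_compact R w ow bw I U UU (fun k => u_ k i) M; last by exists s.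
  apply: filterS Hu => k [Vk Mk]; split; first exact: V_H10.
  by move=> a; apply: le_trans Mk; exact: (comp_le_Vnorm w (inl (inr (i, a)))).
have /choice[g Hg] : forall a, exists g, sqi g /\ nr (D a (u_ k i3) - g) @[k --> U] --> (0 : R).
  move=> a; have [|g sg cg] := @H10_compact R w ow bw I U UU (fun k => D a (u_ k i3)) M; last by exists g.
  apply: filterS Hu => k [Vk Mk]; split; first by apply: H20_D => //; exact: V_H20.
  by move=> b; apply: le_trans Mk; exact: (comp_le_Vnorm w (inr (a, b))).
have L0 : Vdual w (fun=> 0 : R).
  by split=> [k u v _ _|]; [rewrite mulr0 addr0|exists 0 => u _; rewrite normr0 mul0r].
have [u [V0 us _]] := weak_limit UU Hu (fun i => (Hs i).1) (fun i => (Hs i).2) L0.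
have s0 i : sqi (u i) := V_sqi i V0.
have cu i : nr (u_ k i - u i) @[k --> U] --> (0 : R).
  by apply: (nr_cvg_eq mw (Hs i).1 (s0 i) (su i) _ (Hs i).2); rewrite nrBC.
exists u; split=> // [a|L HL].
  have W : is_weak_partial w a (u i3) (g a).
    apply: (weak_cvg ow bw PU (s0 i3) (Hg a).1 (su i3) _ (cu i3) (Hg a).2).
    by apply: filterS Vu => k Vk; apply: H1_weak; exact: V_H1.
  apply: (nr_cvg_eq mw (Hg a).1 (V_sqiD a i3 V0) (sDu a) _ (Hg a).2).
  by rewrite nrBC; exact: (wd_nr ow bw W).
have [v [Vv vs cL]] := weak_limit UU Hu (fun i => (Hs i).1) (fun i => (Hs i).2) HL.
rewrite (_ : L u = L v)//; apply/eqP; rewrite -subr_eq0 -normr_le0.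
have [C C0 LC] := Vdual_dist ow bw HL.
apply: (le_trans (LC _ _ V0 Vv)); rewrite Vnorm_eq0 ?mulr0// => i.
have sv : sqi (v i) := V_sqi i Vv.
rewrite (nr_congr ow (s0 i) (Hs i).1 sv (us i)) nrBC; exact: vs.
Qed.

End Vcompact.

(** * Energies with general coefficients *)

(* [cQ] is the elasticity tensor multiplied by the area density [cS], [cG] and
   [cB] are the Christoffel symbols and the curvature tensor. *)
Record coef (R : realType) := Coef {
  cQ : 'I_2 -> 'I_2 -> 'I_2 -> 'I_2 -> R * R -> R;
  cG : 'I_2 -> 'I_2 -> 'I_2 -> R * R -> R;
  cB : 'I_2 -> 'I_2 -> R * R -> R;
  cS : R * R -> R }.

Section forms.
Context {R : realType}.
Local Notation plane := (R * R)%type.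
Local Notation mplane := (measurableTypeR R * measurableTypeR R)%type.
Local Notation tens := ('I_2 -> 'I_2 -> plane -> R).
Local Notation tens4 := ('I_2 -> 'I_2 -> 'I_2 -> 'I_2 -> plane -> R).
Context (w : set plane) (mw : measurable (w : set mplane)).
Local Notation sqi := (sqi (@leb2 R) w).
Local Notation ip := (ip (@leb2 R) w).
Local Notation nr := (nr (@leb2 R) w).
Implicit Types (f g : plane -> R) (a b s t : 'I_2) (X Y : tens) (Q : tens4).

Definition mbd (K : R) f := measurable_fun (w : set mplane) f /\ forall y, w y -> `|f y| <= K.

Lemma mbd_sqi K f g : mbd K f -> sqi g -> sqi (f * g).
Proof. by move=> [mf fK] sg; exact: (sqiM mw mf fK). Qed.

Lemma mbd_nr K f g : 0 <= K -> mbd K f -> sqi g -> nr (f * g) <= K * nr g.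
Proof. by move=> K0 [mf fK] sg; exact: (nrM mw mf fK). Qed.

Lemma mbd_cst (c : R) : mbd `|c| (cst c).
Proof. by split; [exact: measurable_cst|]. Qed.

Lemma mbdB K L f g : mbd K f -> mbd L g -> mbd (K + L) (f - g).
Proof.
move=> [mf fK] [mg gL]; split; first exact: measurable_funB.
by move=> y wy; apply: (le_trans (ler_normB _ _)); apply: lerD; [exact: fK|exact: gL].
Qed.

Definition tsqi X := forall a b, sqi (X a b).

Definition N2 X : R := \sum_a \sum_b nr (X a b).

Lemma N2_ge0 X : 0 <= N2 X.
Proof. by apply: sumr_ge0 => a _; apply: sumr_ge0 => b _; exact: nr_ge0. Qed.

Lemma nr_le_N2 X a b : nr (X a b) <= N2 X.
Proof.
apply: (le_trans (sum2_ge (x := fun b => nr (X a b)) b (fun _ => nr_ge0 _ _ _))).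
apply: (sum2_ge (x := fun a => \sum_b nr (X a b)) a) => c.
by apply: sumr_ge0 => d _; exact: nr_ge0.
Qed.

Lemma N2_le X k : (forall a b, nr (X a b) <= k) -> N2 X <= 4 * k.
Proof.
move=> H; apply: (@le_trans _ _ (\sum_(a < 2) \sum_(b < 2) k)).
  by apply: ler_sum => a _; apply: ler_sum => b _.
rewrite !sumr_const !card_ord; lra.
Qed.

Lemma N2D X Y : tsqi X -> tsqi Y -> N2 (X + Y) <= N2 X + N2 Y.
Proof.
move=> sX sY; rewrite /N2 -big_split/=; apply: ler_sum => a _; rewrite -big_split/=.
by apply: ler_sum => b _; exact: nrD.
Qed.

Lemma N2B X Y : tsqi X -> tsqi Y -> N2 (X - Y) <= N2 X + N2 Y.
Proof.
move=> sX sY; rewrite /N2 -big_split/=; apply: ler_sum => a _; rewrite -big_split/=.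
by apply: ler_sum => b _; exact: nrB.
Qed.

Lemma tsqiD X Y : tsqi X -> tsqi Y -> tsqi (X + Y).
Proof. by move=> sX sY a b; exact: sqiD. Qed.

Lemma tsqiB X Y : tsqi X -> tsqi Y -> tsqi (X - Y).
Proof. by move=> sX sY a b; exact: sqiB. Qed.

Definition tr2 X : tens := fun a b => X b a.

Lemma tsqi_tr X : tsqi X -> tsqi (tr2 X). Proof. by move=> sX a b; exact: sX. Qed.

Lemma N2_tr X : N2 (tr2 X) = N2 X.
Proof. by rewrite /N2 exchange_big. Qed.

Definition Bf Q X Y : R := \sum_a \sum_b \sum_s \sum_t ip (Q a b s t * X s t) (Y a b).

Definition mbd4 K Q := forall a b s t, mbd K (Q a b s t).

Lemma eq4 (F G : 'I_2 -> 'I_2 -> 'I_2 -> 'I_2 -> R) : (forall a b s t, F a b s t = G a b s t) ->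
  \sum_a \sum_b \sum_s \sum_t F a b s t = \sum_a \sum_b \sum_s \sum_t G a b s t.
Proof. by move=> H; do 4!apply: eq_bigr => ? _; exact: H. Qed.

Lemma split4 (F G : 'I_2 -> 'I_2 -> 'I_2 -> 'I_2 -> R) :
  \sum_a \sum_b \sum_s \sum_t (F a b s t + G a b s t) =
  \sum_a \sum_b \sum_s \sum_t F a b s t + \sum_a \sum_b \sum_s \sum_t G a b s t.
Proof.
by rewrite -big_split/=; apply: eq_bigr => a _; rewrite -big_split/=; apply: eq_bigr => b _;
  rewrite -big_split/=; apply: eq_bigr => s _; rewrite -big_split.
Qed.

Lemma Bf_le K Q X Y : 0 <= K -> mbd4 K Q -> tsqi X -> tsqi Y -> `|Bf Q X Y| <= K * (N2 X * N2 Y).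
Proof.
move=> K0 bQ sX sY.
have -> : K * (N2 X * N2 Y) = \sum_a \sum_b \sum_s \sum_t (K * nr (X s t)) * nr (Y a b).
  rewrite mulrA mulrC /N2 !big_distrl/=; apply: eq_bigr => a _; rewrite big_distrl/=; apply: eq_bigr => b _.
  rewrite mulrC big_distrr/= big_distrl/=; apply: eq_bigr => s _.
  by rewrite big_distrr/= big_distrl/=.
do 4!(apply: (le_trans (ler_norm_sum _ _ _)); apply: ler_sum => ? _).
apply: (le_trans (ip_le mw (mbd_sqi (bQ _ _ _ _) (sX _ _)) (sY _ _))).
by apply: ler_wpM2r; [exact: nr_ge0|exact: mbd_nr].
Qed.

Lemma BfDl K Q X X' Y : mbd4 K Q -> tsqi X -> tsqi X' -> tsqi Y -> Bf Q (X + X') Y = Bf Q X Y + Bf Q X' Y.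
Proof.
move=> bQ sX sX' sY; rewrite /Bf -split4; apply: eq4 => a b s t.
rewrite -(ipDl mw (mbd_sqi (bQ _ _ _ _) (sX _ _)) (mbd_sqi (bQ _ _ _ _) (sX' _ _)) (sY _ _)).
by rewrite -mulrDr.
Qed.

Lemma BfDr K Q X Y Y' : mbd4 K Q -> tsqi X -> tsqi Y -> tsqi Y' -> Bf Q X (Y + Y') = Bf Q X Y + Bf Q X Y'.
Proof.
move=> bQ sX sY sY'; rewrite /Bf -split4; apply: eq4 => a b s t.
by rewrite -(ipDr mw (sY _ _) (sY' _ _) (mbd_sqi (bQ _ _ _ _) (sX _ _))).
Qed.

Lemma BfBl K Q X X' Y : mbd4 K Q -> tsqi X -> tsqi X' -> tsqi Y -> Bf Q (X - X') Y = Bf Q X Y - Bf Q X' Y.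
Proof.
move=> bQ sX sX' sY; apply/eqP; rewrite eq_sym subr_eq -(BfDl bQ _ sX' sY); last exact: tsqiB.
by rewrite subrK.
Qed.

Lemma BfBr K Q X Y Y' : mbd4 K Q -> tsqi X -> tsqi Y -> tsqi Y' -> Bf Q X (Y - Y') = Bf Q X Y - Bf Q X Y'.
Proof.
move=> bQ sX sY sY'; apply/eqP; rewrite eq_sym subr_eq -(BfDr bQ sX _ sY'); last exact: tsqiB.
by rewrite subrK.
Qed.

Lemma BfQ K L Q Q' X Y : mbd4 K Q -> mbd4 L Q' -> tsqi X -> tsqi Y ->
  Bf (Q - Q') X Y = Bf Q X Y - Bf Q' X Y.
Proof.
move=> bQ bQ' sX sY; apply/eqP; rewrite eq_sym subr_eq /Bf -split4; apply/eqP; apply: eq4 => a b s t.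
have bQQ : mbd (K + L) (Q a b s t - Q' a b s t) by exact: mbdB.
rewrite -(ipDl mw (mbd_sqi bQQ (sX _ _)) (mbd_sqi (bQ' _ _ _ _) (sX _ _)) (sY _ _)).
by rewrite -mulrDl subrK.
Qed.

Definition sym4 Q := forall a b s t y, w y -> Q a b s t y = Q b a s t y /\ Q a b s t y = Q a b t s y.

Lemma Bf_trr Q X Y : sym4 Q -> Bf Q X (tr2 Y) = Bf Q X Y.
Proof.
move=> sQ; rewrite /Bf exchange_big; apply: eq4 => a b s t.
by apply: eq_ip => // y /set_mem wy; rewrite !fctE (sQ b a s t y wy).1.
Qed.

Lemma Bf_trl Q X Y : sym4 Q -> Bf Q (tr2 X) Y = Bf Q X Y.
Proof.
move=> sQ; rewrite /Bf; apply: eq_bigr => a _; apply: eq_bigr => b _; rewrite exchange_big.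
apply: eq_bigr => s _; apply: eq_bigr => t _.
by apply: eq_ip => // y /set_mem wy; rewrite !fctE (sQ a b t s y wy).2.
Qed.

(** By the minor symmetries of [Q] the form depends only on the symmetric part of the tensor, which
    is half of [X + tr2 X]. *)
Lemma Bf_sym K Q X : mbd4 K Q -> sym4 Q -> tsqi X ->
  Bf Q (X + tr2 X) (X + tr2 X) = 4 * Bf Q X X.
Proof.
move=> bQ sQ sX; have st := tsqi_tr sX.
rewrite (BfDl bQ sX st (tsqiD sX st)) !(BfDr bQ _ sX st)//.
rewrite (Bf_trr X X sQ) (Bf_trl X (tr2 X) sQ) (Bf_trr X X sQ) (Bf_trl X X sQ).
by move: (Bf Q X X) => x; ring.
Qed.

Lemma Bf_diff K L Q Q' X X' n n' : mbd4 K Q -> mbd4 L Q' -> tsqi X -> tsqi X' ->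
  0 <= K -> 0 <= L -> forall e, 0 <= e -> mbd4 e (Q - Q') -> N2 X <= n -> N2 X' <= n -> N2 (X - X') <= n' ->
  `|Bf Q X X - Bf Q' X' X'| <= e * (n * n) + 2 * (L * (n' * n)).
Proof.
move=> bQ bQ' sX sX' K0 L0 e e0 bQQ Xn X'n XX'; have sXX := tsqiB sX sX'.
have E : Bf Q X X - Bf Q' X' X' = Bf (Q - Q') X X + Bf Q' (X - X') X + Bf Q' X' (X - X').
  rewrite (BfQ bQ bQ' sX sX) (BfBl bQ' sX sX' sX) (BfBr bQ' sX' sX sX').
  by move: (Bf _ _ _) (Bf _ _ _) (Bf _ _ _) (Bf _ _ _) => *; ring.
rewrite E; apply: (le_trans (ler_normD _ _)); apply: (@le_trans _ _ (e * (n * n) + L * (n' * n) + L * (n' * n))); last lra.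
have n0 := le_trans (N2_ge0 X) Xn; have n'0 := le_trans (N2_ge0 _) XX'.
apply: lerD; [apply: (le_trans (ler_normD _ _)); apply: lerD|].
- apply: (le_trans (Bf_le e0 bQQ sX sX)); apply: ler_wpM2l => //; apply: ler_pM => //; exact: N2_ge0.
- apply: (le_trans (Bf_le L0 bQ' sXX sX)); apply: ler_wpM2l => //; apply: ler_pM => //; exact: N2_ge0.
- rewrite (mulrC n'); apply: (le_trans (Bf_le L0 bQ' sX' sXX)); apply: ler_wpM2l => //; apply: ler_pM => //; exact: N2_ge0.
Qed.

Context (lam mu : R) (lam0 : 0 <= lam) (mu0 : 0 < mu).

Definition Q0 : tens4 := fun a b s t => cst (elast lam mu 1%:M a b s t).

(** The form equals a nonnegative multiple of the squared norm of the trace plus the left-hand side;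
    the trace term is dropped. *)
Lemma Bf_Q0 X : tsqi X ->
  mu * \sum_a \sum_b nr (X a b + X b a) ^+ 2 <= Bf Q0 X X.
Proof.
move=> sX; pose c := 4%:R * lam * mu / (lam + 2%:R * mu).
have c0 : 0 <= c by rewrite /c divr_ge0 ?addr_ge0 ?mulr_ge0// ?(ltW mu0).
have E a b s t : ip (Q0 a b s t * X s t) (X a b) = elast lam mu 1%:M a b s t * ip (X s t) (X a b).
  by rewrite -(ipZl mw _ (sX s t) (sX a b)).
have T : Bf Q0 X X = c * nr (X 0 0 + X 1 1) ^+ 2 + mu * \sum_a \sum_b nr (X a b + X b a) ^+ 2.
  rewrite /Bf (eq4 E) !big_ord_recl !big_ord0 /elast -/c.
  have -> : lift ord0 ord0 = 1 :> 'I_2 by exact: val_inj.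
  have -> : ord0 = 0 :> 'I_2 by exact: val_inj.
  rewrite !(sqr_nrD mw (sX _ _) (sX _ _)) !mxE /= !sqr_nr.
  rewrite !(ipC (@leb2 R) w (X 1 1) (X 0 0)) !(ipC (@leb2 R) w (X 0 1) (X 0 0)) !(ipC (@leb2 R) w (X 1 0) (X 0 0)).
  rewrite !(ipC (@leb2 R) w (X 1 1) (X 0 1)) !(ipC (@leb2 R) w (X 1 1) (X 1 0)) !(ipC (@leb2 R) w (X 1 0) (X 0 1)).
  move: (ip (X 0 0) (X 0 0)) (ip (X 0 0) (X 1 1)) (ip (X 0 0) (X 0 1)) (ip (X 0 0) (X 1 0)) (ip (X 0 1) (X 1 1))
    (ip (X 1 0) (X 1 1)) (ip (X 0 1) (X 1 0)) (ip (X 1 1) (X 1 1)) (ip (X 0 1) (X 0 1)) (ip (X 1 0) (X 1 0)) => *.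
  ring.
by rewrite T lerDr mulr_ge0 ?sqr_ge0.
Qed.

Lemma N2_sqr X : N2 X ^+ 2 <= 4 * \sum_a \sum_b nr (X a b) ^+ 2.
Proof.
rewrite /N2 !big_ord_recl !big_ord0.
move: (nr _) (nr _) (nr _) (nr _) => x y z t.
have := sqr_ge0 (x - y); have := sqr_ge0 (x - z); have := sqr_ge0 (x - t).
have := sqr_ge0 (y - z); have := sqr_ge0 (y - t); have := sqr_ge0 (z - t); nra.
Qed.

(** Pass to [Y = X + tr2 X] by [Bf_sym]. There the plate tensor gives at least [mu * N2 Y ^+ 2], and
    the perturbation takes away at most half of it because [e <= mu / 2]. *)
Lemma Bf_coercive K e Q X : mbd4 K Q -> sym4 Q -> 0 <= e <= mu / 2 -> mbd4 e (Q - Q0) -> tsqi X ->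
  mu / 32 * N2 (X + tr2 X) ^+ 2 <= Bf Q X X.
Proof.
move=> bQ sQ /andP[e0 emu] bQQ sX; set Y := X + tr2 X.
have sY : tsqi Y by apply: tsqiD => //; exact: tsqi_tr.
have H1 := Bf_sym bQ sQ sX; rewrite -/Y in H1.
have bQ0 : mbd4 (\sum_a \sum_b \sum_s \sum_t `|elast lam mu 1%:M a b s t|) Q0.
  move=> a b s t; split=> [|y _]; first exact: measurable_cst.
  rewrite /Q0 /=; have p4 (c d e' f : 'I_2) : 0 <= `|elast lam mu 1%:M c d e' f| by exact: normr_ge0.
  apply: (le_trans (sum2_ge (x := fun t => `|elast lam mu 1%:M a b s t|) t _)) => [c|]; first exact: p4.
  apply: (le_trans (sum2_ge (x := fun s => \sum_t `|elast lam mu 1%:M a b s t|) s _)) => [c|].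
    by apply: sumr_ge0 => d _; exact: p4.
  apply: (le_trans (sum2_ge (x := fun b => \sum_s \sum_t `|elast lam mu 1%:M a b s t|) b _)) => [c|].
    by do 2!(apply: sumr_ge0 => ? _); exact: p4.
  apply: (sum2_ge (x := fun a => \sum_b \sum_s \sum_t `|elast lam mu 1%:M a b s t|) a) => c.
  by do 3!(apply: sumr_ge0 => ? _); exact: p4.
have H2 := BfQ bQ bQ0 sY sY; have H3 := Bf_le e0 bQQ sY sY; rewrite H2 in H3.
have H4 := Bf_Q0 sY.
have E a b : Y a b + Y b a = 2 *: Y a b.
  apply/funext => y; rewrite -[LHS]/(X a b y + X b a y + (X b a y + X a b y)).
  by rewrite -[RHS]/(2 * (X a b y + X b a y)); move: (X a b y) (X b a y) => *; ring.
have H5 : \sum_a \sum_b nr (Y a b + Y b a) ^+ 2 = 4 * \sum_a \sum_b nr (Y a b) ^+ 2.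
  rewrite big_distrr/=; apply: eq_bigr => a _; rewrite big_distrr/=; apply: eq_bigr => b _.
  by rewrite E (nrZ mw _ (sY a b)) exprMn ger0_norm//; ring.
rewrite H5 in H4; have H6 := N2_sqr Y.
move: H3; rewrite ler_norml => /andP[H3 _].
move: H1 H3 H4 H6 (N2_ge0 Y); move: (N2 Y) (Bf Q Y Y) (Bf Q0 Y Y) (Bf Q X X) (\sum_a _) => n x y z S H1 H3 H4 H6 n0.
have := ler_wpM2r (sqr_ge0 n) emu; have := ler_wpM2l (ltW mu0) H6; rewrite expr2 => *; nra.
Qed.

End forms.

(** * Elementary inequalities behind coercivity *)

Section arith.
Context {R : realType}.
Implicit Types n h H e f g J K P m A k C : R.

Lemma hessian_arith H f eta C : 0 <= H -> 0 <= C -> 8 * eta * C <= 1 -> 2 * H <= f + 2 * (4 * eta * (C * H)) -> H <= f.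
Proof. by move=> H0 C0 h1 h2; have := ler_wpM2r H0 h1; rewrite mul1r => ?; lra. Qed.

(** Here [n] is the norm of the displacement, [h] the gradient of [(u_1, u_2)], [H] the Hessian and
    [g] the gradient of [u_3], [f] and [e] the symmetrized strains, [e0] the symmetrized plate
    strain, [P] the load. Young's inequality with parameter [k] splits [g * H]. The condition
    [48 * K * A * eta <= 1] absorbs the geometric error [eta * n] into [n], and
    [64 * P * K * k <= m] absorbs the quadratic part of the load term into half of the bending
    energy. *)
Lemma coercive_arith n h H e f e0 g eta J K K1 P m k A :
  0 <= n -> 0 <= H -> 0 <= e0 -> 0 <= g -> 0 <= e ->
  0 <= eta -> 0 <= K -> 0 <= P -> 0 < k -> 0 <= K1 ->
  H <= f -> e0 <= e + 24 * eta * n -> g ^+ 2 <= 2 * (K1 * e0) ->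
  h <= 4 * (e0 + 8 * (g * H)) -> n <= K * (h + H) -> m * (f ^+ 2 + e ^+ 2) - P * n <= J ->
  A = 4 + 32 * K1 / k -> 48 * K * A * eta <= 1 -> 64 * P * K * k <= m ->
  n <= 2 * K * (A * e + 16 * k * f ^+ 2 + f) /\
  m / 2 * (f ^+ 2 + e ^+ 2) - 2 * P * K * (A * e) - 2 * P * K * f <= J.
Proof.
move=> n0 H0 e00 g0 e_0 eta0 K0 P0 k0 K10 Hf he0 hg hh hn hJ hA hA2 hk.
have gH : 8 * (g * H) <= 4 * (k * H ^+ 2) + 8 * (K1 * e0) / k.
  have s := sqr_ge0 (k * H - g); rewrite -(ler_pM2r k0).
  have -> : (4 * (k * H ^+ 2) + 8 * (K1 * e0) / k) * k = 4 * (k * H) ^+ 2 + 8 * (K1 * e0).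
    by field; rewrite gt_eqF.
  have E : 8 * (g * H) * k = 8 * (k * H) * g by ring.
  rewrite E; move: s hg; move: (k * H) (K1 * e0) => x y; rewrite !expr2 => s hg; nra.
have hAe : h <= A * e0 + 16 * k * H ^+ 2.
  apply: (le_trans hh); have -> : A * e0 = 4 * e0 + 4 * (8 * (K1 * e0) / k) by rewrite hA; field; rewrite gt_eqF.
  lra.
have A0 : 0 <= A by rewrite hA addr_ge0// divr_ge0 ?mulr_ge0// ltW.
have Hf2 : H ^+ 2 <= f ^+ 2 by rewrite ler_sqr ?nnegrE ?(le_trans H0 Hf).
have h1 := ler_wpM2l A0 he0.
have h2 : 16 * k * H ^+ 2 <= 16 * k * f ^+ 2 by rewrite ler_wpM2l// mulr_ge0// ltW.
have h3 : h + H <= A * e + 24 * A * eta * n + 16 * k * f ^+ 2 + f.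
  have -> : 24 * A * eta * n = A * (24 * eta * n) by ring.
  by move: h1; rewrite mulrDr; lra.
have h4 := ler_wpM2l K0 h3.
have h5 := ler_wpM2r n0 hA2; rewrite mul1r in h5.
have hn2 : n <= 2 * K * (A * e + 16 * k * f ^+ 2 + f).
  have E1 : K * (A * e + 24 * A * eta * n + 16 * k * f ^+ 2 + f) =
     K * (A * e + 16 * k * f ^+ 2 + f) + 2^-1 * (48 * K * A * eta * n) by field.
  have E2 : 2 * K * (A * e + 16 * k * f ^+ 2 + f) = 2 * (K * (A * e + 16 * k * f ^+ 2 + f)) by ring.
  rewrite E1 in h4; rewrite E2; move: (K * (A * e + _ + f)) (48 * K * A * eta * n) h4 h5 => *; lra.
split => //; apply: le_trans hJ.
have h6 := ler_wpM2l P0 hn2.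
have h7 := ler_wpM2r (sqr_ge0 f) hk.
have m0 : 0 <= m by apply: le_trans hk; rewrite !mulr_ge0// ltW.
have h8 := mulr_ge0 m0 (sqr_ge0 e).
have E3 : P * (2 * K * (A * e + 16 * k * f ^+ 2 + f)) =
  2 * P * K * (A * e) + 2^-1 * (64 * P * K * k * f ^+ 2) + 2 * P * K * f by field.
rewrite E3 in h6; rewrite !mulrDr.
have -> : m / 2 * f ^+ 2 = 2^-1 * (m * f ^+ 2) by field.
have -> : m / 2 * e ^+ 2 = 2^-1 * (m * e ^+ 2) by field.
move: h6 h7 h8; move: (2 * P * K * (A * e)) (64 * P * K * k * f ^+ 2) (2 * P * K * f) (P * n) (m * e ^+ 2) (m * f ^+ 2) => *; lra.
Qed.

Lemma quad_bound x b m : 0 < m -> - (b ^+ 2 / m) <= m / 4 * x ^+ 2 - b * x.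
Proof.
move=> m0; have s := sqr_ge0 (m / 2 * x - b); rewrite -(ler_pM2r m0).
have -> : - (b ^+ 2 / m) * m = - b ^+ 2 by field; rewrite gt_eqF.
have -> : (m / 4 * x ^+ 2 - b * x) * m = (m / 2 * x - b) ^+ 2 - b ^+ 2 by field.
by move: s; move: ((m / 2 * x - b) ^+ 2) => *; lra.
Qed.

(** Completing squares bounds the energy below by [m / 4 * (f ^+ 2 + e ^+ 2) - X]. Where [J <= 1],
    both squares are thus at most [Z], and [x ^+ 2 <= Z] gives [x <= 1 + Z]. *)
Lemma coercive_arith2 n e f J K P m k A : 0 <= e -> 0 <= f -> 0 < m -> 0 <= K -> 0 <= A -> 0 < k ->
  n <= 2 * K * (A * e + 16 * k * f ^+ 2 + f) ->
  m / 2 * (f ^+ 2 + e ^+ 2) - 2 * P * K * (A * e) - 2 * P * K * f <= J ->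
  let X := (2 * P * K * A) ^+ 2 / m + (2 * P * K) ^+ 2 / m in
  let Z := 4 * (1 + X) / m in
  - X <= J /\ (J <= 1 -> n <= 2 * K * (A * (1 + Z) + 16 * k * Z + (1 + Z))).
Proof.
move=> e0 f0 m0 K0 A0 k0 hn hJ X Z.
have q1 := quad_bound e (2 * P * K * A) m0; have q2 := quad_bound f (2 * P * K) m0.
have low : m / 4 * (f ^+ 2 + e ^+ 2) - X <= J.
  apply: le_trans hJ; rewrite /X mulrA; move: q1 q2.
  have -> : m / 2 * (f ^+ 2 + e ^+ 2) = m / 4 * e ^+ 2 + m / 4 * f ^+ 2 + m / 4 * (f ^+ 2 + e ^+ 2) by field.
  move: (2 * P * K * A * e) (2 * P * K * f) (m / 4 * e ^+ 2) (m / 4 * f ^+ 2) (m / 4 * _) => *; lra.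
have m40 : 0 < m / 4 by lra.
have s0 : 0 <= m / 4 * (f ^+ 2 + e ^+ 2) by exact: mulr_ge0 (ltW m40) (addr_ge0 (sqr_ge0 f) (sqr_ge0 e)).
split; first lra.
move=> J1; have hs : f ^+ 2 + e ^+ 2 <= Z.
  rewrite -(ler_pM2l m40) (_ : m / 4 * Z = 1 + X); first lra.
  by rewrite /Z; field; rewrite gt_eqF.
have sf := sqr_ge0 f; have se := sqr_ge0 e.
have f2 : f ^+ 2 <= Z by lra.
have e2 : e ^+ 2 <= Z by lra.
have fZ : f <= 1 + Z by have := sqr_ge0 (f - 1); rewrite expr2 in f2 *; nra.
have eZ : e <= 1 + Z by have := sqr_ge0 (e - 1); rewrite expr2 in e2 *; nra.
apply: (le_trans hn); apply: ler_wpM2l; first by rewrite mulr_ge0.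
by apply: lerD => //; apply: lerD; apply: ler_wpM2l => //; rewrite mulr_ge0// ltW.
Qed.

Lemma sqr_le_product (x g1 H1 g2 H2 g H : R) : 0 <= g1 <= g -> 0 <= H1 <= H -> 0 <= g2 <= g -> 0 <= H2 <= H ->
  x ^+ 2 <= 4 * ((g1 * H1) * (g2 * H2)) -> x <= 2 * (g * H).
Proof.
move=> /andP[a0 a1] /andP[b0 b1] /andP[c0 c1] /andP[d0 d1] hx.
have g0 := le_trans a0 a1; have H0 := le_trans b0 b1.
apply: sqr_le_mono; first by rewrite !mulr_ge0.
apply: (le_trans hx); rewrite exprMn (_ : 2 ^+ 2 = 4 :> R); last by rewrite expr2; lra.
by rewrite ler_wpM2l// expr2 ler_pM ?mulr_ge0// ler_pM.
Qed.

Lemma korn_arith (x y p q S00 S11 S01 S : R) : 0 <= S00 -> 0 <= S11 -> 0 <= S01 -> 0 <= x -> 0 <= y -> 0 <= p -> 0 <= q ->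
  2 * p = S00 -> 2 * q = S11 -> x ^+ 2 + y ^+ 2 <= S01 ^+ 2 + p ^+ 2 + q ^+ 2 ->
  S00 + S01 + S11 <= S -> [/\ x <= S, y <= S, p <= S & q <= S].
Proof.
move=> a0 b0 c0 x0 y0 p0 q0 hp hq H HS; have S0 : 0 <= S by lra.
have le : S01 ^+ 2 + p ^+ 2 + q ^+ 2 <= S ^+ 2.
  apply: (@le_trans _ _ ((S01 + p + q) ^+ 2)).
    have := mulr_ge0 c0 p0; have := mulr_ge0 c0 q0; have := mulr_ge0 p0 q0; rewrite !expr2 => *; nra.
  by rewrite ler_sqr ?nnegrE; lra.
have := sqr_ge0 x; have := sqr_ge0 y => y2 x2.
by split; [apply: sqr_le_mono => //; lra|apply: sqr_le_mono => //; lra|lra|lra].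
Qed.

End arith.

(** * Strains and their a priori estimates *)

Section energy.
Context {R : realType}.
Local Notation plane := (R * R)%type.
Local Notation mplane := (measurableTypeR R * measurableTypeR R)%type.
Local Notation field := ('I_3 -> plane -> R).
Local Notation tens := ('I_2 -> 'I_2 -> plane -> R).
Context (w : set plane) (ow : open w) (bw : bounded_set w).
Local Notation sqi := (sqi (@leb2 R) w).
Local Notation ip := (ip (@leb2 R) w).
Local Notation nr := (nr (@leb2 R) w).
Local Notation D := (wd w).
Local Notation N2 := (N2 w).
Local Notation tsqi := (tsqi w).
Local Notation mbd := (mbd w).
Local Notation mbd4 := (mbd4 w).
Implicit Types (f g : plane -> R) (a b s t : 'I_2) (u v : field) (c : coef R) (eta : R).
Let mw : measurable (w : set mplane) := mw ow.
Let fw := fw ow bw.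

(** The strains are split into a plate part, marked by 0, and a remainder linear in [u] whose
    coefficients [cG] and [cB] are small for nearly flat surfaces. [Ml] is twice the linearized
    membrane strain. *)
Definition Ff0 u : tens := fun a b => D a (D b (u i3)).
Definition Ml u : tens := fun a b => D b (u (lat a)) + D a (u (lat b)).
Definition Mq u : tens := fun a b => D a (u i3) * D b (u i3).
Definition Ef0 u : tens := fun a b => 2^-1 *: Ml u a b + 2^-1 *: Mq u a b.
Definition Fr c u : tens := fun a b => \sum_s cG c s a b * D s (u i3).
Definition Er c u : tens := fun a b => \sum_s cG c s a b * u (lat s) + cB c a b * u i3.
Definition Ef c u : tens := Ef0 u - Er c u.
Definition Ff c u : tens := Ff0 u - Fr c u.

Lemma V_sqiDD a b u : V w u -> sqi (D a (D b (u i3))).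
Proof. by move=> Vu; apply: H1_sqiD => //; apply: H2_D; exact: V_H2. Qed.

Lemma V_H10D a u : V w u -> H10 w (D a (u i3)).
Proof. by move=> Vu; apply: H20_D => //; exact: V_H20. Qed.

Lemma Mq_sqi u : V w u -> tsqi (Mq u).
Proof. by move=> Vu a b; apply: (H10_mul ow bw _ _).1; exact: V_H10D. Qed.

Lemma Ml_sqi u : V w u -> tsqi (Ml u).
Proof. by move=> Vu a b; apply: sqiD => //; exact: V_sqiD. Qed.

Lemma Ff0_sqi u : V w u -> tsqi (Ff0 u).
Proof. by move=> Vu a b; exact: V_sqiDD. Qed.

Lemma Ef0_sqi u : V w u -> tsqi (Ef0 u).
Proof. by move=> Vu a b; apply: sqiD => //; apply: sqiZ => //; [exact: Ml_sqi|exact: Mq_sqi]. Qed.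

Definition mbdc eta c := (forall s a b, mbd eta (cG c s a b)) /\ (forall a b, mbd eta (cB c a b)).

Lemma Fr_sqi eta c u : mbdc eta c -> V w u -> tsqi (Fr c u).
Proof.
move=> [bG bB] Vu a b; apply: sqi_sum => // s _.
by apply: (mbd_sqi mw (bG _ _ _)); exact: V_sqiD.
Qed.

Lemma Er_sqi eta c u : mbdc eta c -> V w u -> tsqi (Er c u).
Proof.
move=> [bG bB] Vu a b; apply: sqiD => //; first apply: sqi_sum => // s _.
  by apply: (mbd_sqi mw (bG _ _ _)); exact: V_sqi.
by apply: (mbd_sqi mw (bB _ _)); exact: V_sqi.
Qed.

Definition gs u : R := \sum_s nr (D s (u i3)).

Lemma gs_ge0 u : 0 <= gs u. Proof. by apply: sumr_ge0 => s _; exact: nr_ge0. Qed.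

Lemma Fr_le eta c u : 0 <= eta -> mbdc eta c -> V w u -> N2 (Fr c u) <= 4 * (eta * gs u).
Proof.
move=> e0 bc Vu; apply: N2_le => a b; have [bG bB] := bc.
have s1 s : sqi (cG c s a b * D s (u i3)) by apply: (mbd_sqi mw (bG _ _ _)); exact: V_sqiD.
have Hs := nr_sum mw (index_enum _) (P := xpredT) (F := fun s => cG c s a b * D s (u i3)) (fun s _ => s1 s).
apply: (le_trans Hs); rewrite /gs big_distrr/=; apply: ler_sum => s _.
by apply: (mbd_nr mw e0 (bG _ _ _)); exact: V_sqiD.
Qed.

Lemma Er_le eta c u : 0 <= eta -> mbdc eta c -> V w u -> N2 (Er c u) <= 4 * (3 * (eta * Vnorm w u)).
Proof.
move=> e0 bc Vu; apply: N2_le => a b; have [bG bB] := bc.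
have s1 s : sqi (cG c s a b * u (lat s)) by apply: (mbd_sqi mw (bG _ _ _)); exact: V_sqi.
have s2 : sqi (cB c a b * u i3) by apply: (mbd_sqi mw (bB _ _)); exact: V_sqi.
have le i : nr (u i) <= Vnorm w u by exact: (comp_le_Vnorm w (inl (inl i))).
have l2 : nr (cB c a b * u i3) <= eta * Vnorm w u.
  by apply: (le_trans (mbd_nr mw e0 (bB _ _) (V_sqi ow bw i3 Vu))); exact: ler_wpM2l.
have l1 s : nr (cG c s a b * u (lat s)) <= eta * Vnorm w u.
  by apply: (le_trans (mbd_nr mw e0 (bG _ _ _) (V_sqi ow bw (lat s) Vu))); exact: ler_wpM2l.
have Hs := nr_sum mw (index_enum _) (P := xpredT) (F := fun s => cG c s a b * u (lat s)) (fun s _ => s1 s).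
have ss := sqi_sum mw (index_enum _) (P := xpredT) (F := fun s => cG c s a b * u (lat s)) (fun s _ => s1 s).
apply: (le_trans (nrD mw ss s2)).
have l3 : \sum_s nr (cG c s a b * u (lat s)) <= \sum_(s < 2) eta * Vnorm w u by apply: ler_sum => s _.
have := lerD (le_trans Hs l3) l2; rewrite sumr_const card_ord => /le_trans; apply.
by move: (eta * Vnorm w u) => *; lra.
Qed.

Definition hs u : R := N2 (fun a b => D a (u (lat b))).

Lemma gs_poincare : exists2 C, 0 <= C & forall u, V w u -> gs u <= C * N2 (Ff0 u).
Proof.
have [C C0 HC] := H10_poincare ow bw; exists C; first exact: ltW.
move=> u Vu; apply: (@le_trans _ _ (C * \sum_b nr (D 0 (D b (u i3))))).
  by rewrite /gs big_distrr/=; apply: ler_sum => b _; apply: HC; exact: V_H10D.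
apply: ler_wpM2l; first exact: ltW.
apply: (sum2_ge (x := fun a => \sum_b nr (D a (D b (u i3)))) 0) => a.
by apply: sumr_ge0 => b _; exact: nr_ge0.
Qed.

Lemma V_poincare : exists2 K, 0 <= K & forall u, V w u -> Vnorm w u <= K * (hs u + N2 (Ff0 u)).
Proof.
have [C C0 HC] := H10_poincare ow bw; have [C' C'0 HC'] := gs_poincare.
exists (1 + C + C' + C * C'); first by rewrite !addr_ge0 ?mulr_ge0// ltW.
move=> u Vu; have C0' := ltW C0.
have N20 : 0 <= N2 (Ff0 u) by exact: N2_ge0.
have hs0 : 0 <= hs u by exact: N2_ge0.
have h1 : \sum_b nr (u (lat b)) <= C * hs u.
  apply: (@le_trans _ _ (C * \sum_b nr (D 0 (u (lat b))))).
    by rewrite big_distrr/=; apply: ler_sum => b _; apply: HC; exact: V_H10.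
  apply: ler_wpM2l => //; apply: (sum2_ge (x := fun a => \sum_b nr (D a (u (lat b)))) 0) => a.
  by apply: sumr_ge0 => b _; exact: nr_ge0.
have h2 : nr (u i3) <= C * gs u.
  apply: (le_trans (HC _ (V_H10 ow bw i3 Vu))); apply: ler_wpM2l => //.
  by apply: (sum2_ge (x := fun s => nr (D s (u i3))) 0) => s; exact: nr_ge0.
have h3 := HC' u Vu.
have h4 : \sum_b H1norm w (u (lat b)) <= \sum_b nr (u (lat b)) + hs u.
  rewrite /hs /N2 exchange_big -big_split/=; apply: ler_sum => b _; exact: H1norm_le.
have h5 : H2norm w (u i3) <= nr (u i3) + gs u + N2 (Ff0 u).
  by rewrite /N2 exchange_big; exact: H2norm_le.
rewrite /Vnorm; apply: (le_trans (lerD h4 h5)).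
have h6 := ler_wpM2l C0' h3; have h7 := mulr_ge0 (mulr_ge0 C0' C'0) hs0; have h8 := mulr_ge0 C'0 hs0.
have h9 := mulr_ge0 C0' N20.
have E : (1 + C + C' + C * C') * (hs u + N2 (Ff0 u)) =
  hs u + N2 (Ff0 u) + C * hs u + C * N2 (Ff0 u) + C' * hs u + C' * N2 (Ff0 u) + C * C' * hs u + C * (C' * N2 (Ff0 u)) by ring.
rewrite E; move: h1 h2 h3 h6 h7 h8 h9.
move: (\sum_b _) (C * hs u) (C' * hs u) (C * C' * hs u) (C * gs u) (C' * N2 _) (C * (_)) (C * N2 _) (nr _) => *.
lra.
Qed.

Lemma hessian_comm u a b : V w u -> nr (Ff0 u a b - Ff0 u b a) = 0.
Proof.
move=> Vu; apply: (weak_comm ow bw (a := a) (b := b) (f := u i3)); apply: H1_weak.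
- exact: V_H1.
- by apply: H2_D; exact: V_H2.
- exact: V_H1.
- by apply: H2_D; exact: V_H2.
Qed.

(** Coercivity bounds only [X + tr2 X]; for the Hessian, whose weak derivatives commute, this loses
    nothing. *)
Lemma N2_asym (X : tens) : tsqi X -> (forall a b, nr (X a b - X b a) = 0) ->
  N2 (X + tr2 X) = 2 * N2 X.
Proof.
move=> sX C; rewrite /N2 big_distrr/=; apply: eq_bigr => a _; rewrite big_distrr/=; apply: eq_bigr => b _.
rewrite -[(X + tr2 X) a b]/(X a b + X b a).
rewrite -[2 in RHS]ger0_norm// -(nrZ mw 2 (sX a b)); apply: (nr_eq mw).
- exact: sqiD.
- exact: sqiZ.
- rewrite (_ : _ - 2 *: _ = - (X a b - X b a)) ?nrN//.
  by rewrite scaler_nat mulr2n !opprD opprK addrACA subrr add0r addrC.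
Qed.

Lemma hessian_sym u : V w u -> N2 (Ff0 u + tr2 (Ff0 u)) = 2 * N2 (Ff0 u).
Proof. by move=> Vu; apply: N2_asym => [|a b]; [exact: Ff0_sqi|exact: hessian_comm]. Qed.

Lemma YE0 u a b : (Ef0 u + tr2 (Ef0 u)) a b = Ml u a b + Mq u a b.
Proof.
apply/funext => y; rewrite -[LHS]/(2^-1 * (D b (u (lat a)) y + D a (u (lat b)) y) + 2^-1 * (D a (u i3) y * D b (u i3) y) +
  (2^-1 * (D a (u (lat b)) y + D b (u (lat a)) y) + 2^-1 * (D b (u i3) y * D a (u i3) y))).
rewrite -[RHS]/(D b (u (lat a)) y + D a (u (lat b)) y + D a (u i3) y * D b (u i3) y).
by move: (D b (u (lat a)) y) (D a (u (lat b)) y) (D a (u i3) y) (D b (u i3) y) => *; field.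
Qed.

(* The boundary conditions make the integral of [div (u_1, u_2)] vanish. *)
Lemma trace_bound u : V w u -> gs u ^+ 2 <= 2 * (nr (cst 1) * N2 (Ef0 u + tr2 (Ef0 u))).
Proof.
move=> Vu; have s1 := sqi_cst mw 1 fw.
have T a : nr (D a (u i3)) ^+ 2 <= nr (cst 1) * nr ((Ef0 u + tr2 (Ef0 u)) a a).
  have sD := V_sqiD ow bw a (lat a) Vu.
  have sq := Mq_sqi Vu a a; have sl := Ml_sqi Vu a a.
  have E : nr (D a (u i3)) ^+ 2 = ip ((Ef0 u + tr2 (Ef0 u)) a a) (cst 1).
    rewrite YE0 (ipDl mw sl sq s1) (ipDl mw sD sD s1).
    rewrite (H10_ip0 ow bw a (V_H10 ow bw (lat a) Vu)) !add0r sqr_nr !ipE.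
    by apply: eq_Rintegral => y _; rewrite mulr1.
  rewrite E mulrC; apply: (le_trans (ler_norm _)); apply: ip_le => //.
  by rewrite YE0; exact: sqiD.
have h0 := T 0; have h1 := T 1.
have l : nr ((Ef0 u + tr2 (Ef0 u)) 0 0) + nr ((Ef0 u + tr2 (Ef0 u)) 1 1) <= N2 (Ef0 u + tr2 (Ef0 u)).
  rewrite /N2 !big_ord_recl !big_ord0 (_ : lift ord0 ord0 = 1 :> 'I_2)//; last exact: val_inj.
  have := nr_ge0 (@leb2 R) w ((Ef0 u + tr2 (Ef0 u)) ord0 1); have := nr_ge0 (@leb2 R) w ((Ef0 u + tr2 (Ef0 u)) 1 ord0).
  rewrite (_ : ord0 = 0 :> 'I_2)//; move: (nr _) (nr _) (nr _) (nr _) => *; lra.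
have := ler_wpM2l (nr_ge0 (@leb2 R) w (cst 1)) l; rewrite mulrDr => h2.
rewrite /gs !big_ord_recl big_ord0 addr0 (_ : lift ord0 ord0 = 1 :> 'I_2)//; last exact: val_inj.
rewrite (_ : ord0 = 0 :> 'I_2)//; move: h0 h1 h2.
move: (nr (D 0 (u i3))) (nr (D 1 (u i3))) (nr (cst 1) * _) (nr (cst 1) * _) (nr (cst 1) * _) => x y z t p h0 h1 h2.
have := sqr_ge0 (x - y); rewrite !expr2 in h0 h1 *; nra.
Qed.

Lemma Mq_le u a b : V w u -> nr (Mq u a b) <= 2 * (gs u * N2 (Ff0 u)).
Proof.
move=> Vu; have [_ H] := H10_mul ow bw (V_H10D a Vu) (V_H10D b Vu).
have g1 s : 0 <= nr (D s (u i3)) <= gs u.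
  by rewrite nr_ge0/=; apply: (sum2_ge (x := fun s => nr (D s (u i3))) s) => ?; exact: nr_ge0.
have h1 s t : 0 <= nr (D s (D t (u i3))) <= N2 (Ff0 u).
  by rewrite nr_ge0/=; exact: (nr_le_N2 w (Ff0 u) s t).
exact: (sqr_le_product (g1 a) (h1 0 a) (g1 b) (h1 1 b) H).
Qed.

(** A diagonal entry of [Ml] is twice [D a u_a]. [H10_korn] then bounds each cross derivative by the
    diagonal ones and by the sum of the two cross derivatives, which is the off-diagonal entry. *)
Lemma korn u : V w u -> hs u <= 4 * N2 (Ml u).
Proof.
move=> Vu.
have D2 a : 2 * nr (D a (u (lat a))) = nr (Ml u a a).
  have -> : Ml u a a = 2 *: D a (u (lat a)) by rewrite scaler_nat mulr2n.
  by rewrite (nrZ mw _ (V_sqiD ow bw a (lat a) Vu)) ger0_norm.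
have K := H10_korn ow bw (V_H10 ow bw (lat 0) Vu) (V_H10 ow bw (lat 1) Vu).
have E : nr (D 0 (u (lat 1)) + D 1 (u (lat 0))) = nr (Ml u 0 1) by rewrite addrC.
rewrite E in K.
have l : nr (Ml u 0 0) + nr (Ml u 0 1) + nr (Ml u 1 1) <= N2 (Ml u).
  rewrite /N2 !big_ord_recl !big_ord0 (_ : lift ord0 ord0 = 1 :> 'I_2)//; last exact: val_inj.
  have := nr_ge0 (@leb2 R) w (Ml u 1 ord0).
  rewrite (_ : ord0 = 0 :> 'I_2)//; move: (nr _) (nr _) (nr _) (nr _) => *; lra.
have [k1 k2 k3 k4] := korn_arith (nr_ge0 _ _ _) (nr_ge0 _ _ _) (nr_ge0 _ _ _) (nr_ge0 _ _ _) (nr_ge0 _ _ _)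
  (nr_ge0 _ _ _) (nr_ge0 _ _ _) (D2 0) (D2 1) K l.
by apply: N2_le; apply: ord2P; apply: ord2P.
Qed.

Context (lam mu k1 k2 : R) (p : 'I_3 -> plane -> R).
Context (lam0 : 0 <= lam) (mu0 : 0 < mu) (k10 : 0 < k1) (k20 : 0 < k2) (sp : forall i, sqi (p i)).

Definition lin c u : R := \sum_i ip (p i) (cS c * u i).

Definition Jc c u : R :=
  2^-1 * (k1 * Bf w (cQ c) (Ff c u) (Ff c u) + k2 * Bf w (cQ c) (Ef c u) (Ef c u)) - lin c u.

(** All that is retained of an immersion: uniform closeness of the coefficients to those of the
    plate, and the minor symmetries of the elasticity tensor. *)
Definition near_flat eta c := [/\ mbd4 eta (cQ c - Q0 lam mu), mbdc eta c,
  mbd eta (cS c - cst 1) & sym4 w (cQ c)].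

Definition KQ : R := \sum_a \sum_b \sum_s \sum_t `|elast lam mu 1%:M a b s t|.

Lemma KQ_ge0 : 0 <= KQ. Proof. by do 4!(apply: sumr_ge0 => ? _); exact: normr_ge0. Qed.

Lemma Q0_mbd : mbd4 KQ (Q0 lam mu).
Proof.
move=> a b s t; split=> [|y _]; first exact: measurable_cst.
rewrite /Q0 /=; have p4 (c d e' f : 'I_2) : 0 <= `|elast lam mu 1%:M c d e' f| by exact: normr_ge0.
apply: (le_trans (sum2_ge (x := fun t => `|elast lam mu 1%:M a b s t|) t _)) => [c|]; first exact: p4.
apply: (le_trans (sum2_ge (x := fun s => \sum_t `|elast lam mu 1%:M a b s t|) s _)) => [c|].
  by apply: sumr_ge0 => d _; exact: p4.
apply: (le_trans (sum2_ge (x := fun b => \sum_s \sum_t `|elast lam mu 1%:M a b s t|) b _)) => [c|].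
  by do 2!(apply: sumr_ge0 => ? _); exact: p4.
apply: (sum2_ge (x := fun a => \sum_b \sum_s \sum_t `|elast lam mu 1%:M a b s t|) a) => c.
by do 3!(apply: sumr_ge0 => ? _); exact: p4.
Qed.

Lemma mbdD K L f g : mbd K f -> mbd L g -> mbd (K + L) (f + g).
Proof.
move=> [mf fK] [mg gL]; split; first exact: measurable_funD.
by move=> y wy; apply: (le_trans (ler_normD _ _)); apply: lerD; [exact: fK|exact: gL].
Qed.

Lemma near_flat_Q eta c : near_flat eta c -> mbd4 (eta + KQ) (cQ c).
Proof.
move=> [bQ _ _ _] a b s t; have := mbdD (bQ a b s t) (Q0_mbd a b s t).
by rewrite subrK.
Qed.

Lemma near_flat_S eta c : near_flat eta c -> mbd (eta + 1) (cS c).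
Proof.
move=> [_ _ bS _]; have := mbdD bS (mbd_cst w 1).
by rewrite subrK normr1.
Qed.

Lemma lin_le eta c u : 0 <= eta <= 1 -> near_flat eta c -> V w u ->
  `|lin c u| <= 2 * (\sum_i nr (p i)) * Vnorm w u.
Proof.
move=> /andP[e0 e1] nc Vu; have bS := near_flat_S nc.
apply: (le_trans (ler_norm_sum _ _ _)); rewrite -mulrA mulrC -mulrA big_distrl/=; apply: ler_sum => i _.
have su := V_sqi ow bw i Vu.
apply: (le_trans (ip_le mw (sp i) (mbd_sqi mw bS su))); apply: ler_wpM2l; first exact: nr_ge0.
have e10 : 0 <= eta + 1 by lra.
apply: (le_trans (mbd_nr mw e10 bS su)); rewrite mulrC; apply: ler_pM => //; [exact: nr_ge0| |lra].
exact: (comp_le_Vnorm w (inl (inl i))).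
Qed.

Lemma Ff_sqi eta c u : near_flat eta c -> V w u -> tsqi (Ff c u).
Proof. by move=> [_ bc _ _] Vu; apply: tsqiB => //; [exact: Ff0_sqi|exact: Fr_sqi bc Vu]. Qed.

Lemma Ef_sqi eta c u : near_flat eta c -> V w u -> tsqi (Ef c u).
Proof. by move=> [_ bc _ _] Vu; apply: tsqiB => //; [exact: Ef0_sqi|exact: Er_sqi bc Vu]. Qed.

End energy.

(** * Coercivity *)

Section arith.
Context {R : realType}.

Lemma small_radius (x y z : R) : 0 <= x -> 0 <= y -> 0 <= z ->
  exists2 e : R, 0 < e & [/\ e <= 1, e * x <= 1, e * y <= 1 & e * z <= 1].
Proof.
move=> x0 y0 z0; have s0 : 0 < 1 + x + y + z by lra.
exists (1 + x + y + z)^-1; first by rewrite invr_gt0.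
have H t : t <= 1 + x + y + z -> (1 + x + y + z)^-1 * t <= 1.
  by move=> ht; rewrite mulrC ler_pdivrMr// mul1r.
by split; [rewrite -[X in X <= _]mulr1|..]; apply: H; lra.
Qed.

Lemma energy_lower (kk k1 k2 mu f e x y l P n : R) : 0 < mu -> 0 <= kk -> kk <= k1 -> kk <= k2 ->
  mu / 32 * f ^+ 2 <= x -> mu / 32 * e ^+ 2 <= y -> `|l| <= P * n ->
  kk * mu / 64 * (f ^+ 2 + e ^+ 2) - P * n <= 2^-1 * (k1 * x + k2 * y) - l.
Proof.
move=> mu0 kk0 h1 h2 hx hy; rewrite ler_norml => /andP[_ hl].
have p1 : 0 <= mu / 32 * f ^+ 2 by rewrite mulr_ge0 ?sqr_ge0// divr_ge0// ltW.
have p2 : 0 <= mu / 32 * e ^+ 2 by rewrite mulr_ge0 ?sqr_ge0// divr_ge0// ltW.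
have a1 : kk * (mu / 32 * f ^+ 2) <= k1 * x by apply: ler_pM.
have a2 : kk * (mu / 32 * e ^+ 2) <= k2 * y by apply: ler_pM.
have E : kk * mu / 64 * (f ^+ 2 + e ^+ 2) = 2^-1 * (kk * (mu / 32 * f ^+ 2) + kk * (mu / 32 * e ^+ 2)) by field.
rewrite E; move: a1 a2; move: (kk * (_ * f ^+ 2)) (kk * (_ * e ^+ 2)) (k1 * x) (k2 * y) (P * n) hl => *; lra.
Qed.

Lemma sqr_cvg0 (I : Type) (F : set_system I) (FF : ProperFilter F) (x : I -> R) :
  (\forall i \near F, 0 <= x i) -> x i ^+ 2 @[i --> F] --> (0 : R) -> x i @[i --> F] --> (0 : R).
Proof.
move=> x0 /cvgrPdist_le H; apply/cvgrPdist_le => e e0.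
have e20 : 0 < e ^+ 2 by rewrite exprn_gt0.
have := H _ e20; apply: filterS2 x0 => i xi; rewrite !sub0r !normrN !ger0_norm ?sqr_ge0//.
by rewrite ler_sqr ?nnegrE// ltW.
Qed.

Lemma cvg0Z (I : Type) (F : set_system I) (FF : ProperFilter F) (x : I -> R) k :
  x i @[i --> F] --> (0 : R) -> k * x i @[i --> F] --> (0 : R).
Proof. by move=> H; rewrite -(mulr0 k); apply: cvgM => //; exact: cvg_cst. Qed.

End arith.

Section energy.
Context {R : realType}.
Local Notation plane := (R * R)%type.
Local Notation mplane := (measurableTypeR R * measurableTypeR R)%type.
Local Notation field := ('I_3 -> plane -> R).
Local Notation tens := ('I_2 -> 'I_2 -> plane -> R).
Context (w : set plane) (ow : open w) (bw : bounded_set w).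
Local Notation sqi := (sqi (@leb2 R) w).
Local Notation ip := (ip (@leb2 R) w).
Local Notation nr := (nr (@leb2 R) w).
Local Notation D := (wd w).
Local Notation N2 := (N2 w).
Local Notation Bf := (Bf w).
Local Notation tsqi := (tsqi w).
Local Notation mbd := (mbd w).
Local Notation mbd4 := (mbd4 w).
Local Notation Ef := (Ef w).
Local Notation Ff := (Ff w).
Local Notation Ef0 := (Ef0 w).
Local Notation Ff0 := (Ff0 w).
Local Notation Mq := (Mq w).
Local Notation Ml := (Ml w).
Implicit Types (f g h : plane -> R) (a b s t : 'I_2) (u v : field) (c : coef R) (eta : R) (X Y : tens).
Let mw : measurable (w : set mplane) := mw ow.
Let fw := fw ow bw.
Context (lam mu k1 k2 : R) (p : 'I_3 -> plane -> R).
Context (lam0 : 0 <= lam) (mu0 : 0 < mu) (k10 : 0 < k1) (k20 : 0 < k2) (sp : forall i, sqi (p i)).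
Local Notation near_flat := (near_flat w lam mu).
Local Notation Jc := (Jc w k1 k2 p).
Local Notation KQ := (KQ lam mu).

Lemma near_flat_mono eta eta' c : eta <= eta' -> near_flat eta c -> near_flat eta' c.
Proof.
move=> ee [h1 [h2 h3] h4 h5].
have M f : mbd eta f -> mbd eta' f by move=> [mf fe]; split=> // y wy; apply: le_trans ee; exact: fe.
by split=> // [a b s t||]; [exact/M/h1|split=> [s a b|a b]; [exact/M/h2|exact/M/h3]|exact: M].
Qed.

Lemma sym_split X Y : X + tr2 X = (X - Y) + tr2 (X - Y) + (Y + tr2 Y).
Proof. by rewrite addrACA subrK; congr (_ + _); apply/funext => a; apply/funext => b; exact/esym/subrK. Qed.

(** The level 1 is enough: since [Jc c 0 <= 0], it is above the energy of every minimizer, and of a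
    minimizing sequence with excess at most 1. *)
Definition unif_coercive (eta0 X M : R) := forall c u, near_flat eta0 c -> V w u ->
  - X <= Jc c u /\ (Jc c u <= 1 -> Vnorm w u <= M).

Lemma Jc_coercive : exists eta0 X M : R, [/\ 0 < eta0, eta0 <= 1, eta0 <= mu / 2 & unif_coercive eta0 X M].
Proof.
have [C C0 HC] := gs_poincare ow bw; have [K K0 HK] := V_poincare ow bw.
pose K1 := nr (cst 1); have K10 : 0 <= K1 by exact: nr_ge0.
pose P := 2 * \sum_i nr (p i).
have P0 : 0 <= P by rewrite mulr_ge0// sumr_ge0// => i _; exact: nr_ge0.
pose kk := Num.min k1 k2.
have kk0 : 0 < kk by rewrite lt_min k10.
have kk1 : kk <= k1 by rewrite ge_min lexx.
have kk2 : kk <= k2 by rewrite ge_min lexx orbT.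
pose m := kk * mu / 64; have m0 : 0 < m by rewrite divr_gt0// mulr_gt0.
(* Small enough for [64 * P * K * k <= m]; the added 1 keeps the denominator positive. *)
pose k := m / (64 * (P * K + 1)).
have PK0 : 0 < 64 * (P * K + 1) by rewrite mulr_gt0// ltr_wpDl// mulr_ge0.
have k0 : 0 < k by rewrite divr_gt0.
pose A := 4 + 32 * K1 / k.
have A0 : 0 <= A by apply: addr_ge0 => //; apply: divr_ge0; [exact: mulr_ge0|exact: ltW].
(* Three smallness conditions: [e0 <= mu / 2] for the coercivity of the elasticity tensor,
   [8 * e0 * C <= 1] to recover the Hessian from [Ff], and [48 * K * A * e0 <= 1] for the error in
   the membrane strain. *)
have [|||e0 e00 [e1 e2 e3 e4]] := @small_radius R (2 / mu) (8 * C) (48 * K * A).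
- by rewrite divr_ge0// ltW.
- by rewrite mulr_ge0.
- by rewrite !mulr_ge0.
(* The two other constants are supplied by [coercive_arith2] at the end; they involve neither [c]
   nor [u]. *)
exists e0; eexists; eexists; split=> //.
  by move: e2; rewrite mulrA ler_pdivrMr// mul1r => ?; lra.
move=> c u nc Vu.
have e0mu : 0 <= e0 <= mu / 2.
  by rewrite ltW//=; move: e2; rewrite mulrA ler_pdivrMr// mul1r => ?; lra.
have [bQ bc bS sQ] := nc; have bQ' := near_flat_Q nc.
have sF := Ff_sqi ow bw nc Vu; have sE := Ef_sqi ow bw nc Vu.
have cF := Bf_coercive mw lam0 mu0 bQ' sQ e0mu bQ sF.
have cE := Bf_coercive mw lam0 mu0 bQ' sQ e0mu bQ sE.
set f := N2 _ in cF; set e := N2 _ in cE.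
have hl : `|lin w p c u| <= P * Vnorm w u by apply: (lin_le ow bw sp _ nc Vu); rewrite ltW.
have low := energy_lower mu0 (ltW kk0) kk1 kk2 cF cE hl.
have sF0 := Ff0_sqi ow Vu; have sFr := Fr_sqi ow bw bc Vu.
have sE0 := Ef0_sqi ow bw Vu; have sEr := Er_sqi ow bw bc Vu.
have H0 : 0 <= N2 (Ff0 u) by exact: N2_ge0.
have Hf : N2 (Ff0 u) <= f.
  apply: (hessian_arith H0 C0 (eta := e0)).
    by move: e3; rewrite (_ : e0 * (8 * C) = 8 * e0 * C)//; ring.
  rewrite -(hessian_sym ow bw Vu).
  have -> : Ff0 u + tr2 (Ff0 u) = (Ff c u + tr2 (Ff c u)) + (Fr w c u + tr2 (Fr w c u)).
    exact: sym_split.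
  apply: (le_trans (N2D mw (tsqiD mw sF (tsqi_tr sF)) (tsqiD mw sFr (tsqi_tr sFr)))).
  apply: lerD => //; apply: (le_trans (N2D mw sFr (tsqi_tr sFr))); rewrite N2_tr.
  have := Fr_le ow bw (ltW e00) bc Vu; have := ler_wpM2l (ltW e00) (HC u Vu).
  have -> : 2 * (4 * e0 * (C * N2 (Ff0 u))) = 8 * (e0 * (C * N2 (Ff0 u))) by ring.
  by move: (N2 (Fr w c u)) (e0 * gs w u) (e0 * (C * _)) => *; lra.
have he : N2 (Ef0 u + tr2 (Ef0 u)) <= e + 24 * e0 * Vnorm w u.
  have -> : Ef0 u + tr2 (Ef0 u) = (Ef c u + tr2 (Ef c u)) + (Er c u + tr2 (Er c u)).
    exact: sym_split.
  apply: (le_trans (N2D mw (tsqiD mw sE (tsqi_tr sE)) (tsqiD mw sEr (tsqi_tr sEr)))).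
  rewrite lerD2l; apply: (le_trans (N2D mw sEr (tsqi_tr sEr))); rewrite N2_tr -mulrA.
  by have := Er_le ow bw (ltW e00) bc Vu; move: (N2 _) (e0 * _) => *; lra.
have hg := trace_bound ow bw Vu.
have hh : hs w u <= 4 * (N2 (Ef0 u + tr2 (Ef0 u)) + 8 * (gs w u * N2 (Ff0 u))).
  apply: (le_trans (korn ow bw Vu)); apply: ler_wpM2l => //.
  have -> : Ml u = (Ef0 u + tr2 (Ef0 u)) - Mq u.
    by apply/funext => a; apply/funext => b; rewrite -[RHS]/((Ef0 u + tr2 (Ef0 u)) a b - Mq u a b) YE0 addrK.
  apply: (le_trans (N2B mw (tsqiD mw sE0 (tsqi_tr sE0)) (Mq_sqi ow bw Vu))); rewrite lerD2l.
  have -> : 8 * (gs w u * N2 (Ff0 u)) = 4 * (2 * (gs w u * N2 (Ff0 u))) by ring.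
  by apply: N2_le => a b; exact: (Mq_le ow bw a b Vu).
have hA2 : 48 * K * A * e0 <= 1 by rewrite mulrC.
have hk : 64 * P * K * k <= m.
  rewrite /k mulrA ler_pdivrMr// mulrC ler_wpM2l ?ltW//; lra.
have [c1 c2] := coercive_arith (Vnorm_ge0 w u) H0 (N2_ge0 _ _) (gs_ge0 w u) (N2_ge0 _ _) (ltW e00) K0 P0 k0 K10
  Hf he hg hh (HK u Vu) low erefl hA2 hk.
exact: (coercive_arith2 (N2_ge0 _ _) (N2_ge0 _ _) m0 K0 A0 k0 c1 c2).
Qed.

(** Turns weak convergence in V, known through continuous linear forms, into weak L^2 convergence of
    the components and of their derivatives. *)
Lemma Vdual_comp (j : cindex) h : sqi h -> Vdual w (fun u => ip (comp w j u) h).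
Proof.
move=> sh; split=> [k u v Vu Vv|].
  have sl := comp_sqi ow bw j (V_lin ow bw k Vu Vv); have su := comp_sqi ow bw j Vu; have sv := comp_sqi ow bw j Vv.
  rewrite -(ipZl mw k su sh) -(ipDl mw (sqiZ mw k su) sv sh); apply/eqP; rewrite -subr_eq0; apply/eqP.
  have sr := sqiD mw (sqiZ mw k su) sv.
  rewrite -(ipBl mw sl sr sh); apply: (ip_nr0l mw (sqiB mw sl sr) sh).
  exact: (comp_lin ow bw j k Vu Vv).
exists (nr h) => u Vu; apply: (le_trans (ip_le mw (comp_sqi ow bw j Vu) sh)).
by rewrite mulrC; apply: ler_wpM2l; [exact: nr_ge0|exact: comp_le_Vnorm].
Qed.

Section limits.
Context (I : Type) (U : set_system I) (PU : ProperFilter U).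

Definition wk (g_ : I -> plane -> R) g := [/\ sqi g, \forall i \near U, sqi (g_ i) &
  forall h, sqi h -> ip (g_ i) h @[i --> U] --> ip g h].

Lemma wk_ext (g_ g'_ : I -> plane -> R) g : (forall i, g_ i = g'_ i) -> wk g_ g -> wk g'_ g.
Proof. by move=> E; rewrite (_ : g_ = g'_)//; exact/funext. Qed.

Lemma wkD (f_ g_ : I -> plane -> R) f g : wk f_ f -> wk g_ g -> wk (fun i => f_ i + g_ i) (f + g).
Proof.
move=> [sf nf cf] [sg ng cg]; split; first exact: sqiD.
  by apply: filterS2 nf ng => i; exact: sqiD.
move=> h sh; rewrite (ipDl mw sf sg sh).
apply: cvg_trans (cvgD (cf h sh) (cg h sh)); apply: near_eq_cvg.
by apply: filterS2 nf ng => i si ti; rewrite (ipDl mw si ti sh).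
Qed.

Lemma wkZ (k : R) (f_ : I -> plane -> R) f : wk f_ f -> wk (fun i => k *: f_ i) (k *: f).
Proof.
move=> [sf nf cf]; split; first exact: sqiZ.
  by apply: filterS nf => i; exact: sqiZ.
move=> h sh; rewrite (ipZl mw k sf sh).
apply: cvg_trans (cvgM (cvg_cst k) (cf h sh)); apply: near_eq_cvg.
by apply: filterS nf => i si; rewrite (ipZl mw k si sh).
Qed.

Lemma wkB (f_ g_ : I -> plane -> R) f g : wk f_ f -> wk g_ g -> wk (fun i => f_ i - g_ i) (f - g).
Proof.
by move=> wf wg; rewrite -(scaleN1r g); apply: wk_ext (wkD wf (wkZ (-1) wg)) => i; rewrite scaleN1r.
Qed.

Lemma wkM K (q : plane -> R) (f_ : I -> plane -> R) f : mbd K q -> wk f_ f -> wk (fun i => q * f_ i) (q * f).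
Proof.
move=> bq [sf nf cf]; split; first exact: (mbd_sqi mw bq).
  by apply: filterS nf => i; exact: (mbd_sqi mw bq).
move=> h sh; have E g : ip (q * g) h = ip g (q * h) by exact: ip_mulA.
by rewrite E; under eq_fun do rewrite E; apply: cf; exact: (mbd_sqi mw bq).
Qed.

Lemma wk_sum (f_ : 'I_2 -> I -> plane -> R) (f : 'I_2 -> plane -> R) :
  (forall s, wk (f_ s) (f s)) -> wk (fun i => \sum_s f_ s i) (\sum_s f s).
Proof.
move=> H; rewrite !big_ord_recl big_ord0 addr0.
apply: wk_ext (wkD (H ord0) (H (lift ord0 ord0))) => i.
by rewrite !big_ord_recl big_ord0 addr0.
Qed.

Lemma wk_strong (f_ : I -> plane -> R) f : sqi f -> (\forall i \near U, sqi (f_ i)) ->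
  nr (f_ i - f) @[i --> U] --> (0 : R) -> wk f_ f.
Proof.
move=> sf nf cf; split=> // h sh; apply: (ip_cvg mw (v := fun=> h)) => //; first exact: nearW.
by under eq_fun do rewrite subrr nr0; exact: cvg_cst.
Qed.

Lemma wk_Bl K Q (X_ : I -> tens) X Y : mbd4 K Q -> tsqi Y -> (forall a b, wk (fun i => X_ i a b) (X a b)) ->
  Bf Q (X_ i) Y @[i --> U] --> Bf Q X Y.
Proof.
move=> bQ sY H; rewrite /Bf.
apply: cvg_big => [|a _]; first exact: add_continuous.
apply: cvg_big => [|b _]; first exact: add_continuous.
apply: cvg_big => [|s _]; first exact: add_continuous.
apply: cvg_big => [|t _]; first exact: add_continuous.
have [_ _ C] := wkM (bQ a b s t) (H s t); apply: C; exact: sY.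
Qed.

Lemma wk_Br K Q (X_ : I -> tens) X Y : mbd4 K Q -> tsqi Y -> (forall a b, wk (fun i => X_ i a b) (X a b)) ->
  Bf Q Y (X_ i) @[i --> U] --> Bf Q Y X.
Proof.
move=> bQ sY H; rewrite /Bf.
apply: cvg_big => [|a _]; first exact: add_continuous.
apply: cvg_big => [|b _]; first exact: add_continuous.
apply: cvg_big => [|s _]; first exact: add_continuous.
apply: cvg_big => [|t _]; first exact: add_continuous.
rewrite ipC; under eq_fun do rewrite ipC.
have [_ _ C] := H a b; apply: C; exact: (mbd_sqi mw (bQ _ _ _ _)).
Qed.

(** Expanding the form of [X_ i - X] cancels the term quadratic in [X_ i]; what is left is affine in
    [X_ i] and passes to the weak limit. *)
Lemma wk_Bdiff K Q (X_ : I -> tens) X : mbd4 K Q -> (forall a b, wk (fun i => X_ i a b) (X a b)) ->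
  Bf Q (X_ i) (X_ i) - Bf Q (X_ i - X) (X_ i - X) @[i --> U] --> Bf Q X X.
Proof.
move=> bQ H; have sX : tsqi X by move=> a b; have [] := H a b.
have C1 := wk_Bl bQ sX H; have C2 := wk_Br bQ sX H.
have C : Bf Q (X_ i) X + Bf Q X (X_ i) - Bf Q X X @[i --> U] --> Bf Q X X + Bf Q X X - Bf Q X X.
  by apply: cvgB; [exact: cvgD|exact: cvg_cst].
rewrite addrK in C; apply: cvg_trans C; apply: near_eq_cvg.
have nX : \forall i \near U, tsqi (X_ i).
  have F a b : \forall i \near U, sqi (X_ i a b) by have [] := H a b.
  apply: filterS2 (filterI (F 0 0) (F 0 1)) (filterI (F 1 0) (F 1 1)) => i [? ?] [? ?].
  by apply: ord2P; apply: ord2P.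
apply: filterS nX => i sXi; have sd := tsqiB mw sXi sX.
rewrite (BfBl mw bQ sXi sX sd) !(BfBr mw bQ _ sXi sX)//.
by move: (Bf _ _ _) (Bf _ _ _) (Bf _ _ _) (Bf _ _ _) => *; ring.
Qed.

End limits.

End energy.

(** * Weak limits of minimizers *)

Section arith.
Context {R : realType}.

Lemma product_le (x d e M g D : R) : 0 <= d -> 0 <= e <= 2 * M -> 0 <= g <= M -> 0 <= D <= M ->
  x <= 4 * ((d * e) * (g * D)) -> x <= 8 * M ^+ 3 * d.
Proof.
move=> d0 /andP[e0 eM] /andP[g0 gM] /andP[D0 DM] hx; apply: (le_trans hx).
have M0 : 0 <= M by lra.
have h : e * (g * D) <= 2 * M * (M * M) by rewrite !ler_pM// mulr_ge0.
have := ler_wpM2l d0 h; rewrite (_ : 8 * M ^+ 3 * d = 4 * (d * (2 * M * (M * M)))); last by ring.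
by rewrite -(mulrA d) => h2; rewrite ler_wpM2l.
Qed.

End arith.

Section energy.
Context {R : realType}.
Local Notation plane := (R * R)%type.
Local Notation mplane := (measurableTypeR R * measurableTypeR R)%type.
Local Notation field := ('I_3 -> plane -> R).
Local Notation tens := ('I_2 -> 'I_2 -> plane -> R).
Context (w : set plane) (ow : open w) (bw : bounded_set w).
Local Notation sqi := (sqi (@leb2 R) w).
Local Notation ip := (ip (@leb2 R) w).
Local Notation nr := (nr (@leb2 R) w).
Local Notation D := (wd w).
Local Notation N2 := (N2 w).
Local Notation Bf := (Bf w).
Local Notation tsqi := (tsqi w).
Local Notation mbd := (mbd w).
Local Notation mbd4 := (mbd4 w).
Local Notation Ef := (Ef w).
Local Notation Ff := (Ff w).
Local Notation Ef0 := (Ef0 w).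
Local Notation Ff0 := (Ff0 w).
Local Notation Mq := (Mq w).
Local Notation Ml := (Ml w).
Local Notation Er := (@Er R).
Implicit Types (f g h : plane -> R) (a b s t : 'I_2) (u v : field) (c : coef R) (eta : R) (X Y : tens).
Let mw : measurable (w : set mplane) := mw ow.
Let fw := fw ow bw.
Context (lam mu k1 k2 : R) (p : 'I_3 -> plane -> R).
Context (lam0 : 0 <= lam) (mu0 : 0 < mu) (k10 : 0 < k1) (k20 : 0 < k2) (sp : forall i, sqi (p i)).
Local Notation near_flat := (near_flat w lam mu).
Local Notation Jc := (Jc w k1 k2 p).
Local Notation KQ := (KQ lam mu).
Local Notation lin := (lin w p).

(** Of the four factors in Ladyzhenskaya's inequality, one is the L^2 distance and the three others
    are bounded: products converge as soon as one factor converges in L^2 with bounded gradients.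
    The primed variant places the difference second, the two places being differentiated in
    different directions. *)
Lemma H10_mul_dist f f' g M : H10 w f -> H10 w f' -> H10 w g -> nr (D 0 f) <= M -> nr (D 0 f') <= M ->
  nr g <= M -> nr (D 1 g) <= M -> nr ((f - f') * g) ^+ 2 <= 8 * M ^+ 3 * nr (f - f').
Proof.
move=> Hf Hf' Hg b1 b2 b3 b4; have [_ H] := H10_mul ow bw (H10_sub ow bw Hf Hf') Hg.
apply: (product_le (nr_ge0 _ _ _) _ _ _ H); rewrite ?nr_ge0//.
rewrite /= (nrD_sub ow bw 0 (H10_H1 Hf) (H10_H1 Hf')).
have s1 := H1_sqiD ow 0 (H10_H1 Hf); have s2 := H1_sqiD ow 0 (H10_H1 Hf').
apply: (le_trans (nrB mw s1 s2)); move: b1 b2; move: (nr _) (nr _) => *; lra.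
Qed.

Lemma H10_mul_dist' f f' g M : H10 w f -> H10 w f' -> H10 w g -> nr (D 1 f) <= M -> nr (D 1 f') <= M ->
  nr g <= M -> nr (D 0 g) <= M -> nr (g * (f - f')) ^+ 2 <= 8 * M ^+ 3 * nr (f - f').
Proof.
move=> Hf Hf' Hg b1 b2 b3 b4; have [_ H] := H10_mul ow bw Hg (H10_sub ow bw Hf Hf').
rewrite (_ : forall x y z t : R, (x * y) * (z * t) = (z * t) * (x * y)) in H; last by move=> *; ring.
apply: (product_le (nr_ge0 _ _ _) _ _ _ H); rewrite ?nr_ge0//.
rewrite /= (nrD_sub ow bw 1 (H10_H1 Hf) (H10_H1 Hf')).
have s1 := H1_sqiD ow 1 (H10_H1 Hf); have s2 := H1_sqiD ow 1 (H10_H1 Hf').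
apply: (le_trans (nrB mw s1 s2)); move: b1 b2; move: (nr _) (nr _) => *; lra.
Qed.

(** Evaluated on differences of strains and not on the strains of [u - v], because [Ef] is not
    linear. *)
Definition Qd c u v : R := k1 * Bf (cQ c) (Ff c u - Ff c v) (Ff c u - Ff c v) +
  k2 * Bf (cQ c) (Ef c u - Ef c v) (Ef c u - Ef c v).

Section limits.
Context (I : Type) (U : set_system I) (PU : ProperFilter U) (u_ : I -> field) (u : field) (M : R).
Context (Bu : \forall i \near U, V w (u_ i) /\ Vnorm w (u_ i) <= M) (Vu : V w u) (uM : Vnorm w u <= M).
Context (cD : forall a, nr (D a (u_ i i3) - D a (u i3)) @[i --> U] --> (0 : R)).
Context (cL : forall L, Vdual w L -> L (u_ i) @[i --> U] --> L u).
Local Notation wk := (wk w U).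

Lemma Vnear : \forall i \near U, V w (u_ i). Proof. by apply: filterS Bu => i []. Qed.

Lemma Mq_cvg a b : nr (Mq (u_ i) a b - Mq u a b) @[i --> U] --> (0 : R).
Proof.
pose x i := nr ((D a (u_ i i3) - D a (u i3)) * D b (u_ i i3)).
pose y i := nr (D a (u i3) * (D b (u_ i i3) - D b (u i3))).
have C1 : x i @[i --> U] --> (0 : R).
  apply: sqr_cvg0; first by apply: nearW => i; exact: nr_ge0.
  apply: (cvg0_squeeze (b := fun i => 8 * M ^+ 3 * nr (D a (u_ i i3) - D a (u i3)))); last exact: cvg0Z.
  apply: filterS Bu => i [Vi Mi]; rewrite sqr_ge0/=; apply: H10_mul_dist; do ?exact: V_H10D.
  - exact: le_trans (comp_le_Vnorm w (inr (a, 0)) _) Mi.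
  - exact: le_trans (comp_le_Vnorm w (inr (a, 0)) _) uM.
  - exact: le_trans (comp_le_Vnorm w (inl (inr (i3, b))) _) Mi.
  - exact: le_trans (comp_le_Vnorm w (inr (b, 1)) _) Mi.
have C2 : y i @[i --> U] --> (0 : R).
  apply: sqr_cvg0; first by apply: nearW => i; exact: nr_ge0.
  apply: (cvg0_squeeze (b := fun i => 8 * M ^+ 3 * nr (D b (u_ i i3) - D b (u i3)))); last exact: cvg0Z.
  apply: filterS Bu => i [Vi Mi]; rewrite sqr_ge0/=; apply: H10_mul_dist'; do ?exact: V_H10D.
  - exact: le_trans (comp_le_Vnorm w (inr (b, 1)) _) Mi.
  - exact: le_trans (comp_le_Vnorm w (inr (b, 1)) _) uM.
  - exact: le_trans (comp_le_Vnorm w (inl (inr (i3, a))) _) uM.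
  - exact: le_trans (comp_le_Vnorm w (inr (a, 0)) _) uM.
apply: cvg0_squeeze (cvgD0 _ C1 C2); apply: filterS Vnear => i Vi; rewrite nr_ge0/=.
rewrite (_ : _ - _ = (D a (u_ i i3) - D a (u i3)) * D b (u_ i i3) + D a (u i3) * (D b (u_ i i3) - D b (u i3))); last first.
  by rewrite /Mq; ring.
apply: nrD => //; apply: (H10_mul ow bw _ _).1; do ?exact: V_H10D; apply: H10_sub => //; exact: V_H10D.
Qed.

Lemma wk_comp (j : cindex) : wk (fun i => comp w j (u_ i)) (comp w j u).
Proof.
split; first exact: comp_sqi.
  by apply: filterS Vnear => i Vi; exact: comp_sqi.
by move=> h sh; apply: (cL (Vdual_comp ow bw j sh)).
Qed.

Lemma wk_u i : wk (fun k => u_ k i) (u i). Proof. exact: (wk_comp (inl (inl i))). Qed.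
Lemma wk_D i a : wk (fun k => D a (u_ k i)) (D a (u i)). Proof. exact: (wk_comp (inl (inr (i, a)))). Qed.

Lemma wk_Ff eta c a b : mbdc w eta c -> wk (fun i => Ff c (u_ i) a b) (Ff c u a b).
Proof.
move=> [bG _]; apply: (wkB ow PU (f_ := fun i => Ff0 (u_ i) a b) (g_ := fun i => Fr w c (u_ i) a b) (wk_comp (inr (b, a)))).
apply: (wk_sum ow PU (f_ := fun s i => cG c s a b * D s (u_ i i3))) => s.
exact: (wkM ow PU (bG s a b) (wk_D i3 s)).
Qed.

Lemma wk_Ef eta c a b : mbdc w eta c -> wk (fun i => Ef c (u_ i) a b) (Ef c u a b).
Proof.
move=> [bG bB]; apply: (wkB ow PU (f_ := fun i => Ef0 (u_ i) a b) (g_ := fun i => Er c (u_ i) a b)).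
  apply: (wkD ow PU); apply: (wkZ ow PU); first exact: (wkD ow PU (wk_D _ _) (wk_D _ _)).
  apply: (wk_strong ow PU _ _ (Mq_cvg a b)); first exact: Mq_sqi.
  by apply: filterS Vnear => i Vi; exact: Mq_sqi.
apply: (wkD ow PU).
  apply: (wk_sum ow PU (f_ := fun s i => cG c s a b * u_ i (lat s))) => s.
  exact: (wkM ow PU (bG s a b) (wk_u _)).
exact: (wkM ow PU (bB a b) (wk_u _)).
Qed.

Lemma lin_cvg eta c : near_flat eta c -> lin c (u_ i) @[i --> U] --> lin c u.
Proof.
move=> nc; have bS := near_flat_S nc.
rewrite /lin; apply: cvg_big => [|i _]; first exact: add_continuous.
have [_ _ C] := wkM ow PU bS (wk_u i).
by rewrite ipC; under eq_fun do rewrite ipC; apply: C.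
Qed.

Lemma Jc_key eta c : near_flat eta c ->
  Jc c (u_ i) - 2^-1 * Qd c (u_ i) u @[i --> U] --> Jc c u.
Proof.
move=> nc; have bQ := near_flat_Q nc; have [_ bc _ _] := nc.
have C1 := wk_Bdiff ow PU bQ (fun a b => wk_Ff a b bc).
have C2 := wk_Bdiff ow PU bQ (fun a b => wk_Ef a b bc).
have C3 := lin_cvg nc.
have C : 2^-1 * (k1 * (Bf (cQ c) (Ff c (u_ i)) (Ff c (u_ i)) - Bf (cQ c) (Ff c (u_ i) - Ff c u) (Ff c (u_ i) - Ff c u)) +
   k2 * (Bf (cQ c) (Ef c (u_ i)) (Ef c (u_ i)) - Bf (cQ c) (Ef c (u_ i) - Ef c u) (Ef c (u_ i) - Ef c u))) - lin c (u_ i)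
   @[i --> U] --> Jc c u.
  apply: cvgB => //; apply: cvgM; first exact: cvg_cst.
  by apply: cvgD; apply: cvgM => //; exact: cvg_cst.
apply: cvg_trans C; apply: near_eq_cvg; apply: nearW => i; rewrite /Jc /Qd.
by move: (Bf _ _ _) (Bf _ _ _) (Bf _ _ _) (Bf _ _ _) (lin _ _) => *; ring.
Qed.

Lemma Qd_ge0 eta c v v' : eta <= mu / 2 -> 0 <= eta -> near_flat eta c -> V w v -> V w v' ->
  mu / 32 * (k1 * N2 ((Ff c v - Ff c v') + tr2 (Ff c v - Ff c v')) ^+ 2 +
    k2 * N2 ((Ef c v - Ef c v') + tr2 (Ef c v - Ef c v')) ^+ 2) <= Qd c v v'.
Proof.
move=> e2 e0 nc Vv Vv'; have bQ := near_flat_Q nc; have [bQ' _ _ sQ] := nc.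
have ee : 0 <= eta <= mu / 2 by rewrite e0.
have sF := tsqiB mw (Ff_sqi ow bw nc Vv) (Ff_sqi ow bw nc Vv').
have sE := tsqiB mw (Ef_sqi ow bw nc Vv) (Ef_sqi ow bw nc Vv').
have h1 := ler_wpM2l (ltW k10) (Bf_coercive mw lam0 mu0 bQ sQ ee bQ' sF).
have h2 := ler_wpM2l (ltW k20) (Bf_coercive mw lam0 mu0 bQ sQ ee bQ' sE).
apply: le_trans (lerD h1 h2); by move: (N2 _) (N2 _) => x y; rewrite le_eqVlt; apply/orP; left; apply/eqP; ring.
Qed.

End limits.

End energy.

(** If the preimage of a neighbourhood were not in [F], then [F] and the complement of this preimage
    would lie in a common ultrafilter, along which convergence fails. It replaces the criterion that
    every subsequence has a further subsequence with the same limit. *)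
Lemma ultra_cvg (T : topologicalType) (I : Type) (F : set_system I) (FF : ProperFilter F) (x : I -> T) (l : T) :
  (forall U, UltraFilter U -> F `<=` U -> x i @[i --> U] --> l) -> x i @[i --> F] --> l.
Proof.
move=> H B Bl; apply: contrapT => nB.
have PG : ProperFilter (within (~` (x @^-1` B)) F).
  split; last exact: within_filter.
  rewrite /within/= => F0; apply: nB; apply: filterS F0 => i h; apply: contrapT => nBi; exact: h.
have [U [UU GU]] := ultraFilterLemma PG.
have FU : F `<=` U.
  by move=> A FA; apply: GU; apply: filterS FA => i Ai _.
have UB : U (x @^-1` B) := H U UU FU B Bl.
have UnB : U (~` (x @^-1` B)) by apply: GU; apply: nearW.
have PU : ProperFilter U by exact: ultra_proper.
by have [i [Bi nBi]] := filter_ex (filterI UB UnB).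
Qed.

Lemma norm_comb {R : realType} (k1 k2 x y a b : R) : 0 <= k1 -> 0 <= k2 -> `|x| <= a -> `|y| <= b ->
  `|2^-1 * (k1 * x + k2 * y)| <= 2^-1 * (k1 * a + k2 * b).
Proof.
move=> k10 k20 xa yb; rewrite normrM ger0_norm// ler_wpM2l//; apply: (le_trans (ler_normD _ _)).
by rewrite !normrM (ger0_norm k10) (ger0_norm k20); apply: lerD; apply: ler_wpM2l.
Qed.

(** * Comparison with the plate energy, and existence of minimizers *)

Section energy.
Context {R : realType}.
Local Notation plane := (R * R)%type.
Local Notation mplane := (measurableTypeR R * measurableTypeR R)%type.
Local Notation field := ('I_3 -> plane -> R).
Local Notation tens := ('I_2 -> 'I_2 -> plane -> R).
Context (w : set plane) (ow : open w) (bw : bounded_set w).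
Local Notation sqi := (sqi (@leb2 R) w).
Local Notation ip := (ip (@leb2 R) w).
Local Notation nr := (nr (@leb2 R) w).
Local Notation D := (wd w).
Local Notation N2 := (N2 w).
Local Notation Bf := (Bf w).
Local Notation tsqi := (tsqi w).
Local Notation mbd := (mbd w).
Local Notation mbd4 := (mbd4 w).
Local Notation Ef := (Ef w).
Local Notation Ff := (Ff w).
Local Notation Ef0 := (Ef0 w).
Local Notation Ff0 := (Ff0 w).
Local Notation Mq := (Mq w).
Local Notation Ml := (Ml w).
Local Notation Er := (@Er R).
Implicit Types (f g h : plane -> R) (a b s t : 'I_2) (u v : field) (c : coef R) (eta : R) (X Y : tens).
Let mw : measurable (w : set mplane) := mw ow.
Let fw := fw ow bw.
Context (lam mu k1 k2 : R) (p : 'I_3 -> plane -> R).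
Context (lam0 : 0 <= lam) (mu0 : 0 < mu) (k10 : 0 < k1) (k20 : 0 < k2) (sp : forall i, sqi (p i)).
Local Notation near_flat := (near_flat w lam mu).
Local Notation Jc := (Jc w k1 k2 p).
Local Notation KQ := (KQ lam mu).
Local Notation lin := (lin w p).
Local Notation Qd := (Qd w k1 k2).

Definition flat : coef R := Coef (Q0 lam mu) (fun _ _ _ => 0) (fun _ _ => 0) (cst 1).

Lemma near_flat_flat : near_flat 0 flat.
Proof.
have m0 : mbd 0 (0 : plane -> R) by split; [exact: measurable_cst|move=> y _; rewrite normr0].
split=> //.
- move=> a b s t; have E : (cQ flat - Q0 lam mu) a b s t = 0 by apply/funext => y; exact: subrr.
  by rewrite E; exact: m0.
- by rewrite /= subrr.
- have I a b : (1%:M : 'M[R]_2) a b = 1%:M b a by rewrite !mxE eq_sym.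
  move=> a b s t y _; rewrite /= /Q0 /elast; split.
    by rewrite /cst (I a b); move: (1%:M b a) (1%:M s t) (1%:M a s) (1%:M b t) (1%:M a t) (1%:M b s) => *; ring.
  by rewrite /cst (I s t); move: (1%:M a b) (1%:M t s) (1%:M a s) (1%:M b t) (1%:M a t) (1%:M b s) => *; ring.
Qed.

Lemma Ff_flat u : Ff flat u = Ff0 u.
Proof.
apply/funext => a; apply/funext => b; apply/funext => y.
rewrite -[LHS]/(Ff0 u a b y - (\sum_s (0 : plane -> R) * D s (u i3)) y).
by rewrite big1 ?subr0// => s _; rewrite mul0r.
Qed.

Lemma Ef_flat u : Ef flat u = Ef0 u.
Proof.
apply/funext => a; apply/funext => b; apply/funext => y.
rewrite -[LHS]/(Ef0 u a b y - (\sum_s (0 : plane -> R) * u (lat s) + (0 : plane -> R) * u i3) y).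
by rewrite mul0r addr0 big1 ?subr0// => s _; rewrite mul0r.
Qed.

Lemma V0 : V w (0 : field).
Proof.
have t0 := @test0 R w.
by split=> [a|]; [exact: test_H10|exact: test_H20].
Qed.

Lemma Vnorm0 : Vnorm w (0 : field) = 0.
Proof.
have := Vnorm_eq0 ow bw V0 V0; rewrite subrr; apply=> i.
by rewrite subrr nr0.
Qed.

Section bounds.
Context (M : R) (u : field) (Vu : V w u) (uM : Vnorm w u <= M).

Lemma Ff0_le : N2 (Ff0 u) <= 4 * M.
Proof. by apply: N2_le => a b; exact: le_trans (comp_le_Vnorm w (inr (b, a)) u) uM. Qed.

Lemma gs_le : gs w u <= 2 * M.
Proof.
have H s : nr (D s (u i3)) <= M by exact: le_trans (comp_le_Vnorm w (inl (inr (i3, s))) u) uM.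
rewrite /gs !big_ord_recl big_ord0; have := H ord0; have := H (lift ord0 ord0).
move: (nr _) (nr _) => *; lra.
Qed.

Lemma Ef0_le : N2 (Ef0 u) <= 4 * (M + 8 * M ^+ 2).
Proof.
apply: N2_le => a b.
have sl := Ml_sqi ow bw Vu a b; have sq := Mq_sqi ow bw Vu a b.
apply: (le_trans (nrD mw (sqiZ mw _ sl) (sqiZ mw _ sq))).
rewrite (nrZ mw _ sl) (nrZ mw _ sq) ger0_norm//.
have h1 : nr (Ml u a b) <= 2 * M.
  apply: (le_trans (nrD mw (V_sqiD ow bw b _ Vu) (V_sqiD ow bw a _ Vu))).
  have := le_trans (comp_le_Vnorm w (inl (inr (lat a, b))) u) uM.
  have := le_trans (comp_le_Vnorm w (inl (inr (lat b, a))) u) uM.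
  by rewrite /comp; move: (nr _) (nr _) => *; lra.
have h2 : nr (Mq u a b) <= 16 * M ^+ 2.
  apply: (le_trans (Mq_le ow bw a b Vu)).
  have := ler_pM (gs_ge0 w u) (N2_ge0 w (Ff0 u)) gs_le Ff0_le.
  by rewrite (_ : 2 * M * (4 * M) = 8 * M ^+ 2)//; [move: (gs w u * _) (M ^+ 2) => *; lra|ring].
by move: h1 h2; move: (nr _) (nr _) (M ^+ 2) => *; lra.
Qed.

Context (eta : R) (c : coef R) (e0 : 0 <= eta) (nc : near_flat eta c).

Lemma Ff_dist : N2 (Ff c u - Ff flat u) <= 8 * M * eta.
Proof.
have [_ bc _ _] := nc; rewrite Ff_flat.
have -> : Ff c u - Ff0 u = 0 - Fr w c u by rewrite /Ff addrAC subrr.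
have s0 : tsqi (0 : tens) by move=> a b; exact: sqi0.
apply: (le_trans (N2B mw s0 (Fr_sqi ow bw bc Vu))).
have -> : N2 (0 : tens) = 0 by rewrite /N2 big1// => a _; rewrite big1// => b _; exact: nr0.
rewrite add0r; apply: (le_trans (Fr_le ow bw e0 bc Vu)).
have := ler_wpM2l e0 gs_le; rewrite (_ : eta * (2 * M) = 2 * (M * eta)); last by ring.
by rewrite -(mulrA 8); move: (eta * _) (M * eta) => *; lra.
Qed.

Lemma Ef_dist : N2 (Ef c u - Ef flat u) <= 12 * M * eta.
Proof.
have [_ bc _ _] := nc; rewrite Ef_flat.
have -> : Ef c u - Ef0 u = 0 - Er c u by rewrite /Ef addrAC subrr.
have s0 : tsqi (0 : tens) by move=> a b; exact: sqi0.
apply: (le_trans (N2B mw s0 (Er_sqi ow bw bc Vu))).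
have -> : N2 (0 : tens) = 0 by rewrite /N2 big1// => a _; rewrite big1// => b _; exact: nr0.
rewrite add0r; apply: (le_trans (Er_le ow bw e0 bc Vu)).
have := ler_wpM2l e0 uM; rewrite (_ : 12 * M * eta = 12 * (eta * M)); last by ring.
by move: (eta * _) (eta * M) => *; lra.
Qed.

(** A common bound for both strains of a field of norm at most [M]: the plate bound of [Ef0_le],
    with room for the distances [8 * M * eta] and [12 * M * eta] when [eta <= 1]. *)
Definition bnd : R := 4 * (M + 8 * M ^+ 2) + 20 * M.

Lemma M_ge0 : 0 <= M. Proof. exact: le_trans (Vnorm_ge0 w u) uM. Qed.

Lemma Ff0_bnd : N2 (Ff flat u) <= bnd.
Proof.
rewrite Ff_flat /bnd; have := Ff0_le; have := M_ge0; have := sqr_ge0 M.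
by move: (N2 _) (M ^+ 2) => *; lra.
Qed.

Lemma Ef0_bnd : N2 (Ef flat u) <= bnd.
Proof.
rewrite Ef_flat /bnd; have := Ef0_le; have := M_ge0.
by move: (N2 _) (M ^+ 2) => *; lra.
Qed.

Context (e1 : eta <= 1).

Lemma Ff_bnd : N2 (Ff c u) <= bnd.
Proof.
have s0 := Ff_sqi ow bw near_flat_flat Vu; have s1 := Ff_sqi ow bw nc Vu.
rewrite -(subrK (Ff flat u) (Ff c u)); apply: (le_trans (N2D mw (tsqiB mw s1 s0) s0)).
apply: (le_trans (lerD Ff_dist (lexx _))); rewrite Ff_flat.
have := Ff0_le; have := M_ge0; have := sqr_ge0 M; have := ler_wpM2l M_ge0 e1.
by rewrite /bnd -(mulrA 8) mulr1; move: (N2 _) (M ^+ 2) (M * eta) => *; lra.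
Qed.

Lemma Ef_bnd : N2 (Ef c u) <= bnd.
Proof.
have s0 := Ef_sqi ow bw near_flat_flat Vu; have s1 := Ef_sqi ow bw nc Vu.
rewrite -(subrK (Ef flat u) (Ef c u)); apply: (le_trans (N2D mw (tsqiB mw s1 s0) s0)).
apply: (le_trans (lerD Ef_dist (lexx _))); rewrite Ef_flat.
have := Ef0_le; have := M_ge0; have := ler_wpM2l M_ge0 e1.
by rewrite /bnd -(mulrA 12) mulr1; move: (N2 _) (M ^+ 2) (M * eta) => *; lra.
Qed.

Lemma lin_dist : `|lin c u - lin flat u| <= (\sum_i nr (p i)) * M * eta.
Proof.
have [_ _ bS _] := nc.
rewrite /lin -sumrB; apply: (le_trans (ler_norm_sum _ _ _)).
rewrite !big_distrl/=; apply: ler_sum => i _.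
have su := V_sqi ow bw i Vu.
have s1 := mbd_sqi mw (near_flat_S nc) su; have s2 := mbd_sqi mw (near_flat_S near_flat_flat) su.
rewrite -(ipBr mw s1 s2 (sp i)).
have -> : cS c * u i - cS flat * u i = (cS c - cst 1) * u i by rewrite mulrBl.
apply: (le_trans (ip_le mw (sp i) (mbd_sqi mw bS su))).
rewrite -mulrA; apply: ler_wpM2l; first exact: nr_ge0.
apply: (le_trans (mbd_nr mw e0 bS su)); rewrite mulrC; apply: ler_wpM2r => //.
exact: le_trans (comp_le_Vnorm w (inl (inl i)) u) uM.
Qed.

Definition Jdist_cst : R := 2^-1 * (k1 * (bnd ^+ 2 + 2 * (KQ * (8 * M * bnd))) +
   k2 * (bnd ^+ 2 + 2 * (KQ * (12 * M * bnd)))) + (\sum_i nr (p i)) * M.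

Lemma Jc_dist : `|Jc c u - Jc flat u| <= Jdist_cst * eta.
Proof.
have bQ := near_flat_Q nc; have bQ0 := Q0_mbd w lam mu; have [bQQ _ _ _] := nc.
have K0 : 0 <= eta + KQ by rewrite addr_ge0// KQ_ge0.
have sF := Ff_sqi ow bw nc Vu; have sF0 := Ff_sqi ow bw near_flat_flat Vu.
have sE := Ef_sqi ow bw nc Vu; have sE0 := Ef_sqi ow bw near_flat_flat Vu.
have H1 := Bf_diff mw bQ bQ0 sF sF0 K0 (KQ_ge0 lam mu) e0 bQQ Ff_bnd Ff0_bnd Ff_dist.
have H2 := Bf_diff mw bQ bQ0 sE sE0 K0 (KQ_ge0 lam mu) e0 bQQ Ef_bnd Ef0_bnd Ef_dist.
have H3 := lin_dist.
have -> : Jc c u - Jc flat u = 2^-1 * (k1 * (Bf (cQ c) (Ff c u) (Ff c u) - Bf (Q0 lam mu) (Ff flat u) (Ff flat u)) +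
  k2 * (Bf (cQ c) (Ef c u) (Ef c u) - Bf (Q0 lam mu) (Ef flat u) (Ef flat u))) - (lin c u - lin flat u).
  rewrite /Jc -[cQ flat]/(Q0 lam mu).
  by move: (Bf _ _ _) (Bf _ _ _) (Bf _ _ _) (Bf _ _ _) (lin _ _) (lin _ _) => *; ring.
apply: (le_trans (ler_normB _ _)); rewrite /Jdist_cst mulrDl; apply: lerD => //.
apply: (le_trans (norm_comb (ltW k10) (ltW k20) H1 H2)).
by rewrite le_eqVlt; apply/orP; left; apply/eqP; ring.
Qed.

End bounds.

(** The chosen weak derivatives of 0 vanish only almost everywhere, so its strains are shown to be
    null through the preceding bounds, taken at [M = 0]. *)
Lemma Jc0_le eta c : 0 <= eta <= 1 -> near_flat eta c -> Jc c 0 <= 0.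
Proof.
move=> /andP[e0 e1] nc; have bQ := near_flat_Q nc.
have K0 : 0 <= eta + KQ by rewrite addr_ge0// KQ_ge0.
have v0 : Vnorm w (0 : field) <= 0 by rewrite Vnorm0.
have b0 : bnd 0 = 0 by rewrite /bnd expr0n /= !mulr0 !addr0 mulr0.
have sF := Ff_sqi ow bw nc V0; have sE := Ef_sqi ow bw nc V0.
have F0 := Ff_bnd V0 v0 e0 nc e1; have E0 := Ef_bnd V0 v0 e0 nc e1; rewrite !b0 in F0 E0.
have F00 : N2 (Ff c 0) = 0 by apply/eqP; rewrite eq_le F0 N2_ge0.
have E00 : N2 (Ef c 0) = 0 by apply/eqP; rewrite eq_le E0 N2_ge0.
have := Bf_le mw K0 bQ sF sF; have := Bf_le mw K0 bQ sE sE; rewrite F00 E00 !mulr0 !normr_le0 => /eqP h1 /eqP h2.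
have e01 : 0 <= eta <= 1 by rewrite e0.
have := lin_le ow bw sp e01 nc V0; rewrite Vnorm0 mulr0 normr_le0 => /eqP h3.
by rewrite /Jc h1 h2 h3 !mulr0 addr0 mulr0 subr0.
Qed.

Lemma minimizer_exists (eta0 K M : R) c : 0 < eta0 -> eta0 <= 1 -> eta0 <= mu / 2 ->
  unif_coercive w lam mu k1 k2 p eta0 K M -> near_flat eta0 c ->
  exists u, is_minimizer w (Jc c) u.
Proof.
move=> e00 e01 e02 HC nc.
pose S := [set Jc c v | v in [set v | V w v]].
have lbS : has_lbound S by exists (- K) => _ [v Vv <-]; have [] := HC c v nc Vv.
have S0 : S (Jc c 0) by exists 0 => //; exact: V0.
have infS : has_inf S by split=> //; exists (Jc c 0).
pose m := inf S.
have m_le v : V w v -> m <= Jc c v by move=> Vv; apply: ge_inf => //; exists v.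
have e0e : 0 <= eta0 <= 1 by rewrite ltW.
have m0 : m <= 0 := le_trans (m_le _ V0) (Jc0_le e0e nc).
have /choice[v Hv] : forall k : nat, exists v, V w v /\ Jc c v < m + harmonic k.
  by move=> k; have [_ [v Vv <-] lt] := inf_adherent (harmonic_gt0 (R := R) k) infS; exists v.
have vM k : V w (v k) /\ Vnorm w (v k) <= M.
  have [Vv lt] := Hv k; split=> //; apply: (HC c (v k) nc Vv).2.
  have h1 : harmonic k <= 1 :> R by rewrite /harmonic /= invf_le1// ?ler1n// ltr0n.
  by move: lt h1 m0; move: (harmonic k) => *; lra.
have [U [UU oU]] := ultraFilterLemma (F := \oo) _.
have PU : ProperFilter U by exact: ultra_proper.
have nM : \forall k \near U, V w (v k) /\ Vnorm w (v k) <= M by exact: nearW.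
have [u [Vu cu cD cL]] := V_compact ow bw UU nM.
exists u; split=> // v' Vv'; apply: le_trans (m_le _ Vv').
(* [Jc_key] asks for one bound valid for the family and for its limit; enlarging [M] dispenses with
   the weak lower semicontinuity of [Vnorm]. *)
have bM : \forall k \near U, V w (v k) /\ Vnorm w (v k) <= Num.max M (Vnorm w u).
  by apply: nearW => k; have [? h] := vM k; split=> //; rewrite le_max h.
have uM : Vnorm w u <= Num.max M (Vnorm w u) by rewrite le_max lexx orbT.
have key := Jc_key (k1 := k1) (k2 := k2) ow bw sp PU bM Vu uM cD cL nc.
have c1 : m + harmonic k @[k --> U] --> m.
  have c2 : m + harmonic k @[k --> \oo] --> m + 0 by apply: cvgD; [exact: cvg_cst|exact: cvg_harmonic].
  by rewrite addr0 in c2; apply: cvg_trans c2 => A; exact: oU.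
apply: (cvg_le_lim key c1); apply: nearW => k; have [Vk lt] := Hv k.
have := Qd_ge0 ow bw lam0 mu0 k10 k20 e02 (ltW e00) nc Vk Vu.
set q := _ * (_ + _) => hq; have q0 : 0 <= q.
  by rewrite mulr_ge0 ?divr_ge0 ?(ltW mu0)// addr_ge0// mulr_ge0 ?sqr_ge0// ltW.
have := le_trans q0 hq; move: lt; move: (Jc _ _) (Qd _ _ _) (harmonic k) => *; lra.
Qed.

End energy.

(** * Strong convergence of minimizers *)

Section energy.
Context {R : realType}.
Local Notation plane := (R * R)%type.
Local Notation mplane := (measurableTypeR R * measurableTypeR R)%type.
Local Notation field := ('I_3 -> plane -> R).
Local Notation tens := ('I_2 -> 'I_2 -> plane -> R).
Context (w : set plane) (ow : open w) (bw : bounded_set w).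
Local Notation sqi := (sqi (@leb2 R) w).
Local Notation ip := (ip (@leb2 R) w).
Local Notation nr := (nr (@leb2 R) w).
Local Notation D := (wd w).
Local Notation N2 := (N2 w).
Local Notation Bf := (Bf w).
Local Notation tsqi := (tsqi w).
Local Notation mbd := (mbd w).
Local Notation mbd4 := (mbd4 w).
Local Notation Ef := (Ef w).
Local Notation Ff := (Ff w).
Local Notation Ef0 := (Ef0 w).
Local Notation Ff0 := (Ff0 w).
Local Notation Mq := (Mq w).
Local Notation Ml := (Ml w).
Local Notation Er := (@Er R).
Implicit Types (f g h : plane -> R) (a b s t : 'I_2) (u v : field) (c : coef R) (eta : R) (X Y : tens).
Let mw : measurable (w : set mplane) := mw ow.
Let fw := fw ow bw.
Context (lam mu k1 k2 : R) (p : 'I_3 -> plane -> R).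
Context (lam0 : 0 <= lam) (mu0 : 0 < mu) (k10 : 0 < k1) (k20 : 0 < k2) (sp : forall i, sqi (p i)).
Local Notation near_flat := (near_flat w lam mu).
Local Notation Jc := (Jc w k1 k2 p).
Local Notation Qd := (Qd w k1 k2).
Local Notation flat := (flat lam mu).

Lemma Ml_sub u v a b : V w u -> V w v -> nr (Ml (u - v) a b) = nr (Ml u a b - Ml v a b).
Proof.
move=> Vu Vv; have Vuv := V_sub ow bw Vu Vv.
have sl := Ml_sqi ow bw Vuv a b; have sd := sqiB mw (Ml_sqi ow bw Vu a b) (Ml_sqi ow bw Vv a b).
apply: (nr_eq mw sl sd).
have E1 := D_sub ow bw b (V_H1 ow bw (lat a) Vu) (V_H1 ow bw (lat a) Vv).
have E2 := D_sub ow bw a (V_H1 ow bw (lat b) Vu) (V_H1 ow bw (lat b) Vv).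
have S1 i s : sqi (D s (u i - v i) - (D s (u i) - D s (v i))).
  by apply: sqiB => //; [exact: (V_sqiD ow bw s i Vuv)|apply: sqiB => //; exact: V_sqiD].
apply/eqP; rewrite eq_le nr_ge0 andbT.
rewrite (_ : _ - _ = (D b (u (lat a) - v (lat a)) - (D b (u (lat a)) - D b (v (lat a)))) +
  (D a (u (lat b) - v (lat b)) - (D a (u (lat b)) - D a (v (lat b))))); last first.
  rewrite /Ml -[(u - v) (lat a)]/(u (lat a) - v (lat a)) -[(u - v) (lat b)]/(u (lat b) - v (lat b)); ring.
by apply: (le_trans (nrD mw (S1 _ _) (S1 _ _))); rewrite E1 E2 addr0.
Qed.

Lemma N2_Ml_sub u v : V w u -> V w v -> N2 (Ml (u - v)) = N2 (Ml u - Ml v).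
Proof. by move=> Vu Vv; rewrite /N2; apply: eq_bigr => a _; apply: eq_bigr => b _; exact: Ml_sub. Qed.

Lemma N2_Ff0_sub u v : V w u -> V w v -> N2 (Ff0 (u - v)) = N2 (Ff0 u - Ff0 v).
Proof.
move=> Vu Vv; rewrite /N2; apply: eq_bigr => a _; apply: eq_bigr => b _.
exact: (comp_sub ow bw (inr (b, a)) Vu Vv).
Qed.

Lemma Ff0_asym u v : V w u -> V w v ->
  N2 ((Ff0 u - Ff0 v) + tr2 (Ff0 u - Ff0 v)) = 2 * N2 (Ff0 (u - v)).
Proof.
move=> Vu Vv; have su := Ff0_sqi ow Vu; have sv := Ff0_sqi ow Vv.
rewrite N2_Ff0_sub//; apply: (N2_asym ow (tsqiB mw su sv)) => a b.
rewrite -[(Ff0 u - Ff0 v) a b]/(Ff0 u a b - Ff0 v a b) -[(Ff0 u - Ff0 v) b a]/(Ff0 u b a - Ff0 v b a).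
rewrite (_ : _ - _ - _ = (Ff0 u a b - Ff0 u b a) - (Ff0 v a b - Ff0 v b a)); last by ring.
apply/eqP; rewrite eq_le nr_ge0 andbT.
apply: (le_trans (nrB mw (sqiB mw (su a b) (su b a)) (sqiB mw (sv a b) (sv b a)))).
by rewrite (hessian_comm ow bw a b Vu) (hessian_comm ow bw a b Vv) addr0.
Qed.

Section limits.
Context (I : Type) (U : set_system I) (PU : ProperFilter U) (u_ : I -> field) (u : field) (M : R).
Context (Bu : \forall i \near U, V w (u_ i) /\ Vnorm w (u_ i) <= M) (Vu : V w u) (uM : Vnorm w u <= M).
Context (cD : forall a, nr (D a (u_ i i3) - D a (u i3)) @[i --> U] --> (0 : R)).
Context (cL : forall L, Vdual w L -> L (u_ i) @[i --> U] --> L u).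

(** Coercivity turns the hypothesis into convergence of the Hessians and of the symmetrized strains.
    Subtracting the products [Mq], which converge strongly, leaves the linear part [Ml (u_ i - u)],
    and the inequalities of Korn and Poincare conclude. *)
Lemma strong_cvg : Qd flat (u_ i) u @[i --> U] --> (0 : R) -> Vnorm w (u_ i - u) @[i --> U] --> (0 : R).
Proof.
move=> C; have Vn := Vnear PU Bu.
pose f i := N2 (Ff0 (u_ i - u)).
pose e i := N2 ((Ef0 (u_ i) - Ef0 u) + tr2 (Ef0 (u_ i) - Ef0 u)).
have nf := near_flat_flat w lam mu.
have low : \forall i \near U, mu / 32 * (k1 * (2 * f i) ^+ 2 + k2 * e i ^+ 2) <= Qd flat (u_ i) u.
  apply: filterS Vn => i Vi; have mu20 : 0 <= mu / 2 by rewrite divr_ge0// ltW.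
  have := Qd_ge0 ow bw lam0 mu0 k10 k20 mu20 (lexx 0) nf Vi Vu.
  by rewrite !Ff_flat !Ef_flat (Ff0_asym Vi Vu).
have mu32 : 0 < mu / 32 by rewrite divr_gt0.
have cf : f i @[i --> U] --> (0 : R).
  apply: sqr_cvg0; first by apply: nearW => i; exact: N2_ge0.
  apply: (cvg0_squeeze (b := fun i => (mu / 32 * k1)^-1 * Qd flat (u_ i) u)); last exact: cvg0Z.
  apply: filterS low => i hi; rewrite sqr_ge0/= mulrC ler_pdivlMr ?mulr_gt0//.
  apply: le_trans hi; have := mulr_ge0 (ltW (mulr_gt0 mu32 k20)) (sqr_ge0 (e i)).
  have := mulr_ge0 (ltW (mulr_gt0 mu32 k10)) (sqr_ge0 (f i)).
  rewrite (_ : mu / 32 * (k1 * _ + _) = 4 * (mu / 32 * k1 * f i ^+ 2) + mu / 32 * k2 * e i ^+ 2); last by ring.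
  by rewrite (mulrC (f i ^+ 2)); move: (_ * f i ^+ 2) (_ * e i ^+ 2) => *; lra.
have ce : e i @[i --> U] --> (0 : R).
  apply: sqr_cvg0; first by apply: nearW => i; exact: N2_ge0.
  apply: (cvg0_squeeze (b := fun i => (mu / 32 * k2)^-1 * Qd flat (u_ i) u)); last exact: cvg0Z.
  apply: filterS low => i hi; rewrite sqr_ge0/= mulrC ler_pdivlMr ?mulr_gt0//.
  apply: le_trans hi; have := mulr_ge0 (ltW (mulr_gt0 mu32 k10)) (sqr_ge0 (2 * f i)).
  rewrite mulrDr (mulrC (e i ^+ 2)) !mulrA => h; lra.
have [K K0 HK] := V_poincare ow bw.
have cM : N2 (Mq (u_ i) - Mq u) @[i --> U] --> (0 : R).
  apply: sum_cvg0 => a; apply: sum_cvg0 => b.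
  exact: (Mq_cvg ow bw PU Bu Vu uM cD).
apply: (cvg0_squeeze (b := fun i => K * (4 * (e i + N2 (Mq (u_ i) - Mq u)) + f i))); last first.
  by apply: cvg0Z; apply: cvgD0 => //; apply: cvg0Z; exact: cvgD0.
apply: filterS Vn => i Vi; rewrite Vnorm_ge0/=.
apply: (le_trans (HK _ (V_sub ow bw Vi Vu))); apply: ler_wpM2l => //; rewrite lerD2r.
apply: (le_trans (korn ow bw (V_sub ow bw Vi Vu))); apply: ler_wpM2l => //; rewrite N2_Ml_sub//.
have sE := tsqiB mw (Ef0_sqi ow bw Vi) (Ef0_sqi ow bw Vu).
have sq := tsqiB mw (Mq_sqi ow bw Vi) (Mq_sqi ow bw Vu).
rewrite (_ : Ml (u_ i) - Ml u = ((Ef0 (u_ i) - Ef0 u) + tr2 (Ef0 (u_ i) - Ef0 u)) - (Mq (u_ i) - Mq u)).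
  exact: (N2B mw (tsqiD mw sE (tsqi_tr sE)) sq).
apply/funext => a; apply/funext => b.
rewrite -[LHS]/(Ml (u_ i) a b - Ml u a b).
have E v := YE0 w v a b.
rewrite -[RHS]/((Ef0 (u_ i) a b - Ef0 u a b) + (Ef0 (u_ i) b a - Ef0 u b a) - (Mq (u_ i) a b - Mq u a b)).
have E1 : Ef0 (u_ i) a b + Ef0 (u_ i) b a = Ml (u_ i) a b + Mq (u_ i) a b := E (u_ i).
have E2 : Ef0 u a b + Ef0 u b a = Ml u a b + Mq u a b := E u.
rewrite addrACA -opprD E1 E2; move: (Ml _ a b) (Mq _ a b) (Ml _ a b) (Mq _ a b) => *; ring.
Qed.

Context (c_ : I -> coef R) (eta_ : I -> R) (eta0 X : R) (e01 : eta0 <= 1).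
Context (near : \forall i \near U, [/\ 0 <= eta_ i, eta_ i <= eta0 & near_flat (eta_ i) (c_ i)]).
Context (ceta : eta_ i @[i --> U] --> (0 : R)).
Context (minu : \forall i \near U, forall v, V w v -> Jc (c_ i) (u_ i) <= Jc (c_ i) v).

(** In [up], [u_ i] does no worse than [v] for the coefficients [c_ i], and these are close to the
    plate on both fields. Used with any [v] this makes [u] a minimizer; used with [u] itself it
    squeezes [Qd] to 0, since [Qd] is at most twice the gap between [x i] and the quantity of
    [Jc_key]. *)
Lemma core_limit : is_minimizer w (Jc flat) u /\ Vnorm w (u_ i - u) @[i --> U] --> (0 : R).
Proof.
have key := Jc_key (k1 := k1) (k2 := k2) ow bw sp PU Bu Vu uM cD cL (near_flat_flat w lam mu).
have mu20 : 0 <= mu / 2 by rewrite divr_ge0// ltW.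
have Q0 : \forall i \near U, 0 <= Qd flat (u_ i) u.
  apply: filterS (Vnear PU Bu) => i Vi.
  apply: le_trans (Qd_ge0 ow bw lam0 mu0 k10 k20 mu20 (lexx 0) (near_flat_flat w lam mu) Vi Vu).
  by rewrite mulr_ge0 ?divr_ge0 ?(ltW mu0)// addr_ge0// mulr_ge0 ?sqr_ge0// ltW.
have up v : V w v -> exists2 x : I -> R, x i @[i --> U] --> Jc flat v &
    \forall i \near U, Jc flat (u_ i) <= x i.
  move=> Vv; pose K := Jdist_cst w lam mu k1 k2 p M + Jdist_cst w lam mu k1 k2 p (Vnorm w v).
  exists (fun i => Jc flat v + K * eta_ i).
    have H : Jc flat v + K * eta_ i @[i --> U] --> Jc flat v + 0.
      by apply: cvgD; [exact: cvg_cst|exact: cvg0Z].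
    by rewrite addr0 in H.
  apply: filterS3 Bu near minu => i [Vi Mi] [e0 ee ne] mi.
  have e1 : eta_ i <= 1 := le_trans ee e01.
  have h1 := Jc_dist ow bw k10 k20 sp Vi Mi e0 ne e1.
  have h2 := Jc_dist ow bw k10 k20 sp Vv (lexx _) e0 ne e1.
  have := mi v Vv; move: h1 h2; rewrite !ler_norml => /andP[h1 _] /andP[_ h2] h3.
  rewrite /K; move: (Jdist_cst _ _ _ _ _ _ _) (Jdist_cst _ _ _ _ _ _ _) h1 h2 h3 => x1 x2; rewrite mulrDl; move: (Jc _ _) (Jc _ _) (Jc _ _) (Jc _ _) (_ * eta_ i) (_ * eta_ i) => *; lra.
have ming : is_minimizer w (Jc flat) u.
  split=> // v Vv; have [x cx hx] := up v Vv; apply: (cvg_le_lim key cx).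
  by apply: filterS2 Q0 hx => i; move: (Jc _ _) (Qd _ _ _) => *; lra.
split=> //; apply: strong_cvg; have [x cx hx] := up u Vu.
have C : 2 * (x i - (Jc flat (u_ i) - 2^-1 * Qd flat (u_ i) u)) @[i --> U] --> (0 : R).
  by apply: cvg0Z; rewrite -(subrr (Jc flat u)); exact: cvgB.
apply: cvg0_squeeze C; apply: filterS2 Q0 hx => i q0 hi; rewrite q0/=.
by move: q0 hi; move: (Jc _ _) (Qd _ _ _) => *; lra.
Qed.

End limits.

End energy.

(** * From ultrafilters back to sequences *)

Section energy.
Context {R : realType}.
Local Notation plane := (R * R)%type.
Local Notation mplane := (measurableTypeR R * measurableTypeR R)%type.
Local Notation field := ('I_3 -> plane -> R).
Context (w : set plane) (ow : open w) (bw : bounded_set w).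
Local Notation sqi := (sqi (@leb2 R) w).
Local Notation ip := (ip (@leb2 R) w).
Local Notation nr := (nr (@leb2 R) w).
Local Notation D := (wd w).
Implicit Types (f g h : plane -> R) (a b s t : 'I_2) (u v : field) (c : coef R) (eta : R).
Let mw : measurable (w : set mplane) := mw ow.
Let fw := fw ow bw.

Lemma Vnorm_tri u v x : V w u -> V w v -> V w x ->
  Vnorm w (u - x) <= \sum_(j : cindex) (Vnorm w (u - v) + Vnorm w (v - x)).
Proof.
move=> Vu Vv Vx; apply: (le_trans (Vnorm_le_comp _ _)); apply: ler_sum => j _.
rewrite (comp_sub ow bw j Vu Vx).
apply: (le_trans (nr_tri mw (comp_sqi ow bw j Vu) (comp_sqi ow bw j Vv) (comp_sqi ow bw j Vx))).
by rewrite -(comp_sub ow bw j Vu Vv) -(comp_sub ow bw j Vv Vx); apply: lerD; exact: comp_le_Vnorm.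
Qed.

(** Pairing a component with [u i - v i] is itself a form in [Vdual]. *)
Lemma weak_uniq u v : V w u -> V w v -> (forall L, Vdual w L -> L u = L v) ->
  forall i, nr (u i - v i) = 0.
Proof.
move=> Vu Vv H i; have su := V_sqi ow bw i Vu; have sv := V_sqi ow bw i Vv.
have sd := sqiB mw su sv.
have E : ip (u i) (u i - v i) = ip (v i) (u i - v i) := H _ (Vdual_comp ow bw (inl (inl i)) sd).
apply/eqP; rewrite -sqrf_eq0 sqr_nr; apply/eqP.
by rewrite (ipBl mw su sv sd) E subrr.
Qed.

Lemma Veq_nr u v : V w u -> V w v -> Veq w u v -> forall i, nr (u i - v i) = 0.
Proof.
move=> Vu Vv E i; apply: (nr_ae mw).
  by apply: measurable_funB; [exact: (V_sqi ow bw i Vu).1|exact: (V_sqi ow bw i Vv).1].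
by apply: ae2S (E i) => y h wy; rewrite !fctE h// subrr.
Qed.

Context (lam mu k1 k2 : R) (p : 'I_3 -> plane -> R).
Context (lam0 : 0 <= lam) (mu0 : 0 < mu) (k10 : 0 < k1) (k20 : 0 < k2) (sp : forall i, sqi (p i)).
Local Notation near_flat := (near_flat w lam mu).
Local Notation Jc := (Jc w k1 k2 p).
Local Notation flat := (flat lam mu).

(** Eventual closeness at every level is turned into a single null sequence of parameters, the
    infimum of the admissible ones at each [n]. The infimum need not be admissible, whence the added
    [harmonic n]. *)
Lemma eta_exists (c_ : nat -> coef R) : (forall e, 0 < e -> \forall n \near \oo, near_flat e (c_ n)) ->
  exists2 eta_ : nat -> R, eta_ n @[n --> \oo] --> (0 : R) &
    \forall n \near \oo, 0 <= eta_ n /\ near_flat (eta_ n) (c_ n).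
Proof.
move=> H; pose S n := [set e : R | 0 < e /\ near_flat e (c_ n)].
have lbS n : has_lbound (S n) by exists 0 => e [/ltW].
have infS n e : S n e -> 0 <= inf (S n) <= e.
  by move=> Se; rewrite (ge_inf (lbS n) Se) andbT; apply: lb_le_inf; [exists e|move=> x [/ltW]].
have N1 : \forall n \near \oo, S n 1 by apply: filterS (H 1 ltr01) => n.
exists (fun n => inf (S n) + harmonic n).
  apply: cvgD0; last exact: cvg_harmonic.
  apply/cvgrPdist_le => e e0; apply: filterS (H e e0) => n h.
  have /andP[i0 ie] := infS n e (conj e0 h).
  by rewrite sub0r normrN ger0_norm.
apply: filterS N1 => n S1; have /andP[i0 i1] := infS n 1 S1.
split; first by rewrite addr_ge0// harmonic_ge0.
have [e [e0 ne] lt] := inf_adherent (harmonic_gt0 (R := R) n) (conj (ex_intro _ 1 S1) (lbS n)).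
exact: near_flat_mono (ltW lt) ne.
Qed.

Context (eta0 K M : R) (e00 : 0 < eta0) (e01 : eta0 <= 1) (HC : unif_coercive w lam mu k1 k2 p eta0 K M).

(* A minimizer has energy at most [Jc c 0 <= 0]. *)
Lemma minimizer_bounded c u : near_flat eta0 c -> is_minimizer w (Jc c) u -> Vnorm w u <= M.
Proof.
move=> nc [Vu mu_]; apply: (HC nc Vu).2; apply: (le_trans (mu_ _ (V0 ow bw))).
have e0e : 0 <= eta0 <= 1 by rewrite ltW.
exact: le_trans (Jc0_le ow bw k1 k2 sp e0e nc) ler01.
Qed.

Context (c_ : nat -> coef R) (u_ : nat -> field).
Context (cc : forall e, 0 < e -> \forall n \near \oo, near_flat e (c_ n)).
Context (minu : \forall n \near \oo, is_minimizer w (Jc (c_ n)) (u_ n)).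

Lemma near_bounded : \forall n \near \oo, V w (u_ n) /\ Vnorm w (u_ n) <= M.
Proof.
apply: filterS2 (cc e00) minu => n nc mn; split; first by case: mn.
exact: minimizer_bounded mn.
Qed.

Lemma ultra_limit (U : set_system nat) (UU : UltraFilter U) u : \oo `<=` U -> V w u ->
  (forall a, nr (D a (u_ n i3) - D a (u i3)) @[n --> U] --> (0 : R)) ->
  (forall L, Vdual w L -> L (u_ n) @[n --> U] --> L u) ->
  is_minimizer w (Jc flat) u /\ Vnorm w (u_ n - u) @[n --> U] --> (0 : R).
Proof.
move=> oU Vu cD cL; have PU : ProperFilter U by exact: ultra_proper.
have [eta_ ceta neta] := eta_exists cc.
have Bu : \forall n \near U, V w (u_ n) /\ Vnorm w (u_ n) <= Num.max M (Vnorm w u).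
  by apply: oU; apply: filterS near_bounded => n [Vn h]; split=> //; rewrite le_max h.
have uM : Vnorm w u <= Num.max M (Vnorm w u) by rewrite le_max lexx orbT.
have H1 : \forall n \near U, [/\ 0 <= eta_ n, eta_ n <= 1 & near_flat (eta_ n) (c_ n)].
  apply: oU; move/cvgrPdist_le : ceta => /(_ 1 ltr01); apply: filterS2 neta => n [e0 ne].
  by rewrite sub0r normrN ger0_norm.
have H2 : \forall n \near U, forall v, V w v -> Jc (c_ n) (u_ n) <= Jc (c_ n) v.
  by apply: oU; apply: filterS minu => n [].
have cU : eta_ n @[n --> U] --> (0 : R) by apply: cvg_trans ceta => A; exact: oU.
exact: (core_limit ow bw lam0 mu0 k10 k20 sp PU Bu Vu uM cD cL (lexx 1) H1 cU H2).
Qed.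

(** The hypothesis says nothing directly about strong convergence of the gradients of [u_3]. Along
    each ultrafilter [V_compact] supplies it with some limit [u'], which all forms identify with
    [u]. *)
Lemma weak_limit_strong u : V w u -> (forall L, Vdual w L -> L (u_ n) @[n --> \oo] --> L u) ->
  Vnorm w (u_ n - u) @[n --> \oo] --> (0 : R) /\ is_minimizer w (Jc flat) u.
Proof.
move=> Vu cL.
have key U (UU : UltraFilter U) : \oo `<=` U ->
    is_minimizer w (Jc flat) u /\ Vnorm w (u_ n - u) @[n --> U] --> (0 : R).
  move=> oU; have PU : ProperFilter U by exact: ultra_proper.
  have Bu : \forall n \near U, V w (u_ n) /\ Vnorm w (u_ n) <= M by apply: oU; exact: near_bounded.
  have [u' [Vu' cu' cD' cL']] := V_compact ow bw UU Bu.
  have cLU L : Vdual w L -> L (u_ n) @[n --> U] --> L u.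
    by move=> HL; apply: cvg_trans (cL L HL) => A; exact: oU.
  have E L : Vdual w L -> L u' = L u.
    move=> HL; apply/eqP; rewrite eq_le (cvg_le_lim (cL' L HL) (cLU L HL)); last exact: nearW.
    by rewrite (cvg_le_lim (cLU L HL) (cL' L HL))//; exact: nearW.
  have E0 := weak_uniq Vu' Vu E.
  apply: ultra_limit => // a.
  apply: (nr_cvg_eq mw (V_sqiD ow bw a i3 Vu') (V_sqiD ow bw a i3 Vu) _ _ (cD' a)).
    by apply: filterS Bu => n [Vn _]; exact: V_sqiD.
  exact: (comp_eq ow bw (inl (inr (i3, a))) Vu' Vu E0).
split; last first.
  have [U [UU oU]] := ultraFilterLemma (F := \oo) _.
  by have [] := key U UU oU.
by apply: ultra_cvg => U UU oU; have [] := key U UU oU.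
Qed.

(** Along every ultrafilter the sequence converges strongly to some minimizer; uniqueness makes this
    limit equal to [u0] up to a null norm, whatever the ultrafilter. *)
Lemma unique_limit_strong u0 : is_unique_minimizer w (Jc flat) u0 ->
  Vnorm w (u_ n - u0) @[n --> \oo] --> (0 : R).
Proof.
move=> [[Vu0 _] uniq0]; apply: ultra_cvg => U UU oU; have PU : ProperFilter U by exact: ultra_proper.
have Bu : \forall n \near U, V w (u_ n) /\ Vnorm w (u_ n) <= M by apply: oU; exact: near_bounded.
have [u [Vu cu cD cL]] := V_compact ow bw UU Bu.
have [mu_ cs] := ultra_limit UU oU Vu cD cL.
have E : Vnorm w (u - u0) = 0 by apply: Vnorm_eq0 => //; apply: Veq_nr => //; exact: uniq0.
apply: (cvg0_squeeze (b := fun n => \sum_(j : cindex) (Vnorm w (u_ n - u) + Vnorm w (u - u0)))).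
  by apply: filterS Bu => n [Vn _]; rewrite Vnorm_ge0/=; exact: Vnorm_tri.
by apply: sum_cvg0 => j; rewrite E; under eq_fun do rewrite addr0.
Qed.

End energy.

(** * Immersions close to the flat one *)

Lemma filter_fin (I : Type) (F : set_system I) (FF : Filter F) (J : finType) (P : J -> I -> Prop) :
  (forall j, \forall i \near F, P j i) -> \forall i \near F, forall j, P j i.
Proof.
move=> H; have K (s : seq J) : \forall i \near F, forall j, j \in s -> P j i.
  elim: s => [|j s IH]; first by apply: filterE => i j.
  apply: filterS2 (H j) IH => i Pj Ps k; rewrite inE => /orP[/eqP->//|]; exact: Ps.
by apply: filterS (K (enum J)) => i h j; apply: h; rewrite mem_enum.
Qed.

Section matrix_limits.
Context {R : realType} (I : Type) (F : set_system I) {FF : Filter F}.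

Lemma cvg_sum_fin (J : finType) (x : J -> I -> R) (l : J -> R) :
  (forall j, x j i @[i --> F] --> l j) -> \sum_j x j i @[i --> F] --> \sum_j l j.
Proof. by move=> H; apply: cvg_big => [|j _]; [exact: add_continuous|exact: H]. Qed.

Lemma cvg_prod_fin (J : finType) (x : J -> I -> R) (l : J -> R) :
  (forall j, x j i @[i --> F] --> l j) -> \prod_j x j i @[i --> F] --> \prod_j l j.
Proof. by move=> H; apply: cvg_big => [|j _]; [exact: mul_continuous|exact: H]. Qed.

(** Entrywise convergence along an arbitrary filter, so that the same lemmas yield continuity at a
    point, hence measurability of the coefficients, and their uniform closeness to the plate. *)
Definition mcvg m n (A : I -> 'M[R]_(m, n)) (B : 'M[R]_(m, n)) :=
  forall i j, A k i j @[k --> F] --> (B i j : R).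

Lemma cvg_det n (A : I -> 'M[R]_n) B : mcvg A B -> \det (A k) @[k --> F] --> \det B.
Proof.
move=> H; apply: cvg_sum_fin => s; apply: cvgM; first exact: cvg_cst.
by apply: cvg_prod_fin => i; exact: H.
Qed.

Lemma mcvg_invmx n (A : I -> 'M[R]_n) B : B \in unitmx -> mcvg A B -> mcvg (fun k => invmx (A k)) (invmx B).
Proof.
move=> uB H i j; have C := cvg_det H.
have dB : \det B != 0 by rewrite -unitfE -unitmxE.
have C2 : (\det (A k))^-1 * cofactor (A k) j i @[k --> F] --> (\det B)^-1 * cofactor B j i.
  apply: cvgM; first exact: cvgV.
  apply: cvgM; first exact: cvg_cst.
  by apply: cvg_det => a b; rewrite !mxE; under eq_fun do rewrite !mxE; exact: H.
rewrite {2}/invmx uB !mxE; apply: cvg_trans C2; apply: near_eq_cvg.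
(* [invmx] is given by cofactors only at invertible matrices, which the [A k] eventually are. *)
have K : \forall k \near F, \det (A k) != 0 by exact: cvgr_neq0 C dB.
apply: filterS K => k dk.
by rewrite /invmx unitmxE unitfE dk !mxE.
Qed.

Lemma cvg_dotv (x z : I -> 'rV[R]_3) x' z' : mcvg x x' -> mcvg z z' ->
  dotv (x k) (z k) @[k --> F] --> dotv x' z'.
Proof. by move=> Hx Hz; apply: cvg_sum_fin => i; apply: cvgM; [exact: Hx|exact: Hz]. Qed.

Lemma cvg_enorm (x : I -> 'rV[R]_3) x' : mcvg x x' -> enorm (x k) @[k --> F] --> enorm x'.
Proof.
move=> Hx; have c := @sqrt_continuous R (dotv x' x').
have C : dotv (x k) (x k) @[k --> F] --> dotv x' x' by exact: cvg_dotv.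
by move=> A /c CA; exact: (C _ CA).
Qed.

Lemma mcvg_cross (x z : I -> 'rV[R]_3) x' z' : mcvg x x' -> mcvg z z' ->
  mcvg (fun k => cross (x k) (z k)) (cross x' z').
Proof.
move=> Hx Hz i j; rewrite mxE; under eq_fun do rewrite mxE.
by apply: cvgB; apply: cvgM; (exact: Hx || exact: Hz).
Qed.

Lemma mcvgZ m n (k : I -> R) (k' : R) (A : I -> 'M[R]_(m, n)) B : k i @[i --> F] --> k' -> mcvg A B ->
  mcvg (fun i => k i *: A i) (k' *: B).
Proof.
move=> Hk HA i j; rewrite mxE; under eq_fun do rewrite mxE.
by apply: cvgM => //; exact: HA.
Qed.

End matrix_limits.

Section frames.
Context {R : realType}.
Implicit Types (x z : 'rV[R]_3).

Let o0 : 'I_3 := 0.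
Let o1 : 'I_3 := 1.
Let o2 : 'I_3 := 2%:R.

Lemma dotvE x z : dotv x z = x 0 o0 * z 0 o0 + x 0 o1 * z 0 o1 + x 0 o2 * z 0 o2.
Proof.
rewrite /dotv !big_ord_recl big_ord0 addr0 addrA.
by congr (_ * _ + _ * _ + _ * _); congr (_ 0 _); exact: val_inj.
Qed.

Lemma crossE x z : [/\ cross x z 0 o0 = x 0 o1 * z 0 o2 - x 0 o2 * z 0 o1,
  cross x z 0 o1 = x 0 o2 * z 0 o0 - x 0 o0 * z 0 o2 &
  cross x z 0 o2 = x 0 o0 * z 0 o1 - x 0 o1 * z 0 o0].
Proof.
have e1 : o0 + 1 = o1 by exact: val_inj.
have e2 : o0 + 2%:R = o2 by exact: val_inj.
have e3 : o1 + 1 = o2 by exact: val_inj.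
have e4 : o1 + 2%:R = o0 by exact: val_inj.
have e5 : o2 + 1 = o0 by exact: val_inj.
have e6 : o2 + 2%:R = o1 by exact: val_inj.
by split; rewrite mxE ?(e1, e2, e3, e4, e5, e6).
Qed.

Lemma o3P (P : 'I_3 -> Prop) : P o0 -> P o1 -> P o2 -> forall i, P i.
Proof.
move=> p0 p1 p2 [[|[|[|//]]] h].
- by rewrite (_ : Ordinal h = o0)//; exact: val_inj.
- by rewrite (_ : Ordinal h = o1)//; exact: val_inj.
- by rewrite (_ : Ordinal h = o2)//; exact: val_inj.
Qed.

Lemma free_cross x z : free [:: x; z] -> cross x z != 0.
Proof.
rewrite free_cons => /andP[xz]; rewrite seq1_free => z0; apply/eqP => c0; move/negP : xz; apply.
have [E0 E1 E2] := crossE x z; rewrite c0 !mxE in E0 E1 E2.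
have key i j : x 0 i * z 0 j = x 0 j * z 0 i.
  by move: i j; apply: o3P; apply: o3P; lra.
have [k zk] : exists k, z 0 k != 0.
  apply: contrapT => h; move/eqP : z0; apply; apply/rowP => k; rewrite mxE.
  by apply: contrapT => hk; apply: h; exists k; apply/eqP.
(* All the minors of the pair vanish, so [x] is proportional to [z]; the ratio is read at a
   coordinate where [z] is not 0. *)
rewrite span_seq1; apply/vlineP; exists (x 0 k / z 0 k).
apply/rowP => j; rewrite mxE mulrAC -key -mulrA divff// ?mulr1//.
Qed.

Lemma dotv_ge0 x : 0 <= dotv x x.
Proof. by rewrite dotvE !addr_ge0// -expr2 sqr_ge0. Qed.

Lemma sqr_enorm x : enorm x ^+ 2 = dotv x x.
Proof. by rewrite /enorm sqr_sqrtr// dotv_ge0. Qed.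

Lemma enorm_gt0 x : x != 0 -> 0 < enorm x.
Proof.
move=> x0; rewrite sqrtr_gt0 lt_neqAle dotv_ge0 andbT eq_sym; apply: contra x0 => /eqP.
rewrite dotvE => E; have h0 := sqr_ge0 (x 0 o0); have h1 := sqr_ge0 (x 0 o1); have h2 := sqr_ge0 (x 0 o2).
rewrite -!expr2 in E; apply/eqP/rowP; apply: o3P; rewrite mxE; apply/eqP; rewrite -sqrf_eq0; apply/eqP; lra.
Qed.

Definition frame x z : 'M[R]_3 := \matrix_j [:: x; z; (enorm (cross x z))^-1 *: cross x z]`_j.
Definition gram x z : 'M[R]_2 := \matrix_(a, b) dotv [:: x; z]`_a [:: x; z]`_b.

Lemma det2 (A : 'M[R]_2) : \det A = A 0 0 * A 1 1 - A 0 1 * A 1 0.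
Proof.
rewrite (expand_det_row _ ord0) !big_ord_recl big_ord0 addr0 /cofactor !det_mx11 !mxE.
(* Naming the entries by natural numbers lets the lifted indices of the cofactors compute. *)
pose e i j := A (inord i) (inord j); have E i j : A i j = e (val i) (val j) by rewrite /e !inord_val.
by rewrite !E /= expr0 expr1; ring.
Qed.

Lemma det3 (A : 'M[R]_3) : \det A =
  A o0 o0 * (A o1 o1 * A o2 o2 - A o1 o2 * A o2 o1) -
  A o0 o1 * (A o1 o0 * A o2 o2 - A o1 o2 * A o2 o0) +
  A o0 o2 * (A o1 o0 * A o2 o1 - A o1 o1 * A o2 o0).
Proof.
rewrite (expand_det_row _ o0) !big_ord_recl big_ord0 addr0 /cofactor !det2 !mxE.
pose e i j := A (inord i) (inord j); have E i j : A i j = e (val i) (val j) by rewrite /e !inord_val.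
by rewrite !E /=; ring.
Qed.

(** Lagrange's identity: the right-hand side is the Gram determinant, so a nonzero cross product
    makes the metric invertible. *)
Lemma dotv_cross x z : dotv (cross x z) (cross x z) = dotv x x * dotv z z - dotv x z ^+ 2.
Proof. by rewrite !dotvE; have [-> -> ->] := crossE x z; ring. Qed.

Lemma frame_unit x z : cross x z != 0 -> frame x z \in unitmx.
Proof.
move=> c0; have n0 := enorm_gt0 c0; rewrite unitmxE unitfE det3.
have F i : [/\ frame x z o0 i = x 0 i, frame x z o1 i = z 0 i &
    frame x z o2 i = (enorm (cross x z))^-1 * cross x z 0 i] by split; rewrite mxE //= mxE.
have [-> -> ->] := F o0; have [-> -> ->] := F o1; have [-> -> ->] := F o2.
have S := sqr_enorm (cross x z); rewrite dotvE in S; have [E0 E1 E2] := crossE x z.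
move: (cross x z 0 o0) (cross x z 0 o1) (cross x z 0 o2) E0 E1 E2 S => c0' c1 c2 E0 E1 E2 S.
move: (enorm _) n0 S => e e0 S.
(* The determinant is the norm [e] of the cross product, the third row being that vector divided by
   [e]. *)
set X := (X in X != 0); suff -> : X = e by rewrite gt_eqF.
rewrite /X.
apply: (mulfI (lt0r_neq0 e0)); rewrite -expr2 S E0 E1 E2; field.
by rewrite gt_eqF.
Qed.

Lemma gram_unit x z : cross x z != 0 -> gram x z \in unitmx.
Proof.
move=> c0; have n0 := enorm_gt0 c0; rewrite unitmxE unitfE det2 !mxE /=.
have -> : dotv z x = dotv x z by rewrite !dotvE; ring.
by rewrite -expr2 -dotv_cross -sqr_enorm sqrf_eq0 gt_eqF.
Qed.

(** The unit normal, the Christoffel symbols and the area density as functions of two tangent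
    vectors and of a second derivative [q]: their continuity becomes a question of finite
    dimension. *)
Definition unormal x z := (enorm (cross x z))^-1 *: cross x z.
Definition chris x z (s : 'I_2) q : R := dotv (col (lat s) (invmx (frame x z)))^T q.
Definition sarea x z : R := Num.sqrt (enorm (cross x z) ^+ 2).

Lemma ginv_sym x z (a b : 'I_2) : invmx (gram x z) a b = invmx (gram x z) b a.
Proof.
have -> : invmx (gram x z) b a = (invmx (gram x z))^T a b by rewrite mxE.
rewrite trmx_inv; congr (invmx _ a b); apply/matrixP => i j; rewrite !mxE.
by rewrite !dotvE; ring.
Qed.

Lemma elast_sym (lam mu : R) (g : 'M[R]_2) (a b s t : 'I_2) : (forall a b, g a b = g b a) ->
  elast lam mu g a b s t = elast lam mu g b a s t /\ elast lam mu g a b s t = elast lam mu g a b t s.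
Proof.
move=> I; rewrite /elast; split.
  by rewrite (I a b); move: (g b a) (g s t) (g a s) (g b t) (g a t) (g b s) => *; ring.
by rewrite (I s t); move: (g a b) (g t s) (g a s) (g b t) (g a t) (g b s) => *; ring.
Qed.

Section limits.
Context (I : Type) (F : set_system I) {FF : Filter F}.
Context (x z q : I -> 'rV[R]_3) (x' z' q' : 'rV[R]_3).
Context (Hx : mcvg F x x') (Hz : mcvg F z z') (Hq : mcvg F q q') (c0 : cross x' z' != 0).

Lemma mcvg_unormal : mcvg F (fun k => unormal (x k) (z k)) (unormal x' z').
Proof.
have C : mcvg F (fun k => cross (x k) (z k)) (cross x' z') by exact: mcvg_cross.
have C2 : enorm (cross (x k) (z k)) @[k --> F] --> enorm (cross x' z').
  by apply: cvg_enorm => i j; exact: C.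
have n0 : enorm (cross x' z') != 0 by rewrite gt_eqF// enorm_gt0.
have C3 : (enorm (cross (x k) (z k)))^-1 @[k --> F] --> (enorm (cross x' z'))^-1 by exact: cvgV.
exact: (mcvgZ C3 C).
Qed.

Lemma mcvg_gram : mcvg F (fun k => gram (x k) (z k)) (gram x' z').
Proof.
move=> a b; rewrite mxE; under eq_fun do rewrite mxE; apply: cvg_dotv.
  by case: a => -[|[|[]]].
by case: b => -[|[|[]]].
Qed.

Lemma mcvg_frame : mcvg F (fun k => frame (x k) (z k)) (frame x' z').
Proof.
have U := mcvg_unormal.
move=> i j; rewrite mxE; under eq_fun do rewrite mxE.
by case: i => -[|[|[|[]]]] //= _; [exact: Hx|exact: Hz|exact: U].
Qed.

Lemma cvg_chris s : chris (x k) (z k) s (q k) @[k --> F] --> chris x' z' s q'.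
Proof.
apply: cvg_dotv => // i j; rewrite !mxE; under eq_fun do rewrite !mxE.
by apply: mcvg_invmx; [exact: frame_unit|exact: mcvg_frame].
Qed.

Lemma cvg_second : dotv (unormal (x k) (z k)) (q k) @[k --> F] --> dotv (unormal x' z') q'.
Proof. by apply: cvg_dotv => //; exact: mcvg_unormal. Qed.

Lemma cvg_sarea : sarea (x k) (z k) @[k --> F] --> sarea x' z'.
Proof.
have E u v : sarea u v = enorm (cross u v) by rewrite /sarea sqrtr_sqr ger0_norm// sqrtr_ge0.
by rewrite E; under eq_fun do rewrite E; apply: cvg_enorm; exact: mcvg_cross.
Qed.

Lemma cvg_elast lam mu a b s t :
  elast lam mu (invmx (gram (x k) (z k))) a b s t * sarea (x k) (z k) @[k --> F] -->
  elast lam mu (invmx (gram x' z')) a b s t * sarea x' z'.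
Proof.
have C : mcvg F (fun k => invmx (gram (x k) (z k))) (invmx (gram x' z')).
  by apply: mcvg_invmx; [exact: gram_unit|exact: mcvg_gram].
apply: cvgM; last exact: cvg_sarea.
by apply: cvgD; (apply: cvgM; [exact: cvg_cst|]); [|apply: cvgD]; apply: cvgM; exact: C.
Qed.

End limits.

Definition tang (a : 'I_2) : 'rV[R]_3 := \row_i [:: (a == 0)%:R; (a == 1)%:R; 0]`_i.

Lemma cross_tang : cross (tang 0) (tang 1) = \row_i [:: 0; 0; 1]`_i.
Proof.
have [E0 E1 E2] := crossE (tang 0) (tang 1).
by apply/rowP; apply: o3P; rewrite ?E0 ?E1 ?E2 !mxE /= ?(mulr0, mul0r, subr0, mulr1, sub0r, oppr0).
Qed.

Lemma cross_tang_neq0 : cross (tang 0) (tang 1) != 0.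
Proof.
apply/eqP => /rowP/(_ o2); rewrite cross_tang !mxE /= => /eqP.
by rewrite oner_eq0.
Qed.

Lemma sarea_tang : sarea (tang 0) (tang 1) = 1.
Proof.
rewrite /sarea sqr_enorm dotvE cross_tang !mxE /=.
by rewrite !mulr0 mulr1 !add0r sqrtr1.
Qed.

Lemma gram_tang : invmx (gram (tang 0) (tang 1)) = 1%:M.
Proof.
rewrite (_ : gram _ _ = 1%:M) ?invmx1//; apply/matrixP => -[[|[|//]] ?] [[|[|//]] ?];
  by rewrite !mxE /= dotvE !mxE /= ?(mulr0, mul0r, mulr1, addr0, add0r).
Qed.

Lemma dotv0 x : dotv x 0 = 0.
Proof. by rewrite dotvE !mxE !mulr0 !addr0. Qed.

End frames.

Section surface.
Context {R : realType}.
Local Notation plane := (R * R)%type.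
Local Notation rV := 'rV[R]_3.
Context (w : set plane) (ow : open w) (bw : bounded_set w).
Implicit Types (th : plane -> rV) (a b s t : 'I_2).

Lemma closure_compact : compact (closure w).
Proof.
have [r r0 wr] := bounded_cbox bw.
have cc := @compact_cbox R (- r) r (- r) r.
apply: (subclosed_compact (@closed_closure _ w) cc).
apply: (subset_trans (closure_subset wr)).
by move=> y; apply: (compact_closed _ cc); exact: norm_hausdorff.
Qed.

Lemma continuous_enorm : continuous (fun x : rV => enorm x).
Proof. by move=> x; apply: (@cvg_enorm R rV (nbhs x) _ id x) => i j; exact: coord_continuous. Qed.

Lemma within_cont th y : {within closure w, continuous th} -> w y -> {for y, continuous th}.
Proof.
move=> /(continuous_subspaceW (@subset_closure _ w)).
by rewrite continuous_open_subspace// => H wy; apply: H; rewrite inE.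
Qed.

Lemma cextP (g : plane -> rV) : (exists G, extends_to_closure w g G) -> extends_to_closure w g (cext w g).
Proof. exact: xgetPex. Qed.

Lemma partial1E th a y : C2bar w th -> w y -> partial1 w a th y = 'D_(e_ a) th y.
Proof. by move=> [_ _ _ H _] wy; have [_] := cextP (H a); apply; rewrite inE. Qed.

Lemma partial2E th a b y : C2bar w th -> w y -> partial2 w a b th y = 'D_(e_ a) ('D_(e_ b) th) y.
Proof. by move=> [_ _ _ _ H] wy; have [_] := cextP (H a b); apply; rewrite inE. Qed.

Lemma partial1_within th a : C2bar w th -> {within closure w, continuous (partial1 w a th)}.
Proof. by move=> [_ _ _ H _]; have [] := cextP (H a). Qed.

Lemma partial2_within th a b : C2bar w th -> {within closure w, continuous (partial2 w a b th)}.
Proof. by move=> [_ _ _ _ H]; have [] := cextP (H a b). Qed.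

Lemma enorm_bounded (G : plane -> rV) : {within closure w, continuous G} ->
  exists M, forall y, closure w y -> enorm (G y) <= M.
Proof.
move=> cG; have c2 : {within closure w, continuous ((fun x => enorm x) \o G)}.
  by apply: within_continuous_comp => // x _; exact: continuous_enorm.
have [M [Mr H]] := compact_bounded (continuous_compact c2 closure_compact).
exists (M + 1) => y wy; apply: le_trans (ler_norm _) _.
by apply: (H (M + 1)); [rewrite ltrDl|exists y].
Qed.

(** [C2norm] is a supremum, which has a default value on unbounded sets; compactness of the closure
    is what makes it an actual bound for the derivatives. *)
Lemma C2norm_ub th : C2bar w th -> has_ubound ([set enorm (th y) | y in closure w] `|`
       \bigcup_a [set enorm (partial1 w a th y) | y in closure w] `|`
       \bigcup_a \bigcup_b [set enorm (partial2 w a b th y) | y in closure w]).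
Proof.
move=> Cth; have [ct _ _ _ _] := Cth.
have [M0 H0] := enorm_bounded ct.
have /choice[M1 H1] := fun a => enorm_bounded (@partial1_within th a Cth).
have /choice[M2 H2] := fun ab : 'I_2 * 'I_2 => enorm_bounded (@partial2_within th ab.1 ab.2 Cth).
exists (`|M0| + \sum_a `|M1 a| + \sum_ab `|M2 ab|).
have s1 : 0 <= \sum_a `|M1 a| by exact: sumr_ge0.
have s2 : 0 <= \sum_ab `|M2 ab| by exact: sumr_ge0.
move=> _ [[[y wy <-]|[a _ [y wy <-]]]|[a _ [b _ [y wy <-]]]].
- apply: (le_trans (H0 y wy)); have := ler_norm M0.
  by move: (\sum_a _) (\sum_ab _) s1 s2 => *; have := normr_ge0 M0; lra.
- apply: (le_trans (H1 a y wy)); apply: (le_trans (ler_norm _)).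
  have : `|M1 a| <= \sum_a `|M1 a| by rewrite (bigD1 a)//= lerDl; exact: sumr_ge0.
  by have := normr_ge0 M0; move: (\sum_a _) (\sum_ab _) s1 s2 => *; lra.
- apply: (le_trans (H2 (a, b) y wy)); apply: (le_trans (ler_norm _)).
  have : `|M2 (a, b)| <= \sum_ab `|M2 ab| by rewrite (bigD1 (a, b))//= lerDl; exact: sumr_ge0.
  by have := normr_ge0 M0; move: (\sum_a _) (\sum_ab _) s1 s2 => *; lra.
Qed.

Lemma partial1_le th a y : C2bar w th -> w y -> enorm (partial1 w a th y) <= C2norm w th.
Proof.
move=> /C2norm_ub ub wy; apply: ub_le_sup => //; left; right.
by exists a => //; exists y => //; exact: subset_closure.
Qed.

Lemma partial2_le th a b y : C2bar w th -> w y -> enorm (partial2 w a b th y) <= C2norm w th.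
Proof.
move=> /C2norm_ub ub wy; apply: ub_le_sup => //; right.
by exists a => //; exists b => //; exists y => //; exact: subset_closure.
Qed.

Lemma theta0E (y : plane) : theta0 y = y.1 *: tang 0 + y.2 *: tang 1.
Proof. by apply/rowP => -[[|[|[|//]]] ?]; rewrite !mxE /= ?mulr0 ?mulr1 ?addr0 ?add0r. Qed.

Lemma theta0_line y a (h : R) : theta0 (h *: e_ a + y) = h *: tang a + theta0 y.
Proof.
apply/rowP => -[[|[|[|//]]] ?]; rewrite !mxE /= ?mulr0 ?add0r//.
Qed.

Lemma is_derive_theta0 y a : is_derive y (e_ a : plane) (theta0 : plane -> rV) (tang a).
Proof.
have C : h^-1 *: ((theta0 \o shift y) (h *: (e_ a : plane)) - theta0 y) @[h --> (0 : R)^'] --> (tang a : rV).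
  have E : \forall h \near (0 : R)^', cst (tang a) h = h^-1 *: ((theta0 \o shift y) (h *: (e_ a : plane)) - theta0 y).
    near=> h; rewrite /= theta0_line addrK scalerA mulVf ?scale1r//; near: h; exact: nbhs_dnbhs_neq.
  apply: (cvg_trans (near_eq_cvg E)); exact: cvg_cst.
apply: DeriveDef; first by apply/cvg_ex; exists (tang a).
exact: cvg_lim C.
Unshelve. all: by end_near.
Qed.

Lemma near_w (P : plane -> Prop) y : w y -> (forall z, w z -> P z) -> \forall z \near y, P z.
Proof. by move=> wy H; apply: filterS (open_nbhs_nbhs (conj ow wy)). Qed.

Section difference.
Context (th : plane -> rV) (Cth : C2bar w th).

Lemma D_diff a y : w y -> derivable (th - theta0) y (e_ a) /\
  'D_(e_ a) (th - theta0) y = 'D_(e_ a) th y - tang a.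
Proof.
move=> wy; have [_ d1 _ _ _] := Cth; have [dt Dt] := is_derive_theta0 y a.
split; first exact: derivableB (d1 a y wy) dt.
by rewrite (deriveB (d1 a y wy) dt) Dt.
Qed.

Lemma DD_diff a b y : w y -> derivable ('D_(e_ b) (th - theta0)) y (e_ a) /\
  'D_(e_ a) ('D_(e_ b) (th - theta0)) y = 'D_(e_ a) ('D_(e_ b) th) y.
Proof.
move=> wy; have [_ _ d2 _ _] := Cth.
have N : {near y, 'D_(e_ b) th - cst (tang b) =1 'D_(e_ b) (th - theta0)}.
  by apply: (near_w wy) => z wz; rewrite (D_diff b wz).2.
have N' : \forall z \near y, 'D_(e_ b) (th - theta0) z = ('D_(e_ b) th - cst (tang b)) z.
  by apply: filterS N => z ->.
have dc : derivable (cst (tang b) : plane -> rV) y (e_ a) by exact: derivable_cst.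
split; first exact: near_eq_derivable N (derivableB (d2 a b y wy) dc).
have Dc : 'D_(e_ a) (cst (tang b) : plane -> rV) y = 0 by exact: derive_cst.
by rewrite (near_eq_derive _ N') (deriveB (d2 a b y wy) dc) Dc subr0.
Qed.

(** Pointwise bounds by [C2norm w (th - theta0)] require that the difference be of this class. As
    [theta0] has constant first derivatives, the extensions are shifted by constants at order 1 and
    unchanged at order 2. *)
Lemma C2bar_diff : C2bar w (th - theta0).
Proof.
have [ct d1 d2 e1 e2] := Cth.
have c0 : continuous (theta0 : plane -> rV).
  rewrite (_ : theta0 = fun y => y.1 *: tang 0 + y.2 *: tang 1); last exact/funext/theta0E.
  by move=> y; apply: cvgD; (apply: cvgZ; [|exact: cvg_cst]); [exact: cvg_fst|exact: cvg_snd].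
split.
- apply: within_continuousB => //; exact: continuous_subspaceT.
- by move=> a y wy; have [] := D_diff a wy.
- by move=> a b y wy; have [] := DD_diff a b wy.
- move=> a; have [G [cG eG]] := e1 a; exists (G - cst (tang a)); split.
    by apply: within_continuousB => //; apply: continuous_subspaceT; exact: cst_continuous.
  by move=> y /[dup] yw /set_mem wy; rewrite (D_diff a wy).2 -(eG y yw).
- move=> a b; have [G [cG eG]] := e2 a b; exists G; split; first exact: cG.
  move=> y /[dup] yw /set_mem wy.
  by rewrite (DD_diff a b wy).2 -(eG y yw).
Qed.

End difference.

End surface.

Section shell.
Context {R : realType}.
Local Notation plane := (R * R)%type.
Local Notation mplane := (measurableTypeR R * measurableTypeR R)%type.
Local Notation rV := 'rV[R]_3.
Context (w : set plane) (ow : open w) (bw : bounded_set w).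
Implicit Types (th : plane -> rV) (a b s t : 'I_2).

Definition shell_coef (lam mu : R) th : coef R :=
  Coef (fun a b s t y => elast lam mu (metric_inv w th y) a b s t * Num.sqrt (area w th y))
    (fun s a b y => Gamma w th s a b y) (fun a b y => bcov w th a b y)
    (fun y => Num.sqrt (area w th y)).

Lemma metricE th y : metric w th y = gram (partial1 w 0 th y) (partial1 w 1 th y).
Proof. by apply/matrixP => -[[|[|//]] ?] [[|[|//]] ?]; rewrite !mxE. Qed.

Lemma sqrt_areaE th y : Num.sqrt (area w th y) = sarea (partial1 w 0 th y) (partial1 w 1 th y).
Proof. by []. Qed.

Section limits.
Context (I : Type) (F : set_system I) {FF : Filter F} (th_ : I -> plane -> rV) (y_ : I -> plane).
Context (x' : 'I_2 -> rV) (q' : 'I_2 -> 'I_2 -> rV) (c0 : cross (x' 0) (x' 1) != 0).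
Context (H1 : forall a, mcvg F (fun i => partial1 w a (th_ i) (y_ i)) (x' a)).
Context (H2 : forall a b, mcvg F (fun i => partial2 w a b (th_ i) (y_ i)) (q' a b)).

(** Both the immersion and the point may vary along the filter: with [flat_filter] this gives
    smallness uniform on [w], and with a fixed immersion, continuity of the coefficients. *)
Lemma cvg_cQ lam mu a b s t : cQ (shell_coef lam mu (th_ i)) a b s t (y_ i) @[i --> F] -->
  elast lam mu (invmx (gram (x' 0) (x' 1))) a b s t * sarea (x' 0) (x' 1).
Proof.
rewrite /= /metric_inv; under eq_fun do rewrite metricE sqrt_areaE.
exact: (cvg_elast (@H1 0) (@H1 1) c0).
Qed.

Lemma cvg_cG lam mu a b s : cG (shell_coef lam mu (th_ i)) s a b (y_ i) @[i --> F] -->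
  chris (x' 0) (x' 1) s (q' b a).
Proof. exact: (cvg_chris (@H1 0) (@H1 1) (@H2 b a) c0). Qed.

Lemma cvg_cB lam mu a b : cB (shell_coef lam mu (th_ i)) a b (y_ i) @[i --> F] -->
  dotv (unormal (x' 0) (x' 1)) (q' a b).
Proof. exact: (cvg_second (@H1 0) (@H1 1) (@H2 a b) c0). Qed.

Lemma cvg_cS lam mu : cS (shell_coef lam mu (th_ i)) (y_ i) @[i --> F] --> sarea (x' 0) (x' 1).
Proof. exact: (cvg_sarea (@H1 0) (@H1 1)). Qed.

End limits.

Lemma immersion_cross th y : immersion w th -> w y -> cross (partial1 w 0 th y) (partial1 w 1 th y) != 0.
Proof. by move=> [_ H] wy; apply: free_cross; apply: H; exact: subset_closure. Qed.

(* Pairs of an immersion and a point of [w], with immersions tending to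
   [theta0]: convergence along this filter is uniform on [w]. *)
Definition near_flat_base (d : R) : set ((plane -> rV) * plane) :=
  [set i | [/\ immersion w i.1, C2norm w (i.1 - theta0) < d & w i.2]].

Definition flat_filter := filter_from [set d : R | 0 < d] near_flat_base.

Instance flat_filter_filter : Filter flat_filter.
Proof.
apply: filter_from_filter; first by exists 1 => /=.
move=> d d' /= d0 d'0; exists (Num.min d d') => /=; first by rewrite lt_min d0.
by move=> [th y] [/= h1]; rewrite lt_min => /andP[h2 h3] h4.
Qed.

Lemma entry_le (x : rV) j : `|x 0 j| <= enorm x.
Proof.
rewrite -sqrtr_sqr ler_sqrt ?dotv_ge0// /dotv (bigD1 j)//= -expr2 lerDl.
by apply: sumr_ge0 => i _; rewrite -expr2 sqr_ge0.
Qed.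

Lemma flat_partial1 a : mcvg flat_filter (fun i => partial1 w a i.1 i.2) (tang a).
Proof.
move=> i j; rewrite (ord1 i); apply/cvgrPdist_le => e e0; exists e => //= -[th y] [/= [Cth _] dth wy].
have C := C2bar_diff ow Cth.
have := le_trans (entry_le _ j) (partial1_le bw a C wy).
rewrite (partial1E a C wy) (D_diff Cth a wy).2 -(partial1E a Cth wy) !mxE distrC => /le_trans; apply.
exact: ltW.
Qed.

Lemma flat_partial2 a b : mcvg flat_filter (fun i => partial2 w a b i.1 i.2) 0.
Proof.
move=> i j; rewrite (ord1 i); apply/cvgrPdist_le => e e0; exists e => //= -[th y] [/= [Cth _] dth wy].
have C := C2bar_diff ow Cth.
have := le_trans (entry_le _ j) (partial2_le bw a b C wy).
rewrite (partial2E a b C wy) (DD_diff ow Cth a b wy).2 -(partial2E a b Cth wy) mxE sub0r normrN => /le_trans; apply.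
exact: ltW.
Qed.

Lemma coord_cvg (G : plane -> rV) y : {for y, continuous G} -> mcvg (nbhs y) G (G y).
Proof.
move=> c i j A hA; have cc : {for G y, continuous (fun M : rV => M i j)} by exact: coord_continuous.
exact: (c _ (cc A hA)).
Qed.

Lemma shell_near_flat lam mu eta : 0 < eta -> exists2 d, 0 < d & forall th, immersion w th ->
  C2norm w (th - theta0) < d -> near_flat w lam mu eta (shell_coef lam mu th).
Proof.
move=> eta0.
have K1 : \forall i \near flat_filter, forall a b s t, `|cQ (shell_coef lam mu i.1) a b s t i.2 - elast lam mu 1%:M a b s t| <= eta.
  apply: filter_fin => a; apply: filter_fin => b; apply: filter_fin => s; apply: filter_fin => t.
  have : cQ (shell_coef lam mu i.1) a b s t i.2 @[i --> flat_filter] -->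
      elast lam mu (invmx (gram (tang 0) (tang 1))) a b s t * sarea (tang 0) (tang 1).
    exact: (cvg_cQ cross_tang_neq0 flat_partial1).
  rewrite gram_tang sarea_tang mulr1 => /cvgrPdist_le/(_ eta eta0).
  by apply: filterS => i; rewrite distrC.
have K2 : \forall i \near flat_filter, forall s a b, `|cG (shell_coef lam mu i.1) s a b i.2| <= eta.
  apply: filter_fin => s; apply: filter_fin => a; apply: filter_fin => b.
  have : cG (shell_coef lam mu i.1) s a b i.2 @[i --> flat_filter] --> chris (tang 0) (tang 1) s 0.
    exact: (cvg_cG cross_tang_neq0 flat_partial1 flat_partial2).
  rewrite /chris dotv0 => /cvgrPdist_le/(_ eta eta0).
  by apply: filterS => i; rewrite sub0r normrN.
have K3 : \forall i \near flat_filter, forall a b, `|cB (shell_coef lam mu i.1) a b i.2| <= eta.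
  apply: filter_fin => a; apply: filter_fin => b.
  have : cB (shell_coef lam mu i.1) a b i.2 @[i --> flat_filter] --> dotv (unormal (tang 0) (tang 1)) 0.
    exact: (cvg_cB cross_tang_neq0 flat_partial1 flat_partial2).
  rewrite dotv0 => /cvgrPdist_le/(_ eta eta0).
  by apply: filterS => i; rewrite sub0r normrN.
have K4 : \forall i \near flat_filter, `|cS (shell_coef lam mu i.1) i.2 - 1| <= eta.
  have : cS (shell_coef lam mu i.1) i.2 @[i --> flat_filter] --> sarea (tang 0) (tang 1).
    exact: (cvg_cS flat_partial1).
  rewrite sarea_tang => /cvgrPdist_le/(_ eta eta0).
  by apply: filterS => i; rewrite distrC.
have [d /= d0 H] := filterI (filterI K1 K2) (filterI K3 K4).
exists d => // th ith dth; have [Cth _] := ith.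
have {}H y wy := H (th, y) (And3 ith dth wy).
(* The limits are now taken with [th] fixed and a moving point: the coefficients are continuous on
   [w], hence measurable. *)
have M1 y : w y -> forall a, mcvg (nbhs y) (fun z => partial1 w a th z) (partial1 w a th y).
  by move=> wy a; apply: coord_cvg; exact: (within_cont ow (@partial1_within R w th a Cth) wy).
have M2 y : w y -> forall a b, mcvg (nbhs y) (fun z => partial2 w a b th z) (partial2 w a b th y).
  by move=> wy a b; apply: coord_cvg; exact: (within_cont ow (@partial2_within R w th a b Cth) wy).
split.
- move=> a b s t; split=> [|y wy]; last by have [[h _] _] := H y wy; exact: h.
  apply: measurable_funB; last exact: measurable_cst.
  apply: continuous_measurable2 => // y wy.
  have : cQ (shell_coef lam mu th) a b s t z @[z --> y] -->
      elast lam mu (invmx (gram (partial1 w 0 th y) (partial1 w 1 th y))) a b s t *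
      sarea (partial1 w 0 th y) (partial1 w 1 th y).
    exact: (cvg_cQ (th_ := fun=> th) (y_ := id) (x' := fun a => partial1 w a th y) (immersion_cross ith wy) (M1 y wy)).
  by rewrite -metricE -sqrt_areaE.
- split.
    move=> s a b; split=> [|y wy]; last by have [[_ h] _] := H y wy; exact: h.
    apply: continuous_measurable2 => // y wy.
    exact: (cvg_cG (th_ := fun=> th) (y_ := id) (x' := fun a => partial1 w a th y)
      (q' := fun a b => partial2 w a b th y) (immersion_cross ith wy) (M1 y wy) (M2 y wy)).
  move=> a b; split=> [|y wy]; last by have [_ [h _]] := H y wy; exact: h.
  apply: continuous_measurable2 => // y wy.
  exact: (cvg_cB (th_ := fun=> th) (y_ := id) (x' := fun a => partial1 w a th y)
    (q' := fun a b => partial2 w a b th y) (immersion_cross ith wy) (M1 y wy) (M2 y wy)).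
- split=> [|y wy]; last by have [_ [_ h]] := H y wy; exact: h.
  apply: measurable_funB; last exact: measurable_cst.
  apply: continuous_measurable2 => // y wy.
  exact: (cvg_cS (th_ := fun=> th) (y_ := id) (x' := fun a => partial1 w a th y) (M1 y wy)).
- move=> a b s t y wy; rewrite /= /metric_inv metricE.
  have [e1 e2] := elast_sym lam mu a b s t (ginv_sym (partial1 w 0 th y) (partial1 w 1 th y)).
  by split; [rewrite e1|rewrite e2].
Qed.

End shell.

(** * The shell and plate energies *)

Section Rintegral_sum.
Context d (T : measurableType d) (R : realType) (mu : {measure set T -> \bar R}).
Context (D : set T) (mD : measurable D).

Lemma Rintegral_sum_fin (J : finType) (h : J -> T -> R) :
  (forall j, mu.-integrable D (EFin \o h j)) ->
  \int[mu]_(x in D) (\sum_j h j x) = \sum_j \int[mu]_(x in D) h j x.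
Proof.
move=> ih; suff K (s : seq J) : mu.-integrable D (EFin \o (fun x => \sum_(j <- s) h j x)) /\
    \int[mu]_(x in D) (\sum_(j <- s) h j x) = \sum_(j <- s) \int[mu]_(x in D) h j x.
  by have [] := K (index_enum J).
elim: s => [|j s [Is Es]].
  have E : (fun x : T => \sum_(j <- [::]) h j x) = cst 0 by apply/funext => x; rewrite big_nil.
  rewrite E big_nil; split; first exact: integrable0.
  by rewrite /Rintegral integral0.
have E : (fun x : T => \sum_(i <- j :: s) h i x) = (fun x => h j x + \sum_(i <- s) h i x).
  by apply/funext => x; rewrite big_cons.
rewrite E big_cons -Es; split; first exact: (integrableD mD (ih j) Is).
exact: (RintegralD mD (ih j) Is).
Qed.

End Rintegral_sum.

Section energies.
Context {R : realType}.
Local Notation plane := (R * R)%type.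
Local Notation mplane := (measurableTypeR R * measurableTypeR R)%type.
Local Notation field := ('I_3 -> plane -> R).
Context (w : set plane) (ow : open w) (bw : bounded_set w).
Local Notation sqi := (sqi (@leb2 R) w).
Local Notation ip := (ip (@leb2 R) w).
Let mw : measurable (w : set mplane) := mw ow.

Lemma sum4_prod (x : 'I_2 -> 'I_2 -> 'I_2 -> 'I_2 -> R) :
  \sum_a \sum_b \sum_s \sum_t x a b s t =
  \sum_(j : 'I_2 * 'I_2 * 'I_2 * 'I_2) x j.1.1.1 j.1.1.2 j.1.2 j.2.
Proof. by rewrite !pair_bigA. Qed.

(** The coefficients being bounded and the tensors square integrable, each of the sixteen terms is
    integrable, which is what allows the integral to be split. *)
Lemma energy_int (k1 k2 K : R) Q X Y : mbd4 w K Q -> tsqi w X -> tsqi w Y ->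
  \int[leb2]_(y in w) (\sum_a \sum_b \sum_s \sum_t
     (k1 * (Q a b s t y * X s t y * X a b y) + k2 * (Q a b s t y * Y s t y * Y a b y))) =
  k1 * Bf w Q X X + k2 * Bf w Q Y Y.
Proof.
move=> bQ sX sY.
have S (Z : 'I_2 -> 'I_2 -> plane -> R) k a b s t : tsqi w Z -> sqi (k *: (Q a b s t * Z s t)).
  by move=> sZ; apply: (sqiZ mw); exact: (mbd_sqi mw (bQ _ _ _ _)).
under eq_Rintegral do rewrite sum4_prod.
rewrite (Rintegral_sum_fin mw) => [|[[[a b] s] t] /=]; last first.
  have := integrableD mw (sqi_int mw (S X k1 a b s t sX) (sX a b)) (sqi_int mw (S Y k2 a b s t sY) (sY a b)).
  apply: eq_integrable => // y _; rewrite /= -EFinD; congr EFin.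
  rewrite -[(k1 *: _) y]/(k1 * (Q a b s t y * X s t y)) -[(k2 *: _) y]/(k2 * (Q a b s t y * Y s t y)).
  by rewrite !mulrA.
rewrite /Bf !sum4_prod !big_distrr/= -big_split/=; apply: eq_bigr => -[[[a b] s] t] _ /=.
have E Z k : tsqi w Z -> \int[leb2]_(y in w) (k * (Q a b s t y * Z s t y * Z a b y)) = k * ip (Q a b s t * Z s t) (Z a b).
  move=> sZ; rewrite -(ipZl mw k (mbd_sqi mw (bQ a b s t) (sZ s t)) (sZ a b)) ipE.
  apply: eq_Rintegral => y _.
  by rewrite -[(k *: _) y]/(k * (Q a b s t y * Z s t y)) !mulrA.
rewrite -(E X k1 sX) -(E Y k2 sY) -(RintegralD mw)//.
- apply: eq_integrable (sqi_int mw (S X k1 a b s t sX) (sX a b)) => // y _.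
  by rewrite /= -[(k1 *: _) y]/(k1 * (Q a b s t y * X s t y)) !mulrA.
- apply: eq_integrable (sqi_int mw (S Y k2 a b s t sY) (sY a b)) => // y _.
  by rewrite /= -[(k2 *: _) y]/(k2 * (Q a b s t y * Y s t y)) !mulrA.
Qed.

Context (lam mu eps : R) (p : field) (sp : forall i, sqi (p i)).
Local Notation k1 := (eps ^+ 3 / 3%:R).
Local Notation Jc := (Jc w k1 eps p).

Lemma subr_sub_add (x s b q : R) : x - s - b + q = x + q - (s + b).
Proof. ring. Qed.

Lemma EshellE th (u : field) a b y : Eshell w th u a b y = Ef w (shell_coef w lam mu th) u a b y.
Proof.
rewrite /Eshell -!wdE.
rewrite -[RHS]/(2^-1 * (wd w b (u (lat a)) y + wd w a (u (lat b)) y) + 2^-1 * (wd w a (u i3) y * wd w b (u i3) y)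
  - ((\sum_s (Gamma w th s a b : plane -> R) * u (lat s)) y + bcov w th a b y * u i3 y)).
have -> : (\sum_s (Gamma w th s a b : plane -> R) * u (lat s)) y = \sum_s Gamma w th s a b y * u (lat s) y.
  by rewrite fct_sumE.
exact: subr_sub_add.
Qed.

Lemma FshellE th (u : field) a b y : Fshell w th u a b y = Ff w (shell_coef w lam mu th) u a b y.
Proof.
rewrite /Fshell -!wdE.
rewrite -[RHS]/(wd w a (wd w b (u i3)) y - (\sum_s (Gamma w th s a b : plane -> R) * wd w s (u i3)) y).
by rewrite fct_sumE; congr (_ - _); apply: eq_bigr => s _; rewrite -wdE.
Qed.

Lemma EplateE (u : field) a b y : Eplate w u a b y = Ef w (flat lam mu) u a b y.
Proof.
rewrite Ef_flat /Eplate -!wdE.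
rewrite -[RHS]/(2^-1 * (wd w b (u (lat a)) y + wd w a (u (lat b)) y) + 2^-1 * (wd w a (u i3) y * wd w b (u i3) y)).
by rewrite (addrC (wd w a (u (lat b)) y)).
Qed.

Lemma lin_int (K : R) S (u : field) : mbd w K S -> (forall i, sqi (u i)) ->
  \int[leb2]_(y in w) ((\sum_i p i y * u i y) * S y) = \sum_i ip (p i) (S * u i).
Proof.
move=> bS su; have sS i := mbd_sqi mw bS (su i).
have E i y : p i y * u i y * S y = p i y * (S * u i) y by rewrite -mulrA (mulrC (u i y)).
under eq_Rintegral do rewrite big_distrl/=.
rewrite (Rintegral_sum_fin mw) => [|i].
  by apply: eq_bigr => i _; rewrite ipE; apply: eq_Rintegral => y _; rewrite E.
by apply: eq_integrable (sqi_int mw (sp i) (sS i)) => // y _; rewrite /= E.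
Qed.

(** Splitting the integrals requires integrability; it comes from the bounds in [near_flat] and from
    the strains of a field of V being square integrable. *)
Lemma JshellE eta th (u : field) : near_flat w lam mu eta (shell_coef w lam mu th) -> V w u ->
  Jshell w lam mu eps p th u = Jc (shell_coef w lam mu th) u.
Proof.
move=> nc Vu; rewrite /Jshell /Jc /lin; congr (_ * _ - _); last first.
  by apply: (lin_int (near_flat_S nc)) => i; exact: V_sqi.
rewrite -(energy_int _ _ (near_flat_Q nc) (Ff_sqi ow bw nc Vu) (Ef_sqi ow bw nc Vu)).
apply: eq_Rintegral => y _; do 4!(rewrite big_distrl/=; apply: eq_bigr => ? _).
rewrite !EshellE !FshellE; move: (elast _ _ _ _ _ _ _) (Num.sqrt _) (Ff _ _ _ _ _ _) (Ff _ _ _ _ _ _) (Ef _ _ _ _ _ _) (Ef _ _ _ _ _ _) => *.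
ring.
Qed.

Lemma JplateE (u : field) : V w u -> Jplate w lam mu eps p u = Jc (flat lam mu) u.
Proof.
move=> Vu; have nc := near_flat_flat w lam mu; rewrite /Jplate /Jc /lin; congr (_ * _ - _); last first.
  rewrite -(lin_int (near_flat_S nc)) => [|i]; last exact: V_sqi.
  by apply: eq_Rintegral => y _; rewrite /= mulr1.
rewrite -(energy_int _ _ (near_flat_Q nc) (Ff_sqi ow bw nc Vu) (Ef_sqi ow bw nc Vu)).
apply: eq_Rintegral => y _; apply: eq_bigr => a _; apply: eq_bigr => b _; apply: eq_bigr => s _; apply: eq_bigr => t _.
rewrite !EplateE -!wdE Ff_flat -[wd w a (wd w b (u i3)) y]/(Ff0 w u a b y) -[wd w s (wd w t (u i3)) y]/(Ff0 w u s t y).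
by rewrite !mulrA.
Qed.

Lemma is_minimizer_eq (J J' : field -> R) u : (forall v, V w v -> J v = J' v) ->
  is_minimizer w J u -> is_minimizer w J' u.
Proof. by move=> E [Vu H]; split=> // v Vv; rewrite -!E//; exact: H. Qed.

End energies.

Lemma leq_homo_ltn (phi : nat -> nat) : {homo phi : m n / (m < n)%N} -> forall n, (n <= phi n)%N.
Proof. by move=> h; elim=> // n IH; exact: leq_ltn_trans IH (h _ _ (ltnSn n)). Qed.

Lemma near_subseq {P : nat -> Prop} {phi : nat -> nat} : {homo phi : m n / (m < n)%N} ->
  (\forall n \near \oo, P n) -> \forall n \near \oo, P (phi n).
Proof.
move=> h [N _ HN]; exists N => // n /= Nn; apply: HN => /=.
exact: leq_trans Nn (leq_homo_ltn h n).
Qed.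

Theorem theorem1 (R : realType) (w : set (R * R)%type)
    (w_open : open w) (w_bounded : bounded_set w) (w_connected : connected w)
    (w_lipschitz : lipschitz_boundary w)
    (lam mu eps : R) (lam_ge0 : 0 <= lam) (mu_gt0 : 0 < mu) (eps_gt0 : 0 < eps)
    (p : 'I_3 -> R * R -> R) (p_L2 : forall i, L2 w (p i)) :
  exists2 delta0 : R, 0 < delta0 &
  ((forall th : R * R -> 'rV[R]_3, immersion w th ->
      C2norm w (th - theta0) < delta0 ->
      exists u, is_minimizer w (Jshell w lam mu eps p th) u) /\
   (forall u : (R * R -> 'rV[R]_3) -> 'I_3 -> R * R -> R,
      (forall th, immersion w th -> C2norm w (th - theta0) < delta0 ->
         is_minimizer w (Jshell w lam mu eps p th) (u th)) ->
      exists M : R, forall th, immersion w th ->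
        C2norm w (th - theta0) < delta0 -> Vnorm w (u th) <= M)) /\
  (forall (th_ : nat -> R * R -> 'rV[R]_3) (u_ : nat -> 'I_3 -> R * R -> R),
     (forall n, immersion w (th_ n)) ->
     C2cvg w th_ theta0 ->
     (forall n, C2norm w (th_ n - theta0) < delta0 ->
        is_minimizer w (Jshell w lam mu eps p (th_ n)) (u_ n)) ->
     (forall (phi : nat -> nat) (u : 'I_3 -> R * R -> R),
        {homo phi : m n / (m < n)%N} ->
        Vweak_cvg w (fun n => u_ (phi n)) u ->
        Vcvg w (fun n => u_ (phi n)) u /\
        is_minimizer w (Jplate w lam mu eps p) u) /\
     (forall u0 : 'I_3 -> R * R -> R,
        is_unique_minimizer w (Jplate w lam mu eps p) u0 ->
        Vcvg w u_ u0)).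
Proof.
have k10 : 0 < eps ^+ 3 / 3%:R by rewrite divr_gt0 ?exprn_gt0 ?ltr0n.
have sp i := (L2E (p i) (mw w_open)).1 (p_L2 i).
have [eta [X [M [e0 e1 e2 HC]]]] := Jc_coercive w_open w_bounded lam_ge0 mu_gt0 k10 eps_gt0 sp.
(* [delta0] is the closeness at which the coefficients are [near_flat eta], where [eta] is the
   radius of uniform coercivity. *)
have [d d0 Hd] := shell_near_flat w_open w_bounded lam mu e0.
have JsE th u : near_flat w lam mu eta (shell_coef w lam mu th) ->
    is_minimizer w (Jshell w lam mu eps p th) u <->
    is_minimizer w (Jc w (eps ^+ 3 / 3%:R) eps p (shell_coef w lam mu th)) u.
  move=> nc; split; apply: is_minimizer_eq => v Vv;
    by rewrite (JshellE w_open w_bounded eps sp nc Vv).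
have JpE u : is_minimizer w (Jplate w lam mu eps p) u <->
    is_minimizer w (Jc w (eps ^+ 3 / 3%:R) eps p (flat lam mu)) u.
  split; apply: is_minimizer_eq => v Vv; by rewrite (JplateE w_open w_bounded lam mu eps sp Vv).
exists d => //; split; [split|].
- move=> th ith nth; have nc := Hd th ith nth.
  have [u mu_] := minimizer_exists w_open w_bounded lam_ge0 mu_gt0 k10 eps_gt0 sp e0 e1 e2 HC nc.
  by exists u; apply/(JsE _ _ nc).
- move=> u mu_; exists M => th ith nth; have nc := Hd th ith nth.
  apply: (minimizer_bounded w_open w_bounded sp e0 e1 HC nc).
  by apply/(JsE _ _ nc); exact: mu_.
move=> th_ u_ ith cth mu_.
have nth e : 0 < e -> \forall n \near \oo, C2norm w (th_ n - theta0) < e.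
  move=> e_gt0; have /cvgrPdist_lt /(_ _ e_gt0) H := cth.
  by apply: filterS H => n; rewrite sub0r normrN; exact: le_lt_trans (ler_norm _).
have cc e : 0 < e -> \forall n \near \oo, near_flat w lam mu e (shell_coef w lam mu (th_ n)).
  move=> e_gt0; have [d' d'0 Hd'] := shell_near_flat w_open w_bounded lam mu e_gt0.
  by apply: filterS (nth _ d'0) => n; exact: Hd'.
have minu : \forall n \near \oo,
    is_minimizer w (Jc w (eps ^+ 3 / 3%:R) eps p (shell_coef w lam mu (th_ n))) (u_ n).
  apply: filterS (nth _ d0) => n nn; apply/(JsE _ _ (Hd _ (ith n) nn)); exact: mu_.
split=> [phi u hphi [Vu wu]|u0 [mu0 uu0]].
  (* Closeness to the plate and minimality are inherited by subsequences, so the result for a full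
     weakly convergent sequence applies to [u_ \o phi]. *)
  have [] := weak_limit_strong w_open w_bounded lam_ge0 mu_gt0 k10 eps_gt0 sp e0 e1 HC
    (fun e e_gt0 => near_subseq hphi (cc e e_gt0)) (near_subseq hphi minu) Vu wu.
  by move=> cu mu_u; split; [split|apply/JpE].
split; first exact: mu0.1.
apply: (unique_limit_strong w_open w_bounded lam_ge0 mu_gt0 k10 eps_gt0 sp e0 e1 HC cc minu).
by split=> [|v /JpE]; [apply/JpE|exact: uu0].
Qed.
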